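(* Let $n\ge 2$ and let $\Omega$ be a bounded simply-connected domain in $\mathbb{C}^n$. For any $f\in L^p(\Omega)$ with $p>n+\frac12$ and any $\beta<\frac{1}{1+2n}$ there are $C^{1,\beta}$ very weak solutions $u$ to $$S_2^{\mathbb{C}}(u)=f \quad\text{in }\Omega.$$ Furthermore these solutions are dense in $C^0(\overline{\Omega})$, i.e. for every $g\in C^0(\overline\Omega)$ and every $\varepsilon>0$ there is a $C^{1,\beta}$ very weak solution $u$ with $\sup_{\Omega}|u-g|<\varepsilon$.
   Context: All functions $u,f,g$ are real-valued. Write $z_j=x_j+iy_j$, $\partial_j=\partial_{z_j}=\frac12(\partial_{x_j}-i\partial_{y_j})$, $\partial_{\bar j}=\partial_{\bar z_j}=\frac12(\partial_{x_j}+i\partial_{y_j})$. For a $C^2$ function $u$ the complex 2-Hessian is $$S_2^{\mathbb{C}}(u)=\sum_{k<j}\big(\partial_k\partial_{\bar k}u\,\partial_j\partial_{\bar j}u-\partial_k\partial_{\bar j}u\,\partial_j\partial_{\bar k}u\big),$$ the second elementary symmetric polynomial of the eigenvalues of the matrix $[\partial_k\partial_{\bar j}u]$. Very weak solution: a function $u\in W^{1,2}_{loc}(\Omega)$ is a very weak solution of $S_2^{\mathbb{C}}(u)=f$ if $$-\tfrac12\Big(\sum_{i}\sum_{j\ne i}\partial_j\partial_{\bar j}\big(\partial_i u\,\partial_{\bar i}u\big)-\sum_{i\neq j}\partial_j\partial_{\bar i}\big(\partial_i u\,\partial_{\bar j}u\big)\Big)=f$$ in the sense of distributions on $\Omega$,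 i.e. for all $\varphi\in C_c^\infty(\Omega)$, $$-\tfrac12\int_\Omega\Big(\sum_{i\ne j}\partial_i u\,\partial_{\bar i}u\,\partial_j\partial_{\bar j}\varphi-\sum_{i\ne j}\partial_i u\,\partial_{\bar j}u\,\partial_j\partial_{\bar i}\varphi\Big)=\int_\Omega f\varphi .$$ (This is the coordinate form of $-\frac12\,\mathrm{tr}\,\mathrm{curl}_L\overline{\mathrm{curl}}_R(\partial u\otimes\bar\partial u)=f$; for smooth $u$ the left-hand side equals $S_2^{\mathbb{C}}(u)$.) $u$ is $C^{1,\beta}$ if $u$ is $C^1$ on $\Omega$, $u$ and its first derivatives are bounded, and the first derivatives are globally $\beta$-Hölder on $\Omega$; here $0<\beta$. *)

(* Defs.v *)
From HB Require Import structures.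
From mathcomp Require Import all_boot all_order all_algebra.
From mathcomp Require Import complex.
From mathcomp Require Import all_classical all_reals all_analysis.

Set Implicit Arguments.
Unset Strict Implicit.
Unset Printing Implicit Defensive.

Import Order.TTheory GRing.Theory Num.Theory.
Import numFieldNormedType.Exports.

Local Open Scope classical_set_scope.
Local Open Scope ring_scope.

(* The product sigma-algebra on matrices; over a realType it is the Borel
   sigma-algebra of the matrix topology. *)
Definition measure_matrix_display : measure_display -> measure_display.
Proof. exact. Qed.

Section measurable_matrix.
Context {d} {T : measurableType d}.
Variables m n : nat.

Definition mx_cylinder : set (set 'M[T]_(m, n)) :=
  [set A | exists i j, exists2 B : set T,
     measurable B & A = [set M : 'M[T]_(m, n) | B (M i j)]].

Let mx_measurable0 : <<s mx_cylinder >> set0.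
Proof. exact: sigma_algebra0. Qed.

Let mx_measurableC A : <<s mx_cylinder >> A -> <<s mx_cylinder >> (~` A).
Proof. exact: sigma_algebraC. Qed.

Let mx_measurable_bigcup (F : _^nat) : (forall i, <<s mx_cylinder >> (F i)) ->
  <<s mx_cylinder >> (\bigcup_i (F i)).
Proof. exact: sigma_algebra_bigcup. Qed.

HB.instance Definition _ := @isMeasurable.Build (measure_matrix_display d)
  'M[T]_(m, n) <<s mx_cylinder >>
  mx_measurable0 mx_measurableC mx_measurable_bigcup.

End measurable_matrix.

Lemma measurable_coord d (T : measurableType d) m n (i : 'I_m) (j : 'I_n) :
  measurable_fun [set: 'M[T]_(m, n)] (fun M => M i j).
Proof.
move=> _ B mB; rewrite setTI; apply: sub_sigma_algebra.
by exists i, j, B.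
Qed.

Lemma measurable_fun_mx d d' (S : measurableType d') (T : measurableType d)
    m n (f : S -> 'M[T]_(m, n)) :
  (forall i j, measurable_fun [set: S] (fun x => f x i j)) ->
  measurable_fun [set: S] f.
Proof.
move=> mf; apply: (measurability (@mx_cylinder d T m n)) => //.
by move=> _ [_ [i [j [B mB ->]]] <-]; exact: mf.
Qed.

Section lebesgue_measure_rV.
Variable R : realType.

Definition cons_rV m (p : measurableTypeR R * 'rV[R]_m) : 'rV[R]_m.+1 :=
  row_mx (const_mx (p.1 : R)) p.2 : 'rV[R]_(1 + m).

Definition uncons_rV m (v : 'rV[R]_m.+1) : measurableTypeR R * 'rV[R]_m :=
  (lsubmx (v : 'rV[R]_(1 + m)) 0 0, rsubmx (v : 'rV[R]_(1 + m))).

Lemma cons_rVK m : cancel (@cons_rV m) (@uncons_rV m).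
Proof.
by case=> x v; rewrite /uncons_rV row_mxKl row_mxKr mxE.
Qed.

Lemma measurable_cons_rV m : measurable_fun setT (@cons_rV m).
Proof.
apply: measurable_fun_mx => i j.
case: (split_ordP (j : 'I_(1 + m))) => k -> /=.
  rewrite (_ : (fun x => _) = fst); first exact: measurable_fst.
  by apply/funext => x; apply: etrans (row_mxEl _ _ _ _) _; rewrite mxE.
rewrite (_ : (fun x => _) = (fun v : 'rV[R]_m => v i k) \o snd).
  by apply: measurableT_comp => //; exact: measurable_coord.
by apply/funext => x; exact: row_mxEr.
Qed.

Lemma measurable_uncons_rV m : measurable_fun setT (@uncons_rV m).
Proof.
apply/measurable_fun_pairP; split.
  rewrite (_ : (_ \o _) = (fun v : 'rV[R]_m.+1 => v 0 (lshift m 0 : 'I_(1 + m)))).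
    exact: measurable_coord.
  by apply/funext => v; rewrite /= mxE.
apply: measurable_fun_mx => i j.
rewrite (_ : (fun x => _) =
  (fun v : 'rV[R]_m.+1 => v i (rshift 1 j : 'I_(1 + m)))).
  exact: measurable_coord.
by apply/funext => v; rewrite /= mxE.
Qed.

Section step.
Variables (m : nat) (nu : {sigma_finite_measure set 'rV[R]_m -> \bar R}).

Definition cons_measure : set 'rV[R]_m.+1 -> \bar R :=
  pushforward (lebesgue_measure \x nu)%E (@cons_rV m).

Let cons_measure0 : cons_measure set0 = 0%E.
Proof. by rewrite /cons_measure /pushforward preimage_set0 measure0. Qed.

Let cons_measure_ge0 A : (0 <= cons_measure A)%E.
Proof. exact: (measure_ge0 (lebesgue_measure \x nu)%E). Qed.

Let cons_measure_sigma_additive : semi_sigma_additive cons_measure.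
Proof.
have mc := @measurable_cons_rV m; exact: measure_semi_sigma_additive.
Qed.

HB.instance Definition _ := isMeasure.Build _ _ _ cons_measure
  cons_measure0 cons_measure_ge0 cons_measure_sigma_additive.

Let cons_measure_sigma_finite : sigma_finite setT cons_measure.
Proof.
have /sigma_finiteP[F [FT ndF Ffin]] := sigma_finiteT (@lebesgue_measure R).
have /sigma_finiteP[G [GT ndG Gfin]] := sigma_finiteT nu.
exists (fun k => @uncons_rV m @^-1` (F k `*` G k)).
  apply/esym/seteqP; split=> // v _ /=.
  have [i _ Fi] : (\bigcup_i F i) (uncons_rV v).1 by rewrite -FT.
  have [j _ Gj] : (\bigcup_i G i) (uncons_rV v).2 by rewrite -GT.
  exists (maxn i j) => //; split.
    by move: Fi; exact/subsetPset/ndF/leq_maxl.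
  by move: Gj; exact/subsetPset/ndG/leq_maxr.
move=> k; have [mF Foo] := Ffin k; have [mG Goo] := Gfin k; split.
  rewrite -[X in measurable X]setTI; apply: measurable_uncons_rV => //.
  exact: measurableX.
rewrite /cons_measure /pushforward -comp_preimage.
rewrite (_ : _ \o _ = id); last exact/funext/cons_rVK.
rewrite preimage_id product_measure1E//.
by rewrite lte_mul_pinfty// ge0_fin_numE.
Qed.

HB.instance Definition _ := @Measure_isSigmaFinite.Build _ _ _
  cons_measure cons_measure_sigma_finite.

End step.

Fixpoint lebesgue_rV m : {sigma_finite_measure set 'rV[R]_m -> \bar R} :=
  match m with
  | 0 => dirac (0 : 'rV[R]_0)
  | k.+1 => cons_measure (lebesgue_rV k)
  end.

End lebesgue_measure_rV.

(* This product formula characterizes lebesgue_rV. *)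
Lemma lebesgue_rV_box (R : realType) m (A : 'I_m -> set (measurableTypeR R)) :
  (forall i, measurable (A i)) ->
  lebesgue_rV R m [set v | forall i, A i (v 0 i)] =
  (\prod_(i < m) lebesgue_measure (A i))%E.
Proof.
elim: m A => [|m IH] A mA.
  rewrite big_ord0 /= diracE mem_set//; by case.
rewrite big_ord_recl -IH//= /cons_measure /pushforward.
rewrite -product_measure1E//; last first.
  rewrite (_ : (fun _ => _) =
    \bigcap_(i in [set: 'I_m]) [set v : 'rV[R]_m | A (lift ord0 i) (v 0 i)]).
    apply: fin_bigcap_measurable => // i _.
    rewrite -[X in measurable X]setTI.
    exact: (@measurable_coord _ R 1 m 0 i measurableT _ (mA _)).
  by apply/seteqP; split=> v /= h i; [move=> _|]; exact: h.
have eA : @cons_rV R m @^-1` [set v | forall i, A i (v 0 i)] =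
  A ord0 `*` [set v : 'rV[R]_m | forall i : 'I_m, A (lift ord0 i) (v 0 i)];
  last first.
  exact: (congr1 (lebesgue_measure \x lebesgue_rV R m)%E eA).
have cons0 (w : measurableTypeR R * 'rV[R]_m) : cons_rV w 0 ord0 = w.1.
  rewrite (_ : ord0 = lshift m ord0 :> 'I_(1 + m)); last exact/val_inj.
  by apply: etrans (row_mxEl _ _ _ _) _; rewrite mxE.
have consS (w : measurableTypeR R * 'rV[R]_m) i :
    cons_rV w 0 (lift ord0 i) = w.2 0 i.
  rewrite (_ : lift ord0 i = rshift 1 i :> 'I_(1 + m)); last exact/val_inj.
  exact: row_mxEr.
apply/seteqP; split=> w /=.
  by move=> h; split=> [|i]; [rewrite -cons0|rewrite -consS]; exact: h.
move=> [h0 h] i; case: (unliftP ord0 i) => [k ->|->].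
  by rewrite consS; exact: h.
by rewrite cons0.
Qed.

Section simply_connected.
Context {R : realType} {T : topologicalType}.

Definition path_in (A : set T) (x y : T) (c : R -> T) :=
  [/\ {within `[0, 1], continuous c}, c 0 = x, c 1 = y &
      forall t, t \in `[0, 1] -> A (c t)].

Definition path_connected (A : set T) :=
  forall x y, A x -> A y -> exists c, path_in A x y c.

Definition null_homotopic_in (A : set T) (x : T) (c : R -> T) :=
  exists H : R * R -> T,
    [/\ {within `[0, 1] `*` `[0, 1], continuous H},
        forall s t, s \in `[0, 1] -> t \in `[0, 1] -> A (H (s, t)),
        forall t, t \in `[0, 1] -> H (0, t) = c t,
        forall t, t \in `[0, 1] -> H (1, t) = x &
        forall s, s \in `[0, 1] -> H (s, 0) = x /\ H (s, 1) = x].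

Definition simply_connected (A : set T) :=
  path_connected A /\
  forall x c, path_in A x x c -> null_homotopic_in A x c.

End simply_connected.
Arguments simply_connected R {T} A.

Section real_calculus.
Context {R : realType} {m : nat}.
Local Notation E := 'rV[R]_m.
Local Notation lambda := (lebesgue_rV R m).
Implicit Types (D : set E) (u v phi : E -> R) (k : 'I_m).

Definition partial k u : E -> R := 'D_(delta_mx 0 k) u.

(* Meant for open D: derivatives at points of D are taken in the whole space. *)
Fixpoint Ck D (r : nat) u : Prop :=
  match r with
  | 0 => {in D, continuous u}
  | s.+1 => [/\ {in D, continuous u},
               forall k x, D x -> derivable u x (delta_mx 0 k) &
               forall k, Ck D s (partial k u)]
  end.

(* The norm of 'rV[R]_m is the sup norm: replacing the Euclidean norm by it
   only changes the constant C. *)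
Definition holder_on D (beta : R) u :=
  exists C, forall x y, D x -> D y -> `|u x - u y| <= C * `|x - y| `^ beta.

Definition C1beta D (beta : R) u :=
  [/\ Ck D 1 u,
      [bounded u x | x in D],
      forall k, [bounded partial k u x | x in D] &
      forall k, holder_on D beta (partial k u)].

Definition test_function D phi :=
  [/\ forall r, Ck setT r phi,
      compact (closure [set x | phi x != 0]) &
      closure [set x | phi x != 0] `<=` D].

Definition L2loc D u :=
  forall K, compact K -> K `<=` D -> u \_ K \in Lfun lambda 2%:E.

Definition weak_partial D k u v :=
  forall phi, test_function D phi ->
    \int[lambda]_(x in D) (u x * partial k phi x) =
    - \int[lambda]_(x in D) (v x * phi x).

(* u is in W^{1,2}_loc(D), with weak gradient g. *)
Definition W12loc_grad D u (g : 'I_m -> E -> R) :=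
  [/\ L2loc D u, forall k, L2loc D (g k) &
      forall k, weak_partial D k u (g k)].

End real_calculus.

(* C^n is identified with R^(2n): the point z with z_j = x_j + i y_j is the row
   vector (x_1, ..., x_n, y_1, ..., y_n). *)
Section complex_calculus.
Context {R : realType} {n : nat}.
Local Notation E := 'rV[R]_(n + n).
Local Notation lambda := (lebesgue_rV R (n + n)).
Implicit Types (D : set E) (u f phi : E -> R) (h : E -> R[i]) (i j : 'I_n).

(* The Wirtinger derivatives in terms of the derivatives a along x_j and b
   along y_j. *)
Definition wirtinger (a b : R[i]) : R[i] := 2^-1 * (a - 'i%C * b).
Definition wirtinger_bar (a b : R[i]) : R[i] := 2^-1 * (a + 'i%C * b).

Definition cpartial (k : 'I_(n + n)) h : E -> R[i] := fun x =>
  (partial k (fun y => complex.Re (h y)) x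
   +i* partial k (fun y => complex.Im (h y)) x)%C.

Definition dz j h : E -> R[i] := fun x =>
  wirtinger (cpartial (lshift n j) h x) (cpartial (rshift n j) h x).
Definition dzbar j h : E -> R[i] := fun x =>
  wirtinger_bar (cpartial (lshift n j) h x) (cpartial (rshift n j) h x).

Definition grad_dz (g : 'I_(n + n) -> E -> R) j : E -> R[i] := fun x =>
  wirtinger (g (lshift n j) x)%:C%C (g (rshift n j) x)%:C%C.
Definition grad_dzbar (g : 'I_(n + n) -> E -> R) j : E -> R[i] := fun x =>
  wirtinger_bar (g (lshift n j) x)%:C%C (g (rshift n j) x)%:C%C.

Definition cintegral D h : R[i] :=
  ((\int[lambda]_(x in D) complex.Re (h x))
   +i* (\int[lambda]_(x in D) complex.Im (h x)))%C.

(* The weak gradient g of u is unique up to null sets, so that its choice does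
   not matter. *)
Definition very_weak_solution D f u :=
  exists2 g : 'I_(n + n) -> E -> R, W12loc_grad D u g &
  forall phi, test_function D phi ->
    let phiC : E -> R[i] := fun x => (phi x)%:C%C in
    - 2^-1 * cintegral D (fun x =>
        \sum_(i < n) \sum_(j < n | j != i)
          grad_dz g i x * grad_dzbar g i x * dz j (dzbar j phiC) x
        - \sum_(i < n) \sum_(j < n | j != i)
          grad_dz g i x * grad_dzbar g j x * dz j (dzbar i phiC) x)
    = (\int[lambda]_(x in D) (f x * phi x))%:C%C.

End complex_calculus.

(* Main.v *)
(* Convex integration with trigonometric polynomials. After rescaling, Omega lies in a cube of side less than 1
   of the torus of side 2 pi. On trigonometric polynomials the very weak Hessian of u is, up to the factor -1/32,
   a second-order operator [hop] applied to the matrix (d_a u * d_b u), and [hop] maps F (e_i0 e_i0 + e_i1 e_i1),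
   with e_i0, e_i1 two of the x-directions, to a weighted Laplacian [wlap F]. One keeps pairs (u, g) with
   hop (d u * d u) = wlap g exactly. Adding to u two waves A cos(mu x_k) / mu, k = i0, i1, adds about A^2 / 2 to g;
   with A^2 close to 2 (delta + h - g), where A is a polynomial in h - g given by an iteration for the square root,
   g comes close to h + delta, and the error terms are put back into g by inverting [wlap], at the cost of a
   logarithm of the degree. Iterating with frequencies 2 ^ (5 q ^ 2), u converges in C^{1,beta} to a function within
   any prescribed distance of the initial one, while g converges to a given Hoelder function H of exponent
   kap = 2 / (1 + 2 n). For H take the limit of solutions of wlap h = V_N * f, with V_N the de la Vallee-Poussin
   kernels: p > n + 1/2 is exactly what makes the dyadic blocks of h decay like 2 ^ (- kap J). Everything passes to
   the limit after integrating by parts against the test function. *)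
From HB Require Import structures.
Require Import Defs.
From mathcomp Require Import all_boot all_order all_algebra.
From mathcomp Require Import complex.
From mathcomp Require Import all_classical all_reals all_analysis.
From mathcomp Require Import measurable_realfun.
From mathcomp Require Import ring lra zify.

Set Implicit Arguments.
Unset Strict Implicit.
Unset Printing Implicit Defensive.

Import Order.TTheory GRing.Theory Num.Theory.
Import numFieldNormedType.Exports.

Local Open Scope classical_set_scope.
Local Open Scope ring_scope.
(** * Trigonometric polynomials *)

(** One wave in direction x_i yields the sum of the Laplacians in z_j, j != i, which is degenerate
    in the plane of z_i. Two waves with [i0 != i1] yield an elliptic operator, whose inverse lets
    the errors go back into g exactly. The price of two frequencies per stage is the threshold b <
    1/5 on the exponent b of the gradient: with the factor 2^(10 q + 5) between successive
    frequencies split as 2^(6 q) and 2^(4 q + 5), the errors decay as soon as 5 b < 1. As n >= 2, 1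
    / (1 + 2 n) <= 1/5 and nothing is lost. The other constraint is 2 b < kap: H has to be resolved
    at each frequency up to the squares of the coming amplitudes. With kap = 2 / (1 + 2 n), the
    condition kap + 2 n / p < 2 reads p > n + 1/2. Trigonometric polynomials replace mollification:
    Bernstein's inequality bounds derivatives and products only add degrees, so the amplitude has to
    be polynomial too. The multiplier bounds on the sup norm come from translations: finite
    combinations of them, then limits. With frequencies 2^(5 q^2) a logarithm of the degree is
    polynomial in q, against gains exponential in q. *)

Section cis.
Variable R : realType.
Implicit Types x y : R.

Definition cis x : R[i] := (cos x +i* sin x)%C.

Lemma cisD x y : cis (x + y) = cis x * cis y.
Proof. by rewrite /cis cosD sinD; apply/eqP; rewrite eq_complex /= eqxx addrC mulrC eqxx. Qed.

Lemma cis0 : cis 0 = 1.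
Proof. by rewrite /cis cos0 sin0. Qed.

Lemma cisN x : cis (- x) = (cis x)^*%C.
Proof. by rewrite /cis cosN sinN. Qed.

Lemma cisX n x : cis (n%:R * x) = cis x ^+ n.
Proof.
elim: n => [|n IH]; first by rewrite mul0r cis0 expr0.
by rewrite -natr1 mulrDl mul1r cisD IH exprSr.
Qed.

Lemma Re_sum (I : Type) (r : seq I) (P : pred I) (F : I -> R[i]) :
  complex.Re (\sum_(i <- r | P i) F i) = \sum_(i <- r | P i) complex.Re (F i).
Proof. by rewrite (big_morph (@complex.Re R) (id1 := 0) (op1 := +%R))//; case=> ? ? []. Qed.

Lemma ReD (a b : R[i]) : complex.Re (a + b) = complex.Re a + complex.Re b.
Proof. by case: a b => ? ? []. Qed.

Lemma ReZ x (a : R[i]) : complex.Re (x%:C%C * a) = x * complex.Re a.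
Proof. by case: a => a b /=; rewrite mul0r subr0. Qed.

(** Product-to-sum formula: it turns products of real parts into sums over added and subtracted
    frequencies. *)
Lemma ReM2 (a b : R[i]) :
  complex.Re a * complex.Re b =
  complex.Re (2^-1 * (a * b)) + complex.Re (2^-1 * (a * (b^*)%C)).
Proof.
rewrite -ReD -mulrDr -mulrDr.
rewrite (_ : 2^-1 = (2^-1)%:C%C); last by rewrite fmorphV rmorph_nat.
by rewrite ReZ; case: a b => a1 a2 [b1 b2] /=; field.
Qed.

End cis.

Section trigpoly.
Variables (R : realType) (m : nat).
Local Notation E := 'rV[R]_m.
Local Notation freq := 'rV[int]_m.

Definition dot (k : freq) (x : E) : R := \sum_a (k 0 a)%:~R * x 0 a.

Lemma dotDr k x y : dot k (x + y) = dot k x + dot k y.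
Proof. by rewrite -big_split/=; apply: eq_bigr => a _; rewrite mxE mulrDr. Qed.

Lemma dotDl k l x : dot (k + l) x = dot k x + dot l x.
Proof. by rewrite -big_split/=; apply: eq_bigr => a _; rewrite mxE intrD mulrDl. Qed.

Lemma dotNl k x : dot (- k) x = - dot k x.
Proof. by rewrite /dot -sumrN; apply: eq_bigr => a _; rewrite mxE mulrNz mulNr. Qed.

Lemma dotZr k t x : dot k (t *: x) = t * dot k x.
Proof. by rewrite /dot mulr_sumr; apply: eq_bigr => a _; rewrite mxE mulrCA. Qed.

Lemma dot_delta k a : dot k (delta_mx 0 a) = (k 0 a)%:~R.
Proof.
rewrite /dot (bigD1 a)//= mxE !eqxx mulr1 big1 ?addr0// => b /negbTE ba.
by rewrite mxE ba andbF mulr0.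
Qed.

Lemma dot0l x : dot 0 x = 0.
Proof. by rewrite /dot big1// => a _; rewrite mxE mul0r. Qed.

(** Real trigonometric polynomials, read through a real part: frequencies may repeat, no symmetry
    between k and -k is imposed, and a function has many lists. *)
Definition tpoly := seq (R[i] * freq).

Definition ev (s : tpoly) (x : E) : R :=
  \sum_(t <- s) complex.Re (t.1 * cis (dot t.2 x)).

Definition symb (f : freq -> R[i]) (s : tpoly) : tpoly :=
  [seq (f t.2 * t.1, t.2) | t <- s].

Definition dle (K : nat) (s : tpoly) :=
  all (fun t : R[i] * freq => [forall a, (absz (t.2 0%R a) <= K)%N]) s.

Lemma ev_symb f s x :
  ev (symb f s) x = \sum_(t <- s) complex.Re (f t.2 * t.1 * cis (dot t.2 x)).
Proof. by rewrite /ev big_map. Qed.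

Lemma ev_cat s1 s2 x : ev (s1 ++ s2) x = ev s1 x + ev s2 x.
Proof. by rewrite /ev big_cat. Qed.

Lemma symb_comp f g s : symb f (symb g s) = symb (fun k => f k * g k) s.
Proof. by rewrite /symb -map_comp; apply: eq_map => t /=; rewrite mulrA. Qed.

Lemma eq_symb K f g s : dle K s ->
  (forall k : freq, (forall a, (absz (k 0%R a) <= K)%N) -> f k = g k) ->
  symb f s = symb g s.
Proof.
move=> /allP ds fg; rewrite /symb; apply/eq_in_map => t ts; congr (_ * _, _).
by apply: fg; apply/forallP; exact: ds.
Qed.

Lemma dle_symb K f s : dle K (symb f s) = dle K s.
Proof. by rewrite /dle all_map; apply: eq_all. Qed.

Lemma dle_cat K s1 s2 : dle K (s1 ++ s2) = dle K s1 && dle K s2.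
Proof. by rewrite /dle all_cat. Qed.

Lemma dle_leq K L s : (K <= L)%N -> dle K s -> dle L s.
Proof.
move=> KL; apply: sub_all => t /forallP h; apply/forallP => a.
exact: leq_trans (h a) KL.
Qed.

Lemma ev_shift s x y : ev s (x + y) = ev (symb (fun k => cis (dot k y)) s) x.
Proof.
by rewrite ev_symb; apply: eq_bigr => t _; rewrite dotDr cisD; congr complex.Re; ring.
Qed.

Lemma ev_symbD f g s x :
  ev (symb (fun k => f k + g k) s) x = ev (symb f s) x + ev (symb g s) x.
Proof.
by rewrite !ev_symb -big_split/=; apply: eq_bigr => t _; rewrite -ReD !mulrDl.
Qed.

Lemma ev_symbZ (c : R) f s x :
  ev (symb (fun k => c%:C%C * f k) s) x = c * ev (symb f s) x.
Proof.
rewrite !ev_symb mulr_sumr; apply: eq_bigr => t _.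
by rewrite -ReZ !mulrA.
Qed.

Lemma ev_symb_sum (I : Type) (r : seq I) (F : I -> freq -> R[i]) s x :
  ev (symb (fun k => \sum_(i <- r) F i k) s) x =
  \sum_(i <- r) ev (symb (F i) s) x.
Proof.
under [RHS]eq_bigr => i _ do rewrite ev_symb.
rewrite ev_symb exchange_big/=; apply: eq_bigr => t _.
by rewrite -Re_sum !mulr_suml.
Qed.

Definition mulp (s1 s2 : tpoly) : tpoly :=
  [seq (2^-1 * (t.1.1 * t.2.1), t.1.2 + t.2.2) | t <- allpairs pair s1 s2] ++
  [seq (2^-1 * (t.1.1 * (t.2.1^*)%C), t.1.2 - t.2.2) | t <- allpairs pair s1 s2].

Lemma ev_mulp s1 s2 x : ev (mulp s1 s2) x = ev s1 x * ev s2 x.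
Proof.
rewrite /mulp ev_cat /ev !big_map/= -big_split/= big_allpairs/= mulr_suml.
apply: eq_bigr => t _; rewrite mulr_sumr; apply: eq_bigr => u _ /=.
rewrite ReM2 !dotDl dotNl !cisD cisN rmorphM/=; congr (complex.Re _ + complex.Re _); ring.
Qed.

Lemma dle_mulp K L s1 s2 : dle K s1 -> dle L s2 -> dle (K + L) (mulp s1 s2).
Proof.
move=> d1 d2; rewrite /mulp dle_cat /dle !all_map; apply/andP; split;
  apply/allP => -[t u] /allpairsP[[t' u']] /= [/(allP d1)/forallP h1 /(allP d2)/forallP h2 [-> ->]];
  apply/forallP => a; rewrite /= !mxE; move: (h1 a) (h2 a) => /=; lia.
Qed.

Lemma is_derive_line (f : E -> R) (x v : E) (d : R) :
  is_derive (0 : R) (1 : R) (fun t : R => f (t *: v + x)) d -> is_derive x v f d.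
Proof.
have eqf : (fun h : R => h^-1 *: (((fun t : R => f (t *: v + x)) \o shift 0) (h *: 1) -
   (fun t : R => f (t *: v + x)) 0)) = (fun h : R => h^-1 *: ((f \o shift x) (h *: v) - f x)).
  by apply/funext => h; rewrite /shift/= scale0r add0r addr0 [h *: 1]mulr1.
by case=> df <-; split; rewrite /derivable /derive -?eqf.
Qed.

Lemma is_derive_ev s x (a : 'I_m) :
  is_derive x (delta_mx 0 a) (ev s)
    (ev (symb (fun k => 'i%C * ((k 0 a)%:~R)%:C%C) s) x).
Proof.
apply: is_derive_line.
elim: s => [|[c k] s IH].
  have -> : (fun t : R => ev [::] (t *: delta_mx 0 a + x)) = cst 0.
    by apply/funext => t; rewrite /ev big_nil.
  have -> : ev (symb (fun k => 'i%C * ((k 0 a)%:~R)%:C%C) [::]) x = 0 by rewrite /ev big_nil.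
  exact: is_derive_cst.
have -> : (fun t : R => ev ((c, k) :: s) (t *: delta_mx 0 a + x)) =
   (fun t => complex.Re c * cos (t * (k 0 a)%:~R + dot k x)
   - complex.Im c * sin (t * (k 0 a)%:~R + dot k x) + ev s (t *: delta_mx 0 a + x)).
  apply/funext => t; rewrite /ev big_cons /=; congr (_ + _).
  by rewrite dotDr dotZr dot_delta; case: c => c1 c2 /=.
have -> : ev (symb (fun k0 => 'i%C * ((k0 0 a)%:~R)%:C%C) ((c, k) :: s)) x =
    complex.Re ('i%C * ((k 0 a)%:~R)%:C%C * c * cis (dot k x)) +
    ev (symb (fun k0 => 'i%C * ((k0 0 a)%:~R)%:C%C) s) x by rewrite /ev big_cons.
apply: is_deriveD.
have -> : complex.Re ('i%C * ((k 0 a)%:~R)%:C%C * c * cis (dot k x)) =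
  complex.Re c * (- sin (0 * (k 0 a)%:~R + dot k x) * (k 0 a)%:~R)
   - complex.Im c * (cos (0 * (k 0 a)%:~R + dot k x) * (k 0 a)%:~R).
  by rewrite mul0r add0r; case: c => c1 c2 /=; ring.
set K : R := (k 0 a)%:~R.
have dl : is_derive (0 : R) (1 : R) (fun t : R => t * K + dot k x) K.
  by apply: is_derive_eq; rewrite /GRing.scale /=; ring.
apply: is_deriveB.
Qed.

Definition tp (K : nat) (F : E -> R) := exists2 s, dle K s & F = ev s.

Lemma tp_leq K L F : (K <= L)%N -> tp K F -> tp L F.
Proof. by move=> KL [s ds ->]; exists s => //; exact: dle_leq ds. Qed.

Lemma tpD K F G : tp K F -> tp K G -> tp K (fun x => F x + G x).
Proof.
move=> [s ds ->] [t dt ->]; exists (s ++ t); first by rewrite dle_cat ds.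
by apply/funext => x; rewrite ev_cat.
Qed.

Lemma tpM K L F G : tp K F -> tp L G -> tp (K + L) (fun x => F x * G x).
Proof.
move=> [s ds ->] [t dt ->]; exists (mulp s t); first exact: dle_mulp.
by apply/funext => x; rewrite ev_mulp.
Qed.

Lemma tp_cst c : tp 0 (fun=> c).
Proof.
exists [:: (c%:C%C, 0)]; first by rewrite /dle/= andbT; apply/forallP => a; rewrite mxE.
by apply/funext => x; rewrite /ev big_seq1 dot0l cis0 mulr1.
Qed.

Lemma tpZ K c F : tp K F -> tp K (fun x => c * F x).
Proof. exact: tpM (tp_cst c). Qed.

Lemma tpN K F : tp K F -> tp K (fun x => - F x).
Proof. by move=> /(tpZ (-1)); congr (tp _ _); apply/funext => x; rewrite mulN1r. Qed.

Lemma tpB K F G : tp K F -> tp K G -> tp K (fun x => F x - G x).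
Proof. by move=> tF /tpN; exact: tpD. Qed.

Lemma tp_symb K f s : dle K s -> tp K (ev (symb f s)).
Proof. by move=> ds; exists (symb f s) => //; rewrite dle_symb. Qed.

Lemma tp_is_derive K F x a : tp K F -> is_derive x (delta_mx 0 a) F (partial a F x).
Proof.
move=> [s _ ->]; apply: DeriveDef; last by [].
by have [] := is_derive_ev s x a.
Qed.

Lemma partial_ev s a : partial a (ev s) = ev (symb (fun k => 'i%C * ((k 0 a)%:~R)%:C%C) s).
Proof. by apply/funext => x; have [] := is_derive_ev s x a. Qed.

Lemma tp_partial K F a : tp K F -> tp K (partial a F).
Proof. by move=> [s ds ->]; rewrite partial_ev; exact: tp_symb. Qed.

Lemma partialC F K a b : tp K F -> partial a (partial b F) = partial b (partial a F).
Proof.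
move=> [s ds ->]; rewrite !partial_ev !symb_comp; congr (ev (symb _ s)).
by apply/funext => k; ring.
Qed.

Lemma partialD K F G a : tp K F -> tp K G ->
  partial a (fun x => F x + G x) = (fun x => partial a F x + partial a G x).
Proof.
move=> tF tG; apply/funext => x.
have := tp_is_derive x a tF; have := tp_is_derive x a tG => dG dF.
by have := is_deriveD dF dG; case.
Qed.

Lemma partialM K L F G a : tp K F -> tp L G ->
  partial a (fun x => F x * G x) = (fun x => partial a F x * G x + F x * partial a G x).
Proof.
move=> tF tG; apply/funext => x.
have := tp_is_derive x a tF; have := tp_is_derive x a tG => dG dF.
have := is_deriveM dF dG; case => _ e; apply: etrans e _.
by rewrite /GRing.scale/= addrC mulrC.
Qed.

Lemma partial_cst (c : R) a : partial a (fun _ : E => c) = fun=> 0.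
Proof. by apply/funext => x; rewrite /partial derive_cst. Qed.

Definition cosx (mu : int) (a : 'I_m) (x : E) : R := cos (mu%:~R * x 0 a).
Definition sinx (mu : int) (a : 'I_m) (x : E) : R := sin (mu%:~R * x 0 a).

Lemma dot_scale_delta mu a x : dot (mu *: delta_mx 0 a) x = mu%:~R * x 0 a.
Proof.
rewrite /dot (bigD1 a)//= !mxE !eqxx mulr1 big1 ?addr0// => b /negbTE ba.
by rewrite !mxE ba andbF mulr0 mul0r.
Qed.

Lemma cosxE mu a : cosx mu a = ev [:: (1, mu *: delta_mx 0 a)].
Proof. by apply/funext => x; rewrite /ev big_seq1 mul1r dot_scale_delta. Qed.

Lemma sinxE mu a : sinx mu a = ev [:: (- 'i%C, mu *: delta_mx 0 a)].
Proof.
apply/funext => x; rewrite /ev big_seq1 dot_scale_delta /= /sinx; ring.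
Qed.

Lemma dle_scale_delta c mu a : dle (absz mu) [:: (c, mu *: delta_mx 0 a)].
Proof.
rewrite /dle /= andbT; apply/forallP => b; rewrite !mxE /= abszM.
by case: (b == a); rewrite ?muln1 ?muln0.
Qed.

Lemma tp_cosx mu a : tp (absz mu) (cosx mu a).
Proof. by rewrite cosxE; eexists; last by []; exact: dle_scale_delta. Qed.

Lemma tp_sinx mu a : tp (absz mu) (sinx mu a).
Proof. by rewrite sinxE; eexists; last by []; exact: dle_scale_delta. Qed.

Lemma partial_cosx mu a b :
  partial b (cosx mu a) = fun x => - (mu%:~R *+ (b == a)) * sinx mu a x.
Proof.
rewrite cosxE partial_ev sinxE; apply/funext => x.
rewrite /ev !big_seq1 /= dot_scale_delta !mxE /=.
by case: (b == a); rewrite ?mulr1n ?mulr0n ?mulr1 ?mulr0 /=; ring.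
Qed.

Lemma partial_sinx mu a b :
  partial b (sinx mu a) = fun x => mu%:~R *+ (b == a) * cosx mu a x.
Proof.
rewrite cosxE sinxE partial_ev; apply/funext => x.
rewrite /ev !big_seq1 /= dot_scale_delta !mxE /=.
by case: (b == a); rewrite ?mulr1n ?mulr0n ?mulr1 ?mulr0 /=; ring.
Qed.

End trigpoly.

(** * Fourier multipliers bounded on the sup norm *)

Lemma cvgn_bigsum (R : realType) (I : Type) (r : seq I) (F : I -> nat -> R) (l : I -> R) :
  (forall i, F i @ \oo --> l i) ->
  (fun N => \sum_(i <- r) F i N) @ \oo --> \sum_(i <- r) l i.
Proof.
move=> h; elim: r => [|i r IH].
  by rewrite big_nil; under eq_fun => N do rewrite big_nil; exact: cvg_cst.
rewrite big_cons; under eq_fun => N do rewrite big_cons.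
by apply: cvgD.
Qed.

Lemma cvgn_le_cst (R : realType) (u : nat -> R) (l c : R) :
  u @ \oo --> l -> (forall N, u N <= c) -> l <= c.
Proof.
move=> ul h; rewrite -(cvg_lim _ ul)//; apply: limr_le; first exact: cvgP ul.
by near=> N; exact: h.
Unshelve. all: by end_near.
Qed.

Section multipliers.
Variables (R : realType) (m : nat).
Local Notation E := 'rV[R]_m.
Local Notation freq := 'rV[int]_m.
Local Notation ev := (@ev R m).

(** The bound is asked of every list. With [M = 0] it forces the output to depend on the function
    [ev s] only, so that it can hold only for symbols for which f(-k) is the conjugate of f(k) up to
    degree K, such as real even symbols and i times real odd ones. *)
Definition mbound (K : nat) (f : freq -> R[i]) (C : R) :=
  forall s (M : R), dle K s -> (forall x, `|ev s x| <= M) ->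
  forall x, `|ev (symb f s) x| <= C * M.

Lemma mbound_eq K f g C :
  (forall k : freq, (forall a, (absz (k 0%R a) <= K)%N) -> f k = g k) ->
  mbound K f C -> mbound K g C.
Proof. by move=> fg bf s M ds sM x; rewrite -(eq_symb ds fg); exact: bf. Qed.

Lemma mbound_le K f C C' : C <= C' -> mbound K f C -> mbound K f C'.
Proof.
move=> CC bf s M ds sM x; apply: le_trans (bf _ _ ds sM x) _.
by apply: ler_wpM2r => //; apply: le_trans (sM 0).
Qed.

(** A translation preserves the sup norm; this is the source of the bounds for all finite
    combinations of translations. *)
Lemma mbound_cis K y : mbound K (fun k => cis (dot k y)) 1.
Proof. by move=> s M ds sM x; rewrite -ev_shift mul1r. Qed.

Lemma mbound_comp K f g C D : mbound K f C -> mbound K g D ->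
  mbound K (fun k => f k * g k) (C * D).
Proof.
move=> bf bg s M ds sM x; rewrite -symb_comp -mulrA.
by apply: bf; [rewrite dle_symb | apply: bg].
Qed.

Lemma mbound_add K f g C D : mbound K f C -> mbound K g D ->
  mbound K (fun k => f k + g k) (C + D).
Proof.
move=> bf bg s M ds sM x; rewrite ev_symbD mulrDl.
by rewrite (le_trans (ler_normD _ _))// lerD// ?bf// ?bg.
Qed.

Lemma mbound_scale K f C (c : R) : mbound K f C ->
  mbound K (fun k => c%:C%C * f k) (`|c| * C).
Proof.
move=> bf s M ds sM x; rewrite ev_symbZ normrM -mulrA.
by apply: ler_wpM2l => //; exact: bf.
Qed.

Lemma mbound_sum K (I : Type) (r : seq I) (f : I -> freq -> R[i]) (C : I -> R) :
  (forall i, mbound K (f i) (C i)) ->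
  mbound K (fun k => \sum_(i <- r) f i k) (\sum_(i <- r) C i).
Proof.
move=> bf s M ds sM x; rewrite ev_symb_sum mulr_suml.
apply: le_trans (ler_norm_sum _ _ _) _; apply: ler_sum => i _; exact: bf.
Qed.

(** Convolution with a finite signed measure is bounded by its total variation. *)
Lemma mbound_meas K (I : Type) (r : seq I) (c : I -> R) (y : I -> E) :
  mbound K (fun k => \sum_(i <- r) (c i)%:C%C * cis (dot k (y i))) (\sum_(i <- r) `|c i|).
Proof.
apply: mbound_sum => i; apply: (@mbound_le _ _ (`|c i| * 1)); first by rewrite mulr1.
by apply: mbound_scale; exact: mbound_cis.
Qed.

(** A given list has finitely many frequencies, so pointwise convergence of the symbols gives
    convergence of the values; only the bounds have to be uniform in N. *)
Lemma mbound_lim K (f_ : nat -> freq -> R[i]) f C :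
  (forall N, mbound K (f_ N) C) ->
  (forall k, (fun N => complex.Re (f_ N k)) @ \oo --> complex.Re (f k)) ->
  (forall k, (fun N => complex.Im (f_ N k)) @ \oo --> complex.Im (f k)) ->
  mbound K f C.
Proof.
move=> bf cRe cIm s M ds sM x.
have cv : (fun N => ev (symb (f_ N) s) x) @ \oo --> ev (symb f s) x.
  rewrite ev_symb; under eq_fun => N do rewrite ev_symb.
  apply: cvgn_bigsum => t.
  have e (z w v : R[i]) : complex.Re (z * w * v) =
     complex.Re z * complex.Re (w * v) - complex.Im z * complex.Im (w * v).
    by case: z w v => ? ? [? ?] [? ?] /=; ring.
  rewrite e; under eq_fun => N do rewrite e.
  by apply: cvgB; (apply: cvgM; [|exact: cvg_cst]).
apply: (cvgn_le_cst (cvg_norm cv)) => N; exact: bf.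
Qed.

Lemma mbound_prod K (I : Type) (r : seq I) (f : I -> freq -> R[i]) :
  (forall i, mbound K (f i) 1) -> mbound K (fun k => \prod_(i <- r) f i k) 1.
Proof.
move=> bf; elim: r => [|i r IH].
  apply: (@mbound_eq _ (fun k => cis (dot k (0 : E)))); last exact: mbound_cis.
  by move=> k _; rewrite big_nil /dot big1 ?cis0// => a _; rewrite mxE mulr0.
have -> : (fun k => \prod_(j <- i :: r) f j k) = (fun k => f i k * \prod_(j <- r) f j k).
  by apply/funext => k; rewrite big_cons.
apply: (@mbound_le _ _ (1 * 1)); first by rewrite mulr1.
exact: mbound_comp.
Qed.

End multipliers.

(** * Equispaced nodes and the Fejer kernel *)

Section grid.
Variable R : realType.

Lemma cis_int2pi (k : int) : cis (k%:~R * (pi *+ 2)) = 1 :> R[i].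
Proof.
have c1 : cis (pi *+ 2) = 1 :> R[i] by rewrite /cis cos2pi sin2pi.
case: k => n; first by rewrite -pmulrn cisX c1 expr1n.
by rewrite NegzE mulrNz mulNr cisN -pmulrn cisX c1 expr1n rmorph1.
Qed.

Lemma cis_neq1 (k : int) (M : nat) : k != 0 -> (absz k < M)%N ->
  cis (k%:~R * (pi *+ 2 / M%:R)) != 1 :> R[i].
Proof.
move=> k0 kM; apply/eqP => -[] c1 _.
have M0 : (0 < M%:R :> R) by rewrite ltr0n (leq_ltn_trans _ kM).
(* Half of the angle: t lies strictly between 0 and pi, so that sin t > 0, against cos (2 t) = 1. *)
set t : R := (absz k)%:R * (pi / M%:R).
have ct : cos (t *+ 2) = 1.
  rewrite -c1; rewrite -[RHS]cos_norm; congr cos.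
  rewrite normrM -intr_norm -abszE -pmulrn /t ger0_norm; last first.
    by rewrite mulr_ge0 ?invr_ge0 ?(ltW M0)// mulrn_wge0// pi_ge0.
  by rewrite -mulrnAr -mulrnAl.
have t0 : 0 < t < pi.
  rewrite /t mulr_gt0 ?divr_gt0 ?pi_gt0// ?ltr0n ?absz_gt0//=.
  by rewrite mulrCA gtr_pMr ?pi_gt0// ltr_pdivrMr// mul1r ltr_nat.
have := sin_gt0_pi t0; rewrite cos_mulr2n in ct.
have := cos2Dsin2 t; nra.
Qed.

Lemma grid_sum (M : nat) (k : int) : (absz k < M)%N ->
  \sum_(r < M) cis (k%:~R * (r%:R * (pi *+ 2 / M%:R))) =
  (M * (k == 0))%:R :> R[i].
Proof.
move=> kM; have M0 : (M%:R != 0 :> R) by rewrite pnatr_eq0 -lt0n (leq_ltn_trans _ kM).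
have [->|k0] := eqVneq k 0.
  rewrite muln1 (eq_bigr (fun=> 1)) ?sumr_const ?card_ord// => r _.
  by rewrite mul0r cis0.
rewrite muln0; set z := cis (k%:~R * (pi *+ 2 / M%:R)) : R[i].
rewrite (eq_bigr (fun r : 'I_M => z ^+ r)); last first.
  by move=> r _; rewrite mulrCA cisX.
apply/eqP; rewrite -(mulrI_eq0 _ (_ : GRing.lreg (z - 1))); last first.
  by apply/lregP; rewrite subr_eq0; exact: cis_neq1.
rewrite -subrX1 /z -cisX.
have -> : M%:R * (k%:~R * (pi *+ 2 / M%:R)) = k%:~R * (pi *+ 2) :> R by field.
by rewrite cis_int2pi subrr.
Qed.

Lemma sum_ord_lt (K c : nat) : (\sum_(p < K) (p < c) = minn K c)%N.
Proof.
elim: K => [|K IH]; first by rewrite big_ord0 min0n.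
by rewrite big_ord_recr /= IH; lia.
Qed.

(** The number of pairs p, q < K with q - p = j, that is, K times the Fourier coefficient of
    [fejer K] at j. *)
Definition shift_count (K : nat) (j : int) : nat :=
  (\sum_(p < K) \sum_(q < K) (p%:Z - q%:Z + j == 0)%R)%N.

Lemma shift_countE K j : shift_count K j = (K - absz j)%N.
Proof.
have key (n : nat) : (\sum_(p < K) \sum_(q < K) ((q : nat) == p + n) = K - n)%N.
  rewrite (eq_bigr (fun p : 'I_K => (p < K - n) : nat)); last first.
    move=> p _; case: ltnP => pn.
      have pK : (p + n < K)%N by lia.
      rewrite (bigD1 (Ordinal pK))//= eqxx big1// => q.
      by rewrite -val_eqE /= => /negbTE ->.
    by apply: big1 => q _; have := ltn_ord q; case: eqP => //; lia.
  by rewrite sum_ord_lt; lia.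
rewrite /shift_count; case: j => n.
  rewrite -key; apply: eq_bigr => p _; apply: eq_bigr => q _; congr nat_of_bool; lia.
rewrite -key exchange_big; apply: eq_bigr => p _; apply: eq_bigr => q _.
congr nat_of_bool; lia.
Qed.

Definition fejer (K : nat) (t : R) : R :=
  (complex.Re (\sum_(p < K) cis (p%:R * t)) ^+ 2 +
   complex.Im (\sum_(p < K) cis (p%:R * t)) ^+ 2) / K%:R.

Lemma fejer_ge0 K t : 0 <= fejer K t.
Proof. by rewrite /fejer divr_ge0// addr_ge0// sqr_ge0. Qed.

Lemma fejerE K t :
  (fejer K t)%:C%C = (K%:R^-1)%:C%C * \sum_(p < K) \sum_(q < K) cis ((p%:R - q%:R) * t).
Proof.
have -> : \sum_(p < K) \sum_(q < K) cis ((p%:R - q%:R) * t) =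
    (\sum_(p < K) cis (p%:R * t)) * ((\sum_(p < K) cis (p%:R * t))^*)%C.
  rewrite rmorph_sum mulr_suml; apply: eq_bigr => p _.
  rewrite mulr_sumr; apply: eq_bigr => q _.
  apply: (@etrans _ _ (cis (p%:R * t) * ((cis (q%:R * t))^*)%C)) => //.
  by rewrite -cisN -cisD; congr cis; ring.
rewrite /fejer; case: (\sum_(p < K) _) => a b /=.
by apply/eqP; rewrite eq_complex /=; apply/andP; split; apply/eqP; ring.
Qed.

(** The summand has degree below [M], so the M nodes compute its Fourier coefficient exactly. *)
Lemma fejer_grid (K M : nat) (j : int) : (0 < K)%N -> (K + absz j < M)%N ->
  \sum_(r < M) (fejer K (r%:R * (pi *+ 2 / M%:R)))%:C%C *
    cis (j%:~R * (r%:R * (pi *+ 2 / M%:R))) =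
  (M%:R * K%:R^-1 * (K - absz j)%N%:R)%:C%C :> R[i].
Proof.
move=> K0 KM; set tau := pi *+ 2 / M%:R.
under eq_bigr => r _ do rewrite fejerE -mulrA mulr_suml.
rewrite -mulr_sumr exchange_big /=.
under eq_bigr => p _ do (under eq_bigr => r _ do rewrite mulr_suml; rewrite exchange_big /=).
set S := (X in _ * X = _); have -> : S = (M * shift_count K j)%:R.
  rewrite /S /shift_count big_distrr /= natr_sum; apply: eq_bigr => p _.
  rewrite big_distrr /= natr_sum; apply: eq_bigr => q _.
  rewrite -grid_sum; last by have := ltn_ord p; have := ltn_ord q; lia.
  apply: eq_bigr => r _; rewrite -cisD !intrD mulrNz -!pmulrn /tau; congr cis; ring.
by rewrite shift_countE natrM !rmorphM !rmorph_nat /=; ring.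
Qed.

End grid.

(** * Bernstein's inequality *)

Section bernstein.
Variables (R : realType) (m : nat).
Local Notation freq := 'rV[int]_m.

Lemma cis_2sin (x : R) : (2 * sin x)%:C%C = 'i%C * (cis (- x) - cis x).
Proof.
rewrite /cis cosN sinN; apply/eqP; rewrite eq_complex /=.
by apply/andP; split; apply/eqP; ring.
Qed.

Lemma dot_scale_r (k : freq) (t : R) a : dot k (t *: delta_mx 0 a) = (k 0 a)%:~R * t.
Proof. by rewrite dotZr dot_delta mulrC. Qed.

Lemma fejer_sum (K M : nat) : (0 < K)%N -> (K < M)%N ->
  \sum_(r < M) fejer K (r%:R * (pi *+ 2 / M%:R)) = M%:R :> R.
Proof.
move=> K0 KM; have KM' : (K + absz 0%R < M)%N by rewrite absz0 addn0.
have := fejer_grid R K0 KM'.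
move=> /(congr1 (@complex.Re R)); rewrite /= Re_sum subn0 divfK ?pnatr_eq0 -?lt0n// => {2}<-.
by apply: eq_bigr => r _; rewrite mul0r cis0 mulr1.
Qed.

(** For |n| <= K, the difference of the triangles of height K centred at K and at -K takes the value
    n. Hence on degree K the derivative is convolution with [fejer K] modulated by 2 K sin (K t), of
    mass at most 2 K. *)
Lemma mbound_d K a : (0 < K)%N ->
  mbound K (fun k : freq => 'i%C * ((k 0 a)%:~R)%:C%C) (2 * K%:R : R).
Proof.
(* The quadrature involves K + |n - K| and K + |n + K|, at most 3 K. *)
move=> K0; set M := (3 * K).+1; set tau : R := pi *+ 2 / M%:R.
have M0 : (M%:R != 0 :> R) by rewrite pnatr_eq0.
have K0' : (K%:R != 0 :> R) by rewrite pnatr_eq0 -lt0n.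
pose c (r : 'I_M) := K%:R / M%:R * fejer K (r%:R * tau) * (2 * sin (K%:R * (r%:R * tau))).
apply: (@mbound_le _ _ _ _ (\sum_r `|c r|)).
  apply: (@le_trans _ _ (\sum_(r < M) (2 * K%:R / M%:R) * fejer K (r%:R * tau))).
    apply: ler_sum => r _; rewrite /c normrM [X in X * _]ger0_norm; last first.
      by rewrite mulr_ge0 ?fejer_ge0// divr_ge0.
    apply: (@le_trans _ _ (K%:R / M%:R * fejer K (r%:R * tau) * 2)); last by rewrite mulrC !mulrA.
    apply: ler_wpM2l; first by rewrite mulr_ge0 ?fejer_ge0// divr_ge0.
    rewrite normrM normr_nat.
    by rewrite ler_piMr// sin_max.
  by rewrite -mulr_sumr fejer_sum ?divfK//; lia.
apply: mbound_eq; last first.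
  apply: (@mbound_meas R m K _ (index_enum 'I_M) c (fun r => (r%:R * tau) *: delta_mx 0 a)).
move=> k kK; set n := k 0 a.
have nK : (absz n <= K)%N by exact: kK.
have -> : \sum_r (c r)%:C%C * cis (dot k ((r%:R * tau) *: delta_mx 0 a)) =
   (K%:R / M%:R)%:C%C * 'i%C *
   (\sum_(r < M) (fejer K (r%:R * tau))%:C%C * cis ((n - K%:Z)%:~R * (r%:R * tau)) -
    \sum_(r < M) (fejer K (r%:R * tau))%:C%C * cis ((n + K%:Z)%:~R * (r%:R * tau))).
  rewrite -sumrB mulr_sumr; apply: eq_bigr => r _.
  have -> : (c r)%:C%C = (K%:R / M%:R)%:C%C * (fejer K (r%:R * tau))%:C%C *
      (2 * sin (K%:R * (r%:R * tau)))%:C%C by rewrite /c !rmorphM.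
  rewrite cis_2sin dot_scale_r -/n.
  have e1 : cis ((n - K%:Z)%:~R * (r%:R * tau)) = cis (n%:~R * (r%:R * tau)) * cis (- (K%:R * (r%:R * tau))).
    by rewrite -cisD intrB -pmulrn; congr cis; ring.
  have e2 : cis ((n + K%:Z)%:~R * (r%:R * tau)) = cis (n%:~R * (r%:R * tau)) * cis (K%:R * (r%:R * tau)).
    by rewrite -cisD intrD -pmulrn; congr cis; ring.
  by rewrite e1 e2 /=; ring.
rewrite !fejer_grid//; [|by rewrite /M; lia..].
rewrite -rmorphB /= mulrAC -rmorphM /= mulrC; congr (_ * _%:C%C).
rewrite -mulrBr mulrA.
have -> : K%:R / M%:R * (M%:R / K%:R) = 1 :> R by field; rewrite K0' M0.
rewrite mul1r !pmulrn -intrB; congr (_%:~R); lia.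
Qed.

(** Convolution with 2 sin (l t) in one variable keeps the frequencies l and -l only, and this
    kernel is bounded by 2. It serves to sum a rapidly decaying odd symbol frequency by
    frequency. *)
Lemma mbound_extract K a (l : nat) : (l <= K)%N ->
  mbound K (fun k : freq => 'i%C * (((k 0%R a == l%:Z)%:R - (k 0%R a == - l%:Z)%:R) : R)%:C%C) 2.
Proof.
move=> lK; set M := (2 * K).+1; set tau : R := pi *+ 2 / M%:R.
have M0 : (M%:R != 0 :> R) by rewrite pnatr_eq0.
pose c (r : 'I_M) := M%:R^-1 * (2 * sin (l%:R * (r%:R * tau))).
apply: (@mbound_le _ _ _ _ (\sum_r `|c r|)).
  apply: (@le_trans _ _ (\sum_(r < M) (2 / M%:R))).
    apply: ler_sum => r _; rewrite /c !normrM normfV !normr_nat mulrCA.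
    by rewrite mulrA ler_piMr// ?sin_max// mulr_ge0// invr_ge0.
  by rewrite sumr_const card_ord -[X in X <= _]mulr_natr divfK.
apply: mbound_eq; last first.
  apply: (@mbound_meas R m K _ (index_enum 'I_M) c (fun r => (r%:R * tau) *: delta_mx 0 a)).
move=> k kK; set n := k 0 a.
have nK : (absz n <= K)%N by exact: kK.
have -> : \sum_r (c r)%:C%C * cis (dot k ((r%:R * tau) *: delta_mx 0 a)) =
   (M%:R^-1)%:C%C * 'i%C *
   (\sum_(r < M) cis ((n - l%:Z)%:~R * (r%:R * tau)) -
    \sum_(r < M) cis ((n + l%:Z)%:~R * (r%:R * tau))).
  rewrite -sumrB mulr_sumr; apply: eq_bigr => r _.
  have -> : (c r)%:C%C = (M%:R^-1)%:C%C * (2 * sin (l%:R * (r%:R * tau)))%:C%C.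
    by rewrite /c !rmorphM.
  rewrite cis_2sin dot_scale_r -/n.
  have e1 : cis ((n - l%:Z)%:~R * (r%:R * tau)) = cis (n%:~R * (r%:R * tau)) * cis (- (l%:R * (r%:R * tau))).
    by rewrite -cisD intrB -pmulrn; congr cis; ring.
  have e2 : cis ((n + l%:Z)%:~R * (r%:R * tau)) = cis (n%:~R * (r%:R * tau)) * cis (l%:R * (r%:R * tau)).
    by rewrite -cisD intrD -pmulrn; congr cis; ring.
  by rewrite e1 e2 /=; ring.
rewrite !grid_sum; [|by rewrite /M; lia..].
rewrite subr_eq0 addr_eq0; set b1 := n == _; set b2 := n == _.
have -> : (M * b1)%:R - (M * b2)%:R = (M%:R * (b1%:R - b2%:R))%:C%C :> R[i].
  by rewrite rmorphM rmorphB !rmorph_nat /= mulrBr !natrM.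
by rewrite mulrAC -rmorphM /= mulrA mulVf// mul1r mulrC.
Qed.

End bernstein.

(** * Gradient bound for a random walk *)

Section carre_du_champ.
Variables (R : realType) (V : zmodType) (h : V).
Implicit Types F : V -> R.

(** One step of the symmetric random walk of step h, whose iterates approximate the heat semigroup;
    [dif] is its discrete derivative. *)
Definition avg F x := (F (x + h) + F (x - h)) / 2.
Definition dif F x := (F (x + h) - F (x - h)) / 2.

Lemma iter_avg_bound N F (M : R) : (forall x, `|F x| <= M) -> forall x, `|iter N avg F x| <= M.
Proof.
move=> FM; elim: N => //= N IH x; rewrite /avg normrM normfV normr_nat.
by rewrite ler_pdivrMr// (le_trans (ler_normD _ _))// mulr_natr mulr2n lerD.
Qed.

Lemma iter_avg_jensen N F x : (iter N avg F x) ^+ 2 <= iter N avg (fun y => F y ^+ 2) x.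
Proof.
elim: N x => //= N IH x; apply: (@le_trans _ _ (avg (fun y => (iter N avg F y) ^+ 2) x)).
  rewrite /avg; set a := iter _ _ _ _; set b := iter _ _ _ _.
  by have := sqr_ge0 (a - b); nra.
by rewrite /avg ler_pM2r// lerD.
Qed.

Lemma iter_dif N F : dif (iter N avg F) = iter N avg (dif F).
Proof.
elim: N F => // N IH F; rewrite iterSr [in RHS]iterSr IH; congr iter.
apply/funext => x; rewrite /dif /avg !(addrK, subrK); ring.
Qed.

(* Telescoping [avg (G^2) - (avg G)^2 = (dif G)^2] along the iterates of avg, with Jensen's inequality for each term. *)
Lemma dif_iter_avg N F (M : R) : (forall x, `|F x| <= M) ->
  forall x, N.+1%:R * (dif (iter N avg F) x) ^+ 2 <= M ^+ 2.
Proof.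
move=> FM x; pose G j := iter j avg (fun y => (iter (N.+1 - j) avg F y) ^+ 2) x.
have step j : (j < N.+1)%N -> (dif (iter N avg F) x) ^+ 2 <= G j.+1 - G j.
  move=> jN.
  have -> : G j.+1 = iter j avg (avg (fun y => iter (N - j) avg F y ^+ 2)) x.
    by rewrite /G subSS -iterSr.
  have -> : G j = iter j avg (fun y => avg (iter (N - j) avg F) y ^+ 2) x.
    by rewrite /G subSn.
  set H := iter (N - j) avg F.
  have iterB P Q n y : iter n avg P y - iter n avg Q y = iter n avg (fun z => P z - Q z) y.
    elim: n y => //= n IHn y; rewrite /avg -!IHn; ring.
  rewrite iterB.
  have -> : (fun z => avg (fun y => H y ^+ 2) z - avg H z ^+ 2) = (fun z => dif H z ^+ 2).
    by apply/funext => z; rewrite /avg /dif; field.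
  have -> : dif (iter N avg F) = iter j avg (dif H).
    by rewrite -iter_dif -iterD subnKC.
  exact: iter_avg_jensen.
have tel n : (n <= N.+1)%N -> n%:R * (dif (iter N avg F) x) ^+ 2 <= G n - G 0%N.
  elim: n => [|n IH] nN; first by rewrite mul0r subrr.
  have := step n nN; have := IH (ltnW nN); rewrite -natr1 mulrDl mul1r; lra.
have := tel N.+1 (leqnn _); rewrite {1}/G subnn /= => h1; apply: (le_trans h1).
have G0 : 0 <= G 0%N by rewrite /G /= sqr_ge0.
rewrite lerBlDr; apply: (@le_trans _ _ (M ^+ 2)); last by rewrite lerDl.
have M0 : 0 <= M by apply: le_trans (FM x).
have := @iter_avg_bound N.+1 (fun y => F y ^+ 2) (M ^+ 2) _ x.
move=> /(_ _)/ler_normlW; apply.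
by move=> y; rewrite normrX ler_sqr.
Qed.

End carre_du_champ.

(** * Gaussian limits of powers of cosines *)

Section gaussian_limits.
Variable R : realType.

(** Squeezed through e^(- v / (1 - v)) <= 1 - v <= e^(- v), raised to the power N. *)
Lemma cvg_expn_expR (v : nat -> R) (u : R) :
  (forall N, 0 <= v N < 1) -> v @ \oo --> (0 : R) ->
  (fun N => N%:R * v N) @ \oo --> u ->
  (fun N => (1 - v N) ^+ N) @ \oo --> expR (- u).
Proof.
move=> v01 v0 vu.
have hi : (fun N => expR (- (N%:R * v N))) @ \oo --> expR (- u).
  by apply: (continuous_cvg _ (@continuous_expR R _)); exact: cvgN.
have lo : (fun N => expR (- (N%:R * v N / (1 - v N)))) @ \oo --> expR (- u).
  apply: (continuous_cvg _ (@continuous_expR R _)); apply: cvgN.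
  rewrite -[u]divr1; apply: cvgM => //; apply: cvgV; first by rewrite oner_neq0.
  by rewrite -[X in _ --> X]subr0; apply: cvgB => //; exact: cvg_cst.
apply: squeeze_cvgr lo hi; near=> N; have /andP[vN0 vN1] := v01 N.
have e1 : 0 <= 1 - v N by lra.
have -> : - (N%:R * v N / (1 - v N)) = N%:R * (- (v N / (1 - v N))) by rewrite mulrN mulrA.
have -> : - (N%:R * v N) = N%:R * (- v N) by rewrite mulrN.
rewrite !expRM_natl; apply/andP; split; last first.
  by apply: lerXn2r; rewrite ?nnegrE ?expR_ge0//; have := expR_ge1Dx (- v N); lra.
apply: lerXn2r; rewrite ?nnegrE ?expR_ge0//.
have e2 : (1 - v N)^-1 <= expR (v N / (1 - v N)).
  apply: le_trans (expR_ge1Dx _); rewrite -[X in _ <= X + _](@divff _ (1 - v N)); last by lra.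
  by rewrite -mulrDl subrK mul1r.
by rewrite expRN -[leRHS]invrK lef_pV2 ?posrE ?expR_gt0 ?invr_gt0//; lra.
Unshelve. all: by end_near.
Qed.

Lemma cvg_sinx_x : (fun x : R => x^-1 * sin x) x @[x --> 0^'] --> (1 : R).
Proof.
have [d e] := is_derive_sin (0 : R).
have := d; rewrite /derivable => /cvg_ex[l hl].
have := hl; rewrite -[l](cvg_lim _ hl)// -/(derive _ _ _) e cos0.
apply: cvg_trans; apply: near_eq_cvg; near=> x.
by rewrite /= addr0 sin0 subr0 [x *: 1]mulr1.
Unshelve. all: by end_near.
Qed.

Lemma cvg_invsqrt : (fun N : nat => (Num.sqrt N.+1%:R)^-1) @ \oo --> (0 : R).
Proof.
have -> : (fun N : nat => (Num.sqrt N.+1%:R)^-1 : R) = (fun N : nat => Num.sqrt (harmonic N)).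
  by apply/funext => N; rewrite /harmonic sqrtrV.
rewrite -[X in _ --> X]sqrtr0; apply: continuous_cvg; first exact: sqrt_continuous.
exact: cvg_harmonic.
Qed.

Lemma cvg_sinq (y : R) :
  (fun N : nat => (Num.sqrt N.+1%:R) * sin (y / Num.sqrt N.+1%:R)) @ \oo --> y.
Proof.
have s0 N : 0 < Num.sqrt N.+1%:R :> R by rewrite sqrtr_gt0 ltr0n.
have [->|y0] := eqVneq y 0.
  have -> : (fun N : nat => Num.sqrt N.+1%:R * sin (0 / Num.sqrt N.+1%:R)) = cst (0 : R).
    by apply/funext => N; rewrite mul0r sin0 mulr0.
  exact: cvg_cst.
have z0 : (fun N : nat => y / Num.sqrt N.+1%:R) @ \oo --> (0 : R).
  by rewrite -[X in _ --> X](mulr0 y); apply: cvgM cvg_invsqrt; exact: cvg_cst.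
have z1 : (fun N : nat => y / Num.sqrt N.+1%:R) @ \oo --> (0 : R)^'.
  move=> A [e /= e0 eA]; have /cvgrPdist_lt/(_ _ e0) := z0.
  apply: filterS => N hN; apply: eA => //.
  by rewrite mulf_eq0 invr_eq0 negb_or y0 gt_eqF.
have := cvg_comp _ _ z1 cvg_sinx_x.
move=> h; rewrite -[X in _ --> X]mulr1.
have -> : (fun N : nat => Num.sqrt N.+1%:R * sin (y / Num.sqrt N.+1%:R)) =
   (fun N => y * ((fun x : R => x^-1 * sin x) \o (fun N : nat => y / Num.sqrt N.+1%:R)) N).
  by apply/funext => N /=; field; rewrite y0 gt_eqF.
by apply: cvgM h; exact: cvg_cst.
Qed.

Lemma cvg_natratio : (fun N : nat => N%:R / N.+1%:R) @ \oo --> (1 : R).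
Proof.
have -> : (fun N : nat => N%:R / N.+1%:R : R) = (fun N => 1 - harmonic N).
  apply/funext => N; rewrite /harmonic; apply: (@mulIf _ N.+1%:R) => //.
  by rewrite divfK// mulrBl mulVf// mul1r -natr1 addrK.
by rewrite -[X in _ --> X]subr0; apply: cvgB; [exact: cvg_cst | exact: cvg_harmonic].
Qed.

(** Reduces to [cvg_expn_expR], since 1 - cos t = 2 sin^2 (t / 2) behaves as y^2 / (2 (N + 1)) at t
    = y / sqrt (N + 1). *)
Lemma cvg_cos_pow (y : R) :
  (fun N : nat => cos (y / Num.sqrt N.+1%:R) ^+ N) @ \oo --> expR (- (y ^+ 2 / 2)).
Proof.
have s0 N : 0 < Num.sqrt N.+1%:R :> R by rewrite sqrtr_gt0 ltr0n.
pose v (N : nat) : R := 1 - cos (y / Num.sqrt N.+1%:R).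
have vE N : v N = 2 * sin (y / 2 / Num.sqrt N.+1%:R) ^+ 2.
  rewrite /v; have -> : y / Num.sqrt N.+1%:R = (y / 2 / Num.sqrt N.+1%:R) *+ 2.
    by rewrite mulr2n; field; rewrite gt_eqF.
  by rewrite cos_mulr2n cos2sin2; lra.
have NvE N : N.+1%:R * v N = 2 * (Num.sqrt N.+1%:R * sin (y / 2 / Num.sqrt N.+1%:R)) ^+ 2.
  by rewrite vE exprMn sqr_sqrtr ?ler0n// mulrCA.
have cNv : (fun N => N.+1%:R * v N) @ \oo --> y ^+ 2 / 2.
  under eq_fun => N do rewrite NvE.
  have -> : y ^+ 2 / 2 = 2 * (y / 2) ^+ 2 by field.
  apply: cvgM; first exact: cvg_cst.
  under eq_fun => N do rewrite expr2.
  by rewrite expr2; apply: cvgM; exact: cvg_sinq.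
have c1 : (fun N => N%:R * v N) @ \oo --> y ^+ 2 / 2.
  rewrite -[X in _ --> X]mul1r.
  have -> : (fun N => N%:R * v N) = (fun N => (N%:R / N.+1%:R) * (N.+1%:R * v N)).
    by apply/funext => N; rewrite mulrA divfK.
  by apply: cvgM cNv; exact: cvg_natratio.
have c0 : v @ \oo --> (0 : R).
  rewrite -[X in _ --> X](mul0r (y ^+ 2 / 2)).
  have -> : v = (fun N => harmonic N * (N.+1%:R * v N)).
    by apply/funext => N; rewrite /harmonic mulKf.
  by apply: cvgM cNv; exact: cvg_harmonic.
have v0 N : 0 <= v N by rewrite /v subr_ge0 cos_le1.
(* The first terms of [v] may exceed 1, so truncate. *)
pose v' N := if v N < 1 then v N else 0.
have ev : \forall N \near \oo, v' N = v N.
  have /cvgrPdist_lt/(_ 1 ltr01) := c0.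
  apply: filterS => N; rewrite sub0r normrN /v' => h.
  by rewrite (le_lt_trans (ler_norm _) h).
have ev' : {near \oo, v =1 v'} by apply: filterS ev => N ->.
have ev1 : {near \oo, (fun N => N%:R * v N) =1 (fun N => N%:R * v' N)}.
  by apply: filterS ev => N ->.
have ev2 : {near \oo, (fun N => (1 - v' N) ^+ N) =1 (fun N => cos (y / Num.sqrt N.+1%:R) ^+ N)}.
  by apply: filterS ev => N ->; rewrite /v; congr (_ ^+ _); lra.
apply: cvg_trans (near_eq_cvg ev2) _; apply: cvg_expn_expR.
- by move=> N; rewrite /v'; case: ifPn => [->|_]; rewrite ?v0// lexx ltr01.
- exact: cvg_trans (near_eq_cvg ev') c0.
- exact: cvg_trans (near_eq_cvg ev1) c1.
Qed.

End gaussian_limits.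

(** * Heat symbols in one variable *)

Section gaussian_symbols.
Variables (R : realType) (m : nat).
Local Notation freq := 'rV[int]_m.
Implicit Types (a : 'I_m) (k : freq) (s : tpoly R m).

Lemma ev_avg s a (h : R) :
  avg (h *: delta_mx 0 a) (ev s) = ev (symb (fun k => (cos ((k 0 a)%:~R * h))%:C%C) s).
Proof.
apply/funext => x; rewrite /avg -scaleNr !ev_shift -ev_symbD mulrC.
rewrite -ev_symbZ; congr (ev (symb _ s) x).
apply/funext => k; rewrite !dot_scale_r mulrN /cis cosN sinN.
by apply/eqP; rewrite eq_complex /=; apply/andP; split; apply/eqP; field.
Qed.

Lemma ev_dif s a (h : R) :
  dif (h *: delta_mx 0 a) (ev s) = ev (symb (fun k => 'i%C * (sin ((k 0 a)%:~R * h))%:C%C) s).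
Proof.
apply/funext => x; rewrite /dif -scaleNr !ev_shift mulrC.
rewrite -[X in _ * (_ - X)]mul1r -mulNr -ev_symbZ -ev_symbD.
rewrite -ev_symbZ; congr (ev (symb _ s) x).
apply/funext => k; rewrite !dot_scale_r mulrN /cis cosN sinN.
by apply/eqP; rewrite eq_complex /=; apply/andP; split; apply/eqP; field.
Qed.

Lemma ev_iter_avg s a (h : R) N :
  iter N (avg (h *: delta_mx 0 a)) (ev s) =
  ev (symb (fun k => (cos ((k 0 a)%:~R * h) ^+ N)%:C%C) s).
Proof.
elim: N => [|N IH] /=.
  rewrite -[LHS](_ : ev (symb (fun=> 1) s) = _).
    by congr (ev (symb _ s)).
  congr ev; rewrite /symb -[RHS]map_id; apply: eq_map => -[c k] /=.
  by rewrite mul1r.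
rewrite IH ev_avg symb_comp; congr (ev (symb _ s)).
by apply/funext => k; rewrite exprS rmorphM.
Qed.

(** Chosen so that N steps of the walk have variance close to 2 t, hence the limit symbol e^(- t
    k^2). *)
Let step (t : R) N := Num.sqrt (2 * t) / Num.sqrt N.+1%:R.

Lemma mbound_gauss K a (t : R) : 0 <= t ->
  mbound K (fun k => (expR (- (t * (k 0 a)%:~R ^+ 2)))%:C%C) 1.
Proof.
move=> t0.
apply: (@mbound_lim R m K (fun N k => (cos ((k 0 a)%:~R * step t N) ^+ N)%:C%C)).
- move=> N s M ds sM x; rewrite -ev_iter_avg mul1r; exact: iter_avg_bound.
- move=> k /=; have := @cvg_cos_pow R ((k 0 a)%:~R * Num.sqrt (2 * t)).
  have -> : ((k 0 a)%:~R * Num.sqrt (2 * t)) ^+ 2 / 2 = t * (k 0 a)%:~R ^+ 2.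
    by rewrite exprMn sqr_sqrtr ?mulr_ge0//; field.
  by rewrite /step; under [X in _ -> X @ _ --> _]eq_fun => N do rewrite mulrA.
- by move=> k /=; exact: cvg_cst.
Qed.

(** The gradient of the heat semigroup: [dif_iter_avg] is divided by the step, the factors sqrt (N +
    1) cancel, and (2 t)^(- 1 / 2) is left. *)
Lemma mbound_dgauss K a (t : R) : 0 < t ->
  mbound K (fun k => 'i%C * ((k 0 a)%:~R * expR (- (t * (k 0 a)%:~R ^+ 2)))%:C%C)
    (Num.sqrt (2 * t))^-1.
Proof.
move=> t0; have st0 : 0 < Num.sqrt (2 * t) by rewrite sqrtr_gt0 mulr_gt0.
have s0 N : 0 < Num.sqrt N.+1%:R :> R by rewrite sqrtr_gt0 ltr0n.
pose g N (x : R) := (step t N)^-1 * (sin (x * step t N) * cos (x * step t N) ^+ N).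
apply: (@mbound_lim R m K (fun N k => 'i%C * (g N (k 0 a)%:~R)%:C%C)).
- move=> N s M ds sM x.
  have -> : ev (symb (fun k => 'i%C * (g N (k 0 a)%:~R)%:C%C) s) x =
     (step t N)^-1 * dif (step t N *: delta_mx 0 a)
       (iter N (avg (step t N *: delta_mx 0 a)) (ev s)) x.
    rewrite ev_iter_avg ev_dif symb_comp -ev_symbZ; congr (ev (symb _ s) x).
    by apply/funext => k; rewrite /g !rmorphM /=; ring.
  have := dif_iter_avg (step t N *: delta_mx 0 a) N sM x.
  set D := dif _ _ _ => hD.
  have M0 : 0 <= M by apply: le_trans (sM 0).
  have hD' : Num.sqrt N.+1%:R * `|D| <= M.
    rewrite -ler_sqr ?nnegrE ?mulr_ge0 ?sqrtr_ge0//.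
    by rewrite exprMn sqr_sqrtr ?ler0n// real_normK ?num_real.
  rewrite normrM /step invfM invrK normrM gtr0_norm ?invr_gt0// gtr0_norm//.
  by rewrite -mulrA; apply: ler_wpM2l hD'; rewrite invr_ge0 ltW.
- move=> k; have e (u : R) : complex.Re ('i%C * u%:C%C) = 0 by rewrite /=; ring.
  by rewrite e; under eq_fun => N do rewrite e; exact: cvg_cst.
- move=> k; have e (u : R) : complex.Im ('i%C * u%:C%C) = u by rewrite /=; ring.
  rewrite e; under eq_fun => N do rewrite e.
  set n : R := (k 0 a)%:~R; set y := n * Num.sqrt (2 * t).
  have cc := @cvg_cos_pow R y; have cs := @cvg_sinq R y.
  have -> : n * expR (- (t * n ^+ 2)) = (Num.sqrt (2 * t))^-1 * (y * expR (- (y ^+ 2 / 2))).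
    have -> : y ^+ 2 / 2 = t * n ^+ 2.
      by rewrite exprMn sqr_sqrtr ?mulr_ge0 ?ltW//; field.
    by rewrite /y; field; rewrite gt_eqF.
  have -> : (fun N => g N n) = (fun N => (Num.sqrt (2 * t))^-1 *
     ((Num.sqrt N.+1%:R * sin (y / Num.sqrt N.+1%:R)) * cos (y / Num.sqrt N.+1%:R) ^+ N)).
    apply/funext => N; rewrite /g /step /y !mulrA.
    by congr (_ * _ * _); field; rewrite !gt_eqF.
  by apply: cvgM; [exact: cvg_cst | exact: cvgM].
Qed.

(** The symbol vanishes at k_a = 0, and the spectral gap gives exponential decay: the frequencies
    are extracted one by one and their bounds summed, uniformly in [K]. *)
Lemma mbound_dgauss_large K a (t : R) : 1 <= t ->
  mbound K (fun k => 'i%C * ((k 0 a)%:~R * expR (- (t * (k 0 a)%:~R ^+ 2)))%:C%C)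
    (4 * expR (- t)).
Proof.
move=> t1.
pose c (l : nat) : R := l%:R * expR (- (t * l%:R ^+ 2)).
apply: (@mbound_le _ _ _ _ (\sum_(l < K) (`|c l.+1| * 2))).
  (* For t >= 1, t (l + 1)^2 >= t + 2 l; together with e^(-1) <= 1/2 and l + 1 <= 2^l this leaves
     e^(- t) 2^(- l). *)
  have c_le l : c l.+1 <= expR (- t) * 2^-1 ^+ l.
    have l2 : (l.+1 <= 2 ^ l)%N by rewrite ltn_expl.
    have e2 : expR (- 1) <= 2^-1 :> R.
      by rewrite expRN lef_pV2 ?posrE ?expR_gt0//; have := expR_ge1Dx (1 : R); lra.
    rewrite /c; have -> : t * l.+1%:R ^+ 2 = t + (t * l.+1%:R ^+ 2 - t) by ring.
    rewrite opprD expRD mulrCA ler_wpM2l ?expR_ge0//.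
    apply: (@le_trans _ _ ((2 ^ l)%:R * expR (- (2 * l)%:R))).
      apply: ler_pM; rewrite ?ler0n ?expR_ge0// ?ler_nat//.
      rewrite ler_expR lerN2 natrM -natr1.
      by have : 0 <= l%:R :> R by []; nra.
    rewrite natrX -mulN1r -mulrC -[(- 1) * _]mulrC expRM_natl.
    apply: (@le_trans _ _ (2^-1 ^+ (2 * l) * 2 ^+ l)).
      apply: ler_wpM2r; first by rewrite exprn_ge0.
      by apply: lerXn2r; rewrite ?nnegrE ?expR_ge0// invr_ge0.
    by rewrite mul2n -addnn exprD -mulrA -exprMn mulVf// expr1n mulr1.
  apply: (@le_trans _ _ (\sum_(l < K) (2 * expR (- t)) * 2^-1 ^+ l)).
    apply: ler_sum => l _; rewrite mulrC -mulrA ler_wpM2l//.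
    by rewrite ger0_norm ?c_le// mulr_ge0 ?expR_ge0.
  rewrite -mulr_sumr (_ : 4 * expR (- t) = 2 * expR (- t) * 2); last by ring.
  rewrite ler_wpM2l ?mulr_ge0 ?expR_ge0//.
  have := subrX1 (2^-1 : R) K; have : 0 <= 2^-1 ^+ K :> R by rewrite exprn_ge0 ?invr_ge0.
  lra.
apply: mbound_eq; last first.
  apply: (@mbound_sum _ _ _ _ (index_enum 'I_K) (fun l k => (c l.+1)%:C%C *
    ('i%C * (((k 0%R a == l.+1%:Z)%:R - (k 0%R a == - l.+1%:Z)%:R) : R)%:C%C))).
  by move=> l; apply: mbound_scale; exact: mbound_extract.
move=> k kK; have := kK a; set n := k 0 a => nK.
have -> : \sum_(l < K) ((c l.+1)%:C%C * ('i%C * (((n == l.+1%:Z)%:R - (n == - l.+1%:Z)%:R) : R)%:C%C)) =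
   'i%C * (\sum_(l < K) c l.+1 * ((n == l.+1%:Z)%:R - (n == - l.+1%:Z)%:R))%:C%C.
  rewrite rmorph_sum mulr_sumr; apply: eq_bigr => l _.
  by rewrite mulrCA; congr (_ * _); exact/esym/rmorphM.
congr (_ * _%:C%C).
have [n0|n0] := eqVneq n 0.
  rewrite n0 mul0r big1// => l _; rewrite [0 == _]negbTE// [0 == _]negbTE ?subrr ?mulr0//.
have pK : ((absz n).-1 < K)%N by lia.
rewrite (bigD1 (Ordinal pK))//= prednK ?absz_gt0// big1 ?addr0; last first.
  move=> l; rewrite -val_eqE /= => ln.
  rewrite [n == _]negbTE; last by apply/eqP; lia.
  rewrite [n == _]negbTE; last by apply/eqP; lia.
  by rewrite subrr mulr0.
rewrite /c; have [np|nn] := leP 0 n.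
  have -> : n == `|n|%N by apply/eqP; lia.
  have -> : (n == - `|n|%N%:Z) = false by apply/eqP; lia.
  by rewrite subr0 mulr1 pmulrn gez0_abs.
have -> : (n == `|n|%N) = false by apply/eqP; lia.
have -> : n == - `|n|%N%:Z by apply/eqP; lia.
rewrite sub0r mulrN1 pmulrn ltz0_abs// mulrNz sqrrN; ring.
Qed.

End gaussian_symbols.

(** * Second derivatives of the inverse weighted Laplacian *)

Section riesz.
Variables (R : realType) (m : nat).
Local Notation freq := 'rV[int]_m.
Implicit Types (w : 'I_m -> R) (c d : 'I_m) (k : freq).

Definition qform w k : R := \sum_a w a * (k 0 a)%:~R ^+ 2.

Lemma qform_ge0 w k : (forall a, 0 <= w a) -> 0 <= qform w k.
Proof. by move=> w0; apply: sumr_ge0 => a _; rewrite mulr_ge0 ?sqr_ge0. Qed.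

Lemma mbound_heat K w (t : R) : (forall a, 0 <= w a) -> 0 <= t ->
  mbound K (fun k => (expR (- (t * qform w k)))%:C%C) 1.
Proof.
move=> w0 t0.
have -> : (fun k => (expR (- (t * qform w k)))%:C%C) =
  (fun k => \prod_a (expR (- (t * w a * (k 0 a)%:~R ^+ 2)))%:C%C).
  apply/funext => k; rewrite -rmorph_prod -expR_sum sumrN mulr_sumr.
  by congr (expR (- _))%:C%C; apply: eq_bigr => a _; rewrite mulrA.
by apply: mbound_prod => a; apply: mbound_gauss; rewrite mulr_ge0.
Qed.

(** As every weight is at least 1, e^(- t k_c^2) splits off and what is left is a heat symbol with
    nonnegative weights, a contraction. *)
Lemma mbound_dheat_gen K w c (t C : R) : (forall a, 1 <= w a) -> 0 <= t ->
  mbound K (fun k => 'i%C * ((k 0 c)%:~R * expR (- (t * (k 0 c)%:~R ^+ 2)))%:C%C) C ->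
  mbound K (fun k => 'i%C * ((k 0 c)%:~R * expR (- (t * qform w k)))%:C%C) C.
Proof.
move=> w1 t0 h; pose w' a := w a - (a == c)%:R.
have w'0 a : 0 <= w' a.
  by rewrite /w'; have := w1 a; case: (a == c) => /=; lra.
have -> : (fun k => 'i%C * ((k 0 c)%:~R * expR (- (t * qform w k)))%:C%C) =
  (fun k => ('i%C * ((k 0 c)%:~R * expR (- (t * (k 0 c)%:~R ^+ 2)))%:C%C) *
    (expR (- (t * qform w' k)))%:C%C).
  apply/funext => k; rewrite -mulrA -rmorphM /= -mulrA -expRD; congr (_ * (_ * expR _)%:C%C).
  rewrite -opprD -mulrDr; congr (- (t * _)).
  rewrite /qform (bigD1 c)//= [in RHS](bigD1 c)//= addrA; congr (_ + _).
    by rewrite /w' eqxx mulr1n; ring.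
  by apply: eq_bigr => a /negbTE ac; rewrite /w' ac subr0.
rewrite -[C]mulr1; apply: mbound_comp => //; exact: mbound_heat.
Qed.

(* The symbol of [\int_0^t e^(- s Q) ds]. *)
Definition bsym w (t : R) k : R :=
  if qform w k == 0 then t else (1 - expR (- (t * qform w k))) / qform w k.

(** Riemann sums of the integral of e^(- x s) over [0, 1], which are geometric sums. *)
Lemma cvg_geo_mean (x : R) : 0 < x ->
  (fun N => (\sum_(j < N.+1) expR (- (x / N.+1%:R)) ^+ j) / N.+1%:R) @ \oo --> (1 - expR (- x)) / x.
Proof.
move=> x0.
pose q N := expR (- (x / N.+1%:R)).
have h0 N : 0 < x / N.+1%:R by rewrite divr_gt0.
have q1 N : q N < 1 by rewrite /q expR_lt1 oppr_lt0.
have cq : (fun N => N.+1%:R * (1 - q N)) @ \oo --> x.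
  have lo : (fun N => x / (1 + x * harmonic N)) @ \oo --> x.
    rewrite -[X in _ --> X]divr1; apply: cvgM; first exact: cvg_cst.
    apply: cvgV; first by rewrite oner_neq0.
    rewrite -[X in _ --> X]addr0; apply: cvgD; first exact: cvg_cst.
    by rewrite -[X in _ --> X](mulr0 x); apply: cvgM; [exact: cvg_cst|exact: cvg_harmonic].
  apply: squeeze_cvgr lo (cvg_cst x); near=> N.
  have e1 := expR_ge1Dx (- (x / N.+1%:R)).
  have e2 := expR_ge1Dx (x / N.+1%:R).
  have n0 : 0 < N.+1%:R :> R by [].
  apply/andP; split.
    have -> : x / (1 + x * harmonic N) = N.+1%:R * (x / N.+1%:R / (1 + x / N.+1%:R)).
      by rewrite -[harmonic N]/(N.+1%:R^-1) [RHS]mulrA [N.+1%:R * _]mulrC divfK ?gt_eqF.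
    rewrite ler_pM2l// /q expRN; have p := expR_gt0 (x / N.+1%:R).
    have hN := h0 N; set y := x / N.+1%:R in e2 p hN *.
    rewrite ler_pdivrMr; last lra.
    have : (expR y)^-1 * (1 + y) <= 1 by rewrite mulrC ler_pdivrMr// mul1r.
    lra.
  rewrite -[leRHS](divfK (lt0r_neq0 n0)) [leRHS]mulrC ler_pM2l//.
  by rewrite lerBlDl -lerBlDr.
have -> : (fun N => (\sum_(j < N.+1) expR (- (x / N.+1%:R)) ^+ j) / N.+1%:R) =
  (fun N => (1 - expR (- x)) / (N.+1%:R * (1 - q N))).
  apply/funext => N; have := subrX1 (q N) N.+1.
  have -> : q N ^+ N.+1 = expR (- x).
    by rewrite /q -expRM_natl mulrN mulrC divfK.
  move=> h; have qn : q N - 1 != 0 by rewrite lt_eqF// subr_lt0.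
  have -> : 1 - expR (- x) = (1 - q N) * \sum_(i < N.+1) q N ^+ i by rewrite -opprB h -mulNr opprB.
  by rewrite -/(q N) [N.+1%:R * _]mulrC -mulf_div divff ?mul1r// -oppr_eq0 opprB.
apply: cvgM; first exact: cvg_cst.
by apply: cvgV => //; rewrite gt_eqF.
Unshelve. all: by end_near.
Qed.

(** An integral of contractions over an interval of length t. *)
Lemma mbound_bsym K w (t : R) : (forall a, 0 <= w a) -> 0 < t ->
  mbound K (fun k => (bsym w t k)%:C%C) t.
Proof.
move=> w0 t0.
apply: (@mbound_lim R m K (fun N k =>
  (t / N.+1%:R)%:C%C * \sum_(j < N.+1) (expR (- (t * j%:R / N.+1%:R * qform w k)))%:C%C)).
- move=> N; apply: (@mbound_le _ _ _ _ (`|t / N.+1%:R| * \sum_(j < N.+1) 1)).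
    rewrite sumr_const card_ord gtr0_norm ?divr_gt0//.
    by rewrite -[X in _ * X]/(N.+1%:R) divfK.
  apply: mbound_scale; apply: mbound_sum => j; apply: mbound_heat => //.
  by rewrite divr_ge0// mulr_ge0// ltW.
- move=> k /=.
  have e N : complex.Re ((t / N.+1%:R)%:C%C * \sum_(j < N.+1) (expR (- (t * j%:R / N.+1%:R * qform w k)))%:C%C)
     = t * ((\sum_(j < N.+1) expR (- ((t * qform w k) / N.+1%:R)) ^+ j) / N.+1%:R).
    rewrite ReZ Re_sum /= mulrA mulrAC; congr (_ * _); congr (_ * _).
    apply: eq_bigr => j _; rewrite -expRM_natl; congr expR.
    by rewrite mulrN; congr (- _); ring.
  under eq_fun => N do rewrite e.
  rewrite /bsym; case: eqP => [->|/eqP Q0].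
    have -> : (fun N : nat => t * ((\sum_(j < N.+1) expR (- (t * 0 / N.+1%:R)) ^+ j) / N.+1%:R)) = cst t.
      apply/funext => N; rewrite mulr0 mul0r oppr0 expR0.
      rewrite (eq_bigr (fun=> 1)); last by move=> j _; rewrite expr1n.
      by rewrite sumr_const card_ord -[X in t * (X / _)]/(N.+1%:R) divff ?mulr1.
    exact: cvg_cst.
  have Qp : 0 < qform w k by rewrite lt_neqAle eq_sym Q0 qform_ge0.
  have -> : (1 - expR (- (t * qform w k))) / qform w k =
     t * ((1 - expR (- (t * qform w k))) / (t * qform w k)).
    by field; rewrite Q0 gt_eqF.
  apply: cvgM; first exact: cvg_cst.
  by apply: cvg_geo_mean; rewrite mulr_gt0.
- move=> k /=; rewrite (_ : (fun _ => _) = cst 0); first exact: cvg_cst.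
  apply/funext => N; rewrite -rmorph_sum; simpl; ring.
Qed.

(** The integral over [t, 2 t] is the one over [0, t] followed by e^(- t Q). *)
Lemma bsym_double w (t : R) k : bsym w (2 * t) k = bsym w t k + expR (- (t * qform w k)) * bsym w t k.
Proof.
rewrite /bsym; case: eqP => [->|/eqP Q0]; first by rewrite mulr0 oppr0 expR0; ring.
have -> : - (2 * t * qform w k) = (- (t * qform w k)) + (- (t * qform w k)) by ring.
by rewrite expRD; field.
Qed.

Definition bddsym w (t : R) c d k : R[i] :=
  (('i%C * ((k 0 c)%:~R)%:C%C) * ('i%C * ((k 0 d)%:~R)%:C%C)) * (bsym w t k)%:C%C.

(** The block of the Riesz transform over the times [t, 2 t]. Each derivative takes half of e^(- t
    Q) and costs t^(- 1 / 2), while the integral costs t: a bounded amount at every scale. For large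
    t the spectral gap adds decay. *)
Lemma mbound_bdd_step K w (t : R) c d : (forall a, 1 <= w a) -> 0 < t ->
  mbound K (fun k => bddsym w t c d k * (expR (- (t * qform w k)))%:C%C)
    (if t < 2 then 1 else 32 / t).
Proof.
move=> w1 t0; have w0 a : 0 <= w a by have := w1 a; lra.
have t2 : 0 < t / 2 by lra.
have st : 0 < Num.sqrt t by rewrite sqrtr_gt0.
have -> : (fun k => bddsym w t c d k * (expR (- (t * qform w k)))%:C%C) =
  (fun k => ('i%C * ((k 0 c)%:~R * expR (- (t / 2 * qform w k)))%:C%C) *
    ('i%C * ((k 0 d)%:~R * expR (- (t / 2 * qform w k)))%:C%C) * (bsym w t k)%:C%C).
  apply/funext => k.
  have -> : - (t * qform w k) = - (t / 2 * qform w k) - t / 2 * qform w k by field.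
  by rewrite expRD /bddsym !rmorphM /=; ring.
have sq : Num.sqrt (2 * (t / 2)) = Num.sqrt t by congr Num.sqrt; field.
have b1 e : mbound K (fun k => 'i%C * ((k 0 e)%:~R * expR (- (t / 2 * qform w k)))%:C%C) (Num.sqrt t)^-1.
  apply: mbound_dheat_gen => //; first exact: ltW.
  by rewrite -sq; exact: mbound_dgauss.
have st2 : Num.sqrt t * Num.sqrt t = t by rewrite -expr2 sqr_sqrtr// ltW.
case: ltP => ht.
  apply: (@mbound_le _ _ _ _ ((Num.sqrt t)^-1 * (Num.sqrt t)^-1 * t)).
    by rewrite -invfM st2 mulVf ?gt_eqF.
  by apply: mbound_comp; [exact: mbound_comp|exact: mbound_bsym].
have b2 : mbound K (fun k => 'i%C * ((k 0 c)%:~R * expR (- (t / 2 * qform w k)))%:C%C) (4 * expR (- (t / 2))).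
  by apply: mbound_dheat_gen => //; [exact: ltW|apply: mbound_dgauss_large; lra].
apply: (@mbound_le _ _ _ _ (4 * expR (- (t / 2)) * (Num.sqrt t)^-1 * t)); last first.
  by apply: mbound_comp; [exact: mbound_comp|exact: mbound_bsym].
have e3 : expR (- (t / 2)) <= 8 / t ^+ 2.
  have := @expR_ge1Dxn R (t / 2) 1 (ltW t2); rewrite -[2`!]/2%N => h.
  rewrite expRN -[leRHS]invrK lef_pV2 ?posrE ?expR_gt0 ?invr_gt0 ?divr_gt0 ?exprn_gt0//.
  apply: le_trans h; rewrite invfM invrK; set y := t ^+ 2.
  have -> : (t / 2) ^+ 2 / 2 = 8^-1 * y by rewrite /y; field.
  by lra.
have s1 : 1 <= Num.sqrt t by rewrite -sqrtr1 ler_wsqrtr//; lra.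
apply: (@le_trans _ _ (4 * (8 / t ^+ 2) * 1 * t)).
  apply: ler_wpM2r; first exact: ltW.
  apply: ler_pM.
  - by rewrite mulr_ge0 ?expR_ge0.
  - by rewrite invr_ge0 ltW.
  - by rewrite ler_pM2l.
  - by rewrite invf_le1.
by rewrite le_eqVlt; apply/orP; left; apply/eqP; field; rewrite gt_eqF.
Qed.

(** Start at the time 4^(- l), where Bernstein's inequality gives the bound 4, and double. The 2 l +
    1 doublings up to time 2 cost 1 each, the later ones form a geometric series of sum 32, and
    infinite time gives the inverse of Q. The number of doublings is the logarithm of the degree. *)
Lemma mbound_riesz (l : nat) w c d : (forall a, 1 <= w a) ->
  mbound (2 ^ l) (fun k => ((k 0 c)%:~R * (k 0 d)%:~R / qform w k : R)%:C%C) (40 * l.+1%:R).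
Proof.
move=> w1; have w0 a : 0 <= w a by have := w1 a; lra.
pose t0 : R := 4^-1 ^+ l; have t0p : 0 < t0 by rewrite exprn_gt0// invr_gt0.
have b0 : mbound (2 ^ l) (bddsym w t0 c d) 4.
  apply: (@mbound_le _ _ _ _ ((2 * (2 ^ l)%:R) * (2 * (2 ^ l)%:R) * t0)).
    rewrite /t0 natrX; have -> : 4^-1 ^+ l = (2 ^+ l * 2 ^+ l)^-1 :> R.
      by rewrite -exprMn exprVn; congr (_ ^+ _)^-1; ring.
    have := exprn_gt0 l (ltr0n R 2) => p.
    by rewrite le_eqVlt; apply/orP; left; apply/eqP; field; rewrite gt_eqF.
  apply: mbound_comp; last exact: mbound_bsym.
  by apply: mbound_comp; apply: mbound_d; rewrite expn_gt0.
have bstep (t C : R) : 0 < t -> mbound (2 ^ l) (bddsym w t c d) C ->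
    mbound (2 ^ l) (bddsym w (2 * t) c d) (C + (if t < 2 then 1 else 32 / t)).
  move=> tp bC.
  have -> : bddsym w (2 * t) c d =
     (fun k => bddsym w t c d k + bddsym w t c d k * (expR (- (t * qform w k)))%:C%C).
    by apply/funext => k; rewrite /bddsym bsym_double rmorphD rmorphM /=; ring.
  by apply: mbound_add => //; exact: mbound_bdd_step.
have b1 J : (J <= (2 * l).+1)%N -> mbound (2 ^ l) (bddsym w (2 ^+ J * t0) c d) (4 + J%:R).
  elim: J => [|J IH] hJ; first by rewrite expr0 mul1r addr0.
  rewrite exprS -mulrA -[J.+1%:R]natr1 addrA.
  have := bstep _ _ _ (IH (ltnW hJ)); rewrite mulr_gt0 ?exprn_gt0// => /(_ isT).
  suff -> : 2 ^+ J * t0 < 2 by [].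
  apply: (@le_lt_trans _ _ 1); last by lra.
  rewrite /t0 exprVn ler_pdivrMr ?exprn_gt0// mul1r.
  have -> : 4 ^+ l = 2 ^+ (2 * l) :> R by rewrite exprM; congr (_ ^+ _); ring.
  by rewrite ler_eXn2l// ?ltr1n.
have b2 i : mbound (2 ^ l) (bddsym w (2 ^+ ((2 * l).+1 + i) * t0) c d)
    (4 + (2 * l).+1%:R + 32 * (1 - 2^-1 ^+ i)).
  elim: i => [|i IH]; first by rewrite addn0 expr0 subrr mulr0 addr0; exact: b1.
  rewrite addnS exprS -mulrA.
  have tE : 2 ^+ ((2 * l).+1 + i) * t0 = 2 ^+ i.+1.
    rewrite addSn -addnS exprD /t0 exprVn.
    have -> : 4 ^+ l = 2 ^+ (2 * l) :> R by rewrite exprM; congr (_ ^+ _); ring.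
    by rewrite mulrAC divff ?mul1r// expf_neq0.
  have := bstep _ _ _ IH; rewrite mulr_gt0 ?exprn_gt0// => /(_ isT).
  apply: mbound_le; rewrite tE ifF; last first.
    by rewrite ltNge -[X in X <= _]expr1 ler_eXn2l// ltr1n.
  rewrite exprVn -!exprVn !exprS; set y := 2^-1 ^+ i.
  by lra.
apply: (@mbound_lim R m _ (fun i k => - bddsym w (2 ^+ ((2 * l).+1 + i) * t0) c d k)).
- move=> i.
  have -> : (fun k => - bddsym w (2 ^+ ((2 * l).+1 + i) * t0) c d k) =
     (fun k => (- 1)%:C%C * bddsym w (2 ^+ ((2 * l).+1 + i) * t0) c d k).
    by apply/funext => k; rewrite rmorphN rmorph1 mulN1r.
  apply: (@mbound_le _ _ _ _ (`|-1| * (4 + (2 * l).+1%:R + 32 * (1 - 2^-1 ^+ i)))).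
    rewrite normrN1 mul1r; have : 0 <= 2^-1 ^+ i :> R by rewrite exprn_ge0 ?invr_ge0.
    rewrite -[(2 * l).+1%:R]natr1 -[l.+1%:R]natr1 natrM; have : 0 <= l%:R :> R by []; lra.
  exact: mbound_scale.
- move=> k.
  have e (u v z : R) : complex.Re (- (('i%C * u%:C%C) * ('i%C * v%:C%C) * z%:C%C)) = u * v * z.
    by rewrite /=; ring.
  rewrite /bddsym; under eq_fun => i do rewrite e.
  rewrite /=.
  (* The zero frequency is harmless: if Q = 0 then k_c = 0, and the quotient is 0 by the convention
     x / 0 = 0. *)
  have kc0 : qform w k = 0 -> (k 0 c)%:~R = 0 :> R.
    move=> Q0; apply/eqP; rewrite -sqrf_eq0 eq_le sqr_ge0 andbT -Q0 /qform (bigD1 c)//=.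
    rewrite -[X in X <= _]addr0 lerD//; last first.
      by apply: sumr_ge0 => a _; rewrite mulr_ge0 ?sqr_ge0.
    by rewrite ler_peMl ?sqr_ge0.
  case: (eqVneq (qform w k) 0) => [Q0|Q0].
    rewrite kc0// !mul0r; under eq_fun => i do rewrite !mul0r.
    exact: cvg_cst.
  have Qp : 0 < qform w k by rewrite lt_neqAle eq_sym Q0 qform_ge0.
  apply: cvgM; first exact: cvg_cst.
  rewrite /bsym (negbTE Q0) -[X in _ --> X]mul1r.
  apply: cvgM; last exact: cvg_cst.
  rewrite -[X in _ --> X]subr0; apply: cvgB; first exact: cvg_cst.
  pose z := expR (- (t0 * qform w k)).
  have z1 : `|z| < 1 by rewrite ger0_norm ?expR_ge0// /z expR_lt1 oppr_lt0 mulr_gt0.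
  have := cvg_geometric 1 z1; move=> cz.
  apply: squeeze_cvgr (cvg_cst (0 : R)) cz.
  near=> i; rewrite expR_ge0 /geometric /= mul1r /z -expRM_natl ler_expR mulrN lerN2.
  rewrite mulrA ler_pM2r// ler_pM2r// -natrX ler_nat.
  have := @ltn_expl 2 i isT; have := @leq_pexp2l 2 i ((2 * l).+1 + i)%N isT (leq_addl _ _); lia.
- move=> k.
  have e (u v z : R) : complex.Im (- (('i%C * u%:C%C) * ('i%C * v%:C%C) * z%:C%C)) = 0.
    by rewrite /=; ring.
  by rewrite /bddsym; under eq_fun => i do rewrite e; exact: cvg_cst.
Unshelve. all: by end_near.
Qed.

Lemma tp_bernstein K (F : 'rV[R]_m -> R) (M : R) a : (0 < K)%N -> tp K F ->
  (forall x, `|F x| <= M) -> forall x, `|partial a F x| <= 2 * K%:R * M.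
Proof.
by move=> K0 [s ds ->] h x; rewrite partial_ev; exact: mbound_d.
Qed.

(** A second derivative has no constant term, so the equation is solvable whatever the mean of F;
    the solution is a double Riesz transform of F. *)
Lemma tp_riesz (K l : nat) w (F : 'rV[R]_m -> R) (M : R) c d :
  (forall a, 1 <= w a) -> (K <= 2 ^ l)%N -> tp K F -> (forall x, `|F x| <= M) ->
  exists G, [/\ tp K G, forall x, `|G x| <= 40 * l.+1%:R * M &
    forall x, \sum_a w a * partial a (partial a G) x = partial c (partial d F) x].
Proof.
move=> w1 Kl [s ds ->] FM.
pose r k : R[i] := ((k 0 c)%:~R * (k 0 d)%:~R / qform w k : R)%:C%C.
exists (ev (symb r s)); split.
- exact: tp_symb.
- by move=> x; apply: (mbound_riesz c d w1) => //; exact: dle_leq ds.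
move=> x; under eq_bigr => a _ do rewrite !partial_ev -ev_symbZ !symb_comp.
rewrite -ev_symb_sum !partial_ev !symb_comp; congr (ev (symb _ s) x).
apply/funext => k.
rewrite (eq_bigr (fun a => - (w a * (k 0 a)%:~R ^+ 2)%:C%C * r k)); last first.
  move=> a _; rewrite rmorphM rmorphXn /=.
  apply: (@etrans _ _ ('i%C ^+ 2 * ((w a)%:C%C * ((k 0 a)%:~R)%:C%C ^+ 2 * r k))); first by ring.
  by rewrite sqr_i; ring.
rewrite -mulr_suml sumrN -rmorph_sum -/(qform w k) /=.
rewrite /r; case: (eqVneq (qform w k) 0) => [Q0|Q0].
  suff k0 : (k 0 c)%:~R = 0 :> R by rewrite Q0 k0 !(mul0r, mulr0, oppr0).
  apply/eqP; rewrite -sqrf_eq0 eq_le sqr_ge0 andbT -Q0 /qform (bigD1 c)//=.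
  rewrite -[X in X <= _]addr0 lerD//; last first.
    by apply: sumr_ge0 => a _; rewrite mulr_ge0 ?sqr_ge0// (le_trans _ (w1 a)).
  by rewrite ler_peMl ?sqr_ge0.
rewrite mulrACA -expr2 sqr_i mulNr mulN1r -!rmorphM /=; congr (- _%:C%C).
by rewrite mulrC divfK.
Qed.

End riesz.

(** * The ring of trigonometric polynomials *)

Section tp_ring.
Variables (R : realType) (m : nat).
Local Notation E := 'rV[R]_m.

(** The degree is hidden so that products stay in one type; the result is a commutative ring, in
    which [ring] checks the identities between waves. *)
Record TP := MkTP { tpf :> E -> R ; tpP : exists K, tp K tpf }.

Lemma TP_ext (F G : TP) : (forall x, F x = G x) -> F = G.
Proof.
case: F G => F hF [G hG] /= /funext FG; move: hF hG; rewrite FG => hF hG.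
by congr MkTP; exact: Prop_irrelevance.
Qed.

Lemma tp_max K L F : tp K F -> tp (maxn K L) (F : E -> R).
Proof. by apply: tp_leq; rewrite leq_maxl. Qed.

Lemma tp_maxr K L F : tp K F -> tp (maxn L K) (F : E -> R).
Proof. by apply: tp_leq; rewrite leq_maxr. Qed.

Definition TPcst (c : R) : TP := MkTP (ex_intro _ 0%N (tp_cst m c)).

Lemma TPadd_subproof (F G : TP) : exists K, tp K (fun x => F x + G x).
Proof.
case: (tpP F) (tpP G) => K tF [L tG]; exists (maxn K L).
by apply: tpD; [exact: tp_max | exact: tp_maxr].
Qed.
Definition TPadd F G := MkTP (TPadd_subproof F G).

Lemma TPopp_subproof (F : TP) : exists K, tp K (fun x => - F x).
Proof. by case: (tpP F) => K tF; exists K; exact: tpN. Qed.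
Definition TPopp F := MkTP (TPopp_subproof F).

Lemma TPmul_subproof (F G : TP) : exists K, tp K (fun x => F x * G x).
Proof. by case: (tpP F) (tpP G) => K tF [L tG]; exists (K + L)%N; exact: tpM. Qed.
Definition TPmul F G := MkTP (TPmul_subproof F G).

HB.instance Definition _ := gen_eqMixin TP.
HB.instance Definition _ := gen_choiceMixin TP.

Lemma TPaddA : associative TPadd.
Proof. by move=> F G H; apply: TP_ext => x /=; rewrite addrA. Qed.
Lemma TPaddC : commutative TPadd.
Proof. by move=> F G; apply: TP_ext => x /=; rewrite addrC. Qed.
Lemma TPadd0 : left_id (TPcst 0) TPadd.
Proof. by move=> F; apply: TP_ext => x /=; rewrite add0r. Qed.
Lemma TPaddN : left_inverse (TPcst 0) TPopp TPadd.
Proof. by move=> F; apply: TP_ext => x /=; rewrite addNr. Qed.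

HB.instance Definition _ := GRing.isZmodule.Build TP TPaddA TPaddC TPadd0 TPaddN.

Lemma TPmulA : associative TPmul.
Proof. by move=> F G H; apply: TP_ext => x /=; rewrite mulrA. Qed.
Lemma TPmulC : commutative TPmul.
Proof. by move=> F G; apply: TP_ext => x /=; rewrite mulrC. Qed.
Lemma TPmul1 : left_id (TPcst 1) TPmul.
Proof. by move=> F; apply: TP_ext => x /=; rewrite mul1r. Qed.
Lemma TPmulDl : left_distributive TPmul TPadd.
Proof. by move=> F G H; apply: TP_ext => x /=; rewrite mulrDl. Qed.
Lemma TP1_neq0 : TPcst 1 != 0 :> TP.
Proof. by apply/eqP => /(congr1 (fun F : TP => F 0)) /= /eqP; rewrite oner_eq0. Qed.

HB.instance Definition _ := GRing.Zmodule_isComNzRing.Build TP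
  TPmulA TPmulC TPmul1 TPmulDl TP1_neq0.

Lemma TPE : (forall (F G : TP) x, (F + G) x = F x + G x) *
  (forall (F G : TP) x, (F - G) x = F x - G x) *
  (forall (F : TP) x, (- F) x = - F x) *
  (forall (F G : TP) x, (F * G) x = F x * G x) *
  (forall c x, TPcst c x = c) * (forall x, (0 : TP) x = 0) * (forall x, (1 : TP) x = 1).
Proof. by []. Qed.

Lemma TPsumE (I : Type) (r : seq I) (P : pred I) (F : I -> TP) x :
  (\sum_(i <- r | P i) F i) x = \sum_(i <- r | P i) F i x.
Proof. by rewrite (big_morph (fun F : TP => F x) (id1 := 0) (op1 := +%R)). Qed.

Lemma TPcstD c d : TPcst (c + d) = TPcst c + TPcst d.
Proof. exact: TP_ext. Qed.
Lemma TPcstM c d : TPcst (c * d) = TPcst c * TPcst d.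
Proof. exact: TP_ext. Qed.
Lemma TPcst1 : TPcst 1 = 1. Proof. exact: TP_ext. Qed.

Lemma td_subproof a (F : TP) : exists K, tp K (partial a F).
Proof. by case: (tpP F) => K tF; exists K; exact: tp_partial. Qed.
Fact td_key : unit. Proof. exact: tt. Qed.
(* Locked: otherwise [ring] compares the derivatives of different atoms by unfolding them. *)
Definition td : 'I_m -> TP -> TP := locked_with td_key (fun a F => MkTP (td_subproof a F)).

Lemma td_fun a F : tpf (td a F) = partial a F.
Proof. by rewrite /td unlock. Qed.

Lemma tdE a F x : td a F x = partial a F x.
Proof. by rewrite td_fun. Qed.

Lemma tp_td K a (F : TP) : tp K F -> tp K (td a F).
Proof. by rewrite /td unlock; exact: tp_partial. Qed.

Lemma tdD a F G : td a (F + G) = td a F + td a G.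
Proof.
apply: TP_ext => x; rewrite [RHS]TPE !tdE; case: (tpP F) (tpP G) => K tF [L tG].
by rewrite (partialD a (tp_max L tF) (tp_maxr K tG)).
Qed.

Lemma tdM a F G : td a (F * G) = td a F * G + F * td a G.
Proof.
apply: TP_ext => x; rewrite [RHS]/= !tdE; case: (tpP F) (tpP G) => K tF [L tG].
by rewrite (partialM a tF tG).
Qed.

Lemma tdC a b F : td a (td b F) = td b (td a F).
Proof.
by apply: TP_ext => x; rewrite /td unlock /=; case: (tpP F) => K tF; rewrite (partialC _ _ tF).
Qed.

Lemma td_cst a c : td a (TPcst c) = 0.
Proof. by apply: TP_ext => x; rewrite tdE partial_cst. Qed.

Lemma td0 a : td a 0 = 0. Proof. exact: td_cst. Qed.

Lemma tdN a F : td a (- F) = - td a F.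
Proof. by apply: (addIr (td a F)); rewrite -tdD !addNr td0. Qed.

Lemma tdB a F G : td a (F - G) = td a F - td a G.
Proof. by rewrite tdD tdN. Qed.

Lemma tdZ a c F : td a (TPcst c * F) = TPcst c * td a F.
Proof. by rewrite tdM td_cst mul0r add0r. Qed.

Definition TPcos (mu : nat) a : TP := MkTP (ex_intro (fun K => tp K _) _ (tp_cosx R mu a)).
Definition TPsin (mu : nat) a : TP := MkTP (ex_intro (fun K => tp K _) _ (tp_sinx R mu a)).

Lemma td_cos mu a b : td b (TPcos mu a) = - (TPcst mu%:R * (b == a)%:R * TPsin mu a).
Proof.
apply: TP_ext => x; rewrite tdE partial_cosx /=; case: (b == a).
  by rewrite mulr1 mulr1n pmulrn mulNr.
by rewrite mulr0 mulr0n oppr0 !mul0r oppr0.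
Qed.

Lemma td_sin mu a b : td b (TPsin mu a) = TPcst mu%:R * (b == a)%:R * TPcos mu a.
Proof.
apply: TP_ext => x; rewrite tdE partial_sinx /=; case: (b == a).
  by rewrite mulr1 mulr1n pmulrn.
by rewrite mulr0 mulr0n !mul0r.
Qed.

Lemma TPcos2sin2 mu a : TPcos mu a * TPcos mu a + TPsin mu a * TPsin mu a = 1.
Proof.
by apply: TP_ext => x /=; rewrite -!expr2 cos2Dsin2.
Qed.

Definition bnd (M : R) (F : TP) := forall x, `|F x| <= M.

Lemma bnd_le M M' F : M <= M' -> bnd M F -> bnd M' F.
Proof. by move=> MM h x; apply: le_trans MM. Qed.

Lemma bnd_ge0 M F : bnd M F -> 0 <= M.
Proof. by move=> h; apply: le_trans (h 0). Qed.

Lemma bndD M M' F G : bnd M F -> bnd M' G -> bnd (M + M') (F + G).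
Proof. by move=> hF hG x; rewrite TPE (le_trans (ler_normD _ _))// lerD. Qed.

Lemma bndN M F : bnd M F -> bnd M (- F).
Proof. by move=> hF x; rewrite TPE normrN. Qed.

Lemma bndB M M' F G : bnd M F -> bnd M' G -> bnd (M + M') (F - G).
Proof. by move=> hF hG; apply: bndD => //; exact: bndN. Qed.

Lemma bndM M M' F G : bnd M F -> bnd M' G -> bnd (M * M') (F * G).
Proof. by move=> hF hG x; rewrite TPE normrM ler_pM. Qed.

Lemma bnd_cst c : bnd `|c| (TPcst c). Proof. by move=> x. Qed.

Lemma bnd_cos mu a : bnd 1 (TPcos mu a). Proof. by move=> x; exact: cos_max. Qed.
Lemma bnd_sin mu a : bnd 1 (TPsin mu a). Proof. by move=> x; exact: sin_max. Qed.

Lemma bnd_td K M (F : TP) a : (0 < K)%N -> tp K F -> bnd M F -> bnd (2 * K%:R * M) (td a F).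
Proof. by move=> K0 tF bF x; rewrite tdE; exact: tp_bernstein. Qed.

End tp_ring.

(** * The Hessian operator and the weighted Laplacian *)

Section hessian_operator.
Variables (R : realType) (n : nat).
Local Notation T := (TP R (n + n)).
Local Notation X := (@lshift n n).
Local Notation Y := (@rshift n n).
Implicit Types (i j : 'I_n) (F : T) (M : 'I_(n + n) -> 'I_(n + n) -> T).

Definition lap i F : T := td (X i) (td (X i) F) + td (Y i) (td (Y i) F).

(** Sixteen times the real part of d_j dbar_j M(i, ibar) - d_j dbar_i M(i, jbar), written out in
    real coordinates. For symmetric M the imaginary part is antisymmetric in i and j and cancels in
    the sum. *)
Definition hterm i j M : T :=
  lap j (M (X i) (X i) + M (Y i) (Y i))
  - (td (X i) (td (X j) (M (X i) (X j) + M (Y i) (Y j)))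
     + td (Y i) (td (Y j) (M (X i) (X j) + M (Y i) (Y j))))
  + (td (X j) (td (Y i) (M (X i) (Y j) - M (Y i) (X j)))
     - td (Y j) (td (X i) (M (X i) (Y j) - M (Y i) (X j)))).

(* Up to the factor -1/32, the very weak complex 2-Hessian, applied to [M a b = d_a u * d_b u]. *)
Definition hop M : T := \sum_i \sum_(j | j != i) hterm i j M.

Lemma hopD M M' : hop (fun a b => M a b + M' a b) = hop M + hop M'.
Proof.
rewrite /hop -big_split /=; apply: eq_bigr => i _; rewrite -big_split /=; apply: eq_bigr => j _.
by rewrite /hterm /lap /= !(tdD, tdN); ring.
Qed.

Lemma hopN M : hop (fun a b => - M a b) = - hop M.
Proof.
rewrite /hop -sumrN; apply: eq_bigr => i _; rewrite -sumrN; apply: eq_bigr => j _.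
by rewrite /hterm /lap /= !(tdD, tdN); ring.
Qed.

Lemma eq_hop M M' : (forall a b, M a b = M' a b) -> hop M = hop M'.
Proof.
by move=> e; congr hop; apply/funext => a; apply/funext => b.
Qed.

Lemma sum_offdiag_swap (V : zmodType) (G : 'I_n -> 'I_n -> V) :
  \sum_i \sum_(j | j != i) G i j = \sum_i \sum_(j | j != i) G j i.
Proof.
rewrite (exchange_big_dep xpredT)//=; apply: eq_bigr => i _.
by apply: eq_bigl => j; rewrite eq_sym.
Qed.

(** Transposing M exchanges the mixed terms of the pairs (i, j) and (j, i). *)
Lemma hop_tr M : hop (fun a b => M b a) = hop M.
Proof.
rewrite /hop.
pose A i j := lap j (M (X i) (X i) + M (Y i) (Y i)).
pose B i j := hterm i j M - A i j.
transitivity (\sum_i \sum_(j | j != i) A i j + \sum_i \sum_(j | j != i) B j i).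
  rewrite -big_split /=; apply: eq_bigr => i _; rewrite -big_split /=; apply: eq_bigr => j _.
  rewrite /B /A /hterm /= !(tdD, tdN).
  by rewrite !(tdC (X i) (X j)) !(tdC (Y i) (Y j)) !(tdC (Y i) (X j)) !(tdC (X i) (Y j)); ring.
rewrite -(sum_offdiag_swap B) -big_split /=; apply: eq_bigr => i _.
by rewrite -big_split /=; apply: eq_bigr => j _; rewrite /B /= addrC subrK.
Qed.

(** A double curl kills gradients: once the derivatives are commuted, the term (i, j) is K i j - K j
    i, and the sum over ordered pairs cancels. This freedom is what removes the fast oscillation of
    a wave. *)
Lemma hop_grad (V : 'I_(n + n) -> T) : hop (fun a b => td a (V b)) = 0.
Proof.
pose K i j := lap j (td (X i) (V (X i)) + td (Y i) (V (Y i))).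
transitivity (\sum_i \sum_(j | j != i) (K i j - K j i)).
  apply: eq_bigr => i _; apply: eq_bigr => j _.
  rewrite /hterm /K /lap !(tdD, tdN).
  rewrite !(tdC (X j) (X i), tdC (Y i) (X i), tdC (Y i) (X j), tdC (Y j) (X i),
    tdC (Y j) (X j), tdC (Y j) (Y i)).
  ring.
under eq_bigr => i _ do rewrite sumrB.
by rewrite sumrB -sum_offdiag_swap subrr.
Qed.

Lemma hop_gradr (V : 'I_(n + n) -> T) : hop (fun a b => td b (V a)) = 0.
Proof. by rewrite -[LHS]hop_tr hop_grad. Qed.

(** F times the rank-one matrix of the direction x_i: the shape of the mean contribution of a wave
    in that direction. *)
Definition proj i (F : T) (a b : 'I_(n + n)) : T := F * (a == X i)%:R * (b == X i)%:R.

Lemma hop_proj i F : hop (proj i F) = \sum_(j | j != i) lap j F.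
Proof.
have XX k l : (X k == X l) = (k == l) by rewrite eq_lshift.
have YX k l : (Y k == X l) = false by apply/negbTE; rewrite eq_rlshift.
rewrite /hop (bigD1 i)//= [X in _ + X]big1 ?addr0.
  apply: eq_bigr => j ji; rewrite /hterm /proj !XX !YX eqxx (negbTE ji).
  by rewrite /lap !(mulr0, mul0r, addr0, subr0, subrr, mulr1, td0).
move=> k ki; apply: big1 => j jk; rewrite /hterm /proj !XX !YX (negbTE ki).
by rewrite /lap !(mulr0, mul0r, addr0, subr0, subrr, mulr1, td0).
Qed.

Variables (i0 i1 : 'I_n).

(** For distinct [i0] and [i1] the weight is 1 on the coordinates of these two indices and 2
    elsewhere. A single direction would leave weight 0 on its own plane, and an operator that is not
    elliptic. *)
Definition hweight (a : 'I_(n + n)) : R :=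
  let j := match fintype.split a with inl j => j | inr j => j end in (j != i0)%:R + (j != i1)%:R.

Definition wlap F : T := \sum_a TPcst _ (hweight a) * td a (td a F).

Lemma hweight_X j : hweight (X j) = (j != i0)%:R + (j != i1)%:R.
Proof. by rewrite /hweight (unsplitK (inl j)). Qed.

Lemma hweight_Y j : hweight (Y j) = (j != i0)%:R + (j != i1)%:R.
Proof. by rewrite /hweight (unsplitK (inr j)). Qed.

Lemma hweight_ge1 : i0 != i1 -> forall a, 1 <= hweight a.
Proof.
move=> i01 a; rewrite -(splitK a); case: (fintype.split a) => j /=; rewrite ?hweight_X ?hweight_Y.
all: case: (eqVneq j i0) => [->|_]; first by rewrite i01 add0r.
all: by case: (j != i1); rewrite ?addr0 ?lerDl.
Qed.

Lemma wlapD F G : wlap (F + G) = wlap F + wlap G.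
Proof. by rewrite /wlap -big_split /=; apply: eq_bigr => a _; rewrite !tdD mulrDr. Qed.

Lemma wlapN F : wlap (- F) = - wlap F.
Proof. by rewrite /wlap -sumrN; apply: eq_bigr => a _; rewrite !tdN mulrN. Qed.

Lemma wlap_cst c : wlap (TPcst _ c) = 0.
Proof. by rewrite /wlap big1// => a _; rewrite td_cst td0 mulr0. Qed.

Lemma wlapE F : wlap F = \sum_j TPcst _ ((j != i0)%:R + (j != i1)%:R) * lap j F.
Proof.
rewrite /wlap big_split_ord /= -big_split /=; apply: eq_bigr => j _.
by rewrite hweight_X hweight_Y /lap mulrDr.
Qed.

Lemma hop_projs F : hop (proj i0 F) + hop (proj i1 F) = wlap F.
Proof.
rewrite wlapE !hop_proj.
rewrite (big_mkcond (fun j => j != i0)) (big_mkcond (fun j => j != i1)) -big_split.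
apply: eq_bigr => j _; rewrite TPcstD mulrDl /=.
have c0 : TPcst (n + n) (0 : R) = 0 by apply: TP_ext.
by case: (j != i0); case: (j != i1); rewrite ?TPcst1 ?c0 ?mul1r ?mul0r.
Qed.

Section solvable.
Hypothesis i01 : i0 != i1.

Definition wsolv (K : nat) (C : R) F := exists G : T, [/\ tp K G, bnd C G & wlap G = F].

Lemma wsolv0 K : wsolv K 0 0.
Proof.
exists 0; split; first exact: tp_leq (leq0n _) (tp_cst _ _).
  by move=> x; rewrite TPE normr0.
by rewrite -[RHS](wlap_cst 0); congr wlap; apply: TP_ext.
Qed.

Lemma wsolvD K C C' F F' : wsolv K C F -> wsolv K C' F' -> wsolv K (C + C') (F + F').
Proof.
move=> [G [tG bG <-]] [G' [tG' bG' <-]]; exists (G + G'); split.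
- exact: tpD.
- exact: bndD.
- exact: wlapD.
Qed.

Lemma wsolvN K C F : wsolv K C F -> wsolv K C (- F).
Proof.
move=> [G [tG bG <-]]; exists (- G); split; [exact: tpN|exact: bndN|exact: wlapN].
Qed.

Lemma wsolv_sum K C (r : seq 'I_n) (P : pred 'I_n) (F : 'I_n -> T) : 0 <= C ->
  (forall i, P i -> wsolv K C (F i)) -> wsolv K ((size r)%:R * C) (\sum_(i <- r | P i) F i).
Proof.
move=> C0 h; elim: r => [|i r IH]; first by rewrite big_nil mul0r; exact: wsolv0.
rewrite big_cons /= -natr1 mulrDl mul1r addrC; case: ifPn => Pi.
  by apply: wsolvD => //; exact: h.
have [G [tG bG <-]] := IH; exists G; split => //.
by apply: bnd_le bG; rewrite lerDr.
Qed.

Lemma wsolv_dd K l C a b F : (K <= 2 ^ l)%N -> tp K F -> bnd C F ->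
  wsolv K (40 * l.+1%:R * C) (td a (td b F)).
Proof.
move=> Kl tF bF; have [G [tG bG eG]] := tp_riesz a b (hweight_ge1 i01) Kl tF bF.
exists (MkTP (ex_intro (fun K => tp K _) K tG)); split => //.
apply: TP_ext => x; rewrite /wlap TPsumE !td_fun -eG.
by apply: eq_bigr => c _; rewrite TPE !td_fun.
Qed.

(** A [hterm] is a signed sum of 12 second derivatives of entries of M, and there are at most n^2
    pairs; 480 is 12 times the constant 40 of the Riesz bound. *)
Lemma wsolv_hop K l C M : (K <= 2 ^ l)%N -> (forall a b, tp K (M a b)) ->
  (forall a b, bnd C (M a b)) ->
  wsolv K (480 * n%:R ^+ 2 * l.+1%:R * C) (hop M).
Proof.
move=> Kl tM bM; set C1 := 40 * l.+1%:R * C.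
have C0 : 0 <= C by apply: (bnd_ge0 (bM (X i0) (X i0))).
have C10 : 0 <= C1 by rewrite !mulr_ge0.
have dd a b c d := wsolv_dd c d Kl (tM a b) (bM a b).
have -> : 480 * n%:R ^+ 2 * l.+1%:R * C =
    (size (index_enum 'I_n))%:R * ((size (index_enum 'I_n))%:R * (12 * C1)).
  by rewrite /index_enum -enumT size_enum_ord /C1; ring.
apply: wsolv_sum => [|i _]; first by rewrite !mulr_ge0.
apply: wsolv_sum => [|j _]; first by rewrite !mulr_ge0.
rewrite /hterm /lap !(tdD, tdN).
have -> : 12 * C1 = (C1 + C1 + (C1 + C1)) + (C1 + C1 + (C1 + C1)) + (C1 + C1 + (C1 + C1)) by ring.
apply: wsolvD; [apply: wsolvD; [|apply: wsolvN]|].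
- by apply: wsolvD; apply: wsolvD; exact: dd.
- by apply: wsolvD; apply: wsolvD; exact: dd.
- by apply: wsolvD; [|apply: wsolvN]; apply: wsolvD; rewrite ?opprD; try (apply: wsolvN); exact: dd.
Qed.

End solvable.
End hessian_operator.

(** * A single wave *)

Section wave.
Variables (R : realType) (n : nat).
Local Notation T := (TP R (n + n)).
Local Notation X := (@lshift n n).
Local Notation cst := (@TPcst R (n + n)).
Implicit Types (i : 'I_n) (u A : T) (mu : nat).

Definition wave mu i A : T := cst mu%:R^-1 * (A * TPcos R mu (X i)).

(** What is left of the new products modulo gradients: the cross terms with u, where the derivative
    of the wave has been moved onto d u; a slow derivative of A times the fast oscillation; the
    square of the slow derivatives. Each carries at least one factor 1 / mu. *)
Definition wave_err mu i u A (a b : 'I_(n + n)) : T :=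
  - (wave mu i A * td a (td b u) + wave mu i A * td a (td b u))
  - cst mu%:R^-1 * (A * td b A) * (TPsin R mu (X i) * TPcos R mu (X i)) * (a == X i)%:R
  + (cst mu%:R^-1 * TPcos R mu (X i) * td a A) * (cst mu%:R^-1 * TPcos R mu (X i) * td b A).

Lemma cstV_mul mu : (0 < mu)%N -> cst mu%:R^-1 * cst mu%:R = 1.
Proof. by move=> mu0; rewrite -TPcstM mulVf ?TPcst1// pnatr_eq0 -lt0n. Qed.

Lemma td_wave mu i A a : (0 < mu)%N ->
  td a (wave mu i A) = cst mu%:R^-1 * (td a A * TPcos R mu (X i))
     - A * TPsin R mu (X i) * (a == X i)%:R.
Proof.
move=> mu0; rewrite /wave tdZ tdM td_cos mulrDr; congr (_ + _).
transitivity (- (cst mu%:R^-1 * cst mu%:R) * (A * TPsin R mu (X i) * (a == X i)%:R)); first by ring.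
by rewrite cstV_mul// mulN1r.
Qed.

Lemma td_bool a (c : bool) : td a (c%:R : T) = 0.
Proof.
case: c; last exact: td0.
by rewrite -[1%:R](TPcst1 R (n + n)) td_cst.
Qed.

(** A^2 sin^2 = A^2 / 2 - A^2 (cos^2 - sin^2) / 2, and the oscillating half is, up to a derivative
    of A, the derivative of A^2 sin cos / (2 mu) in the direction of the wave. It is therefore a
    gradient matrix plus a small error, and [hop] does not see gradients. *)
Lemma hop_wave mu i u A : (0 < mu)%N ->
  hop (fun a b => td a (u + wave mu i A) * td b (u + wave mu i A)) =
  hop (fun a b => td a u * td b u) + hop (proj i (cst 2^-1 * (A * A)))
  + hop (wave_err mu i u A).
Proof.
move=> mu0; set w := wave mu i A; set C := TPcos R mu (X i); set S := TPsin R mu (X i).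
set k := cst mu%:R^-1.
(* [V] and [V'] carry the two cross terms w d u, and [V] also the primitive of the oscillating half
   of A^2 sin^2. *)
pose V b := w * td b u - k * cst 2^-1 * (A * A) * (S * C) * (b == X i)%:R.
pose V' a := w * td a u.
rewrite -[LHS]subr0 -[X in _ - X](addr0 0) -{1}(hop_grad V) -(hop_gradr V').
rewrite -!hopD -hopN -hopD; apply: eq_hop => a b.
have tV : td a (V b) = td a w * td b u + w * td a (td b u)
   - (k * (A * td a A) * (S * C) + cst 2^-1 * (A * A) * (C * C - S * S) * (a == X i)%:R) * (b == X i)%:R.
  rewrite /V tdB tdM; congr (_ - _).
  have h2 : cst 2^-1 + cst 2^-1 = 1.
    by rewrite -TPcstD -TPcst1; congr TPcst; field.
  rewrite tdM td_bool mulr0 addr0; congr (_ * _).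
  have tk F : td a (k * cst 2^-1 * F) = k * cst 2^-1 * td a F.
    by rewrite -TPcstM tdZ.
  rewrite -mulrA tk !tdM td_sin td_cos -/C -/S.
  transitivity (k * (cst 2^-1 + cst 2^-1) * (A * td a A) * (S * C)
     + (k * cst mu%:R) * (cst 2^-1 * (A * A) * (C * C - S * S) * (a == X i)%:R)).
    by ring.
  by rewrite h2 mulr1 cstV_mul// mul1r.
have tV' : td b (V' a) = td b w * td a u + w * td a (td b u).
  by rewrite /V' tdM [td b (td a u)]tdC.
rewrite tV tV' /proj /wave_err !tdD -/w -/C -/S -/k.
have h2 : cst 2^-1 + cst 2^-1 = 1 by rewrite -TPcstD -TPcst1; congr TPcst; field.
have cs : C * C + S * S = 1 by exact: TPcos2sin2.
rewrite (td_wave i A a mu0) (td_wave i A b mu0) -/C -/S -/k.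
apply/eqP; rewrite -subr_eq0; apply/eqP.
transitivity ((A * A) * (a == X i)%:R * (b == X i)%:R *
  ((1 - (cst 2^-1 + cst 2^-1)) * (S * S) + cst 2^-1 * ((C * C + S * S) - 1)) : T).
  by ring.
by rewrite cs h2 !subrr mul0r mulr0 addr0 mulr0.
Qed.

End wave.
(** * Convex integration *)

Section tp_degree.
Variables (R : realType) (m : nat).
Local Notation T := (TP R m).
Implicit Types (F G : T).

Lemma TtpD K F G : tp K F -> tp K G -> tp K (F + G). Proof. exact: tpD. Qed.
Lemma TtpN K F : tp K F -> tp K (- F). Proof. exact: tpN. Qed.
Lemma TtpB K F G : tp K F -> tp K G -> tp K (F - G). Proof. exact: tpB. Qed.
Lemma TtpM K L F G : tp K F -> tp L G -> tp (K + L) (F * G). Proof. exact: tpM. Qed.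
Lemma Ttp_cst K c : tp K (TPcst m c : T).
Proof. exact: tp_leq (leq0n K) (tp_cst m c). Qed.
Lemma TtpZ K c F : tp K F -> tp K (TPcst m c * F). Proof. exact: tpZ. Qed.
Lemma Ttp_bool K (c : bool) : tp K (c%:R : T).
Proof.
by case: c; [rewrite -[1%:R](TPcst1 R m); exact: Ttp_cst | exact: Ttp_cst].
Qed.
Lemma Ttp_cos mu a : tp mu (TPcos R mu a : T). Proof. exact: (@tp_cosx R m mu a). Qed.
Lemma Ttp_sin mu a : tp mu (TPsin R mu a : T). Proof. exact: (@tp_sinx R m mu a). Qed.

Lemma bnd_bool (c : bool) : bnd 1 (c%:R : T).
Proof.
move=> x; case: c; first by rewrite -[1%:R](TPcst1 R m) /= normr1.
by rewrite -[0%:R]/(TPcst m 0 : T) /= normr0.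
Qed.

Lemma bndZ (c M : R) F : 0 <= c -> bnd M F -> bnd (c * M) (TPcst m c * F).
Proof. by move=> c0 bF; apply: bndM bF; rewrite -{1}(ger0_norm c0); exact: bnd_cst. Qed.

End tp_degree.

Section square_root.
Variables (R : realType) (m : nat).
Local Notation T := (TP R m).

(* Heron-like iteration: [sqrt_iter x j] approximates the square root of [1 + x] up to [O(x^(j+1))]. *)
Fixpoint sqrt_iter (x : T) (j : nat) : T :=
  if j is k.+1 then sqrt_iter x k + TPcst m 2^-1 * (1 + x - sqrt_iter x k * sqrt_iter x k)
  else 1.

(** If r is the residual of the iterate p, the next residual is - r ((p - 1) + r / 4); as p - 1 and
    r are at most e in absolute value, each iteration gains at least the factor 2 e. *)
Lemma sqrt_iter_bound (x : T) (e : R) j : 0 <= e <= 4^-1 -> bnd e x ->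
  bnd (4^-1) (sqrt_iter x j - 1) /\
  bnd (e * (2 * e) ^+ j) (1 + x - sqrt_iter x j * sqrt_iter x j).
Proof.
move=> /andP[e0 e4] bx.
suff h y : `|sqrt_iter x j y - 1| <= e * (1 - 2^-1 ^+ j) /\
    `|1 + x y - sqrt_iter x j y * sqrt_iter x j y| <= e * (2 * e) ^+ j.
  split=> y; have [h1 h2] := h y => //.
  rewrite TPE (le_trans h1)// (le_trans _ e4)// ler_piMr// gerBl exprn_ge0// invr_ge0//.
have bxy := bx y; elim: j => [|j [IH1 IH2]] /=.
  rewrite !expr0 !subrr normr0 mulr0; split => //.
  by rewrite !mulr1 (_ : 1 + x y - 1 = x y)//; ring.
set p := sqrt_iter x j y in IH1 IH2 *.
set r := 1 + x y - p * p in IH2 *.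
have rp : `|r| <= e * 2^-1 ^+ j.
  apply: (le_trans IH2); rewrite ler_wpM2l//; apply: lerXn2r; rewrite ?nnegrE ?invr_ge0//; lra.
have p1 : `|p - 1| <= e.
  by apply: (le_trans IH1); rewrite ler_piMr// gerBl exprn_ge0// invr_ge0.
split.
  have -> : p + 2^-1 * r - 1 = (p - 1) + 2^-1 * r by ring.
  rewrite (le_trans (ler_normD _ _))// normrM ger0_norm ?invr_ge0// exprS.
  set z := 2^-1 ^+ j in IH1 rp *; lra.
have -> : 1 + x y - (p + 2^-1 * r) * (p + 2^-1 * r) = - (r * ((p - 1) + 4^-1 * r)).
  by rewrite /r; field.
rewrite normrN normrM exprSr mulrA; apply: ler_pM => //.
have z1 : 2^-1 ^+ j <= 1 :> R by apply: exprn_ile1; rewrite ?invr_ge0// invf_le1//; lra.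
rewrite (le_trans (ler_normD _ _))// normrM ger0_norm ?invr_ge0//.
have : e * 2^-1 ^+ j <= e by rewrite ler_piMr.
by have := normr_ge0 r; lra.
Qed.

(** Each iteration squares, so the degree doubles. This is why the number of iterations is fixed
    once and for all and not adapted to the stage. *)
Lemma tp_sqrt_iter K (x : T) j : tp K x -> tp (2 ^ j * K) (sqrt_iter x j).
Proof.
move=> tx; elim: j => [|j IH]; first exact: (@Ttp_cst R m _ 1).
have l1 : (2 ^ j * K <= 2 ^ j.+1 * K)%N by rewrite leq_mul2r leq_exp2l// leqnSn orbT.
have l2 : (2 ^ j * K + 2 ^ j * K = 2 ^ j.+1 * K)%N by rewrite expnS; lia.
have l3 : (K <= 2 ^ j.+1 * K)%N by rewrite leq_pmull// expn_gt0.
apply: TtpD; first exact: tp_leq IH.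
apply: TtpZ; apply: TtpB; last by rewrite -l2; exact: TtpM.
apply: TtpD; last exact: tp_leq tx.
exact: (@Ttp_cst R m _ 1).
Qed.

End square_root.

(** * One stage *)

Section stage.
Variables (R : realType) (n : nat) (i0 i1 : 'I_n).
Hypothesis i01 : i0 != i1.
Local Notation T := (TP R (n + n)).
Local Notation X := (@lshift n n).
Local Notation cst := (@TPcst R (n + n)).
Local Notation dd u := (fun a b : 'I_(n + n) => td a u * td b u).
Local Notation wlap := (@wlap R n i0 i1).

(** The wave has degree at most 2 mu, so Bernstein's inequality charges 4 mu for each derivative. *)
Lemma wave_bounds nu mu i (A : T) (s : R) : (0 < mu)%N -> (nu <= mu)%N -> tp nu A ->
  bnd (2 * s) A ->
  [/\ tp (2 * mu) (wave mu i A), bnd (2 * s / mu%:R) (wave mu i A),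
    forall a, bnd (8 * s) (td a (wave mu i A)) &
    forall a b, bnd (32 * s * mu%:R) (td a (td b (wave mu i A)))].
Proof.
move=> mu0 numu tA bA.
have m0 : mu%:R != 0 :> R by rewrite pnatr_eq0 -lt0n.
have tw : tp (2 * mu) (wave mu i A).
  apply: TtpZ; rewrite mul2n -addnn; apply: TtpM; last exact: Ttp_cos.
  exact: tp_leq tA.
have bw : bnd (2 * s / mu%:R) (wave mu i A).
  have -> : 2 * s / mu%:R = mu%:R^-1 * ((2 * s) * 1) by ring.
  by apply: bndZ; [rewrite invr_ge0|apply: bndM => //; exact: bnd_cos].
have mu2 : (0 < 2 * mu)%N by rewrite muln_gt0.
have b1 a : bnd (8 * s) (td a (wave mu i A)).
  have -> : 8 * s = 2 * (2 * mu)%:R * (2 * s / mu%:R) by rewrite natrM; field.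
  exact: bnd_td.
split => // a b.
have -> : 32 * s * mu%:R = 2 * (2 * mu)%:R * (8 * s) by rewrite natrM; ring.
by apply: bnd_td => //; exact: tp_td.
Qed.

Lemma wave_err_bounds nu mu L i (u A : T) (s Th : R) :
  (0 < nu)%N -> (nu <= mu)%N -> (2 * mu <= L)%N -> tp nu A -> bnd (2 * s) A ->
  tp L u -> (forall a b, bnd Th (td a (td b u))) ->
  (forall a b, tp (2 * mu + L) (wave_err mu i u A a b)) /\
  forall a b, bnd (4 * s * Th / mu%:R + 24 * s ^+ 2 * nu%:R / mu%:R) (wave_err mu i u A a b).
Proof.
move=> nu0 numu muL tA bA tu bu.
have mu0 : (0 < mu)%N by apply: leq_trans numu.
have m0 : 0 < mu%:R :> R by rewrite ltr0n.
have s0 : 0 <= 2 * s by exact: bnd_ge0 bA.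
have [tw bw _ _] := wave_bounds i mu0 numu tA bA.
have bdA a : bnd (4 * s * nu%:R) (td a A).
  have -> : 4 * s * nu%:R = 2 * nu%:R * (2 * s) by ring.
  exact: bnd_td.
have tc := @Ttp_cos R (n + n) mu (X i); have ts := @Ttp_sin R (n + n) mu (X i).
have bc := @bnd_cos R (n + n) mu (X i); have bs := @bnd_sin R (n + n) mu (X i).
split=> a b; rewrite /wave_err.
  have l4 : (mu + nu + (mu + nu) <= 2 * mu + L)%N by lia.
  have l5 : (nu + nu + (mu + mu) + 0 <= 2 * mu + L)%N by lia.
  apply: TtpD; first apply: TtpB.
  - by apply: TtpN; apply: TtpD; apply: TtpM => //; do 2 apply: tp_td.
  - apply: tp_leq l5 _; apply: TtpM; last exact: Ttp_bool.
    apply: TtpM; last exact: TtpM.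
    by apply: TtpZ; apply: TtpM => //; exact: tp_td.
  - apply: tp_leq l4 _.
    by apply: TtpM; (apply: TtpM; [exact: TtpZ|exact: tp_td]).
have V0 : 0 <= mu%:R^-1 :> R by rewrite invr_ge0 ltW.
have nm : nu%:R / mu%:R <= 1 :> R by rewrite ler_pdivrMr// mul1r ler_nat.
have sn : 0 <= s ^+ 2 * (nu%:R / mu%:R) by rewrite mulr_ge0 ?sqr_ge0// mulr_ge0.
apply: (@bnd_le _ _ ((2 * s / mu%:R * Th + 2 * s / mu%:R * Th) +
   (mu%:R^-1 * (2 * s * (4 * s * nu%:R)) * (1 * 1)) * 1 +
   (mu%:R^-1 * 1 * (4 * s * nu%:R)) * (mu%:R^-1 * 1 * (4 * s * nu%:R)))).
  have -> : mu%:R^-1 * 1 * (4 * s * nu%:R) * (mu%:R^-1 * 1 * (4 * s * nu%:R)) =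
     16 * (s ^+ 2 * (nu%:R / mu%:R) * (nu%:R / mu%:R)) :> R by ring.
  have : s ^+ 2 * (nu%:R / mu%:R) * (nu%:R / mu%:R) <= s ^+ 2 * (nu%:R / mu%:R).
    by rewrite ler_piMr.
  set z := s ^+ 2 * (nu%:R / mu%:R) * (nu%:R / mu%:R).
  have -> : mu%:R^-1 * (2 * s * (4 * s * nu%:R)) * (1 * 1) * 1 = 8 * (s ^+ 2 * (nu%:R / mu%:R)) by ring.
  have -> : 24 * s ^+ 2 * nu%:R / mu%:R = 24 * (s ^+ 2 * (nu%:R / mu%:R)) by ring.
  have -> : 2 * s / mu%:R * Th + 2 * s / mu%:R * Th = 4 * s * Th / mu%:R by ring.
  by lra.
apply: bndD; first apply: bndB.
- by apply: bndN; apply: bndD; exact: bndM.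
- apply: bndM; last exact: bnd_bool.
  by apply: bndM; [apply: bndZ => //; exact: bndM|exact: bndM].
- by apply: bndM; apply: bndM => //; exact: bndZ.
Qed.

(** Here a and b are the two frequencies. The second wave meets the second derivatives of u plus the
    first wave, bounded by Th + 32 s a; this is the source of the term in a / b. *)
Lemma stage_arith (s d Th v a b : R) : 0 <= s -> s * s = d -> 0 <= Th -> 0 <= v ->
  0 < a -> a <= b ->
  (4 * s * Th / a + 24 * s ^+ 2 * v / a) + (4 * s * (Th + 32 * s * a) / b + 24 * s ^+ 2 * v / b) <=
  16 * s * Th / a + 192 * d * v / a + 512 * d * a / b.
Proof.
move=> s0 <- Th0 v0 a0 ab; have b0 : 0 < b by apply: lt_le_trans ab.
have iV : b^-1 <= a^-1 by rewrite lef_pV2 ?posrE.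
have e1 : s * Th / b <= s * Th / a by apply: ler_wpM2l iV; exact: mulr_ge0.
have e2 : s * s * v / b <= s * s * v / a by apply: ler_wpM2l iV; rewrite !mulr_ge0.
have e3 : 0 <= s * s * v / a by rewrite divr_ge0 ?mulr_ge0// ltW.
have e4 : 0 <= s * Th / a by rewrite divr_ge0 ?mulr_ge0// ltW.
have e5 : 0 <= s * s * a / b by rewrite divr_ge0 ?mulr_ge0// ltW.
have -> : 4 * s * (Th + 32 * s * a) / b = 4 * (s * Th / b) + 128 * (s * s * a / b) by ring.
have -> : 24 * s ^+ 2 * v / a = 24 * (s * s * v / a) by ring.
have -> : 24 * s ^+ 2 * v / b = 24 * (s * s * v / b) by ring.
have -> : 4 * s * Th / a = 4 * (s * Th / a) by ring.
have -> : 16 * s * Th / a = 16 * (s * Th / a) by ring.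
have -> : 192 * (s * s) * v / a = 192 * (s * s * v / a) by ring.
have -> : 512 * (s * s) * a / b = 512 * (s * s * a / b) by ring.
by lra.
Qed.

(** [wlap] ignores constants, so [del] may be added to the target: del + h - g is then positive and
    nearly a square A^2 / 2. The two waves together add A^2 / 2 under [wlap], and the potentials of
    their errors join g. *)
Lemma stage (N nu mu1 mu2 l : nat) (u g h : T) (del e Th : R) :
  (0 < nu)%N -> (2 ^ N.+1 * nu <= mu1)%N -> (mu1 <= mu2)%N -> (4 * mu2 <= 2 ^ l)%N ->
  tp nu u -> tp nu g -> tp nu h -> 0 < del -> 0 <= e <= 4^-1 ->
  bnd (del * e) (h - g) -> (forall a b, bnd Th (td a (td b u))) ->
  hop (dd u) = wlap g ->
  exists u' g' : T,
  [/\ [/\ tp (4 * mu2) u', tp (4 * mu2) g' & hop (dd u') = wlap g'],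
      bnd (8 * Num.sqrt del / mu1%:R) (u' - u),
      forall a, bnd (32 * Num.sqrt del) (td a (u' - u)),
      forall a b, bnd (128 * Num.sqrt del * mu2%:R) (td a (td b (u' - u))) &
      bnd (del * e * (2 * e) ^+ N + 480 * n%:R ^+ 2 * l.+1%:R *
         (16 * Num.sqrt del * Th / mu1%:R + 2 ^+ N * 192 * del * nu%:R / mu1%:R
          + 512 * del * mu1%:R / mu2%:R)) (g' - h)].
Proof.
move=> nu0 numu1 mu12 mu2l tu tg th d0 e01 bhg bu Du.
pose nu' := (2 ^ N * nu)%N.
have nu'0 : (0 < nu')%N by rewrite muln_gt0 expn_gt0.
have nn' : (nu <= nu')%N by rewrite leq_pmull// expn_gt0.
have nm1 : (2 * nu' <= mu1)%N by rewrite mulnA -expnS.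
have nm1' : (nu' <= mu1)%N by lia.
have m10 : (0 < mu1)%N by lia.
have m20 : (0 < mu2)%N by lia.
have [dg1 dg2 dg3 dg4 dg5] : [/\ (nu <= 2 * mu1)%N, (nu <= 4 * mu2)%N, (nu' + nu' <= 4 * mu2)%N,
   (2 * mu1 <= 4 * mu2)%N & (2 * mu1 <= 2 * mu2)%N] by split; lia.
have dg6 : (2 * mu1 + 2 * mu1 <= 4 * mu2)%N by lia.
have dg7 : (2 * mu2 + 2 * mu2 <= 4 * mu2)%N by lia.
have dg8 : (2 * mu2 <= 4 * mu2)%N by lia.
have n0 : n%:R != 0 :> R by rewrite pnatr_eq0 -lt0n (leq_ltn_trans _ (ltn_ord i0)).
(* Normalised so that del (1 + x) = del + h - g, with x small enough for the square-root
   iteration. *)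
pose x : T := cst del^-1 * (h - g).
have tx : tp nu x by apply: TtpZ; exact: TtpB.
have bx : bnd e x.
  have -> : e = del^-1 * (del * e) by rewrite mulKf// gt_eqF.
  by apply: bndZ => //; rewrite invr_ge0 ltW.
pose P := sqrt_iter x N; pose r := 1 + x - P * P.
have [bP br] := sqrt_iter_bound N e01 bx.
(* A wave of amplitude A contributes A^2 / 2, hence the 2: here A^2 / 2 = del P^2. *)
pose q := Num.sqrt (2 * del).
pose A : T := cst q * P.
have q0 : 0 <= q by rewrite sqrtr_ge0.
have sd0 : 0 <= Num.sqrt del by rewrite sqrtr_ge0.
have sdd : Num.sqrt del * Num.sqrt del = del by rewrite -expr2 sqr_sqrtr// ltW.
have q2 : q <= 3 / 2 * Num.sqrt del.
  rewrite /q sqrtrM// ler_wpM2r//.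
  rewrite -[leRHS]ger0_norm// -sqrtr_sqr ler_wsqrtr//; lra.
have bA : bnd (2 * Num.sqrt del) A.
  apply: (@bnd_le _ _ (q * (5 / 4))); first lra.
  apply: bndZ => //; rewrite (_ : P = (P - 1) + cst 1); last by rewrite TPcst1 subrK.
  rewrite (_ : 5 / 4 = 4^-1 + 1 :> R); last by field.
  by apply: bndD => // y; rewrite /= normr1.
have tA : tp nu' A by apply: TtpZ; exact: tp_sqrt_iter.
have AA : cst 2^-1 * (A * A) = cst del + (h - g) - cst del * r.
  have c1 : cst 2^-1 * (cst q * cst q) = cst del.
    rewrite -!TPcstM -expr2 sqr_sqrtr ?mulr_ge0 ?ltW//; congr TPcst; by field.
  have c2 : h - g = cst del * x by rewrite /x mulrA -TPcstM divff ?gt_eqF// TPcst1 mul1r.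
  rewrite c2 /r /A -{1}c1.
  transitivity (cst 2^-1 * (cst q * cst q) * (P * P)); first by ring.
  by rewrite c1; ring.
have [tw1 bw1 bdw1 bddw1] := wave_bounds i0 m10 nm1' tA bA.
have [tw2 bw2 bdw2 bddw2] := wave_bounds i1 m20 (leq_trans nm1' mu12) tA bA.
set w1 := wave mu1 i0 A in tw1 bw1 bdw1 bddw1; set w2 := wave mu2 i1 A in tw2 bw2 bdw2 bddw2.
have tu1 : tp (2 * mu1) (u + w1) by apply: TtpD => //; exact: tp_leq tu.
have bu1 a b : bnd (Th + 32 * Num.sqrt del * mu1%:R) (td a (td b (u + w1))).
  by rewrite !tdD; exact: bndD.
have tu' : tp (2 * mu1) u by exact: tp_leq tu.
have [tE1 bE1] := wave_err_bounds i0 nu'0 nm1' (leqnn _) tA bA tu' bu.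
have tu1' : tp (2 * mu2) (u + w1) by exact: tp_leq tu1.
have [tE2 bE2] := wave_err_bounds i1 nu'0 (leq_trans nm1' mu12) (leqnn _) tA bA tu1' bu1.
have tE1' a b : tp (4 * mu2) (wave_err mu1 i0 u A a b) by exact: tp_leq (tE1 a b).
have tE2' a b : tp (4 * mu2) (wave_err mu2 i1 (u + w1) A a b) by exact: tp_leq (tE2 a b).
have [G1 [tG1 bG1 eG1]] := wsolv_hop i01 mu2l tE1' bE1.
have [G2 [tG2 bG2 eG2]] := wsolv_hop i01 mu2l tE2' bE2.
have uE : u + w1 + w2 - u = w1 + w2 by ring.
have m1p : 0 < mu1%:R :> R by rewrite ltr0n.
have m2p : 0 < mu2%:R :> R by rewrite ltr0n.
have iV : mu2%:R^-1 <= mu1%:R^-1 :> R by rewrite lef_pV2 ?posrE// ler_nat.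
(* g + A^2 / 2 equals del + h - del r; the constant del is dropped, as [wlap] kills it. *)
exists (u + w1 + w2), (h - cst del * r + G1 + G2); split; first split.
- by apply: TtpD; [exact: tp_leq tu1|exact: tp_leq tw2].
- apply: TtpD => //; apply: TtpD => //; apply: TtpB; first exact: tp_leq th.
  apply: TtpZ; apply: TtpB; first by apply: TtpD; [exact: (@Ttp_cst R (n + n) _ 1)|exact: tp_leq tx].
  by apply: (tp_leq dg3); apply: TtpM; exact: tp_sqrt_iter.
- rewrite (hop_wave i1 (u + w1) A m20) (hop_wave i0 u A m10) Du -eG1 -eG2.
  have eA : wlap h + wlap (- (cst del * r)) = wlap g + wlap (cst 2^-1 * (A * A)).
    rewrite -!wlapD AA; have -> : g + (cst del + (h - g) - cst del * r) = cst del + (h - cst del * r) by ring.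
    by rewrite [RHS]wlapD wlap_cst add0r.
  by rewrite !wlapD eA -(hop_projs i0 i1 (cst 2^-1 * (A * A))); ring.
- rewrite uE; apply: bnd_le (bndD bw1 bw2).
  have : 2 * Num.sqrt del / mu2%:R <= 2 * Num.sqrt del / mu1%:R by apply: ler_wpM2l iV; rewrite mulr_ge0.
  have : 0 <= Num.sqrt del / mu1%:R by rewrite divr_ge0.
  by lra.
- by move=> a; rewrite uE tdD; apply: bnd_le (bndD (bdw1 a) (bdw2 a)); lra.
- move=> a b; rewrite uE !tdD; apply: bnd_le (bndD (bddw1 a b) (bddw2 a b)).
  have : Num.sqrt del * mu1%:R <= Num.sqrt del * mu2%:R by rewrite ler_wpM2l// ler_nat.
  have : 0 <= Num.sqrt del * mu2%:R by rewrite mulr_ge0.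
  by lra.
have -> : h - cst del * r + G1 + G2 - h = - (cst del * r) + G1 + G2 by ring.
have br' : bnd (del * (e * (2 * e) ^+ N)) (- (cst del * r)) by apply: bndN; apply: bndZ => //; exact: ltW.
apply: bnd_le (bndD (bndD br' bG1) bG2).
have Th0 : 0 <= Th by exact: bnd_ge0 (bu (X i0) (X i0)).
have -> : 2 ^+ N * 192 * del * nu%:R / mu1%:R = 192 * del * nu'%:R / mu1%:R.
  by rewrite /nu' natrM natrX; ring.
have m12 : mu1%:R <= mu2%:R :> R by rewrite ler_nat.
have K0 : 0 <= 480 * n%:R ^+ 2 * l.+1%:R :> R.
  exact: mulr_ge0 (mulr_ge0 (ler0n _ _) (sqr_ge0 _)) (ler0n _ _).
have := stage_arith sd0 sdd Th0 (ler0n R nu') m1p m12.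
move: K0; move: (480 * n%:R ^+ 2 * l.+1%:R) => K K0 hA.
by rewrite -addrA -mulrDr [_ * (e * _)]mulrA lerD2l ler_wpM2l.
Qed.

End stage.

(** * Iteration of the stages *)

Section iteration.
Variables (R : realType) (n : nat) (i0 i1 : 'I_n).
Hypothesis i01 : i0 != i1.
Local Notation T := (TP R (n + n)).
Local Notation dd u := (fun a b : 'I_(n + n) => td a u * td b u).
Local Notation wlap := (@wlap R n i0 i1).
Variables (N : nat) (nu mu lam l : nat -> nat) (sd e tau : nat -> R) (t : nat -> T).

(** The error bound of [stage] when del is the square of sd(q+1) and the second derivatives of u are
    at most 256 sd(q) lam(q). *)
Definition stage_gain (q : nat) : R :=
  sd q.+1 ^+ 2 * e q * (2 * e q) ^+ N + 480 * n%:R ^+ 2 * (l q).+1%:R *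
    (16 * sd q.+1 * (256 * sd q * (lam q)%:R) / (mu q)%:R
     + 2 ^+ N * 192 * sd q.+1 ^+ 2 * (nu q)%:R / (mu q)%:R
     + 512 * sd q.+1 ^+ 2 * (mu q)%:R / (lam q.+1)%:R).

Record stage_params (q : nat) : Prop := StageParams {
  sp_lam : (0 < lam q)%N ;
  sp_nu : (4 * lam q <= nu q)%N ;
  sp_mu : (2 ^ N.+1 * nu q <= mu q)%N ;
  sp_mul : (mu q <= lam q.+1)%N ;
  sp_l : (4 * lam q.+1 <= 2 ^ l q)%N ;
  sp_sd : 0 < sd q.+1 ;
  sp_e : 0 <= e q <= 4^-1 ;
  sp_t : tp (nu q) (t q) ;
  sp_tau : bnd (tau q) (t q.+1 - t q) ;
  sp_gain : stage_gain q + tau q <= sd q.+2 ^+ 2 * e q.+1 ;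
  sp_grow : 2 * (sd q * (lam q)%:R) <= sd q.+1 * (lam q.+1)%:R }.

(** The defect t - g is allowed to be a small fraction e(q) of the square of the next amplitude, as
    the square-root iteration of [stage] requires. *)
Definition stage_inv (q : nat) (u g : T) : Prop :=
  [/\ tp (nu q) u, tp (nu q) g, hop (dd u) = wlap g,
      bnd (sd q.+1 ^+ 2 * e q) (t q - g) &
      forall a b, bnd (256 * sd q * (lam q)%:R) (td a (td b u))].

Definition stage_incr (q : nat) (w : T) : Prop :=
  [/\ bnd (8 * sd q.+1 / (mu q)%:R) w,
      forall a, bnd (32 * sd q.+1) (td a w) &
      forall a b, bnd (128 * sd q.+1 * (lam q.+1)%:R) (td a (td b w))].

(** The bound on second derivatives reproduces itself because [sp_grow] makes the old part at most
    half of the new one: 128 + 256 / 2 = 256. *)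
Lemma stage_step q (u g : T) : stage_params q -> (4 * lam q.+1 <= nu q.+1)%N -> stage_inv q u g ->
  exists u' g' : T, stage_inv q.+1 u' g' /\ stage_incr q (u' - u).
Proof.
case=> lam0 nul mul mul2 ll sd0 e0 tt tauq gain grow nul' [tu tg Du bg bu].
have nu0 : (0 < nu q)%N by lia.
have sd2 : 0 < sd q.+1 ^+ 2 by rewrite exprn_gt0.
have [u' [g' [[tu' tg' Du'] b0 b1 b2 b3]]] := stage i01 nu0 mul mul2 ll tu tg tt sd2 e0 bg bu Du.
have sq : Num.sqrt (sd q.+1 ^+ 2) = sd q.+1 by rewrite sqrtr_sqr gtr0_norm.
rewrite sq in b0 b1 b2 b3.
exists u', g'; split; last by split.
split => //.
- exact: tp_leq tu'.
- exact: tp_leq tg'.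
- have -> : t q.+1 - g' = (t q.+1 - t q) - (g' - t q) by ring.
  apply: bnd_le (bndB tauq b3); rewrite addrC; apply: le_trans gain; exact: lexx.
- move=> a b; have -> : u' = (u' - u) + u by rewrite subrK.
  rewrite (tdD b (u' - u) u) (tdD a); apply: bnd_le (bndD (b2 a b) (bu a b)); lra.
Qed.

Lemma stage_iterate q0 (u0 g0 : T) : (forall q, (q0 <= q)%N -> stage_params q) ->
  stage_inv q0 u0 g0 ->
  exists u g : nat -> T, [/\ u 0%N = u0,
    forall k, stage_inv (q0 + k) (u k) (g k) &
    forall k, stage_incr (q0 + k) (u k.+1 - u k)].
Proof.
move=> sp inv0.
(* Choice needs a step at every pair; where the invariant fails the pair itself is returned. *)
have step (x : nat * (T * T)) : exists y : T * T, (q0 <= x.1)%N -> stage_inv x.1 x.2.1 x.2.2 ->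
    stage_inv x.1.+1 y.1 y.2 /\ stage_incr x.1 (y.1 - x.2.1).
  case: x => q [u g] /=; have [[qq iq]|h] := pselect ((q0 <= q)%N /\ stage_inv q u g).
    have [u' [g' h]] := stage_step (sp q qq) (sp_nu (sp q.+1 (leqW qq))) iq.
    by exists (u', g').
  by exists (u, g) => h1 h2; case: h.
have [f hf] := choice step.
pose s := fix s k := if k is k'.+1 then f ((q0 + k')%N, s k') else (u0, g0).
have inv k : stage_inv (q0 + k) (s k).1 (s k).2.
  elim: k => [|k IH] /=; first by rewrite addn0.
  by rewrite addnS; have [] := hf ((q0 + k)%N, s k) (leq_addr _ _) IH.
exists (fun k => (s k).1), (fun k => (s k).2); split => // k.
by have [_] := hf ((q0 + k)%N, s k) (leq_addr _ _) (inv k).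
Qed.

End iteration.

(** * Real powers of two and the choice of the parameters *)

Section pow2.
Variable R : realType.
Implicit Types x y : R.

Definition p2 x : R := 2 `^ x.

Lemma p2_gt0 x : 0 < p2 x. Proof. exact: powR_gt0. Qed.
Lemma p2_ge0 x : 0 <= p2 x. Proof. exact: powR_ge0. Qed.
Lemma p2D x y : p2 (x + y) = p2 x * p2 y.
Proof. by rewrite /p2 powRD// pnatr_eq0 implybT. Qed.
Lemma p2N x : p2 (- x) = (p2 x)^-1. Proof. exact: powRN. Qed.
Lemma p2_le x y : x <= y -> p2 x <= p2 y.
Proof. by apply: ler_powR; rewrite ler1n. Qed.
Lemma p2_nat k : (2 ^ k)%:R = p2 k%:R. Proof. by rewrite /p2 powR_mulrn// natrX. Qed.
Lemma p2_0 : p2 0 = 1. Proof. exact: powRr0. Qed.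
Lemma p2_1 : p2 1 = 2. Proof. exact: powRr1. Qed.
Lemma p2X x k : p2 x ^+ k = p2 (x * k%:R).
Proof. by rewrite /p2 powRrM -powR_mulrn// powR_ge0. Qed.

Lemma p2_ev (a C : R) : 0 < a ->
  exists Q, forall q, (Q <= q)%N -> C * q.+1%:R ^+ 2 <= p2 (a * q%:R).
Proof.
move=> a0; pose c := a * ln 2.
have c0 : 0 < c by rewrite mulr_gt0// ln_gt0// ltr1n.
(* From e^y >= y^3 / 6 and (q + 1)^2 <= 4 q^2 for q >= 1; 24 is 6 times 4. *)
pose B := 24 * `|C| / c ^+ 3.
exists (Num.truncn B).+1 => q hq.
have qB : B <= q%:R.
  apply: ltW; apply: lt_le_trans (truncnS_gt _) _; by rewrite ler_nat.
have q1 : 1 <= q%:R :> R by rewrite ler1n; lia.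
have -> : p2 (a * q%:R) = expR (c * q%:R).
  by rewrite /p2 /powR pnatr_eq0 /= /c; congr expR; ring.
have h := @expR_ge1Dxn R (c * q%:R) 2 (ltW (mulr_gt0 c0 (lt_le_trans ltr01 q1))).
apply: le_trans (_ : (c * q%:R) ^+ 3 / 6 <= _); last first.
  by apply: le_trans h; rewrite -[3`!]/6%N lerDr.
have C1 : C <= `|C| by exact: ler_norm.
apply: (@le_trans _ _ (`|C| * (4 * q%:R ^+ 2))).
  apply: (@le_trans _ _ (`|C| * q.+1%:R ^+ 2)); first by rewrite ler_wpM2r// sqr_ge0.
  by rewrite ler_wpM2l// -natr1; nra.
have h3 : `|C| = B * c ^+ 3 / 24 by rewrite /B; field; rewrite gt_eqF.
rewrite h3 [(c * q%:R) ^+ 3]exprMn.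
have c3 : 0 <= c ^+ 3 by rewrite exprn_ge0// ltW.
have -> : B * c ^+ 3 / 24 * (4 * q%:R ^+ 2) = (c ^+ 3 / 6) * (B * q%:R ^+ 2) by field.
have -> : c ^+ 3 * q%:R ^+ 3 / 6 = (c ^+ 3 / 6) * (q%:R * q%:R ^+ 2) by ring.
by apply: ler_wpM2l; [rewrite divr_ge0|rewrite ler_wpM2r// sqr_ge0].
Qed.

Lemma nat_above (x : R) : exists Q, forall q, (Q <= q)%N -> x <= q%:R.
Proof.
exists (Num.truncn x).+1 => q hq; apply: ltW; apply: lt_le_trans (truncnS_gt _) _.
by rewrite ler_nat.
Qed.

End pow2.

Section par_ineqs.
Variables (R : realType).
Implicit Types b x N kap : R.

(** Here and below x is the stage q and exponents of 2 are compared. The right side belongs to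
    sd(q+2)^2 e(q+1), with a factor 1/8 taken off so that several errors can be added. *)
Lemma par_ineq_N b x N : 0 < b -> 5 * b < 1 -> 5 * b * x <= x -> N + 11 <= x ->
  5 * x <= 2 * (1 - 5 * b) * N * x ->
  - (10 * b * (x + 1) ^+ 2) + - (2 * (1 - 5 * b) * x) + (1 + - (2 * (1 - 5 * b) * x)) * N <=
  - (10 * b * (x + 2) ^+ 2) - 2 * (1 - 5 * b) * (x + 1) - 3.
Proof. by move=> *; lra. Qed.

(** The leading (1 - 5 b) x is reserved for the logarithm of the degree and the constants. The
    quadratic terms cancel, and the coefficient of x left over is (6 - 30 b) - 3 (1 - 5 b) = 3 (1 -
    5 b). *)
Lemma par_ineq_1 b x : 0 < b -> 5 * b < 1 -> 8 <= (1 - 5 * b) * x ->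
  (1 - 5 * b) * x + (- (5 * b * (x + 1) ^+ 2) - 5 * b * x ^+ 2 - 6 * x) <=
  - (10 * b * (x + 2) ^+ 2) - 2 * (1 - 5 * b) * (x + 1) - 3.
Proof. by move=> *; lra. Qed.

Lemma par_ineq_2 b x : 0 < b -> 5 * b < 1 -> 11 <= x -> 5 * b * x <= x ->
  (1 - 5 * b) * x + (- (10 * b * (x + 1) ^+ 2) - 6 * x) <=
  - (10 * b * (x + 2) ^+ 2) - 2 * (1 - 5 * b) * (x + 1) - 3.
Proof. by move=> *; lra. Qed.

(** The coefficient of x left over is (4 - 20 b) - 3 (1 - 5 b) = 1 - 5 b, the tightest of the
    balances. *)
Lemma par_ineq_3 b x : 0 < b -> 5 * b < 1 -> 8 <= (1 - 5 * b) * x ->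
  (1 - 5 * b) * x + (- (10 * b * (x + 1) ^+ 2) + (5 * x ^+ 2 + 6 * x) - 5 * (x + 1) ^+ 2) <=
  - (10 * b * (x + 2) ^+ 2) - 2 * (1 - 5 * b) * (x + 1) - 3.
Proof. by move=> *; lra. Qed.

Lemma par_ineq_tau b x kap : 0 < b -> 5 * b < 1 -> 11 <= x -> 5 * b * x <= x -> 0 <= b * x ->
  24 * x <= 5 * (kap - 2 * b) * x * x ->
  x + - (5 * kap * x ^+ 2) <= - (10 * b * (x + 2) ^+ 2) - 2 * (1 - 5 * b) * (x + 1) - 3.
Proof. by move=> *; lra. Qed.

Lemma le_sum3 (u v w a c d y : R) : u <= a * y -> v <= c * y -> w <= d * y ->
  u + v + w <= (a + c + d) * y.
Proof. by move=> h1 h2 h3; rewrite 2!mulrDl; apply: lerD h3; apply: lerD. Qed.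

End par_ineqs.

Section parameters.
Variables (R : realType) (n : nat) (b kap CH : R).
Hypotheses (b0 : 0 < b) (b5 : 5 * b < 1) (bk : 2 * b < kap).

Definition par_eta : R := 1 - 5 * b.
Definition par_lam (q : nat) : nat := 2 ^ (5 * q ^ 2).
(** Of the factor 2^(10 q + 5) between consecutive values of [par_lam], the first wave gets 2^(6 q)
    and the second 2^(4 q + 5). With this split the first and the last wave errors in [stage_gain]
    are admissible under one and the same condition, 5 b < 1. *)
Definition par_mu (q : nat) : nat := 2 ^ (5 * q ^ 2 + 6 * q).
Definition par_l (q : nat) : nat := 5 * q.+1 ^ 2 + 2.
Definition par_nu (q : nat) : nat := 12 * n.+2 * par_lam q.
Definition par_sd (M : R) (q : nat) : R := M * p2 (- (5 * b * q%:R ^+ 2)).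
Definition par_e (q : nat) : R := p2 (- (2 * par_eta * q%:R)).
Definition par_tau (q : nat) : R := 2 * CH * p2 (- (5 * kap * q%:R ^+ 2)).

Lemma par_lamE q : (par_lam q)%:R = p2 (5 * q%:R ^+ 2) :> R.
Proof. by rewrite /par_lam p2_nat natrM natrX. Qed.

Lemma par_muE q : (par_mu q)%:R = p2 (5 * q%:R ^+ 2 + 6 * q%:R) :> R.
Proof. by rewrite /par_mu p2_nat natrD natrM natrX [(6 * q)%:R]natrM. Qed.

Lemma par_l_le q : ((par_l q).+1 <= 8 * q.+1 ^ 2)%N.
Proof.
have : (0 < q.+1 ^ 2)%N by rewrite expn_gt0.
by rewrite /par_l; move: (q.+1 ^ 2)%N => k; lia.
Qed.

Lemma par_eta_gt0 : 0 < par_eta.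
Proof. by rewrite subr_gt0. Qed.

(** The threshold [Q] has to be independent of the amplitude [M], which is fixed only after the
    first stage has been chosen. All terms are quadratic in M except [par_tau], for which M >= 1
    suffices. *)
Lemma par_gain_ev : exists N Q, forall q M, (Q <= q)%N -> 1 <= M ->
  stage_gain n.+2 N par_nu par_mu par_lam par_l (par_sd M) par_e q + par_tau q <=
   par_sd M q.+2 ^+ 2 * par_e q.+1.
Proof.
have e0 := par_eta_gt0.
(* The factor (2 e)^N has to beat the loss from sd(q+1)^2 to sd(q+2)^2, which is about 2^(20 b q)
   with 20 b < 4; hence the 5. *)
have [N hN] := nat_above (5 / (2 * par_eta)).
have {}hN : 5 <= 2 * par_eta * N%:R.
  by have := hN N (leqnn _); rewrite ler_pdivrMr ?mulr_gt0// mulrC.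
pose c : R := 480 * n.+2%:R ^+ 2 * 8 * (4096 + 2 ^+ N * 192 * (12 * n.+2%:R) + 512).
have [Q1 h1] := p2_ev c e0.
have [Q2 h2] := nat_above (8 / par_eta).
have [Q3 h3] := p2_ev (2 * CH) (ltr01 : 0 < 1).
have [Q4 h4] := nat_above (24 / (5 * (kap - 2 * b))).
exists N, (N + 11 + Q1 + Q2 + Q3 + Q4)%N => q M hq M1.
have [qN0 qQ1 qQ2 qQ3 qQ4] : [/\ N + 11 <= q, Q1 <= q, Q2 <= q, Q3 <= q & Q4 <= q]%N.
  by clear -hq; split; lia.
have [x xE] : exists x : R, q%:R = x by exists q%:R.
have qN : N%:R + 11 <= x by rewrite -xE -natrD ler_nat.
have x7 : 11 <= x by apply: le_trans qN; rewrite lerDr.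
have {}h1 : c * q.+1%:R ^+ 2 <= p2 (par_eta * x) by rewrite -xE; apply: h1.
have {}h2 : 8 <= par_eta * x by have := h2 q qQ2; rewrite ler_pdivrMr// mulrC xE.
have {}h3 : 2 * CH * q.+1%:R ^+ 2 <= p2 x by have := h3 q qQ3; rewrite mul1r xE.
have {}h4 : 24 <= 5 * (kap - 2 * b) * x.
  by have := h4 q qQ4; rewrite ler_pdivrMr ?mulr_gt0 ?subr_gt0// mulrC xE.
have M2 : 0 < M ^+ 2 by rewrite exprn_gt0// (lt_le_trans ltr01).
have M21 : 1 <= M ^+ 2 by rewrite -(expr1n R 2) lerXn2r ?nnegrE// (le_trans ler01).
have q1 : q.+1%:R = x + 1 :> R by rewrite -natr1 xE.
have q2 : q.+2%:R = x + 2 :> R by rewrite -natr1 q1; ring.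
have bx : 5 * b * x <= x by rewrite ler_piMl ?(ltW b5)//; lra.
have bx0 : 0 <= b * x by rewrite mulr_ge0 ?(ltW b0)//; lra.
have Nx : 5 * x <= 2 * par_eta * N%:R * x by rewrite ler_wpM2r//; lra.
set G := M ^+ 2 * p2 (- (10 * b * (x + 2) ^+ 2) - 2 * par_eta * (x + 1)).
have GE : par_sd M q.+2 ^+ 2 * par_e q.+1 = G.
  rewrite /par_sd /par_e /G exprMn p2X -[LHS]mulrA -p2D q1 q2; congr (_ * p2 _).
  by rewrite -[2%:R]/(2 : R); ring.
have G0 : 0 <= G by rewrite mulr_ge0 ?p2_ge0 ?ltW.
have key (y z : R) : y <= - (10 * b * (x + 2) ^+ 2) - 2 * par_eta * (x + 1) - z ->
    M ^+ 2 * p2 y <= G * p2 (- z).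
  by move=> h; rewrite /G -mulrA -p2D ler_pM2l//; exact: p2_le.
have p23 : p2 (- 3) = 8^-1 :> R.
  by rewrite p2N; congr (_^-1); rewrite -[3]/(3%:R) -p2_nat.
have sq1 : par_sd M q.+1 ^+ 2 = M ^+ 2 * p2 (- (10 * b * (x + 1) ^+ 2)).
  by rewrite /par_sd exprMn p2X q1; congr (_ * p2 _); rewrite -[2%:R]/(2 : R); ring.
rewrite GE /stage_gain.
have T1 : par_sd M q.+1 ^+ 2 * par_e q * (2 * par_e q) ^+ N <= G * 8^-1.
  have -> : par_sd M q.+1 ^+ 2 * par_e q * (2 * par_e q) ^+ N =
     M ^+ 2 * p2 (- (10 * b * (x + 1) ^+ 2) + - (2 * par_eta * x) + (1 + - (2 * par_eta * x)) * N%:R).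
    have -> : 2 * par_e q = p2 (1 + - (2 * par_eta * x)) by rewrite /par_e xE p2D p2_1.
    by rewrite p2X sq1 /par_e xE !(p2D (_ + _)) !(p2D (- _)); ring.
  rewrite -p23; apply: key.
  exact: par_ineq_N.
have K0 : 0 <= 480 * n.+2%:R ^+ 2 * (par_l q).+1%:R :> R.
  exact: mulr_ge0 (mulr_ge0 (ler0n _ _) (sqr_ge0 _)) (ler0n _ _).
have Kl : (par_l q).+1%:R <= 8 * q.+1%:R ^+ 2 :> R.
  by rewrite -natrX -natrM ler_nat par_l_le.
(* The three wave errors are bounded by multiples of y; the factor 2^(eta q) between y and G / 8
   pays for the logarithm, of size (q + 1)^2, and for the constants. *)
set y := G * 8^-1 / p2 (par_eta * x).
have pe := p2_gt0 (par_eta * x).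
have keyy z : par_eta * x + z <= - (10 * b * (x + 2) ^+ 2) - 2 * par_eta * (x + 1) - 3 ->
    M ^+ 2 * p2 z <= y.
  move=> h; rewrite /y ler_pdivlMr// -mulrA -p2D -p23 [z + _]addrC; exact: key.
have a1 : 16 * par_sd M q.+1 * (256 * par_sd M q * (par_lam q)%:R) / (par_mu q)%:R <= 4096 * y.
  have -> : 16 * par_sd M q.+1 * (256 * par_sd M q * (par_lam q)%:R) / (par_mu q)%:R =
     4096 * (M ^+ 2 * p2 (- (5 * b * (x + 1) ^+ 2) - 5 * b * x ^+ 2 - 6 * x)).
    rewrite /par_sd par_lamE par_muE -p2N q1 xE.
    have -> : - (5 * b * (x + 1) ^+ 2) - 5 * b * x ^+ 2 - 6 * x =
      - (5 * b * (x + 1) ^+ 2) + - (5 * b * x ^+ 2) + 5 * x ^+ 2 + - (5 * x ^+ 2 + 6 * x) by ring.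
    by rewrite !p2D; ring.
  apply: ler_wpM2l; first exact: ler0n.
  apply: keyy; exact: par_ineq_1.
have N0 : 0 <= 2 ^+ N * 192 * (12 * n.+2%:R) :> R.
  exact: (mulr_ge0 (mulr_ge0 (exprn_ge0 _ (ler0n _ _)) (ler0n _ _)) (mulr_ge0 (ler0n _ _) (ler0n _ _))).
have a2 : 2 ^+ N * 192 * par_sd M q.+1 ^+ 2 * (par_nu q)%:R / (par_mu q)%:R <=
    2 ^+ N * 192 * (12 * n.+2%:R) * y.
  have -> : 2 ^+ N * 192 * par_sd M q.+1 ^+ 2 * (par_nu q)%:R / (par_mu q)%:R =
     2 ^+ N * 192 * (12 * n.+2%:R) * (M ^+ 2 * p2 (- (10 * b * (x + 1) ^+ 2) - 6 * x)).
    rewrite sq1 /par_nu !natrM par_lamE par_muE -p2N xE.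
    have -> : - (10 * b * (x + 1) ^+ 2) - 6 * x =
      - (10 * b * (x + 1) ^+ 2) + 5 * x ^+ 2 + - (5 * x ^+ 2 + 6 * x) by ring.
    by rewrite !p2D; ring.
  apply: (ler_wpM2l N0).
  apply: keyy; exact: par_ineq_2.
have a3 : 512 * par_sd M q.+1 ^+ 2 * (par_mu q)%:R / (par_lam q.+1)%:R <= 512 * y.
  have -> : 512 * par_sd M q.+1 ^+ 2 * (par_mu q)%:R / (par_lam q.+1)%:R =
     512 * (M ^+ 2 * p2 (- (10 * b * (x + 1) ^+ 2) + (5 * x ^+ 2 + 6 * x) - 5 * (x + 1) ^+ 2)).
    by rewrite sq1 par_lamE par_muE q1 xE !p2D !p2N; ring.
  apply: ler_wpM2l; first exact: ler0n.
  apply: keyy; exact: par_ineq_3.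
have y0 : 0 <= y by rewrite /y divr_ge0 ?p2_ge0// mulr_ge0// invr_ge0.
have T2 : 480 * n.+2%:R ^+ 2 * (par_l q).+1%:R *
    (16 * par_sd M q.+1 * (256 * par_sd M q * (par_lam q)%:R) / (par_mu q)%:R +
     2 ^+ N * 192 * par_sd M q.+1 ^+ 2 * (par_nu q)%:R / (par_mu q)%:R +
     512 * par_sd M q.+1 ^+ 2 * (par_mu q)%:R / (par_lam q.+1)%:R) <= G * 8^-1.
  apply: (@le_trans _ _ (480 * n.+2%:R ^+ 2 * (par_l q).+1%:R *
     ((4096 + 2 ^+ N * 192 * (12 * n.+2%:R) + 512) * y))).
    by apply: (ler_wpM2l K0); exact: le_sum3.
  have -> : G * 8^-1 = p2 (par_eta * x) * y by rewrite /y [RHS]mulrC divfK// gt_eqF.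
  rewrite mulrA; apply: ler_wpM2r => //; apply: le_trans h1.
  have -> : c * q.+1%:R ^+ 2 = 480 * n.+2%:R ^+ 2 * (8 * q.+1%:R ^+ 2) *
     (4096 + 2 ^+ N * 192 * (12 * n.+2%:R) + 512) by rewrite /c; ring.
  apply: ler_wpM2r; first exact: (addr_ge0 (addr_ge0 (ler0n _ _) N0) (ler0n _ _)).
  by apply: (ler_wpM2l _ Kl); exact: (mulr_ge0 (ler0n _ _) (sqr_ge0 _)).
have T3 : par_tau q <= G * 8^-1.
  rewrite /par_tau xE; apply: (@le_trans _ _ (M ^+ 2 * p2 (x + - (5 * kap * x ^+ 2)))).
    rewrite (p2D x) [M ^+ 2 * _]mulrA; apply: ler_wpM2r; first exact: p2_ge0.
    apply: (@le_trans _ _ (p2 x)); last first.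
      by rewrite ler_peMl// p2_ge0.
    have [C0|C0] := leP 0 (2 * CH); last by apply: le_trans (p2_ge0 x); exact: ltW.
    by apply: le_trans h3; apply: (ler_peMr C0); apply: exprn_ege1; rewrite ler1n.
  have h4x : 24 * x <= 5 * (kap - 2 * b) * x * x by rewrite ler_wpM2r//; apply: le_trans x7.
  rewrite -p23; apply: key; exact: par_ineq_tau.
have -> : G = G * 8^-1 + G * 8^-1 + G * 8^-1 + G * (5 / 8) by field.
apply: ler_wpDr; last by rewrite lerD// lerD.
by apply: mulr_ge0 G0 _; apply: divr_ge0; exact: ler0n.
Qed.

Lemma par_other_ev N : exists Q, forall q M, (Q <= q)%N -> 1 <= M ->
  [/\ (0 < par_lam q)%N, (4 * par_lam q <= par_nu q)%N, (2 ^ N.+1 * par_nu q <= par_mu q)%N,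
      (par_mu q <= par_lam q.+1)%N & (4 * par_lam q.+1 <= 2 ^ par_l q)%N] /\
  [/\ 0 < par_sd M q, 0 <= par_e q <= 4^-1 &
      2 * (par_sd M q * (par_lam q)%:R) <= par_sd M q.+1 * (par_lam q.+1)%:R].
Proof.
have e0 := par_eta_gt0.
have [Q1 h1] := nat_above (1 / par_eta).
exists (Q1 + 2 ^ N.+1 * (12 * n.+2))%N => q M hq M1.
have {}h1 : 1 <= par_eta * q%:R.
  by have := h1 q; rewrite ler_pdivrMr// mulrC; apply; lia.
split; first split.
- by rewrite expn_gt0.
- by rewrite /par_nu leq_mul2r; apply/orP; right; lia.
- rewrite /par_nu /par_mu expnD mulnA mulnC /par_lam leq_mul2l; apply/orP; right.
  have : (q < 2 ^ q)%N by rewrite ltn_expl.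
  have : (2 ^ q <= 2 ^ (6 * q))%N by rewrite leq_exp2l//; lia.
  by lia.
- by rewrite /par_mu /par_lam leq_exp2l//; nia.
- by rewrite /par_l /par_lam expnD mulnC leq_mul2l orbT.
split.
- by rewrite mulr_gt0 ?p2_gt0// (lt_le_trans ltr01).
- rewrite p2_ge0 /par_e /=.
  have -> : 4^-1 = p2 (- 2) :> R by rewrite p2N; congr (_^-1); rewrite -[2]/(2%:R) -p2_nat.
  by apply: p2_le; lra.
rewrite /par_sd !par_lamE -!mulrA mulrCA ler_pM2l ?(lt_le_trans ltr01)//.
rewrite -p2D -p2D -{1}p2_1 -p2D; apply: p2_le.
rewrite -[q.+1%:R]natr1; set x : R := q%:R; have x0 : 0 <= x by exact: ler0n.
have bx : 5 * b * x <= x by apply: ler_piMl x0 _; exact: ltW.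
by move: (b5) (b0) => *; lra.
Qed.

End parameters.

(** * Lipschitz bounds and geometric limits *)

Section mean_value.
Variables (R : realType) (m : nat).
Local Notation E := 'rV[R]_m.

Lemma is_derive_along (f : E -> R) (x v : E) (t d : R) :
  is_derive (t *: v + x) v f d -> is_derive t (1 : R) (fun s : R => f (s *: v + x)) d.
Proof.
have eqf : (fun h : R => h^-1 *: (((fun s : R => f (s *: v + x)) \o shift t) (h *: 1) -
   f (t *: v + x))) = (fun h : R => h^-1 *: ((f \o shift (t *: v + x)) (h *: v) - f (t *: v + x))).
  by apply/funext => h; rewrite /shift/= [h *: 1]mulr1 scalerDl addrA.
by case=> df <-; split; rewrite /derivable /derive ?eqf.
Qed.

Lemma mvt_along (f : E -> R) (v x : E) (t : R) : (forall y, derivable f y v) ->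
  exists2 s, `|s| <= `|t| & f (t *: v + x) - f x = t * 'D_v f (s *: v + x).
Proof.
move=> df.
have dg (s : R) : is_derive s (1 : R) (fun s : R => f (s *: v + x)) ('D_v f (s *: v + x)).
  by apply: is_derive_along; exact: derivableP.
have cg : continuous (fun s : R => f (s *: v + x)).
  by move=> s; apply: differentiable_continuous; apply/derivable1_diffP; case: (dg s).
have [t0|t0] := leP 0 t.
  have [c /[!in_itv]/= /andP[c0 ct] e] := @MVT_segment R (fun s : R => f (s *: v + x)) _ 0 t t0
    (fun s _ => dg s) (continuous_subspaceT cg).
  exists c; first by rewrite !ger0_norm.
  by move: e; rewrite scale0r add0r subr0 mulrC.
have [c /[!in_itv]/= /andP[ct c0] e] := @MVT_segment R (fun s : R => f (s *: v + x)) _ t 0 (ltW t0)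
  (fun s _ => dg s) (continuous_subspaceT cg).
exists c; first by rewrite !ler0_norm ?(ltW t0)// lerN2.
by move: e; rewrite scale0r add0r sub0r mulrN mulrC => e; rewrite -opprB e opprK.
Qed.

(** The coordinates are changed one at a time. *)
Lemma lip_along (f : E -> R) (B : R) :
  (forall a t x, `|f (t *: delta_mx 0 a + x) - f x| <= B * `|t|) ->
  forall x y, `|f y - f x| <= B * \sum_a `|y 0 a - x 0 a|.
Proof.
move=> h x y; have ye : y = \sum_a (y 0 a - x 0 a) *: delta_mx 0 a + x.
  rewrite -[LHS](subrK x); congr (_ + x); rewrite [LHS]row_sum_delta.
  by apply: eq_bigr => a _; rewrite !mxE.
rewrite {1}ye; elim: index_enum => [|a r IH]; first by rewrite !big_nil add0r subrr normr0 mulr0.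
rewrite !big_cons /= -addrA; set z := _ + x in IH *.
rewrite -[X in `|X|](subrKA (f z)) (le_trans (ler_normD _ _))// mulrDr; exact: lerD.
Qed.

Lemma tp_lip (F : TP R m) (B : R) : (forall a, bnd B (td a F)) ->
  forall x y, `|F y - F x| <= B * \sum_a `|y 0 a - x 0 a|.
Proof.
move=> h; apply: lip_along => a t x; have [K tF] := tpP F.
have [|s _ ->] := @mvt_along F (delta_mx 0 a) x t.
  by move=> y; have [] := tp_is_derive y a tF.
by rewrite normrM mulrC ler_wpM2r//; have := h a (s *: delta_mx 0 a + x); rewrite tdE.
Qed.

End mean_value.

Section geometric_limits.
Variables (R : realType) (T : Type).

Lemma geom_diff (f : nat -> R) (A r : R) : 0 <= A -> 0 <= r -> r < 1 ->
  (forall k, `|f k.+1 - f k| <= A * r ^+ k) ->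
  forall k j, `|f (k + j)%N - f k| <= A / (1 - r) * r ^+ k.
Proof.
move=> A0 r0 r1 h k j; have r1' : 0 < 1 - r by rewrite subr_gt0.
apply: (@le_trans _ _ (A / (1 - r) * (r ^+ k - r ^+ (k + j)))); last first.
  by rewrite ler_wpM2l ?divr_ge0 ?(ltW r1')// gerBl exprn_ge0.
elim: j => [|j IH]; first by rewrite addn0 !subrr normr0 mulr0.
rewrite addnS -[X in `|X|](subrKA (f (k + j)%N)) (le_trans (ler_normD _ _))//.
apply: le_trans (lerD (h _) IH) _; rewrite exprS.
rewrite -(@ler_pM2l _ (1 - r))// le_eqVlt; apply/orP; left; apply/eqP.
by field; rewrite gt_eqF.
Qed.

(** The limit is the supremum of the lower bounds f k x - c r^k, which all lie below every upper
    bound f k x + c r^k; the rate then comes at once. *)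
Lemma geom_limit (f : nat -> T -> R) (A r : R) : 0 <= A -> 0 <= r -> r < 1 ->
  (forall k x, `|f k.+1 x - f k x| <= A * r ^+ k) ->
  exists F : T -> R, forall k x, `|f k x - F x| <= A / (1 - r) * r ^+ k.
Proof.
move=> A0 r0 r1 h; set c := A / (1 - r).
have c0 : 0 <= c by rewrite divr_ge0// subr_ge0 ltW.
have fb x k j : `|f (k + j)%N x - f k x| <= c * r ^+ k.
  exact: (@geom_diff (fun k => f k x)).
have ub x k : ubound (range (fun k => f k x - c * r ^+ k)) (f k x + c * r ^+ k).
  move=> _ [j _ <-]; have [/subnKC kj|/ltnW/subnKC jk] := leqP k j.
    apply: (@le_trans _ _ (f j x)); first by rewrite gerBl mulr_ge0// exprn_ge0.
    by have := fb x k (j - k)%N; rewrite kj ler_distl => /andP[].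
  have := fb x j (k - j)%N; rewrite jk ler_distl => /andP[fj _].
  by apply: le_trans fj _; rewrite lerDl mulr_ge0// exprn_ge0.
exists (fun x => sup (range (fun k => f k x - c * r ^+ k))) => k x.
rewrite ler_distlC; apply/andP; split.
  by apply: ub_le_sup; [exists (f k x + c * r ^+ k); exact: ub | exists k].
by apply: ge_sup; [exists (f k x - c * r ^+ k), k | exact: ub].
Qed.

End geometric_limits.

(** * Solutions on the torus *)

Lemma leq_sqr k : (k <= k ^ 2)%N.
Proof. by case: k => // k; rewrite leq_pmulr. Qed.

Lemma p2_le1 (R : realType) (x : R) : x <= 0 -> p2 x <= 1.
Proof. by move=> x0; rewrite -[X in _ <= X](p2_0 R); exact: p2_le. Qed.

Lemma p2_ge1 (R : realType) (x : R) : 0 <= x -> 1 <= p2 x.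
Proof. by move=> x0; rewrite -[X in X <= _](p2_0 R); exact: p2_le. Qed.

Lemma p2_small (R : realType) (a C e : R) : 0 < a -> 0 < e ->
  exists Q, forall q, (Q <= q)%N -> C * p2 (- (a * q%:R)) <= e.
Proof.
move=> a0 e0; have [Q h] := p2_ev (`|C| / e) a0; exists Q => q /h {}h.
rewrite p2N ler_pdivrMr ?p2_gt0// -ler_pdivrMl// mulrC.
apply: le_trans h; apply: (@le_trans _ _ (`|C| / e)).
  by rewrite ler_pM2r ?invr_gt0// ler_norm.
by rewrite ler_peMr ?divr_ge0 ?(ltW e0)// exprn_ege1// ler1n.
Qed.

(** Rests on min (1, s) <= s^beta: interpolation between a sup bound and a Lipschitz bound. *)
Lemma powR_interp (R : realType) (z A s beta : R) : 0 <= A -> 0 < s -> 0 <= beta <= 1 ->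
  z <= A -> z <= A * s -> z <= A * s `^ beta.
Proof.
move=> A0 s0 /andP[b0 b1] zA zs; have [s1|s1] := leP s 1.
  apply: le_trans zs _; apply: ler_wpM2l => //.
  by rewrite -{1}(powRr1 (ltW s0)) ger_powR ?s0 ?b0.
apply: le_trans zA _; rewrite -{1}(mulr1 A); apply: ler_wpM2l => //.
by rewrite -(powRr0 s) ler_powR// ltW.
Qed.

Lemma p2_lt1 (R : realType) (x : R) : 0 < x -> p2 (- x) < 1.
Proof.
move=> x0; rewrite p2N invf_lt1 ?p2_gt0// /p2 /powR pnatr_eq0 /=.
by rewrite expR_gt1 mulr_gt0// ln_gt0// ltr1n.
Qed.

Lemma TP_bnd (R : realType) (m : nat) (F : TP R m) : exists2 B, 0 <= B & bnd B F.
Proof.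
have [K [s _ vs]] := tpP F; exists (\sum_(ck <- s) (`|complex.Re ck.1| + `|complex.Im ck.1|)).
  by apply: sumr_ge0 => ck _; rewrite addr_ge0.
move=> x; rewrite vs /ev (le_trans (ler_norm_sum _ _ _))//; apply: ler_sum => -[[c1 c2] k] _ /=.
rewrite (le_trans (ler_normB _ _))//; apply: lerD.
  by rewrite normrM ler_piMr// cos_max.
by rewrite normrM ler_piMr// sin_max.
Qed.

Lemma TP_bnd_fam (R : realType) (m : nat) (I : finType) (F : I -> TP R m) :
  exists2 B, 0 <= B & forall i, bnd B (F i).
Proof.
have /choice[B hB] i : exists B, 0 <= B /\ bnd B (F i) by have [B] := TP_bnd (F i); exists B.
exists (\sum_i B i); first by apply: sumr_ge0 => i _; have [] := hB i.
move=> i; apply: bnd_le (proj2 (hB i)); rewrite (bigD1 i)//= lerDl.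
by apply: sumr_ge0 => j _; have [] := hB j.
Qed.

Section torus_solution.
Variables (R : realType) (n : nat) (i0 i1 : 'I_n.+2).
Hypothesis i01 : i0 != i1.
Variables (beta b kap CJ BH : R).
Hypotheses (beta0 : 0 < beta) (betab : beta < b) (b5 : 5 * b < 1) (bk : 2 * b < kap).
Local Notation m := (n.+2 + n.+2)%N.
Local Notation E := 'rV[R]_m.
Local Notation T := (TP R m).
Local Notation dd u := (fun a b : 'I_m => td a u * td b u).
Local Notation wlap := (@wlap R n.+2 i0 i1).
Variables (H : E -> R) (jt : nat -> T).
Hypothesis CJ_ge0 : 0 <= CJ.
Hypothesis tp_jt : forall q, tp (par_nu n q) (jt q).
Hypothesis jt_err : forall q x, `|jt q x - H x| <= CJ * p2 (- (5 * kap * q%:R ^+ 2)).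
Hypothesis Hbnd : forall x, `|H x| <= BH.

Let b0 : 0 < b. Proof. exact: lt_trans betab. Qed.

Lemma par_lam_gt0 q : (0 < par_lam q)%N. Proof. by rewrite expn_gt0. Qed.

Lemma jt_tau q : bnd (par_tau kap CJ q) (jt q.+1 - jt q).
Proof.
move=> x; rewrite TPE -[X in `|X|](subrKA (H x)) (le_trans (ler_normD _ _))//.
have -> : par_tau kap CJ q = CJ * p2 (- (5 * kap * q%:R ^+ 2)) + CJ * p2 (- (5 * kap * q%:R ^+ 2)).
  by rewrite /par_tau; ring.
apply: lerD; last by rewrite distrC; exact: jt_err.
apply: le_trans (jt_err _ _) _; apply: ler_wpM2l; first exact: CJ_ge0.
apply: p2_le; rewrite lerN2; apply: ler_wpM2l; last by rewrite lerXn2r ?nnegrE// ler_nat.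
by move: (b0) (bk) => *; lra.
Qed.

Lemma jt_bnd q : bnd (CJ + BH) (jt q).
Proof.
move=> x; rewrite -[jt q x](subrK (H x)) (le_trans (ler_normD _ _))//; apply: lerD (Hbnd x).
apply: le_trans (jt_err _ _) _; rewrite ler_piMr ?CJ_ge0//; apply: p2_le1.
rewrite oppr_le0; apply: mulr_ge0; last exact: sqr_ge0.
by move: (b0) (bk) => *; lra.
Qed.

Lemma le_par_nu q : (q <= par_nu n q)%N.
Proof.
apply: (@leq_trans (par_lam q)); last by rewrite /par_nu leq_pmull.
have h : (5 * q ^ 2 < 2 ^ (5 * q ^ 2))%N by rewrite ltn_expl.
by apply: leq_trans (ltnW h); apply: leq_trans (leq_sqr q) _; rewrite leq_pmull.
Qed.

(* The amplitude constant is chosen so that the error allowed at stage [q0] is [G ^+ 2]. *)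
Let ampl (G : R) q0 : R := G * p2 (5 * b * q0.+1%:R ^+ 2 + par_eta b * q0%:R).

Let ampl_ge G q0 : 1 <= G -> G <= ampl G q0.
Proof.
move=> G1; have G0 : 0 <= G by exact: le_trans G1.
rewrite /ampl ler_peMr//; apply: p2_ge1; apply: addr_ge0.
  by apply: mulr_ge0; [rewrite mulr_ge0// ltW | exact: sqr_ge0].
by apply: mulr_ge0 => //; exact/ltW/par_eta_gt0.
Qed.

(** The amplitude M is large, yet v moves little: the waves of stage q have size at most 8 sd(q+1) /
    mu(q), and dividing by mu(q) leaves at most 8 G 2^(- q), where G depends on the data only. A
    late first stage makes this small. *)
Lemma torus_iteration (v : T) (eps : R) : 0 < eps ->
  exists (u g : nat -> T) (q0 : nat) (M : R), [/\ u 0%N = v, 0 < M,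
    forall k, hop (dd (u k)) = wlap (g k) &
    [/\ forall k, bnd (eps / 2 * 2^-1 ^+ k) (u k.+1 - u k),
    forall k, bnd (par_sd b M (q0 + k).+1 ^+ 2 * par_e b (q0 + k)) (jt (q0 + k) - g k) ,
    forall k a, bnd (32 * par_sd b M (q0 + k).+1) (td a (u k.+1 - u k)) &
    forall k a c, bnd (128 * par_sd b M (q0 + k).+1 * (par_lam (q0 + k).+1)%:R)
       (td a (td c (u k.+1 - u k)))]].
Proof.
move=> eps0.
have [Kv tv] := tpP v.
have [Bv _ bv] := TP_bnd_fam (fun a => td a v).
have [Bw _ bw] : exists2 B, 0 <= B & forall a c, bnd B (td a (td c v)).
  have [B B0 hB] := TP_bnd_fam (fun ac : 'I_m * 'I_m => td ac.1 (td ac.2 v)).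
  by exists B => // a c; exact: (hB (a, c)).
have tdd a c : tp (Kv + Kv) (td a v * td c v) by apply: tpM; exact: tp_td.
(* v comes with no smallness, so its potential g0 may be far from the target; M is later taken so
   large that this defect is admissible at stage q0. *)
have [g0 [tg0 bg0 eg0]] : wsolv i0 i1 (Kv + Kv)
    (480 * n.+2%:R ^+ 2 * (Kv + Kv).+1%:R * (Bv * Bv)) (hop (dd v)).
  apply: wsolv_hop => //; first exact/ltnW/ltn_expl.
  by move=> a c; apply: bndM.
set Bg := 480 * _ * _ * _ in bg0.
have [N [Q1 h1]] := @par_gain_ev R n b kap CJ b0 b5 bk.
have [Q2 h2] := @par_other_ev R n b kap b0 b5 bk N.
(* Bounds, independently of q0, the initial defect and the second derivatives of v. *)
pose G : R := 1 + `|Bg| + `|CJ + BH| + `|Bw|.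
have G1 : 1 <= G by rewrite /G -!addrA lerDl !addr_ge0.
have G0 : 0 < G by exact: lt_le_trans G1.
have [Q3 h3] := p2_small (16 * G) ltr01 eps0.
have [q0 [q01 q02 q03 q0K]] : exists q0, [/\ Q1 <= q0, Q2 <= q0, Q3 <= q0 & Kv + Kv <= q0]%N.
  by exists (Q1 + Q2 + Q3 + (Kv + Kv))%N; clear; split; lia.
have [M ME] : exists M, M = ampl G q0 by exists (ampl G q0).
have M1 : 1 <= M by rewrite ME; apply: (le_trans G1); exact: ampl_ge.
have M0 : 0 < M by exact: lt_le_trans M1.
have sp q : (q0 <= q)%N -> stage_params N (par_nu n) par_mu par_lam par_l (par_sd b M)
    (par_e b) (par_tau kap CJ) jt q.
  move=> qq; have [] := h2 q M (leq_trans q02 qq) M1.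
  move=> [l1 l2 l3 l4 l5] [s0 s1 s2].
  split => //.
  - by rewrite /par_sd mulr_gt0// p2_gt0.
  - exact: jt_tau.
  - exact: (h1 _ _ (leq_trans q01 qq) M1).
have tq0 K (F : T) : tp K F -> (K <= Kv + Kv)%N -> tp (par_nu n q0) F.
  move=> tF K0; apply: tp_leq tF; apply: leq_trans (le_par_nu q0); exact: leq_trans q0K.
have inv0 : stage_inv i0 i1 (par_nu n) par_lam (par_sd b M) (par_e b) jt q0 v g0.
  split => //.
  - by apply: tq0 tv _; exact: leq_addr.
  - exact: tq0 tg0 _.
  - apply: bnd_le (bndB (jt_bnd q0) bg0).
    have -> : par_sd b M q0.+1 ^+ 2 * par_e b q0 = G ^+ 2.
      rewrite /par_sd /par_e ME /ampl -[G * _ * _]mulrA -p2D exprMn p2X -[LHS]mulrA -p2D.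
      set z := (X in p2 X); have -> : z = 0 by rewrite /z; ring.
      by rewrite p2_0 mulr1.
    apply: (@le_trans _ _ G).
      by rewrite /G; have := ler_norm Bg; have := ler_norm (CJ + BH); have := normr_ge0 Bw; lra.
    by rewrite expr2 ler_peMr// ltW.
  - move=> a c; apply: bnd_le (bw a c); apply: (@le_trans _ _ G).
      rewrite /G; have := ler_norm Bw; have := normr_ge0 (CJ + BH); have := normr_ge0 Bg; lra.
    rewrite -mulrA; apply: (@le_trans _ _ (1 * G)); first by rewrite mul1r.
    apply: ler_pM => //; [exact: ltW | by rewrite ler1n | rewrite par_lamE /par_sd ME /ampl].
    rewrite -!mulrA -!p2D; apply: ler_peMr; [exact: ltW | apply: p2_ge1].
    have := @par_eta_gt0 R b b5; have : 0 <= q0%:R :> R by exact: ler0n.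
    rewrite -[q0.+1%:R]natr1; move: (q0%:R : R) (par_eta b) => x y x0 y0.
    set z := (X in 0 <= X).
    have -> : z = 10 * (b * x) + 5 * b + y * x + 5 * x ^+ 2 by rewrite /z; ring.
    by rewrite !addr_ge0 ?mulr_ge0 ?(ltW b0) ?(ltW y0) ?sqr_ge0.
have [u [g [u0 hinv hinc]]] := stage_iterate i01 sp inv0.
exists u, g, q0, M; split => //; first by move=> k; have [] := hinv k.
split; first 1 last.
- by move=> k; have [] := hinv k.
- by move=> k; have [] := hinc k.
- by move=> k; have [] := hinc k.
move=> k; have [h _ _] := hinc k; apply: bnd_le h.
set q := (q0 + k)%N.
have qk : q%:R = q0%:R + k%:R :> R by rewrite natrD.
apply: (@le_trans _ _ (8 * G * p2 (- q%:R))).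
  rewrite par_muE -p2N /par_sd ME /ampl.
  rewrite -mulrA -!mulrA -!p2D; apply: ler_wpM2l; first exact: ler0n.
  rewrite ler_pM2l//; apply: p2_le.
  have e1 := @par_eta_gt0 R b b5; rewrite -![_.+1%:R]natr1 qk.
  have := ler0n R q0; have := ler0n R k; move: (q0%:R : R) (k%:R : R) => x y y0 x0.
  rewrite -subr_ge0 /par_eta.
  set z := (X in 0 <= X).
  have -> : z = 5 * b * (y * (2 * (x + 1) + y)) + 5 * (x + y) ^+ 2 + 5 * y + 4 * x + 5 * b * x by rewrite /z; ring.
  by rewrite !addr_ge0 ?mulr_ge0 ?(ltW b0) ?sqr_ge0// ?addr_ge0 ?mulr_ge0 ?addr_ge0.
have -> : 2^-1 ^+ k = p2 (- k%:R) :> R by rewrite p2N -p2_nat natrX exprVn.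
rewrite qk opprD p2D mulrA ler_pM2r ?p2_gt0// ler_pdivlMr//.
have := h3 q0 q03; rewrite mul1r; apply: le_trans.
by rewrite le_eqVlt; apply/orP; left; apply/eqP; ring.
Qed.

(** The gradient increment with top frequency lam(q) is of order sd(q), with Lipschitz constant of
    order sd(q) lam(q). Its beta-Hoelder constant is thus of order sd(q) lam(q)^beta = M 2^(- 5 (b -
    beta) q^2), which is summable as beta < b. *)
Lemma torus_solution (v : T) (eps : R) : 0 < eps ->
  exists (u g : nat -> T) (U : E -> R) (V : 'I_m -> E -> R) (C : R),
  [/\ forall k, hop (dd (u k)) = wlap (g k),
    forall e, 0 < e -> exists k, [/\ forall x, `|u k x - U x| <= e,
      forall a x, `|td a (u k) x - V a x| <= e & forall x, `|g k x - H x| <= e],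
    forall x, `|U x - v x| <= eps,
    forall a (x y : E) (D : R), 0 < D -> (forall c, `|y 0 c - x 0 c| <= D) ->
      `|V a y - V a x| <= C * D `^ beta &
    forall a x, `|V a x| <= C].
Proof.
move=> eps0; have [u [g [q0 [M [u0 M0 hD [hu hg hd hdd]]]]]] := torus_iteration v eps0.
have half1 : 2^-1 < 1 :> R by rewrite invf_lt1// ltr1n.
have [U hU] : exists U : E -> R, forall k x, `|u k x - U x| <= eps / 2 / (1 - 2^-1) * 2^-1 ^+ k.
  apply: geom_limit => //; first by rewrite divr_ge0// ltW.
have {}hU k x : `|u k x - U x| <= eps * 2^-1 ^+ k.
  by apply: le_trans (hU k x) _; rewrite le_eqVlt; apply/orP; left; apply/eqP; field.
pose r := p2 (- (5 * b)).
have r1 : r < 1 by apply: p2_lt1; rewrite mulr_gt0.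
have r0 : 0 <= r by exact: p2_ge0.
have sq k : k%:R <= (q0 + k).+1%:R ^+ 2 :> R.
  by rewrite -natrX ler_nat; apply: leq_trans (leq_sqr _); rewrite leqW ?leq_addl.
have sdk k : par_sd b M (q0 + k).+1 <= M * r ^+ k.
  rewrite /par_sd /r p2X ler_pM2l//; apply: p2_le; rewrite mulNr lerN2.
  by rewrite ler_pM2l ?mulr_gt0.
have /choice[V hV] a : exists F : E -> R, forall k x,
    `|td a (u k) x - F x| <= 32 * M / (1 - r) * r ^+ k.
  apply: geom_limit => //; first by rewrite mulr_ge0// ltW.
  move=> k x; have := hd k a x; rewrite tdB TPE => /le_trans; apply.
  by rewrite -[_ * M * _]mulrA; apply: ler_wpM2l; [exact: ler0n | exact: sdk].
have eta0 := @par_eta_gt0 R b b5.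
have kap0 : 0 < kap by move: (b0) (bk) => *; lra.
have hconv e : 0 < e -> exists k, [/\ forall x, `|u k x - U x| <= e,
      forall a x, `|td a (u k) x - V a x| <= e & forall x, `|g k x - H x| <= e].
  move=> e0; have e20 : 0 < e / 2 by rewrite divr_gt0.
  have [Q1 h1] := p2_small eps ltr01 e0.
  have [Q2 h2] := p2_small (32 * M / (1 - r)) (mulr_gt0 (ltr0n _ 5) b0) e0.
  have [Q3 h3] := p2_small (M ^+ 2) (mulr_gt0 (ltr0n _ 2) eta0) e20.
  have [Q4 h4] := p2_small CJ (mulr_gt0 (ltr0n _ 5) kap0) e20.
  have [k [k1 k2 k3 k4]] : exists k, [/\ Q1 <= k, Q2 <= k, Q3 <= k & Q4 <= k]%N.
    by exists (Q1 + Q2 + Q3 + Q4)%N; clear; split; lia.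
  exists k; split.
  - move=> x; apply: le_trans (hU k x) _; have := h1 k k1; rewrite mul1r.
    by rewrite p2N -p2_nat natrX exprVn.
  - move=> a x; apply: le_trans (hV a k x) _; have := h2 k k2.
    by rewrite /r p2X mulNr.
  - move=> x; have -> : g k x - H x = - (jt (q0 + k) x - g k x) + (jt (q0 + k) x - H x) by ring.
    rewrite (le_trans (ler_normD _ _))// normrN [e]splitr; apply: lerD.
      have := hg k x; rewrite TPE => /le_trans; apply; apply: le_trans (h3 k k3).
      rewrite /par_sd /par_e exprMn p2X -[X in X <= _]mulrA -p2D ler_pM2l ?exprn_gt0//.
      apply: p2_le; rewrite mulNr -opprD lerN2; apply: ler_wpDl.
        by rewrite !mulr_ge0 ?sqr_ge0// ltW.
      by rewrite ler_pM2l ?mulr_gt0// ler_nat leq_addl.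
    apply: le_trans (jt_err _ _) _; apply: le_trans (h4 k k4).
    apply: ler_wpM2l; first exact: CJ_ge0.
    apply: p2_le; rewrite lerN2 ler_pM2l ?mulr_gt0// -natrX ler_nat.
    by apply: leq_trans (leq_sqr _); rewrite leq_addl.
have [Bv Bv0 bv] := TP_bnd_fam (fun a => td a v).
have [Bw Bw0 bw] : exists2 B, 0 <= B & forall a c, bnd B (td c (td a v)).
  have [B B0 hB] := TP_bnd_fam (fun ac : 'I_m * 'I_m => td ac.2 (td ac.1 v)).
  by exists B => // a c; exact: (hB (a, c)).
pose r2 := p2 (- (5 * (b - beta))).
have bb0 : 0 < b - beta by rewrite subr_gt0.
have r21 : r2 < 1 by apply: p2_lt1; rewrite mulr_gt0.
have r20 : 0 <= r2 by exact: p2_ge0.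
have betaI : 0 <= beta <= 1.
  by rewrite ltW//=; move: (b0) (b5) (betab) => *; lra.
pose C0 := 2 * Bv + m%:R * Bw; pose A2 := 128 * m%:R * M.
have C00 : 0 <= C0 by rewrite addr_ge0// mulr_ge0.
have A20 : 0 <= A2 by rewrite mulr_ge0 ?mulr_ge0// ltW.
have m1 : 1 <= m%:R :> R by rewrite ler1n.
have sumD (x y : E) (D : R) : (forall c, `|y 0 c - x 0 c| <= D) ->
    \sum_c `|y 0 c - x 0 c| <= m%:R * D.
  move=> h; apply: (@le_trans _ _ (\sum_(c < m) D)); first by apply: ler_sum => c _.
  by rewrite sumr_const card_ord mulr_natl.
have hold k a (x y : E) (D : R) : 0 < D -> (forall c, `|y 0 c - x 0 c| <= D) ->
    `|td a (u k) y - td a (u k) x| <= (C0 + A2 / (1 - r2)) * D `^ beta.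
  move=> D0 hxy; have Db : 0 <= D `^ beta by exact: powR_ge0.
  pose f k := td a (u k) y - td a (u k) x.
  have f0 : `|f 0%N| <= C0 * D `^ beta.
    apply: powR_interp => //; rewrite /f u0.
      rewrite (le_trans (ler_normB _ _))// /C0; have := bv a x; have := bv a y.
      by have := mulr_ge0 (le_trans ler01 m1) Bw0; lra.
    apply: le_trans (tp_lip (bw a) x y) _; apply: (@le_trans _ _ (Bw * (m%:R * D))).
      by apply: ler_wpM2l => //; exact: sumD.
    rewrite mulrCA mulrA; apply: ler_wpM2r; first exact: ltW.
    by rewrite /C0 lerDr mulr_ge0.
  have fk i : `|f i.+1 - f i| <= A2 * D `^ beta * r2 ^+ i.
    pose w := u i.+1 - u i; have fE : f i.+1 - f i = td a w y - td a w x.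
      by rewrite /w tdB !TPE /f; ring.
    rewrite fE; set q := (q0 + i).+1.
    have sd0 : 0 <= par_sd b M q by rewrite mulr_ge0 ?p2_ge0// ltW.
    have lam0 : 0 < (par_lam q)%:R * D by rewrite mulr_gt0// ltr0n par_lam_gt0.
    apply: (@le_trans _ _ (128 * m%:R * par_sd b M q * ((par_lam q)%:R * D) `^ beta)).
      apply: powR_interp => //.
      - by rewrite mulr_ge0// mulr_ge0.
      - rewrite (le_trans (ler_normB _ _))//; apply: le_trans (lerD (hd i a y) (hd i a x)) _.
        by rewrite -/q; move: m1 sd0; move: (m%:R : R) (par_sd b M q) => y1 y2 *; nra.
      - have hb c := hdd i c a; apply: le_trans (tp_lip hb x y) _; rewrite -/q.
        apply: (@le_trans _ _ (128 * par_sd b M q * (par_lam q)%:R * (m%:R * D))).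
          by apply: ler_wpM2l; [rewrite mulr_ge0// mulr_ge0 | exact: sumD].
        by rewrite le_eqVlt; apply/orP; left; apply/eqP; ring.
    rewrite powRM ?ler0n ?(ltW D0)// par_lamE /p2 -powRrM -/(p2 _) /par_sd /A2.
    rewrite (_ : _ * (_ * _) = 128 * m%:R * M * D `^ beta *
      p2 (- (5 * b * q%:R ^+ 2) + 5 * q%:R ^+ 2 * beta)); last by rewrite p2D; ring.
    apply: ler_wpM2l; first by rewrite mulr_ge0.
    rewrite /r2 p2X; apply: p2_le.
    have -> : - (5 * b * q%:R ^+ 2) + 5 * q%:R ^+ 2 * beta = - (5 * (b - beta)) * q%:R ^+ 2 by ring.
    by rewrite !mulNr lerN2 ler_pM2l ?mulr_gt0//; exact: sq.
  have := @geom_diff R f (A2 * D `^ beta) r2 (mulr_ge0 A20 Db) r20 r21 fk 0%N k.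
  rewrite add0n expr0 mulr1 => h.
  rewrite -[X in `|X|](subrK (f 0%N)) (le_trans (ler_normD _ _))// addrC mulrDl.
  by apply: lerD => //; apply: le_trans h _; rewrite mulrAC.
pose C := C0 + A2 / (1 - r2) + Bv + 32 * M / (1 - r).
have C1 : 0 <= A2 / (1 - r2) by rewrite divr_ge0// subr_ge0 ltW.
have C2 : 0 <= 32 * M / (1 - r) by rewrite divr_ge0 ?mulr_ge0 ?subr_ge0// ltW.
exists u, g, U, V, C; split => //.
- by move=> x; rewrite distrC -u0; have := hU 0%N x; rewrite expr0 mulr1.
- move=> a x y D D0 hxy; apply: (@le_trans _ _ ((C0 + A2 / (1 - r2)) * D `^ beta)); last first.
    by apply: ler_wpM2r; [exact: powR_ge0 | rewrite /C -[X in _ <= X]addrA; apply: ler_wpDr => //; exact: addr_ge0].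
  apply/ler_addgt0Pr => e e0; have [|k [_ hk _]] := hconv (e / 2); first by rewrite divr_gt0.
  have -> : V a y - V a x = (td a (u k) y - td a (u k) x) +
     ((td a (u k) x - V a x) - (td a (u k) y - V a y)) by ring.
  rewrite (le_trans (ler_normD _ _))//; apply: lerD; first exact: hold.
  by rewrite (le_trans (ler_normB _ _))// [e]splitr; apply: lerD.
- move=> a x; have := hV a 0%N x; rewrite expr0 mulr1 u0 distrC => h.
  rewrite -[V a x](subrK (td a v x)) (le_trans (ler_normD _ _))//.
  by apply: (le_trans (lerD h (bv a x))); rewrite /C; lra.
Qed.

End torus_solution.
(** * Integration over row vectors *)

Section measurability.
Variables (R : realType) (m : nat).
Local Notation E := 'rV[R]_m.

Definition box (L : R) : set E := [set x | forall a, `[- L, L]%classic (x 0 a)].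

Lemma measurable_box L : measurable (box L).
Proof.
rewrite (_ : box L = \bigcap_(a in [set: 'I_m]) [set x : E | `[- L, L]%classic (x 0 a)]).
  apply: fin_bigcap_measurable => // a _; rewrite -[X in measurable X]setTI.
  exact: (@measurable_coord _ (measurableTypeR R) 1 m 0 a measurableT _ (measurable_itv _)).
by apply/seteqP; split=> x h a; [move=> _|]; exact: h.
Qed.

(** The sigma-algebra is generated by coordinate cylinders; an open set is the countable union of
    the rational boxes that it contains. *)
Lemma open_measurable_rV (U : set E) : open U -> measurable U.
Proof.
move=> oU.
pose C (q : 'rV[rat]_m * nat) : set E :=
  [set x | forall a, `]ratr (q.1 0 a) - q.2.+1%:R^-1, ratr (q.1 0 a) + q.2.+1%:R^-1[%classic (x 0 a)].
have mC q : measurable (C q).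
  rewrite (_ : C q = \bigcap_(a in [set: 'I_m]) [set x : E |
     `]ratr (q.1 0 a) - q.2.+1%:R^-1, ratr (q.1 0 a) + q.2.+1%:R^-1[%classic (x 0 a)]).
    apply: fin_bigcap_measurable => // a _; rewrite -[X in measurable X]setTI.
    exact: (@measurable_coord _ (measurableTypeR R) 1 m 0 a measurableT _ (measurable_itv _)).
  by apply/seteqP; split=> x h a; [move=> _|]; exact: h.
rewrite (_ : U = \bigcup_(q in [set q | C q `<=` U]) C q).
  rewrite bigcup_mkcond; apply: countable_bigcupT_measurable => [|q]; first exact: countableP.
  by case: ifP => _; [exact: mC | exact: measurable0].
apply/seteqP; split=> [x Ux|x [q qU Cx]]; last exact: qU.
have /nbhs_ballP[e /= e0 eU] : nbhs x U by exact: open_nbhs_nbhs.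
have [k [d [dE d0 de]]] : exists (k : nat) (d : R), [/\ k.+1%:R^-1 = d, 0 < d & 2 * d < e].
  exists (Num.truncn (2 / e)), (Num.truncn (2 / e)).+1%:R^-1; split => //.
  rewrite ltr_pdivrMr ?ltr0n// mulrC -ltr_pdivrMr//; exact: truncnS_gt.
have /choice[q hq] a : exists q : rat, x 0 a - d < ratr q < x 0 a + d.
  have xd : x 0 a - d < x 0 a + d by lra.
  by have [q] := rat_in_itvoo xd; rewrite in_itv /=; exists q.
exists (\row_a q a, k); last first.
  by move=> a; have := hq a; rewrite /= in_itv /= mxE dE => /andP[h1 h2]; apply/andP; split; lra.
move=> y hy; apply: eU; split => // i j; rewrite ord1 /ball /=.
have := hq j; have := hy j; rewrite /= in_itv /= mxE dE => /andP[h1 h2] /andP[h3 h4].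
by rewrite ltr_norml; apply/andP; split; lra.
Qed.

Lemma continuous_measurable_rV (f : E -> R) : continuous f -> measurable_fun setT f.
Proof.
move=> /continuousP cf; apply: (measurability _ (RGenOpens.measurableE R)).
move=> _ [_ [a [b ->] <-]]; rewrite setTI; apply: open_measurable_rV.
exact/cf/interval_open.
Qed.

Lemma compact_box L : compact (box L).
Proof.
rewrite (_ : box L = [set v : E | forall i, `[- L, L]%classic (v ord0 i)]); last first.
  by apply/seteqP; split.
by apply: (@rV_compact _ _ (fun=> `[- L, L]%classic)) => _; exact: segment_compact.
Qed.

Lemma le_coord_norm (x : E) a : `|x 0 a| <= `|x|.
Proof.
rewrite [X in _ <= X]mx_normrE (bigD1 (0, a))//= le_max lexx //.
Qed.

Lemma box_bounded (A : set E) : bounded_set A -> exists2 L, 0 < L & A `<=` box L.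
Proof.
move=> [M [_ hM]]; exists (`|M| + 1); first by rewrite ltr_wpDl.
move=> x Ax a; have := hM (`|M| + 1) _ x Ax; rewrite (le_lt_trans (ler_norm M)) ?ltrDl// => /(_ isT).
by rewrite /= in_itv /= => h; rewrite -ler_norml; apply: le_trans h; exact: le_coord_norm.
Qed.

End measurability.
Arguments box {R} m L.

Section box_functions.
Variables (R : realType) (m : nat).
Local Notation E := 'rV[R]_m.
Local Notation lam := (lebesgue_rV R m).

Lemma lebesgue_box (L : R) : 0 <= L -> lam (box m L) = ((2 * L) ^+ m)%:E.
Proof.
move=> L0; rewrite (lebesgue_rV_box (A := fun=> `[- L, L]%classic)) => [|_]; last exact: measurable_itv.
rewrite (eq_bigr (fun=> (2 * L)%:E)) => [|i _]; last first.
  rewrite lebesgue_measure_itv /= lte_fin; case: ltP => [_|LL].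
    by rewrite -EFinD opprK; congr _%:E; ring.
  by congr _%:E; lra.
by rewrite prodEFin prodr_const card_ord.
Qed.

Lemma lebesgue_box_lty (L : R) : (lam (box m L) < +oo)%E.
Proof.
have [L0|L0] := leP 0 L; first by rewrite lebesgue_box// ltry.
apply: (@le_lt_trans _ _ (lam (box m 0))); last by rewrite lebesgue_box// ltry.
apply: le_measure; rewrite ?inE; [exact: measurable_box | exact: measurable_box |].
by move=> x h a; have := h a; rewrite /= !in_itv /= => /andP[h1 h2]; apply/andP; split; lra.
Qed.

(** Bounded, measurable, supported in a box: a class in which integrability is automatic, stable
    under multiplication by continuous functions, and containing the test functions. *)
Definition bsf (f : E -> R) := measurable_fun setT f /\
  exists B L : R, [/\ 0 <= B, forall x, `|f x| <= B & forall x, ~ box m L x -> f x = 0].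

Lemma bsf_integrable f : bsf f -> lam.-integrable setT (EFin \o f).
Proof.
move=> [mf [B [L [B0 fB fL]]]].
have -> : EFin \o f = (EFin \o f) \_ (box m L).
  apply/funext => x; rewrite patchE; case: ifPn => // /negP; rewrite inE => /fL /= ->.
  by [].
apply/integrable_restrict => //; first exact: measurable_box.
rewrite setTI; apply: measurable_bounded_integrable.
- exact: measurable_box.
- exact: lebesgue_box_lty.
- exact: measurable_funTS.
- by exists B; split; [exact: num_real | move=> M BM x _ /=; apply: le_trans (fB x) (ltW BM)].
Qed.

Lemma bsfD f g : bsf f -> bsf g -> bsf (fun x => f x + g x).
Proof.
move=> [mf [B [L [B0 fB fL]]]] [mg [B' [L' [B0' gB gL]]]].
split; first exact: measurable_funD.
exists (B + B'), (Num.max L L'); split; first exact: addr_ge0.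
  by move=> x; rewrite (le_trans (ler_normD _ _))// lerD.
move=> x h; rewrite fL ?gL ?addr0// => hx; apply: h => a; have := hx a;
  rewrite /= !in_itv /= -!ler_norml le_max => ->; rewrite ?orbT//.
Qed.

Lemma bsfZ (c : R) f : bsf f -> bsf (fun x => c * f x).
Proof.
move=> [mf [B [L [B0 fB fL]]]]; split; first exact: measurable_funM.
exists (`|c| * B), L; split; first by rewrite mulr_ge0.
  by move=> x; rewrite normrM ler_wpM2l.
by move=> x /fL ->; rewrite mulr0.
Qed.

Lemma bsfN f : bsf f -> bsf (fun x => - f x).
Proof.
move=> /(bsfZ (-1)) h; rewrite (_ : (fun x => - f x) = (fun x => -1 * f x))//.
by apply/funext => x; rewrite mulN1r.
Qed.

Lemma bsfB f g : bsf f -> bsf g -> bsf (fun x => f x - g x).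
Proof. by move=> hf hg; apply: bsfD => //; exact: bsfN. Qed.

Lemma bsf_norm f : bsf f -> bsf (fun x => `|f x|).
Proof.
move=> [mf [B [L [B0 fB fL]]]]; split; first exact: measurableT_comp.
exists B, L; split => // x; first by rewrite normr_id.
by move=> /fL ->; rewrite normr0.
Qed.

Lemma bsfM (c f : E -> R) : measurable_fun setT c -> (exists B, forall x, `|c x| <= B) -> bsf f ->
  bsf (fun x => c x * f x).
Proof.
move=> mc [B' cB] [mf [B [L [B0 fB fL]]]]; split; first exact: measurable_funM.
exists (B' * B), L; split; first by rewrite mulr_ge0// (le_trans _ (cB 0)).
  by move=> x; rewrite normrM ler_pM.
by move=> x /fL ->; rewrite mulr0.
Qed.

Lemma bsf_box L : bsf (\1_(box m L)).
Proof.
split; first by apply: measurable_indic; exact: measurable_box.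
exists 1, L; split => // x; first by rewrite indicE; case: (_ \in _); rewrite ?normr1 ?normr0.
by move=> h; rewrite indicE memNset.
Qed.

Lemma bsf_cont (c f : E -> R) : continuous c -> bsf f -> bsf (fun x => c x * f x).
Proof.
move=> cc hf; have [mf [B [L [B0 fB fL]]]] := hf.
have mc := continuous_measurable_rV cc; split; first exact: measurable_funM.
have [M [_ hM]] : bounded_set (c @` box m L).
  apply: compact_bounded; apply: continuous_compact; last exact: compact_box.
  by apply: continuous_subspaceT.
exists ((`|M| + 1) * B), L; split; first by rewrite mulr_ge0// addr_ge0.
  move=> x; have [hx|/fL ->] := pselect (box m L x); last by rewrite mulr0 normr0 mulr_ge0// addr_ge0.
  rewrite normrM ler_pM//; apply: (hM (`|M| + 1)); last by exists x.
  by rewrite (le_lt_trans (ler_norm M))// ltrDl.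
by move=> x /fL ->; rewrite mulr0.
Qed.

Lemma cont_bsf (f : E -> R) L : continuous f -> (forall x, ~ box m L x -> f x = 0) -> bsf f.
Proof.
move=> cf fL; have -> : f = (fun x => f x * \1_(box m L) x).
  apply/funext => x; rewrite indicE; have [hx|hx] := pselect (box m L x).
    by rewrite mem_set// mulr1.
  by rewrite memNset// mulr0 fL.
by apply: bsf_cont => //; exact: bsf_box.
Qed.

Definition Int (f : E -> R) : R := \int[lam]_x f x.

Lemma IntD f g : bsf f -> bsf g -> Int (fun x => f x + g x) = Int f + Int g.
Proof. by move=> hf hg; rewrite /Int RintegralD//; exact: bsf_integrable. Qed.

Lemma IntB f g : bsf f -> bsf g -> Int (fun x => f x - g x) = Int f - Int g.
Proof. by move=> hf hg; rewrite /Int RintegralB//; exact: bsf_integrable. Qed.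

Lemma IntZ c f : bsf f -> Int (fun x => c * f x) = c * Int f.
Proof. by move=> hf; rewrite /Int RintegralZl//; exact: bsf_integrable. Qed.

Lemma IntN f : bsf f -> Int (fun x => - f x) = - Int f.
Proof.
move=> hf; rewrite -mulN1r -IntZ//; congr Int.
by apply/funext => x; rewrite mulN1r.
Qed.

Lemma Int0 : Int (fun=> 0) = 0.
Proof. by rewrite /Int /Rintegral integral0. Qed.

Lemma bsf0 : bsf (fun=> 0).
Proof. by split; [exact: measurable_cst | exists 0, 0; split => // x; rewrite normr0]. Qed.

Lemma bsf_sum (I : Type) (r : seq I) (P : pred I) (f : I -> E -> R) : (forall i, bsf (f i)) ->
  bsf (fun x => \sum_(i <- r | P i) f i x).
Proof.
move=> h; elim: r => [|i r IH].
  rewrite (_ : (fun x => _) = fun=> 0); first exact: bsf0.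
  by apply/funext => x; rewrite big_nil.
rewrite (_ : (fun x => _) = fun x => (if P i then f i x else 0) + \sum_(i <- r | P i) f i x).
  by apply: bsfD => //; case: (P i) => //; exact: bsf0.
by apply/funext => x; rewrite big_cons; case: ifP => // _; rewrite add0r.
Qed.

Lemma Int_sum (I : Type) (r : seq I) (P : pred I) (f : I -> E -> R) : (forall i, bsf (f i)) ->
  Int (fun x => \sum_(i <- r | P i) f i x) = \sum_(i <- r | P i) Int (f i).
Proof.
move=> h; elim: r => [|i r IH].
  by rewrite [RHS]big_nil -[RHS]Int0; congr Int; apply/funext => x; rewrite big_nil.
rewrite big_cons; case: ifP => Pi.
  rewrite -IH -IntD//; last exact: bsf_sum.
  by congr Int; apply/funext => x; rewrite big_cons Pi.
by rewrite -IH; congr Int; apply/funext => x; rewrite big_cons Pi.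
Qed.

Lemma Int_le f g : bsf f -> bsf g -> (forall x, f x <= g x) -> Int f <= Int g.
Proof. by move=> hf hg fg; apply: le_Rintegral => //; exact: bsf_integrable. Qed.

Lemma Int_norm f : bsf f -> `|Int f| <= Int (fun x => `|f x|).
Proof. by move=> hf; apply: le_normr_Rintegral => //; exact: bsf_integrable. Qed.

Lemma Int_ge0 f : (forall x, 0 <= f x) -> 0 <= Int f.
Proof. by move=> f0; apply: Rintegral_ge0 => x _. Qed.

Lemma Int_approx (f g w : E -> R) e : bsf w -> bsf (fun x => f x * w x) -> bsf (fun x => g x * w x) ->
  (forall x, `|f x - g x| <= e) ->
  `|Int (fun x => f x * w x) - Int (fun x => g x * w x)| <= e * Int (fun x => `|w x|).
Proof.
move=> hw hf hg h; rewrite -IntB// (le_trans (Int_norm _))//; first exact: bsfB.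
rewrite -IntZ; last exact: bsf_norm.
apply: Int_le; [exact/bsf_norm/bsfB | exact/bsfZ/bsf_norm | move=> x].
by rewrite -mulrBl normrM ler_wpM2r.
Qed.

End box_functions.

(** * Fubini's theorem for the first coordinate *)

Section fubini_cons.
Variables (R : realType).
Local Notation leb := (@lebesgue_measure R).

Lemma cons_rV0 m (w : measurableTypeR R * 'rV[R]_m) : cons_rV w 0 ord0 = w.1.
Proof.
rewrite (_ : ord0 = lshift m ord0 :> 'I_(1 + m)); last exact/val_inj.
by apply: etrans (row_mxEl _ _ _ _) _; rewrite mxE.
Qed.

Lemma cons_rVS m (w : measurableTypeR R * 'rV[R]_m) i : cons_rV w 0 (lift ord0 i) = w.2 0 i.
Proof.
rewrite (_ : lift ord0 i = rshift 1 i :> 'I_(1 + m)); last exact/val_inj.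
exact: row_mxEr.
Qed.

Lemma leb_itv_lty (a b : R) : (leb `[a, b]%classic < +oo)%E.
Proof. by rewrite lebesgue_measure_itv /=; case: ifP => // _; rewrite -EFinD ltry. Qed.

Definition bs1 (f : R -> R) := measurable_fun setT f /\
  exists B L : R, [/\ 0 <= B, forall x, `|f x| <= B & forall x, x \notin `[- L, L] -> f x = 0].

Lemma bs1_integrable f : bs1 f -> leb.-integrable setT (EFin \o f).
Proof.
move=> [mf [B [L [B0 fB fL]]]].
have -> : EFin \o f = (EFin \o f) \_ `[- L, L].
  apply/funext => x; rewrite patchE; case: ifPn => //; rewrite notin_setE /= => h.
  by rewrite fL//; apply/negP.
apply/integrable_restrict => //.
rewrite setTI; apply: measurable_bounded_integrable => //.
- exact: leb_itv_lty.
- exact: measurable_funTS.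
- by exists B; split; [exact: num_real | move=> M BM x _ /=; apply: le_trans (fB x) (ltW BM)].
Qed.

Variable m : nat.
Local Notation lam := (lebesgue_rV R m).

Lemma box_cons L x (v : 'rV[R]_m) :
  box m.+1 L (cons_rV (x, v)) <-> x \in `[- L, L] /\ box m L v.
Proof.
split=> [h|[h1 h2] a]; last first.
  by case: (unliftP ord0 a) => [j ->|->]; rewrite ?cons_rVS ?cons_rV0 /=; [exact: h2 | exact: h1].
split; first by have := h ord0; rewrite cons_rV0.
by move=> a; have := h (lift ord0 a); rewrite cons_rVS.
Qed.

Lemma bsf_cons1 (f : 'rV[R]_m.+1 -> R) x : bsf f -> bsf (fun v => f (cons_rV (x, v))).
Proof.
move=> [mf [B [L [B0 fB fL]]]]; split.
  apply: (measurableT_comp mf); apply: (measurableT_comp (measurable_cons_rV (m := m))).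
  exact: measurable_pair1.
by exists B, L; split => // v h; apply: fL => /box_cons[].
Qed.

Lemma bsf_cons2 (f : 'rV[R]_m.+1 -> R) v : bsf f -> bs1 (fun x => f (cons_rV (x, v))).
Proof.
move=> [mf [B [L [B0 fB fL]]]]; split.
  apply: (measurableT_comp mf); apply: (measurableT_comp (measurable_cons_rV (m := m))).
  exact: measurable_pair2.
by exists B, L; split => // x h; apply: fL => /box_cons[]; rewrite (negbTE h).
Qed.

Lemma integrable_cons (f : 'rV[R]_m.+1 -> R) : bsf f ->
  (leb \x lam)%E.-integrable setT (fun w => (f (cons_rV w))%:E).
Proof.
move=> hf; have [mf [B [L [B0 fB fL]]]] := hf.
have mc : measurable_fun setT (fun w => f (@cons_rV R m w)).
  by apply: measurableT_comp mf _; exact: measurable_cons_rV.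
have mS : measurable (`[- L, L]%classic `*` box m L).
  by apply: measurableX; [exact: measurable_itv | exact: measurable_box].
have -> : (fun w => (f (cons_rV w))%:E) = (EFin \o (fun w => f (@cons_rV R m w))) \_ (`[- L, L]%classic `*` box m L).
  apply/funext => -[x v]; rewrite patchE; case: ifPn => //; rewrite notin_setE /= => h.
  by rewrite fL// => /box_cons; exact: h.
apply/integrable_restrict => //.
rewrite setTI; apply: measurable_bounded_integrable => //.
- have h := product_measure1E leb lam (measurable_itv `[- L, L]) (@measurable_box R m L).
  have hlt : (leb `[(- L)%R, L]%classic * lam (box m L) < +oo)%E.
    apply: lte_mul_pinfty; [exact: measure_ge0 | | exact: lebesgue_box_lty].
    by rewrite ge0_fin_numE; [exact: leb_itv_lty | exact: measure_ge0].
  by rewrite -h in hlt; exact: hlt.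
- exact: measurable_funTS.
- by exists B; split; [exact: num_real | move=> M BM w _ /=; apply: le_trans (fB _) (ltW BM)].
Qed.

Lemma integral_cons (f : 'rV[R]_m.+1 -> R) : bsf f ->
  (\int[lebesgue_rV R m.+1]_x (f x)%:E = \int[leb \x lam]_w (f (cons_rV w))%:E)%E.
Proof.
move=> hf; have [mf _] := hf.
have h := @integral_pushforward _ _ _ _ R _ (@measurable_cons_rV R m) (leb \x lam)%E setT
  (EFin \o f) _ _ measurableT.
rewrite preimage_setT in h; apply: h; first exact/measurable_EFinP.
exact: integrable_cons.
Qed.

Lemma Int_cons1 (f : 'rV[R]_m.+1 -> R) : bsf f ->
  Int f = \int[leb]_x Int (fun v => f (cons_rV (x, v))).
Proof.
move=> hf; rewrite /Int /Rintegral integral_cons//.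
rewrite -(integral12_prod_meas1 (integrable_cons hf)); congr fine.
apply: eq_integral => x _; rewrite fineK//.
by apply: integrable_fin_num => //; exact: bsf_integrable (bsf_cons1 x hf).
Qed.

Lemma Int_cons2 (f : 'rV[R]_m.+1 -> R) : bsf f ->
  Int f = Int (fun v => \int[leb]_x f (cons_rV (x, v))).
Proof.
move=> hf; rewrite /Int /Rintegral integral_cons//.
rewrite -(integral21_prod_meas1 (integrable_cons hf)); congr fine.
apply: eq_integral => v _; rewrite fineK//.
by apply: integrable_fin_num => //; exact: bs1_integrable (bsf_cons2 v hf).
Qed.

End fubini_cons.

Section product_integral.
Variables (R : realType).
Local Notation leb := (@lebesgue_measure R).

Lemma bsf_prod m (u : 'I_m -> R -> R) : (forall a, bs1 (u a)) ->
  bsf (fun x : 'rV[R]_m => \prod_a u a (x 0 a)).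
Proof.
move=> hu; have mu a : measurable_fun setT (fun x : 'rV[R]_m => u a (x 0 a)).
  by apply: (measurableT_comp (proj1 (hu a))); exact: measurable_coord.
have /choice[B hB] a : exists B, 0 <= B /\ forall x, `|u a x| <= B.
  by have [_ [B [L [B0 h _]]]] := hu a; exists B.
have /choice[L hL] a : exists L, forall x, x \notin `[- L, L] -> u a x = 0.
  by have [_ [B' [L' [B0 _ h]]]] := hu a; exists L'.
split.
  have : forall r : seq 'I_m, measurable_fun setT (fun x : 'rV[R]_m => \prod_(a <- r) u a (x 0 a)).
    elim=> [|a r IH].
      by under eq_fun do rewrite big_nil; exact: measurable_cst.
    by under eq_fun do rewrite big_cons; exact: measurable_funM.
  exact.
exists (\prod_a B a), (\sum_a `|L a|); split.
- by apply: prodr_ge0 => a _; have [] := hB a.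
- by move=> x; rewrite normr_prod; apply: ler_prod => a _; rewrite normr_ge0; have [_ ->] := hB a.
- move=> x h; have [a ha] : exists a, x 0 a \notin `[- L a, L a].
    apply/not_existsP => h'; apply: h => a.
    have La : L a <= \sum_a `|L a|.
      by rewrite (bigD1 a)//= (le_trans (ler_norm _))// lerDl sumr_ge0.
    have := h' a; rewrite /= !in_itv /= => /negP; rewrite negbK => /andP[h1 h2].
    by apply/andP; split; [apply: le_trans h1; rewrite lerN2 | exact: le_trans h2 La].
  by rewrite (bigD1 a)//= hL// mul0r.
Qed.

Lemma Int_prod m (u : 'I_m -> R -> R) : (forall a, bs1 (u a)) ->
  Int (fun x : 'rV[R]_m => \prod_a u a (x 0 a)) = \prod_a (\int[leb]_t u a t).
Proof.
elim: m u => [|m IH] u hu.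
  (* In dimension 0 the measure is a unit point mass, in agreement with the empty product. *)
  rewrite big_ord0 (_ : (fun x : 'rV[R]_0 => \prod_(a < 0) u a (x 0 a)) = cst 1); last by apply/funext => x; rewrite big_ord0.
  rewrite /Int Rintegral_cst// mul1r.
  have h : lebesgue_rV R 0 [set: 'rV[R]_0] = 1%E by rewrite /= diracE mem_set.
  by apply: etrans (congr1 fine h) _.
have hu' : forall a : 'I_m, bs1 (u (lift ord0 a)) by [].
rewrite Int_cons1; last exact: bsf_prod.
rewrite big_ord_recl -IH// -RintegralZr//; last exact: bs1_integrable.
apply: eq_Rintegral => x _.
rewrite -(IntZ (u ord0 x) (@bsf_prod m (fun a => u (lift ord0 a)) hu')).
congr Int; apply/funext => v; rewrite big_ord_recl cons_rV0; congr (_ * _).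
by apply: eq_bigr => a _; rewrite cons_rVS.
Qed.

End product_integral.

(** * Integration by parts *)

Section integration_by_parts.
Variables (R : realType).
Local Notation leb := (@lebesgue_measure R).

Lemma cont_rV (T : topologicalType) m (g : T -> 'rV[R]_m) :
  (forall a, continuous (fun x => g x 0 a)) -> continuous g.
Proof.
move=> h x; apply/cvg_ballP => e e0.
have : \forall y \near x, forall a, ball (g x 0 a) e (g y 0 a).
  apply: filter_forall => a; have := h a x.
  by move/cvg_ballP; apply.
apply: filterS => y hy; split => // i j; rewrite (ord1 i); exact: hy.
Qed.

Lemma cont_coord m (a : 'I_m) : continuous (fun x : 'rV[R]_m => x 0 a).
Proof. exact: coord_continuous. Qed.

Lemma cont_cons1 m (x : R) : continuous (fun v : 'rV[R]_m => cons_rV (x, v)).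
Proof.
apply: cont_rV => a; case: (unliftP ord0 a) => [j ->|->].
  by under eq_fun do rewrite cons_rVS; exact: cont_coord.
by under eq_fun do rewrite cons_rV0; exact: cst_continuous.
Qed.

Lemma cont_cons2 m (v : 'rV[R]_m) : continuous (fun x : R => cons_rV (x, v)).
Proof.
apply: cont_rV => a; case: (unliftP ord0 a) => [j ->|->].
  by under eq_fun do rewrite cons_rVS; exact: cst_continuous.
by under eq_fun do rewrite cons_rV0; move=> y; exact: cvg_id.
Qed.

Lemma cons_line0 m (t : R) (v : 'rV[R]_m) :
  cons_rV (t, v) = t *: delta_mx 0 ord0 + cons_rV (0, v).
Proof.
apply/rowP => a; rewrite [RHS]mxE [X in _ = X + _]mxE [X in _ * X]mxE.
case: (unliftP ord0 a) => [j ->|->].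
  by rewrite !cons_rVS /= mulr0 add0r.
by rewrite !cons_rV0 /= addr0 mulr1.
Qed.

Lemma cons_lineS m j (t x : R) (v : 'rV[R]_m) :
  cons_rV (x, t *: delta_mx 0 j + v) = t *: delta_mx 0 (lift ord0 j) + cons_rV (x, v).
Proof.
apply/rowP => a; rewrite [RHS]mxE [X in _ = X + _]mxE [X in _ = _ * X + _]mxE.
case: (unliftP ord0 a) => [i ->|->]; last by rewrite !cons_rV0 /= mulr0 add0r.
by rewrite !cons_rVS /= !mxE (inj_eq lift_inj).
Qed.

Lemma Rint_derive0 (f df : R -> R) L : continuous df -> (forall t, is_derive t (1 : R) f (df t)) ->
  (forall t, t \notin `[- L, L] -> f t = 0 /\ df t = 0) -> \int[leb]_t df t = 0.
Proof.
(* Strictly beyond the support, so that f vanishes at both ends; the absolute value allows for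
   negative L. *)
move=> cdf hd h0; pose M : R := `|L| + 1.
have LM : L < M by rewrite /M (le_lt_trans (ler_norm L))// ltrDl.
have M0 : 0 < M by rewrite ltr_wpDl.
have fM : f M = 0 /\ f (- M) = 0.
  by split; apply: (proj1 (h0 _ _)); rewrite in_itv /= negb_and -!ltNge; apply/orP;
    [right | left; lra].
have cf : continuous f.
  by move=> s; apply: differentiable_continuous; apply/derivable1_diffP; case: (hd s).
rewrite /Rintegral (_ : (\int[leb]_t (df t)%:E = \int[leb]_(t in `[(- M)%R, M]) (df t)%:E)%E).
  rewrite (@continuous_FTC2 R df f (- M) M).
  - by case: fM => -> ->; rewrite subee.
  - by lra.
  - exact: continuous_subspaceT.
  - split=> [x _||]; first by case: (hd x).
      by apply: cvg_at_right_filter; exact: cf.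
    by apply: cvg_at_left_filter; exact: cf.
  - by move=> x _; rewrite derive1E; case: (hd x) => _ ->.
rewrite [RHS]integral_mkcond; apply: eq_integral => t _; rewrite patchE; case: ifPn => //.
rewrite notin_setE /= => tM; rewrite (proj2 (h0 t _))//; apply/negP => h; apply: tM.
by move: h; rewrite !in_itv /= => /andP[h1 h2]; apply/andP; split; lra.
Qed.

(** A derivative in the first coordinate is integrated in that coordinate first, by the fundamental
    theorem of calculus; for any other, the first coordinate is integrated last and the induction
    hypothesis applies to the slices. *)
Lemma Int_partial0 m (k : 'I_m) (f df : 'rV[R]_m -> R) L : continuous df ->
  (forall x, is_derive x (delta_mx 0 k) f (df x)) ->
  (forall x, ~ box m L x -> f x = 0 /\ df x = 0) -> Int df = 0.
Proof.
elim: m k f df => [[]//|m IH] k f df cdf hd h0.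
have bdf : bsf df by apply: (cont_bsf cdf) => x /h0[].
case: (unliftP ord0 k) hd => [j ->|->] hd.
  rewrite Int_cons1// (_ : (fun x => _) = cst 0); first by rewrite Rintegral_cst ?mul0r.
  apply/funext => x; apply: (IH j (fun v => f (cons_rV (x, v)))).
  - by move=> v; apply: continuous_comp; [exact: cont_cons1 | exact: cdf].
  - move=> v; apply: is_derive_line.
    rewrite (_ : (fun t => _) = (fun t : R => f (t *: delta_mx 0 (lift ord0 j) + cons_rV (x, v)))).
      by apply: is_derive_along; rewrite scale0r add0r.
    by apply/funext => t; rewrite cons_lineS.
  - by move=> v hv; apply: h0 => /box_cons[].
rewrite Int_cons2// (_ : (fun v => _) = fun=> 0); first exact: Int0.
apply/funext => v; apply: (@Rint_derive0 (fun t => f (cons_rV (t, v))) _ L).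
- by move=> t; apply: continuous_comp; [exact: cont_cons2 | exact: cdf].
- move=> t; rewrite (_ : (fun t => _) = (fun t : R => f (t *: delta_mx 0 ord0 + cons_rV (0, v)))).
    by apply: is_derive_along; rewrite -cons_line0.
  by apply/funext => s; rewrite cons_line0.
- by move=> t /negP ht; apply: h0 => /box_cons[].
Qed.

End integration_by_parts.
Section integrable_functions.
Variables (R : realType) (m : nat).
Local Notation E := 'rV[R]_m.
Local Notation lam := (lebesgue_rV R m).

(** Serves for the datum f, which may be unbounded. *)
Definition ing (f : E -> R) := lam.-integrable setT (EFin \o f).

Lemma bsf_ing f : bsf f -> ing f. Proof. exact: bsf_integrable. Qed.

Lemma ingD f g : ing f -> ing g -> ing (fun x => f x + g x).
Proof. by move=> hf hg; have := integrableD measurableT hf hg. Qed.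

Lemma ingZ c f : ing f -> ing (fun x => c * f x).
Proof. by move=> hf; have := integrableZl measurableT c hf. Qed.

Lemma ing_measurable f : ing f -> measurable_fun setT f.
Proof. by move=> /measurable_int /measurable_EFinP. Qed.

Lemma ingM f (c : E -> R) : ing f -> measurable_fun setT c -> (exists B, forall x, `|c x| <= B) ->
  ing (fun x => f x * c x).
Proof.
move=> hf mc [B hB]; have := integrableMl measurableT hf mc; apply.
by exists B; split; [exact: num_real | move=> M BM x _ /=; apply: le_trans (hB x) (ltW BM)].
Qed.

Lemma ing_norm f : ing f -> ing (fun x => `|f x|).
Proof. by move=> hf; have := integrable_norm hf. Qed.

Lemma iIntD f g : ing f -> ing g -> Int (fun x => f x + g x) = Int f + Int g.
Proof. by move=> hf hg; rewrite /Int RintegralD. Qed.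

Lemma iIntB f g : ing f -> ing g -> Int (fun x => f x - g x) = Int f - Int g.
Proof. by move=> hf hg; rewrite /Int RintegralB. Qed.

Lemma iIntZ c f : ing f -> Int (fun x => c * f x) = c * Int f.
Proof. by move=> hf; rewrite /Int RintegralZl. Qed.

Lemma iIntZr c f : ing f -> Int (fun x => f x * c) = Int f * c.
Proof. by move=> hf; rewrite /Int RintegralZr. Qed.

Lemma iInt_le f g : ing f -> ing g -> (forall x, f x <= g x) -> Int f <= Int g.
Proof. by move=> hf hg fg; apply: le_Rintegral. Qed.

Lemma iInt_norm f : ing f -> `|Int f| <= Int (fun x => `|f x|).
Proof. by move=> hf; apply: le_normr_Rintegral. Qed.

Lemma contD (f g : E -> R) : continuous f -> continuous g -> continuous (fun x => f x + g x).
Proof. by move=> hf hg x; exact: (continuousD (hf x) (hg x)). Qed.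

Lemma contN (f : E -> R) : continuous f -> continuous (fun x => - f x).
Proof. by move=> hf x; exact: (continuousN (hf x)). Qed.

Lemma contM (f g : E -> R) : continuous f -> continuous g -> continuous (fun x => f x * g x).
Proof. by move=> hf hg x; exact: (continuousM (hf x) (hg x)). Qed.

Lemma contC (c : R) : continuous (fun _ : E => c).
Proof. by move=> x; exact: cst_continuous. Qed.

Lemma cont_comp (h : R -> R) (f : E -> R) : continuous h -> continuous f -> continuous (fun x => h (f x)).
Proof. by move=> hh hf x; apply: continuous_comp; [exact: hf | exact: hh]. Qed.

Lemma continuous_dot (k : 'rV[int]_m) (s : R) : continuous (fun x : E => dot k (s *: x)).
Proof.
rewrite /dot; elim: (index_enum 'I_m) => [|a r IH].
  by under eq_fun do rewrite big_nil; exact: contC.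
under eq_fun do rewrite big_cons mxE.
apply: contD IH; apply: contM; first exact: contC.
by apply: contM; [exact: contC | exact: cont_coord].
Qed.

Lemma continuous_evZ (t : tpoly R m) (s : R) : continuous (fun x : E => ev t (s *: x)).
Proof.
rewrite /ev; elim: t => [|[[c1 c2] k] t IH].
  by under eq_fun do rewrite big_nil; exact: contC.
under eq_fun do rewrite big_cons /=.
apply: contD IH; apply: contD; last apply: contN; apply: contM; try exact: contC.
  exact: (cont_comp (@continuous_cos R) (@continuous_dot k s)).
exact: (cont_comp (@continuous_sin R) (@continuous_dot k s)).
Qed.

Lemma ev_bounded (t : tpoly R m) : exists2 B, 0 <= B & forall x, `|ev t x| <= B.
Proof.
exists (\sum_(ck <- t) (`|complex.Re ck.1| + `|complex.Im ck.1|)).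
  by apply: sumr_ge0 => ck _; rewrite addr_ge0.
move=> x; rewrite /ev (le_trans (ler_norm_sum _ _ _))//; apply: ler_sum => -[[c1 c2] k] _ /=.
rewrite (le_trans (ler_normB _ _))//; apply: lerD.
  by rewrite normrM ler_piMr// cos_max.
by rewrite normrM ler_piMr// sin_max.
Qed.

End integrable_functions.

(** * Convolution as a multiplier *)

Section convolution.
Variables (R : realType) (m : nat) (s : R).
Local Notation E := 'rV[R]_m.
Local Notation freq := 'rV[int]_m.

Definition cosint (f : E -> R) (k : freq) := Int (fun y => f y * cos (dot k (s *: y))).
Definition sinint (f : E -> R) (k : freq) := Int (fun y => f y * sin (dot k (s *: y))).
(** Fourier coefficients on the torus of side 2 pi / s, without normalisation; the volume of the
    torus is accounted for by one constant at the end. *)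
Definition fhat (f : E -> R) (k : freq) : R[i] := (cosint f k +i* - sinint f k)%C.

Lemma ing_cos (f : E -> R) (k : freq) : ing f -> ing (fun y => f y * cos (dot k (s *: y))).
Proof.
move=> hf; apply: ingM => //; last by exists 1 => x; exact: cos_max.
apply: continuous_measurable_rV.
exact: (cont_comp (@continuous_cos R) (@continuous_dot R m k s)).
Qed.

Lemma ing_sin (f : E -> R) (k : freq) : ing f -> ing (fun y => f y * sin (dot k (s *: y))).
Proof.
move=> hf; apply: ingM => //; last by exists 1 => x; exact: sin_max.
apply: continuous_measurable_rV.
exact: (cont_comp (@continuous_sin R) (@continuous_dot R m k s)).
Qed.

Lemma ing_ev (f : E -> R) t x : ing f -> ing (fun y => f y * ev t (x - s *: y)).
Proof.
move=> hf; apply: ingM => //; last by have [B _ h] := ev_bounded t; exists B.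
apply: continuous_measurable_rV; under eq_fun do rewrite addrC -scaleNr ev_shift.
exact: continuous_evZ.
Qed.

Lemma conv_term (c : R[i]) (k : freq) (x y : E) :
  complex.Re (c * cis (dot k (x - s *: y))) =
  complex.Re (c * cis (dot k x)) * cos (dot k (s *: y)) +
  complex.Im (c * cis (dot k x)) * sin (dot k (s *: y)).
Proof.
have -> : dot k (x - s *: y) = dot k x - dot k (s *: y) by rewrite dotDr -scaleNr !dotZr mulNr.
rewrite cisD mulrA.
by case: (c * cis _) => a b; rewrite cisN /=; ring.
Qed.

Lemma ev_fhat (f : E -> R) t x : ing f -> ev (symb (fhat f) t) x = Int (fun y => f y * ev t (x - s *: y)).
Proof.
move=> hf; elim: t => [|[c k] t IH].
  rewrite /ev big_nil -[LHS](@Int0 R m); congr Int; apply/funext => y.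
  by rewrite big_nil mulr0.
have -> : (fun y => f y * ev ((c, k) :: t) (x - s *: y)) = (fun y =>
    (complex.Re (c * cis (dot k x)) * (f y * cos (dot k (s *: y))) +
    complex.Im (c * cis (dot k x)) * (f y * sin (dot k (s *: y)))) +
    f y * ev t (x - s *: y)).
  by apply/funext => y; rewrite {1}/ev big_cons -/(ev t _) conv_term; ring.
have h1 := ing_cos k hf; have h2 := ing_sin k hf.
rewrite iIntD; [|by apply: ingD; apply: ingZ|exact: ing_ev].
rewrite iIntD; [|exact: ingZ|exact: ingZ].
rewrite !iIntZ// -IH /symb /= {1}/ev big_cons -/(ev _ x) /=; congr (_ + _).
rewrite /fhat -/(cosint f k) -/(sinint f k) -mulrA.
by case: (c * cis _) => a b /=; ring.
Qed.

(** The kernel is a finite sum of products of a function of x and a function of y, so the order of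
    integration is exchanged term by term, by linearity alone. *)
Lemma Int_ev_swap (f phi : E -> R) t : ing f -> ing phi ->
  ing (fun y => f y * Int (fun x => phi x * ev t (s *: x - s *: y))) /\
  Int (fun x => phi x * ev (symb (fhat f) t) (s *: x)) =
  Int (fun y => f y * Int (fun x => phi x * ev t (s *: x - s *: y))).
Proof.
move=> hf hphi; elim: t => [|[c k] t [i3 IH]].
  have e0 : (fun y => f y * Int (fun x => phi x * ev [::] (s *: x - s *: y))) = fun=> 0.
    apply/funext => y; rewrite (_ : (fun x => phi x * _) = fun=> 0) ?Int0 ?mulr0//.
    by apply/funext => x; rewrite /ev big_nil mulr0.
  rewrite e0; split; first exact/bsf_ing/bsf0.
  by congr Int; apply/funext => x; rewrite /ev big_nil mulr0.
have bev u : exists B, forall x : E, `|ev u (s *: x)| <= B.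
  by have [B _ h] := ev_bounded u; exists B.
have mev u := continuous_measurable_rV (@continuous_evZ R m u s).
pose A x := complex.Re (c * cis (dot k (s *: x))).
pose B x := complex.Im (c * cis (dot k (s *: x))).
have e1 x : A x = ev [:: (c, k)] (s *: x) by rewrite /ev big_seq1.
have e2 x : B x = ev [:: (- 'i%C * c, k)] (s *: x).
  by rewrite /ev big_seq1 /B /=; case: (c) => c1 c2 /=; ring.
have iA : ing (fun x => phi x * A x).
  by under eq_fun do rewrite e1; exact: ingM.
have iB : ing (fun x => phi x * B x).
  by under eq_fun do rewrite e2; exact: ingM.
have -> : (fun x => phi x * ev (symb (fhat f) ((c, k) :: t)) (s *: x)) =
   (fun x => (cosint f k * (phi x * A x) + sinint f k * (phi x * B x)) +
      phi x * ev (symb (fhat f) t) (s *: x)).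
  apply/funext => x; rewrite {1}/ev /symb /= big_cons -/(symb _ _) -/(ev _ _) /= -mulrA /A /B.
  by case: (c * cis _) => a b /=; ring.
have -> : (fun y => f y * Int (fun x => phi x * ev ((c, k) :: t) (s *: x - s *: y))) =
   (fun y => ((f y * cos (dot k (s *: y))) * Int (fun x => phi x * A x) +
     (f y * sin (dot k (s *: y))) * Int (fun x => phi x * B x)) +
     f y * Int (fun x => phi x * ev t (s *: x - s *: y))).
  apply/funext => y; rewrite -[_ * _ * Int _]mulrA -[_ * _ * Int _]mulrA -!mulrDr; congr (_ * _).
  have i1 : ing (fun x => phi x * ev t (s *: x - s *: y)).
    by under eq_fun do rewrite ev_shift; exact: ingM.
  rewrite -!iIntZ// -iIntD; [|exact: ingZ|exact: ingZ].
  rewrite -iIntD//; last by apply: ingD; apply: ingZ.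
  congr Int; apply/funext => x; rewrite {1}/ev big_cons -/(ev t _) conv_term -/(A x) -/(B x); ring.
have h1 := ing_cos k hf; have h2 := ing_sin k hf.
have iZr (g : E -> R) c' : ing g -> ing (fun x => g x * c').
  by move=> /(ingZ c'); under eq_fun do rewrite mulrC.
split; first by apply: ingD i3; apply: ingD; exact: iZr.
rewrite [LHS]iIntD; [|by apply: ingD; apply: ingZ|exact: ingM].
rewrite [X in X + _ = _]iIntD; [|exact: ingZ|exact: ingZ].
rewrite !iIntZ// IH.
rewrite iIntD//; last by apply: ingD; exact: iZr.
by rewrite iIntD ?iIntZr//; exact: iZr.
Qed.

End convolution.
(** * The de la Vallee-Poussin potential *)

Section fejer_coefficients.
Variable R : realType.
Local Notation leb := (@lebesgue_measure R).

(** The window [L] may exceed [K], so that kernels of different degrees become sums over the same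
    indices. *)
Lemma fejer_coef (K L : nat) (t : R) : (K <= L)%N ->
  (fejer K t)%:C%C = \sum_(i < (2 * L).+1)
    ((K - absz (i%:Z - L%:Z))%N%:R / K%:R)%:C%C * cis ((i%:Z - L%:Z)%:~R * t).
Proof.
move=> KL; rewrite fejerE.
have key (p q : 'I_K) : cis ((p%:R - q%:R) * t) = \sum_(i < (2 * L).+1)
    (p%:Z - q%:Z + - (i%:Z - L%:Z) == 0)%:R * cis ((i%:Z - L%:Z)%:~R * t) :> R[i].
  have iL : (p + L - q < (2 * L).+1)%N by have := ltn_ord p; have := ltn_ord q; lia.
  have qp : (q <= p + L)%N by have := ltn_ord p; have := ltn_ord q; lia.
  rewrite (bigD1 (Ordinal iL))//= big1 ?addr0 => [|i].
    have -> : ((p + L - q)%N%:Z - L%:Z = p%:Z - q%:Z)%R by lia.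
    by rewrite subrr eqxx mul1r intrB.
  rewrite -val_eqE /= => il; case: eqP => [h|]; last by rewrite mul0r.
  by exfalso; move/eqP: il; apply; lia.
under eq_bigr => p _ do (under eq_bigr => q _ do rewrite key; rewrite exchange_big /=).
rewrite exchange_big mulr_sumr; apply: eq_bigr => i _ /=.
under eq_bigr => p _ do rewrite -mulr_suml.
rewrite -mulr_suml mulrA; congr (_ * _).
have -> : \sum_(p < K) \sum_(q < K) (p%:Z - q%:Z + - (i%:Z - L%:Z) == 0)%:R =
   (shift_count K (- (i%:Z - L%:Z)))%:R :> R[i].
  rewrite /shift_count natr_sum; apply: eq_bigr => p _.
  by rewrite natr_sum; apply: eq_bigr => q _; case: eqP.
by rewrite shift_countE abszN [LHS]mulrC rmorphM /= rmorph_nat.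
Qed.

Lemma fejer_cos (K : nat) (t : R) :
  fejer K t = \sum_(i < (2 * K).+1)
    (K - absz (i%:Z - K%:Z))%N%:R / K%:R * cos ((i%:Z - K%:Z)%:~R * t).
Proof.
have /(congr1 (@complex.Re R)) := fejer_coef t (leqnn K).
by rewrite /= Re_sum => ->; apply: eq_bigr => i _; rewrite ReZ.
Qed.

Lemma fejer_le (K : nat) (t : R) : fejer K t <= K%:R.
Proof.
have [->|K0] := posnP K; first by rewrite /fejer invr0 mulr0.
apply: (@le_trans _ _ (fejer K 0)).
  rewrite !fejer_cos; apply: ler_sum => i _; rewrite mulr0 cos0 mulr1.
  by rewrite ler_piMr ?cos_le1// divr_ge0.
rewrite /fejer (eq_bigr (fun=> 1)); last by move=> p _; rewrite mulr0 cis0.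
rewrite sumr_const card_ord (_ : 1 *+ K = (K%:R)%:C%C); last by rewrite rmorph_nat.
by rewrite /= expr0n addr0 expr2 mulfK// pnatr_eq0 -lt0n.
Qed.

(** The square of |e^(i t) - 1|, a periodic substitute for t^2. *)
Definition chord (t : R) : R := 2 - 2 * cos t.

Lemma chord_ge0 t : 0 <= chord t.
Proof. by rewrite /chord; have := cos_le1 t; lra. Qed.

(** The geometric sum gives K F_K(t) |e^(i t) - 1|^2 = |e^(i K t) - 1|^2 <= 4. *)
Lemma fejer_chord (K : nat) (t : R) : fejer K t * chord t <= 4 / K%:R.
Proof.
pose nsq (a : R[i]) := complex.Re a ^+ 2 + complex.Im a ^+ 2.
have nsqM a c : nsq (a * c) = nsq a * nsq c by case: a c => a1 a2 [c1 c2]; rewrite /nsq /=; ring.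
have nsqc u : nsq (cis u - 1) = chord u.
  by rewrite /nsq /chord /= subr0; have := cos2Dsin2 u; lra.
have -> : fejer K t * chord t = nsq (cis (K%:R * t) - 1) / K%:R.
  rewrite /fejer -/(nsq _) -nsqc mulrAC -nsqM; congr (nsq _ / _).
  by rewrite cisX subrX1 mulrC; congr (_ * _); apply: eq_bigr => p _; rewrite cisX.
rewrite nsqc ler_wpM2r ?invr_ge0// /chord.
by have := cos_geN1 (K%:R * t); lra.
Qed.

(** The cosine decreases on [0, pi], and an angle beyond pi is reflected to 2 pi - t. *)
Lemma chord_far (d t : R) : 0 < d -> d <= `|t| -> `|t| <= 2 * pi - d -> chord d <= chord t.
Proof.
move=> d0 dt td; rewrite /chord -[cos t]cos_norm; move: `|t| dt td => {}t dt td.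
rewrite lerD2l lerN2 ler_pM2l//; have p0 := pi_ge0 R.
have mono u v : 0 <= u -> u <= v -> v <= pi -> cos v <= cos u :> R.
  move=> u0 uv vp; rewrite leNgt; apply/negP.
  rewrite ltr_cos ?in_itv /= ?u0 ?vp ?(le_trans u0 uv) ?(le_trans uv vp)// => vu.
  by move: (le_lt_trans uv vu); rewrite ltxx.
have [tp|tp] := leP t pi; first by apply: mono => //; exact: ltW.
have -> : cos t = cos (2 * pi - t).
  rewrite -[RHS]cosN opprB -(cosD2pi (t - 2 * pi)); congr cos; rewrite -mulr_natl; ring.
by apply: mono; [exact: ltW | lra | lra].
Qed.

Lemma chord_gt0 (d : R) : 0 < d -> d <= pi -> 0 < chord d.
Proof.
move=> d0 dp; rewrite /chord; suff : cos d < cos 0 by rewrite cos0; lra.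
by rewrite ltr_cos ?in_itv /= ?lexx ?(ltW d0) ?pi_ge0.
Qed.

Variable s : R.
Hypothesis s0 : 0 < s.
Local Notation I := `[- (pi / s), pi / s]%classic.

Lemma Rint_cos (j : int) (c : R) : \int[leb]_(t in I) cos (j%:~R * (s * t - c)) =
  (j == 0)%:R * (2 * pi / s).
Proof.
have ps : 0 < pi / s by rewrite divr_gt0 ?pi_gt0.
have [->|j0] := eqVneq j 0.
  rewrite mul1r; under eq_Rintegral => t _ do rewrite mul0r cos0.
  have h : leb I = (2 * pi / s)%:E.
    rewrite lebesgue_measure_itv /= lte_fin gtrN// -EFinD opprK /=; congr _%:E.
    by ring.
  by rewrite Rintegral_cst// mul1r; exact: (congr1 fine h).
have js : j%:~R * s != 0 by rewrite mulf_neq0 ?intr_eq0// gt_eqF.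
rewrite mul0r /Rintegral.
pose F (t : R) := (j%:~R * s)^-1 * sin (j%:~R * (s * t - c)).
have dF t : is_derive t (1 : R) F (cos (j%:~R * (s * t - c))).
  have h : is_derive t (1 : R) (fun t : R => j%:~R * (s * t - c)) (j%:~R * s).
    by apply: is_derive_eq; rewrite /GRing.scale /=; ring.
  have hs := @is_derive1_comp R sin _ t _ _ (is_derive_sin _) h.
  apply: is_derive_eq; rewrite /GRing.scale /=; field.
  by move: js; rewrite mulf_eq0 negb_or andbC.
rewrite (@continuous_FTC2 R _ F).
- rewrite -EFinB /= /F -mulrBr.
  have -> : j%:~R * (s * (pi / s) - c) = j%:~R * (s * - (pi / s) - c) + j%:~R * (pi *+ 2).
    by rewrite -mulr_natl; field; rewrite gt_eqF.
  have := cis_int2pi R j => /(congr1 (fun z => (complex.Re z, complex.Im z))) [e1 e2].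
  by rewrite sinD e1 e2 mulr1 mulr0 addr0 subrr mulr0.
- by rewrite gtrN.
- apply: continuous_subspaceT => t; apply: continuous_comp; last exact: continuous_cos.
  by apply: cvgM; [exact: cvg_cst | apply: cvgB; [apply: cvgM; [exact: cvg_cst | exact: cvg_id] | exact: cvg_cst]].
- have cF : continuous F.
    by move=> t; apply: differentiable_continuous; apply/derivable1_diffP; case: (dF t).
  split=> [t _||]; first by case: (dF t).
    by apply: cvg_at_right_filter; exact: cF.
  by apply: cvg_at_left_filter; exact: cF.
- by move=> t _; rewrite derive1E; case: (dF t) => _ ->.
Qed.

Lemma cont1_integrable (g : R -> R) : continuous g -> leb.-integrable I (EFin \o g).
Proof.
by move=> cg; apply: continuous_compact_integrable; [exact: segment_compact | exact: continuous_subspaceT].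
Qed.

Lemma cont_cos_lin (j c : R) : continuous (fun t : R => cos (j * (s * t - c))).
Proof.
move=> t; apply: continuous_comp; last exact: continuous_cos.
by apply: cvgM; [exact: cvg_cst | apply: cvgB; [apply: cvgM; [exact: cvg_cst | exact: cvg_id] | exact: cvg_cst]].
Qed.

Lemma Rint_cos_sum (r : seq (R * int)) (c : R) :
  continuous (fun t : R => \sum_(x <- r) x.1 * cos (x.2%:~R * (s * t - c))) /\
  \int[leb]_(t in I) (\sum_(x <- r) x.1 * cos (x.2%:~R * (s * t - c))) =
  \sum_(x <- r) x.1 * ((x.2 == 0)%:R * (2 * pi / s)).
Proof.
elim: r => [|[a j] r [IHc IH]].
  split; first by under eq_fun do rewrite big_nil; move=> t; exact: cvg_cst.
  under eq_Rintegral => t _ do rewrite big_nil.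
  by rewrite big_nil Rintegral_cst// mul0r.
have ca : continuous (fun t : R => a * cos (j%:~R * (s * t - c))).
  by move=> t; apply: cvgM; [exact: cvg_cst | exact: cont_cos_lin].
split; first by under eq_fun do rewrite big_cons /=; move=> t; apply: cvgD; [exact: ca | exact: IHc].
under eq_Rintegral => t _ do rewrite big_cons /=.
rewrite RintegralD//; [|exact: cont1_integrable|exact: cont1_integrable].
rewrite RintegralZl//; last by apply: cont1_integrable; exact: cont_cos_lin.
by rewrite Rint_cos IH big_cons.
Qed.

Lemma Rint_fejer (K : nat) (c : R) : (0 < K)%N ->
  continuous (fun t => fejer K (s * t - c)) /\
  \int[leb]_(t in I) fejer K (s * t - c) = 2 * pi / s.
Proof.
move=> K0; pose r := [seq ((K - absz (i%:Z - K%:Z))%N%:R / K%:R : R, i%:Z - K%:Z) | i : 'I_(2 * K).+1 <- index_enum _].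
have fE t : fejer K (s * t - c) = \sum_(x <- r) x.1 * cos (x.2%:~R * (s * t - c)).
  by rewrite fejer_cos /r big_map.
have [h1 h2] := Rint_cos_sum r c.
split; first by under eq_fun do rewrite fE.
rewrite (eq_Rintegral leb (g := fun t : R => \sum_(x <- r) x.1 * cos (x.2%:~R * (s * t - c)))) => [|t _]; last exact: fE.
rewrite h2 /r big_map.
have KK : (K < (2 * K).+1)%N by lia.
rewrite (bigD1 (Ordinal KK))//= big1 ?addr0 => [|i].
  by rewrite subrr eqxx mul1r absz0 subn0 divff ?mul1r// pnatr_eq0 -lt0n.
rewrite -val_eqE /= => iK; rewrite (_ : (i%:Z - K%:Z == 0) = false) ?mul0r ?mulr0//.
by apply/negbTE; move: iK; apply: contra_neq => h; lia.
Qed.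

End fejer_coefficients.

(** * The kernel in several variables and its majorant *)

Section vallee_poussin.
Variables (R : realType) (m : nat).
Local Notation E := 'rV[R]_m.
Local Notation freq := 'rV[int]_m.

(** Coefficients of 2 F_(2 N) - F_N: they are 1 up to N and 0 from 2 N on. The majorants [vw] and
    [VW] add the two Fejer kernels instead and stay nonnegative, at the cost of a factor 3 in mass
    for each variable. *)
Definition vh (N : nat) (j : int) : R :=
  2 * ((2 * N - absz j)%N%:R / (2 * N)%N%:R) - (N - absz j)%N%:R / N%:R.
Definition vk (N : nat) (t : R) : R := 2 * fejer (2 * N) t - fejer N t.
Definition vw (N : nat) (t : R) : R := 2 * fejer (2 * N) t + fejer N t.
Definition vhat (N : nat) (k : freq) : R := \prod_a vh N (k 0 a).
Definition VP (N : nat) (x : E) : R := \prod_a vk N (x 0 a).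
Definition VW (N : nat) (x : E) : R := \prod_a vw N (x 0 a).

Definition lattice (L : nat) (F : {ffun 'I_m -> 'I_(2 * L).+1}) : freq :=
  \row_a ((F a)%:Z - L%:Z).
(** All frequencies of a cube with coefficient 1, so that [symb f] turns it into the kernel with
    coefficients f. *)
Definition dirichlet (L : nat) : tpoly R m := [seq (1, lattice F) | F <- index_enum {ffun 'I_m -> 'I_(2 * L).+1}].

Lemma dle_dirichlet L : dle L (dirichlet L).
Proof.
rewrite /dle all_map; apply/allP => F _ /=; apply/forallP => a; rewrite mxE.
by case: (F a) => i /= hi; lia.
Qed.

Lemma vh_low N j : (0 < N)%N -> (absz j <= N)%N -> vh N j = 1.
Proof.
move=> N0 jN; have N1 : N%:R != 0 :> R by rewrite pnatr_eq0 -lt0n.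
rewrite /vh !natrB ?natrM//; last by lia.
by field.
Qed.

Lemma vh_bound N j : `|vh N j| <= 2.
Proof.
have b (k l : nat) : 0 <= ((k - l)%N%:R / k%:R : R) <= 1.
  have [->|k0] := posnP k; first by rewrite invr0 mulr0 lexx ler01.
  rewrite divr_ge0//= ler_pdivrMr ?ltr0n// mul1r ler_nat; lia.
have /andP[h1 h2] := b (2 * N)%N (absz j); have /andP[h3 h4] := b N (absz j).
by rewrite /vh ler_norml; apply/andP; split; lra.
Qed.

Lemma vk_coef N L t : (2 * N <= L)%N ->
  (vk N t)%:C%C = \sum_(i < (2 * L).+1) (vh N (i%:Z - L%:Z))%:C%C * cis ((i%:Z - L%:Z)%:~R * t).
Proof.
move=> NL; rewrite /vk rmorphB rmorphM /= (fejer_coef t NL) (@fejer_coef R N L); last by lia.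
rewrite mulr_sumr -sumrB; apply: eq_bigr => i _.
by rewrite mulrA -mulrBl -rmorphM -rmorphB.
Qed.

Lemma cis_dot (k : freq) (x : E) : cis (dot k x) = \prod_a cis ((k 0 a)%:~R * x 0 a).
Proof. by rewrite /dot (big_morph (@cis R) (id1 := 1) (op1 := *%R))//; [exact: cisD | exact: cis0]. Qed.

Lemma VP_ev N L x : (2 * N <= L)%N -> VP N x = ev (symb (fun k => (vhat N k)%:C%C) (dirichlet L)) x.
Proof.
move=> NL; have -> : VP N x = complex.Re (VP N x)%:C%C by [].
rewrite /VP rmorph_prod /=; under eq_bigr => a _ do rewrite (vk_coef _ NL).
rewrite bigA_distr_bigA Re_sum ev_symb big_map; apply: eq_bigr => F _.
transitivity (complex.Re ((vhat N (lattice F))%:C%C * 1 * cis (dot (lattice F) x))); last by [].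
rewrite mulr1 cis_dot /vhat rmorph_prod -big_split; congr complex.Re.
by apply: eq_bigr => a _; rewrite mxE.
Qed.

Lemma vw_ge0 N t : 0 <= vw N t.
Proof. by apply: addr_ge0; [apply: mulr_ge0; [exact: ler0n|]|]; exact: fejer_ge0. Qed.

Lemma vk_vw N t : `|vk N t| <= vw N t.
Proof.
have := fejer_ge0 (2 * N) t; have := fejer_ge0 N t.
by rewrite /vk /vw ler_norml => *; apply/andP; split; lra.
Qed.

Lemma vw_le N t : vw N t <= 5 * N%:R.
Proof.
have := fejer_le (2 * N) t; have := fejer_le N t; rewrite /vw natrM => *; lra.
Qed.

Lemma vw_chord N t : (0 < N)%N -> vw N t * chord t <= 8 / N%:R.
Proof.
move=> N0; have N1 : N%:R != 0 :> R by rewrite pnatr_eq0 -lt0n.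
have h1 := fejer_chord (2 * N) t; have h2 := fejer_chord N t.
have e : 4 / (2 * N)%N%:R = 2 / N%:R :> R by rewrite natrM; field.
rewrite e in h1; rewrite /vw mulrDl -mulrA.
have -> : 8 / N%:R = 2 * (2 / N%:R) + 4 / N%:R :> R by field.
by apply: lerD => //; rewrite ler_pM2l.
Qed.

Lemma VW_ge0 N x : 0 <= VW N x.
Proof. by apply: prodr_ge0 => a _; exact: vw_ge0. Qed.

Lemma VP_VW N x : `|VP N x| <= VW N x.
Proof. by rewrite normr_prod; apply: ler_prod => a _; rewrite normr_ge0 vk_vw. Qed.

Lemma VW_le N x : VW N x <= (5 * N%:R) ^+ m.
Proof.
apply: (@le_trans _ _ (\prod_(a < m) (5 * N%:R))); last by rewrite prodr_const card_ord.
by apply: ler_prod => a _; rewrite vw_ge0 vw_le.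
Qed.

Variable s : R.
Hypothesis s0 : 0 < s.
Local Notation leb := (@lebesgue_measure R).
Local Notation I := `[- (pi / s), pi / s]%classic.
Local Notation cube := (box m (pi / s)).

Lemma bs1_itv (g : R -> R) : continuous g -> bs1 (fun t => g t * \1_I t).
Proof.
move=> cg; have mI : measurable (I : set R) by exact: measurable_itv.
split; first by apply: measurable_funM; [exact: continuous_measurable_fun | exact: measurable_indic].
have [M [_ hM]] : bounded_set (g @` I).
  by apply: compact_bounded; apply: continuous_compact; [exact: continuous_subspaceT | exact: segment_compact].
exists (`|M| + 1), (pi / s); split; first by rewrite addr_ge0.
  move=> t; rewrite indicE; case: (boolP (t \in _)) => h; last by rewrite mulr0 normr0 addr_ge0.
  rewrite mulr1; apply: (hM (`|M| + 1)); last by exists t => //; rewrite inE in h.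
  by rewrite (le_lt_trans (ler_norm M))// ltrDl.
by move=> t ht; rewrite indicE memNset ?mulr0//; apply/negP.
Qed.

Lemma Rint_itv (g : R -> R) : \int[leb]_t (g t * \1_I t) = \int[leb]_(t in I) g t.
Proof.
rewrite [RHS]Rintegral_mkcond; apply: eq_Rintegral => t _; rewrite patchE indicE.
by case: ifP => _; rewrite ?mulr1 ?mulr0.
Qed.

Lemma cube_prod (u : 'I_m -> R -> R) : (forall a, continuous (u a)) ->
  bsf (fun x : E => \1_cube x * \prod_a u a (x 0 a)) /\
  Int (fun x : E => \1_cube x * \prod_a u a (x 0 a)) = \prod_a \int[leb]_(t in I) u a t.
Proof.
move=> cu; have e : (fun x : E => \1_cube x * \prod_a u a (x 0 a)) =
    (fun x => \prod_a (u a (x 0 a) * \1_I (x 0 a))).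
  apply/funext => x; rewrite big_split /= mulrC; congr (_ * _); rewrite indicE.
  case: (boolP (x \in _)) => h.
    by rewrite big1// => a _; rewrite indicE mem_set//; rewrite inE in h; exact: h.
  have [a ha] : exists a, ~ I (x 0 a).
    by apply/not_existsP => h'; move/negP: h; apply; rewrite inE => a; apply: contrapT; exact: h'.
  by rewrite (bigD1 a)//= indicE memNset// mul0r.
have hb a := bs1_itv (cu a).
rewrite e; split; first exact: (bsf_prod hb).
by rewrite (Int_prod hb); apply: eq_bigr => a _; rewrite Rint_itv.
Qed.

Local Notation c0 := (2 * pi / s).

Lemma cont_fejer K (c : R) : (0 < K)%N -> continuous (fun t => fejer K (s * t - c)).
Proof. by move=> K0; have [] := Rint_fejer s0 c K0. Qed.

Lemma Rint_vk N c : (0 < N)%N -> continuous (fun t => vk N (s * t - c)) /\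
  \int[leb]_(t in I) vk N (s * t - c) = c0.
Proof.
move=> N0; have N2 : (0 < 2 * N)%N by lia.
have c1 := @cont_fejer _ c N0; have c2 := @cont_fejer _ c N2.
have c3 : continuous (fun t => 2 * fejer (2 * N) (s * t - c)).
  by move=> t; apply: cvgM; [exact: cvg_cst | exact: c2].
split; first by move=> t; apply: cvgB; [exact: c3 | exact: c1].
rewrite RintegralB//; [|exact: cont1_integrable|exact: cont1_integrable].
rewrite RintegralZl//; last exact: cont1_integrable.
rewrite (proj2 (Rint_fejer s0 c N0)) (proj2 (Rint_fejer s0 c N2)); ring.
Qed.

Lemma Rint_vw N c : (0 < N)%N -> continuous (fun t => vw N (s * t - c)) /\
  \int[leb]_(t in I) vw N (s * t - c) = 3 * c0.
Proof.
move=> N0; have N2 : (0 < 2 * N)%N by lia.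
have c1 := @cont_fejer _ c N0; have c2 := @cont_fejer _ c N2.
have c3 : continuous (fun t => 2 * fejer (2 * N) (s * t - c)).
  by move=> t; apply: cvgM; [exact: cvg_cst | exact: c2].
split; first by move=> t; apply: cvgD; [exact: c3 | exact: c1].
rewrite RintegralD//; [|exact: cont1_integrable|exact: cont1_integrable].
rewrite RintegralZl//; last exact: cont1_integrable.
rewrite (proj2 (Rint_fejer s0 c N0)) (proj2 (Rint_fejer s0 c N2)); ring.
Qed.

Lemma Int_VP N (c : E) : (0 < N)%N -> bsf (fun x => \1_cube x * VP N (s *: x - c)) /\
  Int (fun x => \1_cube x * VP N (s *: x - c)) = c0 ^+ m.
Proof.
move=> N0; have e : (fun x : E => \1_cube x * VP N (s *: x - c)) =
    (fun x => \1_cube x * \prod_a vk N (s * x 0 a - c 0 a)).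
  by apply/funext => x; congr (_ * _); apply: eq_bigr => a _; rewrite !mxE.
rewrite e; have h a := Rint_vk (c 0 a) N0.
have [h1 ->] := @cube_prod (fun a t => vk N (s * t - c 0 a)) (fun a => proj1 (h a)).
split => //; under eq_bigr => a _ do rewrite (proj2 (h a)).
by rewrite prodr_const card_ord.
Qed.

Lemma Int_VW N (c : E) : (0 < N)%N -> bsf (fun x => \1_cube x * VW N (s *: x - c)) /\
  Int (fun x => \1_cube x * VW N (s *: x - c)) = (3 * c0) ^+ m.
Proof.
move=> N0; have e : (fun x : E => \1_cube x * VW N (s *: x - c)) =
    (fun x => \1_cube x * \prod_a vw N (s * x 0 a - c 0 a)).
  by apply/funext => x; congr (_ * _); apply: eq_bigr => a _; rewrite !mxE.
rewrite e; have h a := Rint_vw (c 0 a) N0.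
have [h1 ->] := @cube_prod (fun a t => vw N (s * t - c 0 a)) (fun a => proj1 (h a)).
split => //; under eq_bigr => a _ do rewrite (proj2 (h a)).
by rewrite prodr_const card_ord.
Qed.

(** The integral factors over the coordinates, and only the factor of coordinate b meets the chord,
    where [vw_chord] gains 1 / N. *)
Lemma Int_VW_chord N (c : E) b : (0 < N)%N ->
  bsf (fun x => \1_cube x * (VW N (s *: x - c) * chord (s * x 0 b - c 0 b))) /\
  Int (fun x => \1_cube x * (VW N (s *: x - c) * chord (s * x 0 b - c 0 b))) <=
    8 / N%:R * (3 * c0) ^+ m.
Proof.
move=> N0; have c00 : 0 < c0 by rewrite divr_gt0// mulr_gt0// pi_gt0.
have N1 : 0 < N%:R :> R by rewrite ltr0n.
pose u a t := vw N (s * t - c 0 a) * (if a == b then chord (s * t - c 0 a) else 1).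
have e : (fun x : E => \1_cube x * (VW N (s *: x - c) * chord (s * x 0 b - c 0 b))) =
    (fun x => \1_cube x * \prod_a u a (x 0 a)).
  apply/funext => x; congr (_ * _); rewrite /u big_split /=; congr (_ * _).
    by apply: eq_bigr => a _; rewrite !mxE.
  by rewrite -big_mkcond /= big_pred1_eq.
have cchord c' : continuous (fun t : R => chord (s * t - c')).
  move=> t; apply: cvgB; first exact: cvg_cst.
  apply: cvgM; first exact: cvg_cst.
  by have := @cont_cos_lin R s 1 c' t; under eq_fun do rewrite mul1r.
have cu a : continuous (u a).
  move=> t; apply: cvgM; first exact: (proj1 (Rint_vw (c 0 a) N0)).
  by case: (a == b); [exact: cchord | exact: cvg_cst].
have [h1 h2] := cube_prod cu; rewrite e h2; split => //.
have u0 a t : 0 <= u a t by rewrite mulr_ge0 ?vw_ge0//; case: (a == b) => //; exact: chord_ge0.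
rewrite (bigD1 b)//=.
have -> : 8 / N%:R * (3 * c0) ^+ m = 8 / N%:R * (3 * c0) * \prod_(a < m | a != b) (3 * c0).
  have hp : \prod_(a < m) (3 * c0) = 3 * c0 * \prod_(a < m | a != b) (3 * c0) by rewrite (bigD1 b).
  have hp2 : \prod_(a < m) (3 * c0) = (3 * c0) ^+ m by rewrite prodr_const card_ord.
  by rewrite -hp2 hp [LHS]mulrA.
apply: ler_pM.
- by apply: Rintegral_ge0 => t _.
- by apply: prodr_ge0 => a _; apply: Rintegral_ge0 => t _.
(* A constant written as a multiple of cos 0, so that [Rint_cos] integrates it. *)
- have -> : 8 / N%:R * (3 * c0) = \int[leb]_(t in I) (24 / N%:R * cos (0%:~R * (s * t - 0))).
    rewrite RintegralZl//; last by apply: cont1_integrable; exact: cont_cos_lin.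
    by rewrite (Rint_cos s0) eqxx mul1r; ring.
  apply: le_Rintegral => //; [exact: cont1_integrable | apply: cont1_integrable| ].
    by move=> t; apply: cvgM; [exact: cvg_cst | exact: cont_cos_lin].
  move=> t _; rewrite /u eqxx mul0r cos0 mulr1; apply: le_trans (vw_chord _ N0) _.
  by rewrite ler_pM2r ?invr_gt0//; lra.
- apply: ler_prod => a ab; rewrite Rintegral_ge0//= /u (negbTE ab).
  under eq_Rintegral => t _ do rewrite mulr1.
  by rewrite (proj2 (Rint_vw (c 0 a) N0)).
Qed.

End vallee_poussin.

(** * Approximation of the identity *)

Section kernel_approximation.
Variables (R : realType) (m : nat) (s : R).
Hypothesis s0 : 0 < s.
Local Notation E := 'rV[R]_m.
Local Notation cube := (box m (pi / s)).
Local Notation c0 := (2 * pi / s).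

(** Near y the oscillation of psi is at most e. Elsewhere some coordinate differs by more than d,
    its chord is at least [chord (s * d)], and 2 B is at most a multiple of that chord, whose
    integral against the majorant is O(1 / N): a Chebyshev inequality. The bounds on s y and s d
    keep all differences within one period. *)
Lemma VP_approx (psi : E -> R) (B e d : R) (N : nat) (y : E) : (0 < N)%N ->
  measurable_fun setT psi -> (forall x, `|psi x| <= B) -> 0 < d -> s * d <= 2^-1 -> 0 <= e ->
  (forall a, `|s * y 0 a| <= 2^-1) ->
  (forall x, cube x -> (forall a, `|x 0 a - y 0 a| <= d) -> `|psi x - psi y| <= e) ->
  `|Int (fun x => (\1_cube x * psi x) * VP N (s *: x - s *: y)) - c0 ^+ m * psi y| <=
    (e + 2 * B / chord (s * d) * m%:R * (8 / N%:R)) * (3 * c0) ^+ m.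
Proof.
move=> N0 mpsi psiB d0 sd e0 ys psie.
have B0 : 0 <= B by exact: le_trans (psiB 0).
have [b1 i1] := @Int_VP R m s s0 N (s *: y) N0.
have [b2 i2] := @Int_VW R m s s0 N (s *: y) N0.
have h3 b := @Int_VW_chord R m s s0 N (s *: y) b N0.
have p1 : 1 <= pi :> R by have := pi_ge2 R; lra.
have chi0 : 0 < chord (s * d) by apply: chord_gt0; [exact: mulr_gt0 | lra].
set K := 2 * B / chord (s * d).
have K0 : 0 <= K by rewrite divr_ge0 ?mulr_ge0// ltW.
have bf : bsf (fun x => (\1_cube x * psi x) * VP N (s *: x - s *: y)).
  have -> : (fun x => (\1_cube x * psi x) * VP N (s *: x - s *: y)) =
    (fun x => psi x * (\1_cube x * VP N (s *: x - s *: y))) by apply/funext => x; ring.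
  by apply: bsfM => //; exists B.
have -> : c0 ^+ m * psi y = Int (fun x => psi y * (\1_cube x * VP N (s *: x - s *: y))).
  by rewrite IntZ// i1 mulrC.
rewrite -IntB//; last exact: bsfZ.
apply: (@le_trans _ _ (Int (fun x => e * (\1_cube x * VW N (s *: x - s *: y)) +
   K * \sum_b (\1_cube x * (VW N (s *: x - s *: y) * chord (s * x 0 b - (s *: y) 0 b)))))); last first.
  have bs : bsf (fun x => \sum_b (\1_cube x * (VW N (s *: x - s *: y) * chord (s * x 0 b - (s *: y) 0 b)))).
    by apply: bsf_sum => b; exact: (proj1 (h3 b)).
  rewrite IntD; [|exact: bsfZ|exact: bsfZ].
  rewrite IntZ// i2 IntZ// Int_sum; last by move=> b; exact: (proj1 (h3 b)).
  have -> : (e + K * m%:R * (8 / N%:R)) * (3 * c0) ^+ m =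
    e * (3 * c0) ^+ m + K * (m%:R * (8 / N%:R * (3 * c0) ^+ m)) by ring.
  rewrite lerD2l; apply: ler_wpM2l => //.
  apply: (@le_trans _ _ (\sum_(b < m) (8 / N%:R * (3 * c0) ^+ m))).
    by apply: ler_sum => b _; exact: (proj2 (h3 b)).
  by rewrite sumr_const card_ord -[X in X <= _]mulr_natl.
have bd := bsfB bf (bsfZ (psi y) b1).
apply: le_trans (Int_norm bd) _; apply: Int_le.
- exact: bsf_norm.
- apply: bsfD; first exact: bsfZ.
  by apply/bsfZ/bsf_sum => b; exact: (proj1 (h3 b)).
move=> x.
have -> : \1_cube x * psi x * VP N (s *: x - s *: y) - psi y * (\1_cube x * VP N (s *: x - s *: y)) =
  \1_cube x * ((psi x - psi y) * VP N (s *: x - s *: y)) by ring.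
rewrite indicE; case: (boolP (x \in cube)) => hx; last first.
  by rewrite !mul0r normr0 mulr0 add0r mulr_ge0// sumr_ge0// => b _; rewrite mul0r.
rewrite inE in hx; rewrite !mul1r normrM.
under eq_bigr => b _ do rewrite mul1r.
rewrite -mulr_sumr mulrCA [e * _]mulrC -mulrDr mulrC; apply: ler_pM => //; first exact: VP_VW.
have Kch b : 0 <= K * chord (s * x 0 b - (s *: y) 0 b) by rewrite mulr_ge0 ?chord_ge0.
have [h|/existsNP[b /negP hb]] := pselect (forall a, `|x 0 a - y 0 a| <= d).
  apply: le_trans (psie x hx h) _; rewrite lerDl mulr_ge0// sumr_ge0// => b _.
  exact: chord_ge0.
rewrite -ltNge in hb; apply: (@le_trans _ _ (2 * B)).
  by rewrite (le_trans (ler_normB _ _))// mulr_natl mulr2n lerD.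
apply: ler_wpDl => //; rewrite mulr_sumr (bigD1 b)//=; apply: ler_wpDr.
  by apply: sumr_ge0 => a _.
have -> : 2 * B = K * chord (s * d) by rewrite /K divfK// gt_eqF.
apply: ler_wpM2l => //; rewrite mxE; apply: chord_far.
- exact: mulr_gt0.
- by rewrite -mulrBr normrM gtr0_norm// ler_pM2l// ltW.
- have hxb : `|s * x 0 b| <= pi.
    have := hx b; rewrite /= in_itv /= -ler_norml normrM gtr0_norm// => hh.
    by rewrite mulrC -ler_pdivlMr.
  rewrite (le_trans (ler_normB _ _))//; have := ys b; lra.
Qed.

End kernel_approximation.

(** * Dyadic blocks of the potential *)

Section potential.
Variables (R : realType) (m : nat) (s : R).
Hypothesis s0 : 0 < s.
Local Notation E := 'rV[R]_m.
Local Notation freq := 'rV[int]_m.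
Local Notation cube := (box m (pi / s)).
Local Notation c0 := (2 * pi / s).

Lemma VP_opp N (x : E) : VP N (- x) = VP N x.
Proof.
have fN K (t : R) : fejer K (- t) = fejer K t.
  by rewrite !fejer_cos; apply: eq_bigr => i _; rewrite mulrN cosN.
by apply: eq_bigr => a _; rewrite mxE /vk !fN.
Qed.

Lemma VW_opp N (x : E) : VW N (- x) = VW N x.
Proof.
have fN K (t : R) : fejer K (- t) = fejer K t.
  by rewrite !fejer_cos; apply: eq_bigr => i _; rewrite mulrN cosN.
by apply: eq_bigr => a _; rewrite mxE /vw !fN.
Qed.

Variables (f : E -> R) (p : R).
Hypotheses (fing : ing f) (f0 : forall x, ~ cube x -> f x = 0) (p1 : 1 <= p).
Hypothesis fp : ing (fun x => `|f x| `^ p).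
Local Notation A := (Int (fun x => `|f x| `^ p)).

(* Split according to whether [|f| <= l]: the kernel has bounded mass and height of order [N ^+ m]. *)
Lemma conv_bound (l : R) N x : 0 < l -> (0 < N)%N ->
  `|Int (fun y => f y * VP N (x - s *: y))| <= l * (3 * c0) ^+ m + l `^ (1 - p) * (5 * N%:R) ^+ m * A.
Proof.
move=> l0 N0; have [b2 i2] := @Int_VW R m s s0 N x N0.
have iv : ing (fun y => f y * VP N (x - s *: y)).
  have := @ing_ev R m s f (symb (fun k => (vhat R N k)%:C%C) (dirichlet R m (2 * N))) x fing.
  by under eq_fun do rewrite -VP_ev//.
apply: le_trans (iInt_norm iv) _; rewrite -i2 -(IntZ l b2) -(iIntZ _ fp).
rewrite -iIntD; [|exact/bsf_ing/bsfZ|exact: ingZ].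
apply: iInt_le; [exact: ing_norm|by apply: ingD; [exact/bsf_ing/bsfZ|exact: ingZ]|move=> y].
have [cy|/f0 ->] := pselect (cube y); last first.
  rewrite mul0r normr0 addr_ge0// mulr_ge0 ?mulr_ge0 ?powR_ge0 ?exprn_ge0 ?VW_ge0// ?ltW//.
rewrite indicE mem_set// mul1r normrM -VW_opp opprB.
have W0 := VW_ge0 N (x - s *: y); have P0 := powR_ge0 `|f y| p.
have l1 := powR_ge0 l (1 - p).
have [fl|lf] := leP `|f y| l.
  apply: ler_wpDr; first by rewrite !mulr_ge0// exprn_ge0.
  by apply: ler_pM => //; exact: VP_VW.
apply: ler_wpDl; first by rewrite mulr_ge0// ltW.
have ly : 0 < `|f y| by exact: lt_trans lf.
have e : `|f y| <= `|f y| `^ p * l `^ (1 - p).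
  have e1 : `|f y| = `|f y| `^ p * `|f y| `^ (1 - p).
    have e2 : `|f y| `^ (p + (1 - p)) = `|f y| `^ p * `|f y| `^ (1 - p).
      by rewrite powRD//; apply/implyP => _; rewrite gt_eqF.
    by rewrite -e2 (_ : p + (1 - p) = 1) ?powRr1//; ring.
  rewrite [X in X <= _]e1.
  apply: ler_wpM2l => //; rewrite -[1 - p]opprB !powRN lef_pV2 ?posrE ?powR_gt0//.
  by rewrite ge0_ler_powR ?nnegrE ?subr_ge0// ltW.
apply: (@le_trans _ _ (`|f y| `^ p * l `^ (1 - p) * (5 * N%:R) ^+ m)); last first.
  by rewrite le_eqVlt; apply/orP; left; apply/eqP; ring.
apply: ler_pM => //.
by apply: le_trans (VP_VW _ _) (VW_le _ _).
Qed.


Lemma lap_symb (w : 'I_m -> R) (t : tpoly R m) x :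
  \sum_a w a * partial a (partial a (ev t)) x = ev (symb (fun k => (- qform w k)%:C%C) t) x.
Proof.
under eq_bigr => a _ do rewrite !partial_ev -ev_symbZ !symb_comp.
rewrite -ev_symb_sum; congr (ev (symb _ t) x); apply/funext => k.
rewrite /qform rmorphN rmorph_sum -sumrN; apply: eq_bigr => a _ /=.
rewrite rmorphM rmorphXn /=.
apply: (@etrans _ _ ('i%C ^+ 2 * ((w a)%:C%C * ((k 0 a)%:~R)%:C%C ^+ 2))); first by ring.
by rewrite sqr_i mulN1r.
Qed.

Variable w : 'I_m -> R.
Hypothesis w1 : forall a, 1 <= w a.
Hypothesis fint : Int f = 0.
Variable kap : R.
Hypothesis kap2 : kap + m%:R / p < 2.

Let w0 a : 0 <= w a. Proof. exact: le_trans (w1 a). Qed.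
Let pp : 0 < p. Proof. exact: lt_le_trans p1. Qed.

Definition qinv (k : freq) : R := if qform w k == 0 then 0 else (qform w k)^-1.

Lemma qform_ge (k : freq) (a : 'I_m) (N : nat) : (N < absz (k 0%R a))%N -> N%:R ^+ 2 <= qform w k.
Proof.
move=> h; apply: (@le_trans _ _ ((k 0 a)%:~R ^+ 2)).
  have -> : (k 0 a)%:~R ^+ 2 = (absz (k 0 a))%:R ^+ 2 :> R.
    by case: (k 0 a) => z; rewrite ?NegzE ?mulrNz ?sqrrN -?pmulrn.
  by rewrite lerXn2r ?nnegrE// ler_nat ltnW.
rewrite /qform (bigD1 a)//= ler_wpDr//.
  by apply: sumr_ge0 => b _; rewrite mulr_ge0 ?sqr_ge0.
by rewrite ler_peMl ?sqr_ge0.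
Qed.

Lemma vhat_low (N : nat) (k : freq) : (0 < N)%N -> (forall a, absz (k 0%R a) <= N)%N -> vhat R N k = 1.
Proof. by move=> N0 h; rewrite /vhat big1// => a _; exact: vh_low. Qed.

Lemma vhat_bound (N : nat) (k : freq) : `|vhat R N k| <= 2 ^+ m.
Proof.
rewrite /vhat normr_prod; apply: (@le_trans _ _ (\prod_(a < m) 2)); last by rewrite prodr_const card_ord.
by apply: ler_prod => a _; rewrite normr_ge0 vh_bound.
Qed.

(** A dyadic block: it vanishes when all frequencies are at most 2^J, so that Q >= 4^J on its
    support. *)
Definition vdif (J : nat) (k : freq) : R := vhat R (2 * 2 ^ J) k - vhat R (2 ^ J) k.

Lemma vdif_low J (k : freq) : vdif J k != 0 -> (2 ^ J)%:R ^+ 2 <= qform w k.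
Proof.
have N0 : (0 < 2 ^ J)%N by rewrite expn_gt0.
move=> h; have [a ha] : exists a, (2 ^ J < absz (k 0%R a))%N.
  apply/not_existsP => h'; move/negP: h; apply; rewrite /vdif.
  have kN a : (absz (k 0%R a) <= 2 ^ J)%N by rewrite leqNgt; apply/negP; exact: h'.
  rewrite !vhat_low ?subrr ?muln_gt0// => a; apply: leq_trans (kN a) _; rewrite leq_pmull//.
exact: qform_ge ha.
Qed.

Definition tail_list (J : nat) : tpoly R m :=
  symb (fun k => (vdif J k)%:C%C) (symb (fhat s f) (dirichlet R m (4 * 2 ^ J))).

Lemma tail_listE J x : ev (tail_list J) x =
  Int (fun y => f y * VP (2 * 2 ^ J) (x - s *: y)) - Int (fun y => f y * VP (2 ^ J) (x - s *: y)).
Proof.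
have key N : (2 * N <= 4 * 2 ^ J)%N ->
    ev (symb (fun k => (vhat R N k)%:C%C) (symb (fhat s f) (dirichlet R m (4 * 2 ^ J)))) x =
    Int (fun y => f y * VP N (x - s *: y)).
  move=> NJ; rewrite symb_comp.
  rewrite (_ : symb _ _ = symb (fhat s f) (symb (fun k => (vhat R N k)%:C%C) (dirichlet R m (4 * 2 ^ J)))).
    by rewrite ev_fhat//; congr Int; apply/funext => y; rewrite (VP_ev _ NJ).
  by rewrite symb_comp; congr symb; apply/funext => k; rewrite mulrC.
rewrite -!key; [|lia|lia].
rewrite /tail_list (_ : (fun k => (vdif J k)%:C%C) =
   (fun k => (vhat R (2 * 2 ^ J) k)%:C%C + (-1)%:C%C * (vhat R (2 ^ J) k)%:C%C)).
  by rewrite ev_symbD ev_symbZ mulN1r.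
by apply/funext => k; rewrite /vdif rmorphB rmorphN1 mulN1r.
Qed.

Local Notation rho := (m%:R / p).

(** In [conv_bound] with N = 2^J, the level l = 2^(J m / p) balances the two terms, as l^p = N^m. *)
Lemma tail_bound : exists2 C, 0 <= C & forall J x, `|ev (tail_list J) x| <= C * p2 (rho * J%:R).
Proof.
have A0 : 0 <= A by apply: Int_ge0 => x; exact: powR_ge0.
have c00 : 0 <= 3 * c0 by rewrite mulr_ge0// divr_ge0 ?mulr_ge0 ?pi_ge0// ltW.
exists (2 * (3 * c0) ^+ m + (10 ^+ m + 5 ^+ m) * A).
  by rewrite addr_ge0 ?mulr_ge0 ?addr_ge0 ?exprn_ge0.
move=> J x; rewrite tail_listE (le_trans (ler_normB _ _))//.
have l0 : 0 < p2 (rho * J%:R) :> R by exact: p2_gt0.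
have N0 : (0 < 2 ^ J)%N by rewrite expn_gt0.
have N20 : (0 < 2 * 2 ^ J)%N by rewrite muln_gt0.
apply: le_trans (lerD (conv_bound x l0 N20) (conv_bound x l0 N0)) _.
set l := p2 _ in l0 *.
have e : l `^ (1 - p) * (2 ^ J)%:R ^+ m = l.
  rewrite /l p2_nat p2X /p2 -powRrM -powRD ?pnatr_eq0 ?implybT//; congr (_ `^ _).
  by field; rewrite gt_eqF.
have -> : (5 * (2 * 2 ^ J)%N%:R) ^+ m = 10 ^+ m * (2 ^ J)%:R ^+ m :> R.
  by rewrite natrM mulrA -natrM exprMn.
rewrite [(5 * _) ^+ m]exprMn; move: ((3 * c0) ^+ m) => X.
rewrite le_eqVlt; apply/orP; left; apply/eqP.
apply: (@etrans _ _ (2 * X * l + (10 ^+ m + 5 ^+ m) * A * (l `^ (1 - p) * (2 ^ J)%:R ^+ m))); first by ring.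
by rewrite e; ring.
Qed.

Lemma p2_lin (th : R) : 0 < th -> exists2 C, 0 <= C & forall J : nat, J.+1%:R <= C * p2 (th * J%:R).
Proof.
move=> t0; have l2 : 0 < ln 2 :> R by rewrite ln_gt0// ltr1n.
exists (1 + (th * ln 2)^-1); first by rewrite addr_ge0// invr_ge0 mulr_ge0// ltW.
move=> J; rewrite -natr1 /p2 /powR pnatr_eq0 /=.
set z := th * J%:R * ln 2.
have z0 : 0 <= z by rewrite !mulr_ge0// ltW.
have h : 1 + z <= expR z by exact: expR_ge1Dx.
have -> : J%:R = (th * ln 2)^-1 * z :> R.
  by rewrite /z; field; rewrite !gt_eqF.
have i0 : 0 <= (th * ln 2)^-1 by rewrite invr_ge0 mulr_ge0// ltW.
rewrite mulrDl mul1r addrC; apply: lerD; first by apply: le_trans h; rewrite lerDl.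
by apply: ler_wpM2l => //; apply: le_trans h; rewrite lerDr.
Qed.

Definition hpot (J : nat) : tpoly R m := symb (fun k => (qinv k)%:C%C) (tail_list J).

Lemma dle_hpot J : dle (4 * 2 ^ J) (hpot J).
Proof. by rewrite /hpot /tail_list !dle_symb dle_dirichlet. Qed.

(** 1 / Q = (1 - e^(- t Q)) / Q + e^(- t Q) / Q. The first symbol has norm at most t; the second is
    tiny on the block when t is somewhat larger than 4^(- J). *)
Lemma hpot_split J t x : ev (hpot J) x = ev (symb (fun k => (bsym w t k)%:C%C) (tail_list J)) x +
  ev (symb (fun k => (expR (- (t * qform w k)) * qinv k)%:C%C) (tail_list J)) x.
Proof.
rewrite -ev_symbD /hpot /tail_list !symb_comp; congr (ev (symb _ _) x); apply/funext => k.
congr (_ * _).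
have [->|/vdif_low h] := eqVneq (vdif J k) 0; first by rewrite rmorph0 !mulr0.
have Q0 : 0 < qform w k by apply: lt_le_trans h; rewrite exprn_gt0// ltr0n expn_gt0.
congr (_ * _); rewrite -rmorphD /=; congr _%:C%C.
by rewrite /qinv /bsym gt_eqF//; field; rewrite gt_eqF.
Qed.

Lemma fhat_bound k : `|complex.Re (fhat s f k)| <= Int (fun x => `|f x|) /\
  `|complex.Im (fhat s f k)| <= Int (fun x => `|f x|).
Proof.
split=> /=; rewrite ?normrN.
  apply: le_trans (iInt_norm (ing_cos s k fing)) _.
  apply: iInt_le; [exact/ing_norm/ing_cos|exact: ing_norm|move=> x].
  by rewrite normrM ler_piMr// cos_max.
apply: le_trans (iInt_norm (ing_sin s k fing)) _.
apply: iInt_le; [exact/ing_norm/ing_sin|exact: ing_norm|move=> x].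
by rewrite normrM ler_piMr// sin_max.
Qed.

(** Sum of absolute values over the frequencies, of which there are at most 9 2^J in each variable;
    wasteful, but it is used against an exponentially small symbol. *)
Lemma crude_bound (J : nat) (r : freq -> R) (B : R) x : 0 <= B -> (forall k, `|r k * vdif J k| <= B) ->
  `|ev (symb (fun k => (r k)%:C%C) (tail_list J)) x| <=
  9 ^+ m * (2 ^ J)%:R ^+ m * (B * (2 * Int (fun x => `|f x|))).
Proof.
move=> B0 hB; rewrite /tail_list !symb_comp ev_symb /dirichlet big_map.
rewrite (le_trans (ler_norm_sum _ _ _))//.
have F0 : 0 <= Int (fun x => `|f x|) by exact: Int_ge0.
apply: (@le_trans _ _ (\sum_(F : {ffun 'I_m -> 'I_(2 * (4 * 2 ^ J)).+1}) B * (2 * Int (fun x => `|f x|)))).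
  apply: ler_sum => F _; set k := lattice F.
  rewrite -[(1, k).2]/k -[(1, k).1]/1 mulr1.
  have [] := fhat_bound k; case: (fhat s f k) => a c /= ha hc.
  rewrite [X in `|X|](_ : _ = r k * vdif J k * (a * cos (dot k x) - c * sin (dot k x))); last by ring.
  rewrite normrM; apply: ler_pM => //.
  rewrite mulr_natl mulr2n /= (le_trans (ler_normB _ _))//; apply: lerD.
    by rewrite normrM -[X in _ <= X]mulr1; apply: ler_pM => //; exact: cos_max.
  by rewrite normrM -[X in _ <= X]mulr1; apply: ler_pM => //; exact: sin_max.
rewrite sumr_const -[X in X <= _]mulr_natl; apply: ler_wpM2r; first by rewrite !mulr_ge0.
rewrite card_ffun !card_ord natrX -exprMn lerXn2r ?nnegrE ?mulr_ge0//.
have N0 : (0 < 2 ^ J)%N by rewrite expn_gt0.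
by rewrite -natrM ler_nat; move: N0; clear; lia.
Qed.

(** The heat time is t = (m + 2) (J + 1) 4^(- J). On the block e^(- t Q) <= 2^(- (m + 2) J), which
    pays for the 2^(m J) frequencies and leaves 2^(- 2 J). The main term t 2^(J m / p) is of order
    2^(- (2 - m / p) J) up to the factor J + 1, absorbed by the strict inequality kap + m / p <
    2. *)
Lemma hpot_bound : exists2 C, 0 <= C & forall J x, `|ev (hpot J) x| <= C * p2 (- (kap * J%:R)).
Proof.
have [C1 C10 hT] := tail_bound.
have th0 : 0 < 2 - kap - rho by move: (kap2) => h; lra.
have [C2 C20 hJ] := p2_lin th0.
have F0 : 0 <= Int (fun x => `|f x|) by exact: Int_ge0.
have rho0 : 0 <= rho by rewrite divr_ge0// ltW.
pose B0 : R := 2 * 2 ^+ m.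
pose C3 : R := 9 ^+ m * (B0 * (2 * Int (fun x => `|f x|))).
have C30 : 0 <= C3 by rewrite !mulr_ge0// exprn_ge0.
exists ((m.+2)%:R * C2 * C1 + C3); first by rewrite addr_ge0// !mulr_ge0.
move=> J x; pose t : R := m.+2%:R * J.+1%:R * p2 (- (2 * J%:R)).
have t0 : 0 < t by rewrite !mulr_gt0 ?ltr0n// p2_gt0.
rewrite (hpot_split J t) (le_trans (ler_normD _ _))// mulrDl; apply: lerD.
  have dl : dle (4 * 2 ^ J) (tail_list J) by rewrite /tail_list !dle_symb dle_dirichlet.
  apply: le_trans (mbound_bsym w0 t0 dl (hT J) x) _.
  rewrite /t; have h := hJ J.
  have -> : m.+2%:R * C2 * C1 * p2 (- (kap * J%:R)) =
    m.+2%:R * (C2 * p2 ((2 - kap - rho) * J%:R)) * p2 (- (2 * J%:R)) * (C1 * p2 (rho * J%:R)).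
    have -> : - (kap * J%:R) = (2 - kap - rho) * J%:R + - (2 * J%:R) + rho * J%:R by ring.
    by rewrite !p2D; ring.
  apply: ler_wpM2r; first by rewrite mulr_ge0 ?p2_ge0.
  apply: ler_wpM2r; first exact: p2_ge0.
  by apply: ler_wpM2l.
pose e := p2 (- (m.+2%:R * J%:R)) : R.
have hb k : `|expR (- (t * qform w k)) * qinv k * vdif J k| <= e * B0.
  have [->|v0] := eqVneq (vdif J k) 0; first by rewrite mulr0 normr0 mulr_ge0 ?p2_ge0// mulr_ge0// exprn_ge0.
  have h := vdif_low v0; have Q1 : 1 <= qform w k.
    by apply: le_trans h; rewrite exprn_ege1// ler1n expn_gt0.
  have Q0 : 0 < qform w k by exact: lt_le_trans Q1.
  rewrite !normrM; apply: ler_pM => //.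
    rewrite -[X in _ <= X]mulr1; apply: ler_pM => //; last first.
      by rewrite /qinv gt_eqF// ger0_norm ?invr_ge0 ?(ltW Q0)// invf_le1.
    rewrite ger0_norm ?expR_ge0// /e /p2 /powR pnatr_eq0 /= ler_expR mulNr lerN2.
    apply: (@le_trans _ _ (m.+2%:R * J.+1%:R)); last first.
      rewrite /t -mulrA; apply: ler_peMr; first by rewrite mulr_ge0.
      rewrite p2N ler_pdivlMl ?p2_gt0// mulr1; apply: le_trans h.
      by rewrite p2_nat p2X mulrC.
    rewrite -mulrA; apply: ler_wpM2l => //; apply: (@le_trans _ _ (J%:R * 1)).
      by apply: ler_wpM2l => //; rewrite -[2]/(1 + 1); apply: le_ln1Dx; lra.
    by rewrite mulr1 ler_nat.
  rewrite /vdif /B0 mulr_natl mulr2n (le_trans (ler_normB _ _))//.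
  by apply: lerD; exact: vhat_bound.
have e0 : 0 <= e by exact: p2_ge0.
have eB : 0 <= e * B0 by rewrite mulr_ge0// mulr_ge0// exprn_ge0.
apply: le_trans (crude_bound x eB hb) _.
have -> : 9 ^+ m * (2 ^ J)%:R ^+ m * (e * B0 * (2 * Int (fun x => `|f x|))) =
   C3 * ((2 ^ J)%:R ^+ m * e) by rewrite /C3; ring.
apply: ler_wpM2l => //; rewrite p2_nat p2X /e -p2D; apply: p2_le.
have -> : J%:R * m%:R - m.+2%:R * J%:R = - (2 * J%:R) :> R by rewrite -[m.+2%:R]natr1 -[m.+1%:R]natr1; ring.
by rewrite lerN2 ler_wpM2r//; lra.
Qed.

(** The potential of the convolution of f with V_1; the minus sign comes from the symbol - Q of the
    Laplacian. *)
Definition gpot0 : tpoly R m :=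
  symb (fun k => (- qinv k)%:C%C) (symb (fun k => (vhat R 1 k)%:C%C) (symb (fhat s f) (dirichlet R m 2))).

Lemma tp_hpot J : tp (4 * 2 ^ J) (ev (hpot J)).
Proof. by exists (hpot J) => //; exact: dle_hpot. Qed.

Lemma tp_gpot0 : tp 2 (ev gpot0).
Proof. by exists gpot0 => //; rewrite /gpot0 !dle_symb; exact: dle_dirichlet. Qed.

Fixpoint gpot (J : nat) : TP R m :=
  if J is J'.+1 then gpot J' - MkTP (ex_intro (fun K => tp K _) _ (tp_hpot J'))
  else MkTP (ex_intro (fun K => tp K _) _ tp_gpot0).

Lemma tp_gpot J : tp (2 * 2 ^ J) (gpot J).
Proof.
elim: J => [|J IH].
  exact: tp_gpot0.
apply: tpB; first by apply: tp_leq IH; rewrite expnS; lia.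
by have := tp_hpot J; rewrite expnS mulnA.
Qed.

Lemma gpotS J x : gpot J.+1 x - gpot J x = - ev (hpot J) x.
Proof. by rewrite /= addrAC subrr add0r. Qed.

Lemma qform0 (k : freq) : qform w k = 0 -> k = 0.
Proof.
move=> Q0; apply/rowP => a; rewrite mxE; apply/eqP; apply/negP => /negP ka.
have := @qform_ge k a 0; rewrite absz_gt0 => /(_ ka).
have : (1 : R) <= (k 0 a)%:~R ^+ 2.
  have -> : (k 0 a)%:~R ^+ 2 = (absz (k 0 a))%:R ^+ 2 :> R.
    by case: (k 0 a) => z; rewrite ?NegzE ?mulrNz ?sqrrN -?pmulrn.
  by rewrite exprn_ege1// ler1n absz_gt0.
have : (k 0 a)%:~R ^+ 2 <= qform w k :> R.
  rewrite /qform (bigD1 a)//= ler_wpDr//.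
    by apply: sumr_ge0 => b _; rewrite mulr_ge0 ?sqr_ge0.
  by rewrite ler_peMl ?sqr_ge0.
by rewrite Q0 => h1 h2; have := le_trans h2 h1; rewrite ler10.
Qed.

(** The coefficient at 0 is the mean of f, and 0 is the one frequency at which the Laplacian cannot
    be inverted. *)
Lemma fhat0 : fhat s f 0 = 0.
Proof.
rewrite /fhat /cosint /sinint (_ : (fun y => _) = f); last first.
  by apply/funext => y; rewrite dot0l cos0 mulr1.
rewrite fint (_ : (fun y => f y * sin _) = fun=> 0) ?Int0 ?oppr0//.
by apply/funext => y; rewrite dot0l sin0 mulr0.
Qed.

Lemma lap_gpot J x : \sum_a w a * td a (td a (gpot J)) x = Int (fun y => f y * VP (2 ^ J) (x - s *: y)).
Proof.
elim: J => [|J IH].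
  under eq_bigr => a _ do rewrite !td_fun /=.
  rewrite lap_symb /gpot0 !symb_comp expn0.
  rewrite (_ : symb _ _ = symb (fhat s f) (symb (fun k => (vhat R 1 k)%:C%C) (dirichlet R m 2))).
    by rewrite ev_fhat//; congr Int; apply/funext => y; rewrite (@VP_ev R m 1 2 _ isT).
  rewrite symb_comp; congr symb; apply/funext => k.
  rewrite -rmorphM /= /qinv; case: (eqVneq (qform w k) 0) => [/qform0 ->|Q0].
    by rewrite fhat0 !(mulr0, mul0r).
  by rewrite mulrNN divff// mul1r mulrC.
have h : \sum_a w a * partial a (partial a (ev (hpot J))) x = - ev (tail_list J) x.
  rewrite lap_symb /hpot symb_comp -mulN1r -ev_symbZ /tail_list !symb_comp.
  congr (ev (symb _ _) x); apply/funext => k.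
  congr (_ * _); have [->|/vdif_low hk] := eqVneq (vdif J k) 0; first by rewrite rmorph0 !mulr0.
  congr (_ * _); rewrite -rmorphM /= /qinv gt_eqF; last first.
    by apply: lt_le_trans hk; rewrite exprn_gt0// ltr0n expn_gt0.
  rewrite mulNr divff// gt_eqF//.
  by apply: lt_le_trans hk; rewrite exprn_gt0// ltr0n expn_gt0.
have -> : \sum_a w a * td a (td a (gpot J.+1)) x =
    \sum_a w a * td a (td a (gpot J)) x - \sum_a w a * partial a (partial a (ev (hpot J))) x.
  rewrite -sumrB; apply: eq_bigr => a _; rewrite -mulrBr; congr (_ * _).
  rewrite -[gpot J.+1]/(gpot J - MkTP (ex_intro (fun K => tp K _) _ (tp_hpot J))) !tdB TPE.
  by congr (_ - _); rewrite !td_fun.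
by rewrite IH h tail_listE expnS; ring.
Qed.

End potential.
(** * From the torus to the domain *)

Lemma eq_eps (R : realType) (X Y C : R) : (forall e, 0 < e -> `|X - Y| <= C * e) -> X = Y.
Proof.
move=> h; apply/eqP; rewrite -subr_eq0 -normr_le0; apply/ler_addgt0Pr => e e0; rewrite add0r.
have C0 : 0 < `|C| + 1 by rewrite ltr_wpDl.
apply: le_trans (h (e / (`|C| + 1)) _) _; first by rewrite divr_gt0.
rewrite mulrCA ger_pMr// ler_pdivrMr// mul1r.
by apply: le_trans (ler_norm C) _; rewrite lerDl.
Qed.

Section test_functions.
Variables (R : realType) (m : nat) (s : R) (D : set 'rV[R]_m).
Local Notation E := 'rV[R]_m.
Local Notation T := (TP R m).
Implicit Types phi : E -> R.

Lemma test_cont phi : test_function D phi -> continuous phi.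
Proof. by move=> [/(_ 0%N) /= h _ _] x; apply: h; rewrite inE. Qed.

Lemma test_derive phi k x : test_function D phi -> is_derive x (delta_mx 0 k) phi (partial k phi x).
Proof. by move=> [/(_ 1%N) /= [_ h _] _ _]; apply/derivableP; exact: h. Qed.

Lemma test_out phi x : test_function D phi -> ~ D x -> phi x = 0.
Proof.
move=> [_ _ h] Dx; apply/eqP; apply/negPn/negP => px; apply: Dx; apply: h.
exact: subset_closure.
Qed.

Lemma test_partial phi k : test_function D phi -> test_function D (partial k phi).
Proof.
move=> [h1 h2 h3].
have sub : closure [set x | partial k phi x != 0] `<=` closure [set x | phi x != 0].
  rewrite [X in _ `<=` X](closure_id _).1; last exact: closed_closure.
  apply: closureS => x /= px; apply: contrapT => hx; move/negP: px; apply; apply/eqP.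
  have op : open (~` closure [set x | phi x != 0]) by apply: closed_openC; exact: closed_closure.
  have nx : \forall y \near x, phi y = cst (0 : R) y.
    have : nbhs x (~` closure [set x | phi x != 0]) by apply: open_nbhs_nbhs.
    apply: filterS => y hy /=; apply/eqP; apply/negPn/negP => py; apply: hy.
    exact: subset_closure.
  by rewrite /partial (near_eq_derive _ nx) derive_cst.
split.
- by move=> r; have [_ _] := h1 r.+1; exact.
- by apply: subclosed_compact h2 sub; exact: closed_closure.
- exact: subset_trans sub h3.
Qed.

Lemma test_box phi : test_function D phi -> exists L, forall x, ~ box m L x -> phi x = 0.
Proof.
move=> [_ h2 _]; have [L _ hL] := box_bounded (compact_bounded h2).
exists L => x hx; apply/eqP; apply/negPn/negP => px; apply: hx; apply: hL.
exact: subset_closure.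
Qed.

Lemma test_bsf phi : test_function D phi -> bsf phi.
Proof. by move=> h; have [L hL] := test_box h; apply: (cont_bsf (test_cont h)) hL. Qed.

Lemma Int_test (h phi : E -> R) : test_function D phi ->
  \int[lebesgue_rV R m]_(x in D) (h x * phi x) = Int (fun x => h x * phi x).
Proof.
move=> tp; rewrite Rintegral_mkcond; congr Rintegral; apply/funext => x; rewrite patchE.
by case: ifPn => // hx; rewrite (test_out tp) ?mulr0//; move/negP: hx; rewrite inE.
Qed.

Lemma cont_TPs (F : T) : continuous (fun x : E => F (s *: x)).
Proof. by have [K [t _ ->]] := tpP F; exact: continuous_evZ. Qed.

Lemma derive_TPs (F : T) k x :
  is_derive x (delta_mx 0 k) (fun x : E => F (s *: x)) (s * td k F (s *: x)).
Proof.
apply: is_derive_line; have [K tF] := tpP F.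
have hl : is_derive (0 : R) (1 : R) (fun t : R => s * t) s by apply: is_derive_eq; rewrite /GRing.scale /=; ring.
have h0 : is_derive (s * 0 : R) (1 : R) (fun t : R => F (t *: delta_mx 0 k + s *: x)) (td k F (s *: x)).
  by apply: is_derive_along; rewrite mulr0 scale0r add0r tdE; exact: tp_is_derive tF.
have := @is_derive1_comp R (fun t : R => F (t *: delta_mx 0 k + s *: x)) (fun t => s * t) 0 _ _ h0 hl.
rewrite mulrC; congr (is_derive _ _ _ _); apply/funext => t /=.
by rewrite scalerDr scalerA.
Qed.

(** The pairing of F, dilated to the scale of the domain, with a test function. *)
Definition Lam phi (F : T) : R := Int (fun x => F (s *: x) * phi x).

Lemma bsf_TPs phi (F : T) : test_function D phi -> bsf (fun x => F (s *: x) * phi x).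
Proof. by move=> /test_bsf h; apply: bsf_cont => //; exact: cont_TPs. Qed.

Lemma LamD phi F G : test_function D phi -> Lam phi (F + G) = Lam phi F + Lam phi G.
Proof.
move=> h; rewrite /Lam -IntD; [|exact: bsf_TPs|exact: bsf_TPs].
by congr Int; apply/funext => x; rewrite TPE mulrDl.
Qed.

Lemma LamN phi F : test_function D phi -> Lam phi (- F) = - Lam phi F.
Proof.
move=> h; rewrite /Lam -IntN; last exact: bsf_TPs.
by congr Int; apply/funext => x; rewrite TPE mulNr.
Qed.

Lemma LamZ phi c F : test_function D phi -> Lam phi (TPcst _ c * F) = c * Lam phi F.
Proof.
move=> h; rewrite /Lam -IntZ; last exact: bsf_TPs.
by congr Int; apply/funext => x; rewrite TPE mulrA.
Qed.

Lemma Lam_sum phi (I : Type) (r : seq I) (P : pred I) (F : I -> T) : test_function D phi ->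
  Lam phi (\sum_(i <- r | P i) F i) = \sum_(i <- r | P i) Lam phi (F i).
Proof.
move=> h; rewrite (big_morph (Lam phi) (id1 := 0) (op1 := +%R))//.
  by move=> F1 F2; exact: LamD.
by rewrite -[RHS](@Int0 R m); congr Int; apply/funext => x; rewrite TPE mul0r.
Qed.

Lemma Lam_ibp phi k F : test_function D phi -> Lam (partial k phi) F = - s * Lam phi (td k F).
Proof.
move=> tp; have tp' := test_partial k tp.
have [L hL] := test_box tp; have [L' hL'] := test_box tp'.
have hb : forall x, ~ box m (Num.max L L') x -> phi x = 0 /\ partial k phi x = 0.
  move=> x hx; split; [apply: hL|apply: hL'] => h; apply: hx => a; have := h a;
    by rewrite /= !in_itv /= -!ler_norml le_max => ->; rewrite ?orbT.
have : Int (fun x => s * (td k F (s *: x) * phi x) + F (s *: x) * partial k phi x) = 0.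
  apply: (@Int_partial0 R m k (fun x => F (s *: x) * phi x) _ (Num.max L L')).
  - apply: contD; last by apply: contM; [exact: cont_TPs | exact: test_cont].
    apply: contM; first exact: contC.
    by apply: contM; [exact: cont_TPs | exact: test_cont].
  - move=> x; have h1 := derive_TPs F k x; have h2 := test_derive k x tp.
    apply: is_derive_eq (is_deriveM h1 h2) _.
    by rewrite /GRing.scale /=; ring.
  - by move=> x /hb[-> ->]; rewrite !mulr0 addr0.
rewrite IntD; [|by apply: bsfZ; exact: bsf_TPs|exact: bsf_TPs].
rewrite IntZ; last exact: bsf_TPs.
by rewrite /Lam => h; lra.
Qed.

Lemma Lam_ibp2 phi a b F : test_function D phi ->
  Lam (partial a (partial b phi)) F = s ^+ 2 * Lam phi (td a (td b F)).
Proof.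
by move=> h; rewrite Lam_ibp ?Lam_ibp//; [rewrite tdC; ring | exact: test_partial].
Qed.

Lemma Lam_approx phi (U : E -> R) (F : T) e : test_function D phi -> continuous U ->
  (forall x, `|F x - U x| <= e) ->
  `|Int (fun x => U (s *: x) * phi x) - Lam phi F| <= e * Int (fun x => `|phi x|).
Proof.
move=> h cU hF; apply: Int_approx; [exact: test_bsf| |exact: bsf_TPs|by move=> x; rewrite distrC].
apply: bsf_cont; last exact: test_bsf.
move=> x; apply: (continuous_comp (f := fun x : E => s *: x)); last exact: cU.
exact: scaler_continuous.
Qed.

End test_functions.

Lemma min_bound (R : realType) (e e' a k1 k2 : R) : e' <= e -> 0 <= a * k1 -> 0 <= a * k2 ->
  e' * a * k1 + e' * a * k2 <= (a * k1 + a * k2) * e.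
Proof.
move=> h h1 h2; have -> : e' * a * k1 + e' * a * k2 = (a * k1 + a * k2) * e' by ring.
by apply: ler_wpM2l => //; exact: addr_ge0.
Qed.

(** * The Hessian of the limit *)

Section hessian_limit.
Variables (R : realType) (n : nat).
Local Notation m := (n.+2 + n.+2)%N.
Local Notation E := 'rV[R]_m.
Local Notation T := (TP R m).
Local Notation X := (@lshift n.+2 n.+2).
Local Notation Y := (@rshift n.+2 n.+2).
Local Notation dd u := (fun a b : 'I_m => td a u * td b u).
Local Notation I4 := ('I_m * 'I_m * 'I_m * 'I_m)%type.
Variables (i0 i1 : 'I_n.+2).
Local Notation wlap := (@wlap R n.+2 i0 i1).

(** The real and the imaginary part of the Hessian are stored as lists of signed index quadruples,
    so that integrals and limits are treated once for both. *)
Definition comb (L : 'I_n.+2 -> 'I_n.+2 -> seq (R * I4)) (Q : I4 -> R) : R :=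
  \sum_i \sum_(j | j != i) \sum_(t <- L i j) t.1 * Q t.2.

(* An index (c, d, e, f) stands for the integral of [d_c u * d_d u * d_e (d_f phi)]. *)
Definition reL (i j : 'I_n.+2) : seq (R * I4) :=
  [:: (1, (X i, X i, X j, X j)); (1, (Y i, Y i, X j, X j)); (1, (X i, X i, Y j, Y j));
      (1, (Y i, Y i, Y j, Y j)); (-1, (X i, X j, X j, X i)); (-1, (Y i, Y j, X j, X i));
      (-1, (X i, X j, Y j, Y i)); (-1, (Y i, Y j, Y j, Y i)); (1, (X i, Y j, X j, Y i));
      (-1, (Y i, X j, X j, Y i)); (-1, (X i, Y j, Y j, X i)); (1, (Y i, X j, Y j, X i))].
Definition imL (i j : 'I_n.+2) : seq (R * I4) :=
  [:: (1, (X i, X i, X j, Y j)); (1, (Y i, Y i, X j, Y j)); (-1, (X i, X i, Y j, X j));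
      (-1, (Y i, Y i, Y j, X j)); (-1, (X i, Y j, X j, X i)); (1, (Y i, X j, X j, X i));
      (-1, (X i, Y j, Y j, Y i)); (1, (Y i, X j, Y j, Y i)); (-1, (X i, X j, X j, Y i));
      (-1, (Y i, Y j, X j, Y i)); (1, (X i, X j, Y j, X i)); (1, (Y i, Y j, Y j, X i))].

Lemma comb_le L (Q Q' : I4 -> R) B : (forall x, `|Q x - Q' x| <= B) ->
  `|comb L Q - comb L Q'| <= comb (fun i j => [seq (`|t.1|, t.2) | t <- L i j]) (fun=> B).
Proof.
move=> h; rewrite /comb -sumrB (le_trans (ler_norm_sum _ _ _))//; apply: ler_sum => i _.
rewrite -sumrB (le_trans (ler_norm_sum _ _ _))//; apply: ler_sum => j _.
rewrite -sumrB (le_trans (ler_norm_sum _ _ _))// big_map; apply: ler_sum => t _.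
by rewrite -mulrBr normrM ler_wpM2l.
Qed.

Lemma combZ L (c : R) (Q : I4 -> R) : comb L (fun x => c * Q x) = c * comb L Q.
Proof.
rewrite /comb mulr_sumr; apply: eq_bigr => i _; rewrite mulr_sumr; apply: eq_bigr => j _.
by rewrite mulr_sumr; apply: eq_bigr => t _; rewrite mulrCA.
Qed.

Lemma Int_comb L (Q : I4 -> E -> R) : (forall x, bsf (Q x)) ->
  bsf (fun x => comb L (fun q => Q q x)) /\
  Int (fun x => comb L (fun q => Q q x)) = comb L (fun q => Int (Q q)).
Proof.
move=> hQ; have h1 t : bsf (fun x => t.1 * Q t.2 x) by exact: bsfZ.
have h2 i j : bsf (fun x => \sum_(t <- L i j) t.1 * Q t.2 x) by exact: bsf_sum.
have h3 i : bsf (fun x => \sum_(j | j != i) \sum_(t <- L i j) t.1 * Q t.2 x) by exact: bsf_sum.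
split; first exact: bsf_sum.
rewrite /comb Int_sum//; apply: eq_bigr => i _; rewrite Int_sum//; apply: eq_bigr => j _.
by rewrite Int_sum//; apply: eq_bigr => t _; rewrite IntZ.
Qed.

(** Under the two symmetries the twelve terms of a pair become t i j - t j i, and the sum over
    ordered pairs cancels. *)
Lemma comb_im0 (J : I4 -> R) : (forall c d e f, J (c, d, e, f) = J (d, c, e, f)) ->
  (forall c d e f, J (c, d, e, f) = J (c, d, f, e)) -> comb imL J = 0.
Proof.
move=> s1 s2; rewrite /comb.
pose t i j := - J (X i, Y j, X j, X i) - J (X i, Y j, Y j, Y i) - J (X i, X j, X j, Y i) -
  J (Y i, Y j, X j, Y i).
transitivity (\sum_i \sum_(j | j != i) (t i j - t j i)).
  apply: eq_bigr => i _; apply: eq_bigr => j _; rewrite !big_cons big_nil /= /t.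
  rewrite (s2 (X i) (X i) (Y j) (X j)) (s2 (Y i) (Y i) (Y j) (X j)).
  rewrite (s1 (X j) (Y i) (X i) (X j)) (s2 (Y i) (X j) (X i) (X j)).
  rewrite (s1 (X j) (Y i) (Y i) (Y j)) (s2 (Y i) (X j) (Y i) (Y j)).
  rewrite (s1 (X j) (X i) (X i) (Y j)) (s2 (X i) (X j) (X i) (Y j)).
  rewrite (s1 (Y j) (Y i) (X i) (Y j)) (s2 (Y i) (Y j) (X i) (Y j)).
  by ring.
under eq_bigr => i _ do rewrite sumrB.
by rewrite sumrB (sum_offdiag_swap (fun i j => t j i)) subrr.
Qed.

Variables (s : R) (D : set E) (phi : E -> R).
Hypothesis tphi : test_function D phi.
Variables (V : 'I_m -> E -> R) (C : R).
Hypothesis cV : forall a, continuous (V a).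
Hypothesis bV : forall a x, `|V a x| <= C.

Let d2 (q : I4) := partial q.1.2 (partial q.2 phi).
Let td2 q : test_function D (d2 q). Proof. by apply: test_partial; exact: test_partial. Qed.

Definition Jint (q : I4) : R := Int (fun x => V q.1.1.1 (s *: x) * V q.1.1.2 (s *: x) * d2 q x).

Lemma comb_hop (u : T) :
  comb reL (fun q => Lam s (d2 q) (td q.1.1.1 u * td q.1.1.2 u)) = s ^+ 2 * Lam s phi (hop (dd u)).
Proof.
have -> : (fun q => Lam s (d2 q) (td q.1.1.1 u * td q.1.1.2 u)) =
    (fun q => s ^+ 2 * Lam s phi (td q.1.2 (td q.2 (td q.1.1.1 u * td q.1.1.2 u)))).
  by apply/funext => q; rewrite /d2 (Lam_ibp2 _ _ _ _ tphi).
rewrite combZ; congr (_ * _); rewrite /hop (Lam_sum _ _ _ _ tphi); apply: eq_bigr => i _.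
rewrite (Lam_sum _ _ _ _ tphi); apply: eq_bigr => j _.
rewrite !big_cons big_nil /= /hterm /lap !(tdD, tdN) !(LamD _ _ _ tphi, LamN _ _ tphi, LamD _ _ _ tphi).
rewrite !(tdC (X i) (X j)) !(tdC (Y i) (Y j)).
by ring.
Qed.

Lemma Jint_approx (u : T) e : 0 < e -> e <= 1 -> (forall a x, `|td a u x - V a x| <= e) ->
  forall q, `|Jint q - Lam s (d2 q) (td q.1.1.1 u * td q.1.1.2 u)| <=
    e * (2 * C + 1) * Int (fun x => `|d2 q x|).
Proof.
move=> e0 e1 hu q.
apply: (@Lam_approx R m s D (d2 q) (fun x => V q.1.1.1 x * V q.1.1.2 x)); first exact: td2.
  exact: contM.
move=> x; rewrite TPE; set a := td _ _ x; set b := td _ _ x.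
have -> : a * b - V q.1.1.1 x * V q.1.1.2 x =
  (a - V q.1.1.1 x) * (b - V q.1.1.2 x) + (a - V q.1.1.1 x) * V q.1.1.2 x +
  V q.1.1.1 x * (b - V q.1.1.2 x) by ring.
have C0 : 0 <= C by exact: le_trans (bV q.2 x).
have -> : e * (2 * C + 1) = e * 1 + e * C + C * e by ring.
rewrite (le_trans (ler_normD _ _))//; apply: lerD; last first.
  by rewrite normrM; apply: ler_pM; rewrite ?normr_ge0 ?bV ?hu.
rewrite (le_trans (ler_normD _ _))//; apply: lerD; last first.
  by rewrite normrM; apply: ler_pM; rewrite ?normr_ge0 ?bV ?hu.
by rewrite normrM; apply: ler_pM => //; [exact: hu | apply: le_trans e1; exact: hu].
Qed.

Variables (H : E -> R) (Lval : R).
Hypothesis happrox : forall e, 0 < e -> exists u g : T, [/\ hop (dd u) = wlap g,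
  forall a x, `|td a u x - V a x| <= e & forall x, `|g x - H x| <= e].
Hypothesis hpot : forall e, 0 < e -> exists t : T, (forall x, `|t x - H x| <= e) /\
  `|Lam s phi (wlap t) - Lval| <= e.

(** The product of V c and V d is approximated by a trigonometric polynomial; both derivatives are
    moved from phi onto it, commuted there, and moved back. *)
Lemma Jint_sym2 c d e f : Jint (c, d, e, f) = Jint (c, d, f, e).
Proof.
pose K1 := Int (fun x => `|partial e (partial f phi) x|).
pose K2 := Int (fun x => `|partial f (partial e phi) x|).
apply: (@eq_eps R _ _ ((2 * C + 1) * K1 + (2 * C + 1) * K2)) => eps eps0.
have e'0 : 0 < Num.min eps 1 by rewrite lt_min eps0 ltr01.
have [u [g [_ hu _]]] := happrox e'0.
have e1 : Num.min eps 1 <= 1 by rewrite ge_min lexx orbT.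
have ee : Num.min eps 1 <= eps by rewrite ge_min lexx.
have C0 : 0 <= C by exact: le_trans (bV c 0).
have K10 : 0 <= (2 * C + 1) * K1 by apply: mulr_ge0; [lra | exact: Int_ge0].
have K20 : 0 <= (2 * C + 1) * K2 by apply: mulr_ge0; [lra | exact: Int_ge0].
have [A1 [h1 h2]] : exists A1, `|Jint (c, d, e, f) - A1| <= Num.min eps 1 * (2 * C + 1) * K1 /\
    `|Jint (c, d, f, e) - A1| <= Num.min eps 1 * (2 * C + 1) * K2.
  exists (Lam s (partial e (partial f phi)) (td c u * td d u)); split.
    exact: (Jint_approx e'0 e1 hu (c, d, e, f)).
  rewrite [Lam _ _ _](_ : _ = Lam s (partial f (partial e phi)) (td c u * td d u)).
    exact: (Jint_approx e'0 e1 hu (c, d, f, e)).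
  apply: etrans (Lam_ibp2 s e f _ tphi) _; apply: etrans _ (esym (Lam_ibp2 s f e _ tphi)).
  by rewrite (tdC e f).
move: (Jint (c, d, e, f)) (Jint (c, d, f, e)) h1 h2 => j1 j2 h1 h2.
rewrite -(subrKA A1) (le_trans (ler_normD _ _))// [`|A1 - j2|]distrC.
apply: le_trans (lerD h1 h2) _.
exact: min_bound.
Qed.

Lemma Jint_sym1 c d e f : Jint (c, d, e, f) = Jint (d, c, e, f).
Proof. by congr Int; apply/funext => x /=; rewrite [V c _ * _]mulrC. Qed.

Lemma comb_Jint_im : comb imL Jint = 0.
Proof. by apply: comb_im0 => c d e f; [exact: Jint_sym1 | exact: Jint_sym2]. Qed.

Lemma Lam_wlap (F : T) : Lam s phi (wlap F) =
  \sum_a hweight R i0 i1 a * Lam s phi (td a (td a F)).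
Proof.
rewrite /wlap (Lam_sum _ _ _ _ tphi); apply: eq_bigr => a _; exact: LamZ tphi.
Qed.

(** A chain of approximations: V is close to the gradient of u, so the left side is close to the
    pairing of [hop (dd u)], which is [wlap g], with phi; g and t are both uniformly close to H, so
    the pairings of [wlap g] and [wlap t] are close once the derivatives are on phi; and the pairing
    of [wlap t] is close to [Lval]. *)
Lemma comb_Jint_re : s != 0 -> comb reL Jint = s ^+ 2 * Lval.
Proof.
move=> s0; have C0 : 0 <= C by exact: le_trans (bV (X i0) 0).
pose S q := Int (fun x => `|d2 q x|).
pose B0 := (2 * C + 1) * \sum_q S q.
have S0 q : 0 <= S q by apply: Int_ge0 => x.
have B00 : 0 <= B0 by rewrite mulr_ge0 ?addr_ge0 ?mulr_ge0// sumr_ge0.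
pose aL := fun i j => [seq (`|t.1|, t.2) | t <- reL i j].
pose W := \sum_a hweight R i0 i1 a * Int (fun x => `|partial a (partial a phi) x|).
apply: (@eq_eps R _ _ (comb aL (fun=> B0) + 2 * W + s ^+ 2)) => eps eps0.
(* The error of a product of two approximations has a quadratic part; capping at 1 makes it
   linear. *)
have e'0 : 0 < Num.min eps 1 by rewrite lt_min eps0 ltr01.
have e1 : Num.min eps 1 <= 1 by rewrite ge_min lexx orbT.
have ee : Num.min eps 1 <= eps by rewrite ge_min lexx.
have [u [g [hug hu hg]]] := happrox e'0.
have [t [ht hL]] := hpot eps0.
have h1 : `|comb reL Jint - s ^+ 2 * Lam s phi (hop (dd u))| <= comb aL (fun=> B0) * eps.
  rewrite -comb_hop; apply: le_trans (comb_le _ (B := eps * B0) _) _.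
    move=> q; apply: le_trans (Jint_approx e'0 e1 hu q) _; rewrite -mulrA.
    apply: ler_pM => //; first exact: ltW.
      by rewrite mulr_ge0 ?addr_ge0 ?mulr_ge0//; exact: S0.
    apply: ler_wpM2l; first by rewrite addr_ge0 ?mulr_ge0.
    by rewrite (bigD1 q)//= lerDl sumr_ge0.
  by rewrite (combZ aL eps (fun=> B0)) mulrC.
have h2 : `|s ^+ 2 * Lam s phi (wlap g) - s ^+ 2 * Lam s phi (wlap t)| <= 2 * W * eps.
  have -> : 2 * W * eps = \sum_a 2 * (hweight R i0 i1 a * Int (fun x => `|partial a (partial a phi) x|)) * eps.
    by rewrite /W mulr_sumr mulr_suml.
  rewrite !Lam_wlap [s ^+ 2 * \sum_a hweight R i0 i1 a * Lam s phi (td a (td a g))]mulr_sumr.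
  rewrite [s ^+ 2 * \sum_a hweight R i0 i1 a * Lam s phi (td a (td a t))]mulr_sumr.
  rewrite -sumrB (le_trans (ler_norm_sum _ _ _))//.
  apply: ler_sum => a _.
  have w0 : 0 <= hweight R i0 i1 a by rewrite addr_ge0.
  have -> : s ^+ 2 * (hweight R i0 i1 a * Lam s phi (td a (td a g))) -
     s ^+ 2 * (hweight R i0 i1 a * Lam s phi (td a (td a t))) =
     hweight R i0 i1 a * (Lam s (partial a (partial a phi)) g - Lam s (partial a (partial a phi)) t).
    rewrite (Lam_ibp2 s a a g tphi) (Lam_ibp2 s a a t tphi).
    by move: (Lam s phi (td a (td a g))) (Lam s phi (td a (td a t))) => y1 y2; ring.
  have -> : 2 * (hweight R i0 i1 a * Int (fun x => `|partial a (partial a phi) x|)) * eps =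
    hweight R i0 i1 a * (2 * eps * Int (fun x => `|partial a (partial a phi) x|)) by ring.
  rewrite normrM ger0_norm//; apply: ler_wpM2l => //.
  have tt : test_function D (partial a (partial a phi)) by apply: test_partial; exact: test_partial.
  apply: Int_approx; [exact: test_bsf tt|exact: bsf_TPs tt|exact: bsf_TPs tt|move=> x].
  rewrite -[X in `|X|](subrKA (H (s *: x))) -[X in _ + X]opprB.
  rewrite (le_trans (ler_normB _ _))// mulr_natl mulr2n lerD//.
  exact: le_trans (hg _) ee.
rewrite -(subrKA (s ^+ 2 * Lam s phi (hop (dd u)))) (le_trans (ler_normD _ _))// mulrDl mulrDl -addrA lerD//.
rewrite hug -(subrKA (s ^+ 2 * Lam s phi (wlap t))) (le_trans (ler_normD _ _))// lerD//.
by rewrite -mulrBr normrM ger0_norm ?sqr_ge0// ler_wpM2l// sqr_ge0.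
Qed.

End hessian_limit.

Lemma cont_eps (R : realType) (T : topologicalType) (f : T -> R) :
  (forall x e, 0 < e -> \forall y \near x, `|f x - f y| <= e) -> continuous f.
Proof. by move=> h x; apply/cvgrPdist_le => e; exact: h. Qed.

Lemma eps_cont (R : realType) (T : topologicalType) (f : T -> R) (x : T) (e : R) :
  continuous f -> 0 < e -> \forall y \near x, `|f x - f y| <= e.
Proof. by move=> cf; move/cvgrPdist_le: (cf x); apply. Qed.

(** * Regularity and weak gradient of the limit *)

Section scaled_limit.
Variables (R : realType) (m : nat) (s : R) (D : set 'rV[R]_m).
Local Notation E := 'rV[R]_m.
Local Notation T := (TP R m).
Hypothesis s0 : 0 < s.
Variables (U : E -> R) (V : 'I_m -> E -> R) (C beta : R).
Hypothesis beta0 : 0 < beta.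
Hypothesis happ : forall e, 0 < e -> exists t : T, (forall x, `|t x - U x| <= e) /\
  forall a x, `|td a t x - V a x| <= e.
Hypothesis hV : forall a (x y : E) (d : R), 0 < d -> (forall c, `|y 0 c - x 0 c| <= d) ->
  `|V a y - V a x| <= C * d `^ beta.
Hypothesis bV : forall a x, `|V a x| <= C.

Let u (x : E) : R := U (s *: x).
Let g a (x : E) : R := s * V a (s *: x).

Lemma is_derive_holder (f : E -> R) (x v : E) (d K : R) :
  (forall t, `|f (t *: v + x) - f x - t * d| <= K * `|t| `^ beta * `|t|) -> is_derive x v f d.
Proof.
move=> hf; have h : h^-1 *: (f (h *: v + x) - f x) @[h --> 0^'] --> d.
  apply/cvgrPdist_le => e e0.
  have K0 : 0 < `|K| + 1 by rewrite ltr_wpDl.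
  pose r := (e / (`|K| + 1)) `^ beta^-1.
  have r0 : 0 < r by rewrite powR_gt0// divr_gt0.
  near=> h.
  have h0 : h != 0 by near: h; exact: nbhs_dnbhs_neq.
  have hr : `|h| <= r by near: h; exact: dnbhs0_le.
  rewrite distrC; have -> : h^-1 *: (f (h *: v + x) - f x) - d = h^-1 * (f (h *: v + x) - f x - h * d).
    by rewrite mulrBr mulKf.
  rewrite normrM normfV ler_pdivrMl ?normr_gt0// [X in _ <= X]mulrC (le_trans (hf h))//.
  apply: ler_wpM2r => //; apply: (@le_trans _ _ ((`|K| + 1) * r `^ beta)).
    apply: (@le_trans _ _ ((`|K| + 1) * `|h| `^ beta)).
      apply: ler_wpM2r; first exact: powR_ge0.
      by rewrite (le_trans (ler_norm _))// lerDl.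
    apply: ler_wpM2l; first exact: ltW.
    by apply: ge0_ler_powR; rewrite ?nnegrE ?(ltW beta0) ?(ltW r0).
  rewrite /r -powRrM mulVf ?gt_eqF// powRr1; last by rewrite divr_ge0// ltW.
  by rewrite mulrC divfK// gt_eqF.
by apply: DeriveDef; [exact: cvgP h | exact: cvg_lim h].
Unshelve. all: by end_near. Qed.

(** The mean value theorem is applied to an approximant, whose gradient is close to V; Hoelder
    continuity of V compares the intermediate point with x. For fixed t the approximation error is
    then sent to 0. *)
Lemma scaled_taylor a x t :
  `|u (t *: delta_mx 0 a + x) - u x - t * g a x| <= s * C * s `^ beta * `|t| `^ beta * `|t|.
Proof.
have [->|t0] := eqVneq t 0.
  by rewrite scale0r add0r subrr mul0r subr0 normr0 mulr0.
have st0 : 0 < s * `|t| by rewrite mulr_gt0// normr_gt0.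
apply/ler_addgt0Pr => e e0.
(* The approximant enters through two values and, with weight s |t|, one derivative: the total error
   w (2 + s |t|) is e. *)
pose w := e / (2 + s * `|t|).
have w0 : 0 < w by rewrite divr_gt0// addr_gt0.
have [F [hF hd]] := happ w0.
have dF y : is_derive y (delta_mx 0 a) (fun x => F (s *: x)) (s * td a F (s *: y)).
  exact: derive_TPs.
have [z hz] := @mvt_along R m (fun x => F (s *: x)) (delta_mx 0 a) x t (fun y => @ex_derive _ _ _ _ _ _ _ (dF y)).
rewrite derive_val => Ez; set y := z *: delta_mx 0 a + x in Ez.
have hVy : `|V a (s *: y) - V a (s *: x)| <= C * (s * `|t|) `^ beta.
  apply: hV => // c; rewrite !mxE -mulrBr addrK normrM gtr0_norm// ler_pM2l//.
  rewrite eqxx /= normrM (le_trans _ hz)// ler_piMr//.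
  by case: (_ == _); rewrite ?normr1 ?normr0.
have -> : u (t *: delta_mx 0 a + x) - u x - t * g a x =
    - (F (s *: (t *: delta_mx 0 a + x)) - u (t *: delta_mx 0 a + x)) + (F (s *: x) - u x) +
    t * s * ((td a F (s *: y) - V a (s *: y)) + (V a (s *: y) - V a (s *: x))).
  move: Ez; rewrite /g; move: (F _) (F _) (u _) (u _) (V a _) (V a _) (td _ _ _) => A1 A2 A3 A4 A5 A6 A7 Ez.
  have -> : t * s * (A7 - A5 + (A5 - A6)) = t * (s * A7) - t * (s * A6) by ring.
  by rewrite -Ez; ring.
apply: (@le_trans _ _ (w + w + `|t| * s * (w + C * (s * `|t|) `^ beta))).
  rewrite (le_trans (ler_normD _ _))//; apply: lerD.
    by rewrite (le_trans (ler_normD _ _))// normrN; apply: lerD; exact: hF.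
  rewrite normrM normrM (gtr0_norm s0); apply: ler_wpM2l; first by rewrite mulr_ge0// ltW.
  by rewrite (le_trans (ler_normD _ _))//; apply: lerD.
rewrite powRM ?(ltW s0)//; have -> : e = w * (2 + s * `|t|).
  by rewrite /w divfK// gt_eqF// addr_gt0.
by move: (w) (s `^ beta) (`|t| `^ beta) `|t| => w1 w2 w3 w4; rewrite le_eqVlt; apply/orP; left; apply/eqP; ring.
Qed.

Lemma scaled_derive a x : is_derive x (delta_mx 0 a) u (g a x).
Proof. by apply: is_derive_holder => t; exact: scaled_taylor. Qed.

Lemma scaled_partial a : partial a u = g a.
Proof. by apply/funext => x; rewrite /partial; have h := scaled_derive a x; exact: derive_val. Qed.

Let C0 : 'I_m -> 0 <= C. Proof. by move=> a; exact: le_trans (bV a 0). Qed.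

Lemma cont_limit_grad a : continuous (V a).
Proof.
apply: cont_eps => x e e0.
have K0 : 0 < C + 1 by rewrite ltr_wpDl// (C0 a).
pose r := (e / (C + 1)) `^ beta^-1.
have r0 : 0 < r by rewrite powR_gt0// divr_gt0.
near=> y.
have hy : ball x r y by near: y; exact: nbhsx_ballx.
apply: (@le_trans _ _ (C * r `^ beta)).
  apply: hV => // c; apply: ltW; exact: (hy.2 0 c).
rewrite /r -powRrM mulVf ?gt_eqF// powRr1; last by rewrite divr_ge0// ltW.
by rewrite mulrA ler_pdivrMr// mulrC ler_pM2l// lerDl.
Unshelve. all: by end_near. Qed.

Lemma cont_limit : continuous U.
Proof.
apply: cont_eps => x e e0.
have e3 : 0 < e / 3 by rewrite divr_gt0.
have [t [ht _]] := happ e3.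
have ct : continuous (fun x : E => t (1 *: x)) by exact: cont_TPs.
have hx := eps_cont x ct e3.
near=> y.
have : `|t (1 *: x) - t (1 *: y)| <= e / 3 by near: y.
rewrite !scale1r => hy.
rewrite -(subrKA (t x)) -[t x - U y](subrKA (t y)).
have -> : e = e / 3 + (e / 3 + e / 3) by field.
rewrite (le_trans (ler_normD _ _))// lerD//; first by rewrite distrC.
by rewrite (le_trans (ler_normD _ _))// lerD.
Unshelve. all: by end_near. Qed.

Let cscale : continuous (fun x : E => s *: x).
Proof. by move=> x; exact: scaler_continuous. Qed.

Lemma scaled_cont : continuous u.
Proof. by move=> x; apply: continuous_comp; [exact: cscale | exact: cont_limit]. Qed.

Lemma scaled_grad_cont a : continuous (g a).
Proof.
apply: contM; first exact: contC.
by move=> x; apply: continuous_comp; [exact: cscale | exact: cont_limit_grad].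
Qed.

Lemma scaled_C1beta : C1beta D beta u.
Proof.
split.
- split=> [x _|k x _|k]; first exact: scaled_cont.
    by have [] := scaled_derive k x.
  by rewrite scaled_partial => x _; exact: scaled_grad_cont.
- have [t [ht _]] := happ ltr01; have [B B0 hB] := TP_bnd t.
  exists (B + 1); split; first exact: num_real.
  move=> M hM x _ /=; apply: le_trans (ltW hM).
  have -> : u x = t (s *: x) - (t (s *: x) - u x) by ring.
  by rewrite (le_trans (ler_normB _ _))// lerD//.
- move=> k; exists (s * C); split; first exact: num_real.
  move=> M hM x _ /=; apply: le_trans (ltW hM).
  by rewrite scaled_partial /g normrM gtr0_norm// ler_pM2l.
- move=> k; exists (s * C * s `^ beta) => x y _ _; rewrite !scaled_partial /g.
  have [->|xy] := eqVneq x y.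
    by rewrite subrr normr0 !mulr_ge0 ?powR_ge0 ?(ltW s0) ?(C0 k).
  have d0 : 0 < s * `|x - y| by rewrite mulr_gt0// normr_gt0 subr_eq0.
  rewrite -mulrBr normrM gtr0_norm// -!mulrA ler_pM2l// -powRM ?(ltW s0)//.
  apply: hV => // c; rewrite !mxE -mulrBr normrM gtr0_norm// ler_pM2l//.
  by have := le_coord_norm (x - y) c; rewrite !mxE.
Qed.

Lemma bsf_Lfun2 (h : E -> R) : bsf h -> h \in Lfun (lebesgue_rV R m) 2%:E.
Proof.
move=> hh; have [mh [B [L [B0 hB hL]]]] := hh; rewrite inE; apply/andP; split; rewrite inE//=.
rewrite /finite_norm unlock; apply: poweR_lty.
have : bsf (fun x => h x * h x) by apply: bsfM => //; exists B.
move=> /bsf_integrable/integrableP[_]; apply: le_lt_trans; rewrite le_eqVlt; apply/orP; left; apply/eqP.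
apply: eq_integral => x _ /=.
by rewrite powR_mulrn// normrM -expr2.
Qed.

Lemma cont_L2loc (h : E -> R) : continuous h -> L2loc D h.
Proof.
move=> ch K cK _; apply: bsf_Lfun2.
have mK : measurable K.
  rewrite -[K]setCK; apply: measurableC; apply: open_measurable_rV; rewrite openC.
  by apply: compact_closed => //; exact: norm_hausdorff.
have [L _ hL] := box_bounded (compact_bounded cK).
have -> : h \_ K = (fun x => h x * \1_K x).
  by apply/funext => x; rewrite patchE indicE; case: (_ \in K); rewrite ?mulr1 ?mulr0.
apply: bsf_cont => //; split; first exact: measurable_indic.
exists 1, L; split => // x; first by rewrite indicE; case: (_ \in _); rewrite ?normr1 ?normr0.
by move=> hx; rewrite indicE memNset// => Kx; apply: hx; exact: hL.
Qed.

(** Integration by parts holds for the approximants, and both sides converge uniformly against the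
    test function. *)
Lemma scaled_weak_partial k : weak_partial D k u (g k).
Proof.
move=> phi tp; have tp' := test_partial k tp.
rewrite (Int_test _ tp) (Int_test _ tp').
have -> : Int (fun x => g k x * phi x) = s * Int (fun x => V k (s *: x) * phi x).
  rewrite -IntZ; first by congr Int; apply/funext => x; rewrite /g mulrA.
  apply: bsf_cont (test_bsf tp); move=> x.
  by apply: continuous_comp; [exact: cscale | exact: cont_limit_grad].
pose K1 := Int (fun x => `|partial k phi x|); pose K2 := Int (fun x => `|phi x|).
apply: (@eq_eps R _ _ (K1 + s * K2)) => e e0.
have [t [ht hd]] := happ e0.
have h1 : `|Int (fun x => u x * partial k phi x) - Lam s (partial k phi) t| <= e * K1.
  exact: Lam_approx tp' cont_limit ht.
have h2 : `|Int (fun x => V k (s *: x) * phi x) - Lam s phi (td k t)| <= e * K2.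
  exact: Lam_approx tp (@cont_limit_grad k) (hd k).
move: h1 h2; rewrite (Lam_ibp _ _ _ tp).
move: (Int _) (Int _) (Lam _ _ _) K1 K2 => I1 I2 L1 k1 k2 h1 h2.
have -> : I2 - - (s * I1) = (I2 - - s * L1) + s * (I1 - L1) by ring.
rewrite (le_trans (ler_normD _ _))// mulrDl; apply: lerD; first by rewrite [k1 * e]mulrC.
by rewrite normrM gtr0_norm// -mulrA ler_pM2l// mulrC.
Qed.

Lemma scaled_W12 : W12loc_grad D u g.
Proof.
split; [exact: cont_L2loc scaled_cont | | exact: scaled_weak_partial].
by move=> k; exact: cont_L2loc (@scaled_grad_cont k).
Qed.

End scaled_limit.

(** * Wirtinger derivatives in real coordinates *)

Section complex_hessian.
Variables (R : realType) (n : nat).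
Local Notation m := (n.+2 + n.+2)%N.
Local Notation E := 'rV[R]_m.
Local Notation X := (@lshift n.+2 n.+2).
Local Notation Y := (@rshift n.+2 n.+2).
Variables (D : set E) (phi : E -> R).
Hypothesis tphi : test_function D phi.
Let phiC : E -> R[i] := fun x => (phi x)%:C%C.

Lemma half_complex : (2^-1 : R[i]) = (2^-1 : R)%:C%C.
Proof. by rewrite -[2]/(2%:R) -[2 in RHS]/(2%:R) fmorphV rmorph_nat. Qed.

Lemma wirtingerE (a b c d : R) : wirtinger (a +i* b)%C (c +i* d)%C =
  (2^-1 * (a + d) +i* (2^-1 * (b - c)))%C.
Proof. by rewrite /wirtinger half_complex; apply/eqP; rewrite eq_complex /=; apply/andP; split; apply/eqP; ring. Qed.

Lemma wirtinger_barE (a b c d : R) : wirtinger_bar (a +i* b)%C (c +i* d)%C =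
  (2^-1 * (a - d) +i* (2^-1 * (b + c)))%C.
Proof. by rewrite /wirtinger_bar half_complex; apply/eqP; rewrite eq_complex /=; apply/andP; split; apply/eqP; ring. Qed.

Lemma partial_half a (h : E -> R) k x : (forall x, is_derive x (delta_mx 0 k) h (a x)) ->
  partial k (fun y => 2^-1 * h y) x = 2^-1 * a x.
Proof.
move=> hd; rewrite /partial; have hx := hd x.
have := is_deriveZ (2^-1 : R) hx; rewrite (_ : _ \*: _ = fun y => 2^-1 * h y)// => hz.
by rewrite derive_val.
Qed.

Lemma partial_cst0 k (x : E) : partial k (fun=> 0 : R) x = 0.
Proof. exact: derive_cst. Qed.

Lemma dzbar_real j : dzbar j phiC =
  fun x => (2^-1 * partial (X j) phi x +i* (2^-1 * partial (Y j) phi x))%C.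
Proof.
apply/funext => x; rewrite /dzbar /cpartial /= wirtinger_barE !partial_cst0.
by rewrite subr0 add0r.
Qed.

Lemma dz_dzbar_real i j x : dz i (dzbar j phiC) x =
  (4^-1 * (partial (X i) (partial (X j) phi) x + partial (Y i) (partial (Y j) phi) x) +i*
   (4^-1 * (partial (X i) (partial (Y j) phi) x - partial (Y i) (partial (X j) phi) x)))%C.
Proof.
have h a b x' : partial a (fun y => 2^-1 * partial b phi y) x' = 2^-1 * partial a (partial b phi) x'.
  by apply: partial_half => y; apply: test_derive; exact: test_partial tphi.
rewrite dzbar_real /dz /cpartial /= !h wirtingerE.
have -> : 4^-1 = 2^-1 * 2^-1 :> R by field.
move: (partial _ _ _) (partial _ _ _) (partial _ _ _) (partial _ _ _) => p1 p2 p3 p4.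
by move: (2^-1 : R) => q; congr (_ +i* _)%C; ring.
Qed.

Lemma sum_complex (I : Type) (r : seq I) (P : pred I) (a b : I -> R) :
  \sum_(i <- r | P i) (a i +i* b i)%C = ((\sum_(i <- r | P i) a i) +i* (\sum_(i <- r | P i) b i))%C.
Proof.
elim: r => [|i r IH]; first by rewrite !big_nil.
by rewrite !big_cons; case: ifP => // _; rewrite IH.
Qed.

Lemma real_complexE (a : R) : a%:C%C = (a +i* 0)%C. Proof. by []. Qed.

Lemma mulr_complexE (a b c d : R) : (a +i* b)%C * (c +i* d)%C = ((a * c - b * d) +i* (a * d + b * c))%C.
Proof. by []. Qed.

Lemma subr_complexE (a b c d : R) : (a +i* b)%C - (c +i* d)%C = ((a - c) +i* (b - d))%C.
Proof. by []. Qed.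

(** The factor 1/16 gathers the halves of the four Wirtinger derivatives; [reL] and [imL] are what
    the expansion produces. *)
Lemma hessian_alg (g : 'I_m -> R) (P : 'I_m -> 'I_m -> R) i j :
  wirtinger (g (X i))%:C%C (g (Y i))%:C%C * wirtinger_bar (g (X i))%:C%C (g (Y i))%:C%C *
    (4^-1 * (P (X j) (X j) + P (Y j) (Y j)) +i* (4^-1 * (P (X j) (Y j) - P (Y j) (X j))))%C -
  wirtinger (g (X i))%:C%C (g (Y i))%:C%C * wirtinger_bar (g (X j))%:C%C (g (Y j))%:C%C *
    (4^-1 * (P (X j) (X i) + P (Y j) (Y i)) +i* (4^-1 * (P (X j) (Y i) - P (Y j) (X i))))%C =
  ((16^-1 * \sum_(t <- @reL R n i j) t.1 * (g t.2.1.1.1 * g t.2.1.1.2 * P t.2.1.2 t.2.2)) +i*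
   (16^-1 * \sum_(t <- @imL R n i j) t.1 * (g t.2.1.1.1 * g t.2.1.1.2 * P t.2.1.2 t.2.2)))%C.
Proof.
rewrite !big_cons !big_nil /=.
rewrite !real_complexE !wirtingerE !wirtinger_barE !mulr_complexE subr_complexE.
have -> : 16^-1 = 2^-1 * 2^-1 * (2^-1 * 2^-1) :> R by field.
have -> : 4^-1 = 2^-1 * 2^-1 :> R by field.
move: (P _ _) (P _ _) (P _ _) (P _ _) (P _ _) (P _ _) (P _ _) (P _ _) => p1 p2 p3 p4 p5 p6 p7 p8.
move: (g _) (g _) (g _) (g _) => g1 g2 g3 g4.
move: (2^-1) => h; rewrite !(addr0, add0r, subr0, sub0r, mulr0, mul0r).
by congr (_ +i* _)%C; ring.
Qed.

Variable G : 'I_m -> E -> R.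

Lemma hessian_comb x :
  \sum_(i < n.+2) \sum_(j < n.+2 | j != i) grad_dz G i x * grad_dzbar G i x * dz j (dzbar j phiC) x
  - \sum_(i < n.+2) \sum_(j < n.+2 | j != i) grad_dz G i x * grad_dzbar G j x * dz j (dzbar i phiC) x =
  (16^-1 * comb (@reL R n) (fun q => G q.1.1.1 x * G q.1.1.2 x * partial q.1.2 (partial q.2 phi) x) +i*
  (16^-1 * comb (@imL R n) (fun q => G q.1.1.1 x * G q.1.1.2 x * partial q.1.2 (partial q.2 phi) x)))%C.
Proof.
rewrite -sumrB /comb !mulr_sumr -sum_complex; apply: eq_bigr => i _.
rewrite -sumrB !mulr_sumr -sum_complex; apply: eq_bigr => j _.
rewrite !dz_dzbar_real.
exact: (hessian_alg (fun a => G a x) (fun a b => partial a (partial b phi) x) i j).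
Qed.

Lemma Int_supp (h : E -> R) : (forall x, ~ D x -> h x = 0) ->
  \int[lebesgue_rV R m]_(x in D) h x = Int h.
Proof.
move=> h0; rewrite Rintegral_mkcond; congr Rintegral; apply/funext => x; rewrite patchE.
by case: ifPn => // hx; rewrite h0//; move/negP: hx; rewrite inE.
Qed.

Lemma cintegral_hessian (s : R) (V : 'I_m -> E -> R) : (forall a, continuous (V a)) ->
  G = (fun a x => s * V a (s *: x)) ->
  cintegral D (fun x =>
    \sum_(i < n.+2) \sum_(j < n.+2 | j != i) grad_dz G i x * grad_dzbar G i x * dz j (dzbar j phiC) x
  - \sum_(i < n.+2) \sum_(j < n.+2 | j != i) grad_dz G i x * grad_dzbar G j x * dz j (dzbar i phiC) x) =
  (16^-1 * (s ^+ 2 * comb (@reL R n) (Jint s phi V)) +i*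
   (16^-1 * (s ^+ 2 * comb (@imL R n) (Jint s phi V))))%C.
Proof.
move=> cV GE.
pose Q (q : 'I_m * 'I_m * 'I_m * 'I_m) x := G q.1.1.1 x * G q.1.1.2 x * partial q.1.2 (partial q.2 phi) x.
have t2 (q : 'I_m * 'I_m * 'I_m * 'I_m) : test_function D (partial q.1.2 (partial q.2 phi)).
  by apply: test_partial; exact: test_partial.
have cVs a : continuous (fun x : E => V a (s *: x)).
  by move=> x; apply: continuous_comp; [exact: scaler_continuous | exact: cV].
have QE q : Q q = fun x => s ^+ 2 * (V q.1.1.1 (s *: x) * V q.1.1.2 (s *: x) * partial q.1.2 (partial q.2 phi) x).
  by apply/funext => x; rewrite /Q GE; ring.
have bJ q : bsf (fun x => V q.1.1.1 (s *: x) * V q.1.1.2 (s *: x) * partial q.1.2 (partial q.2 phi) x).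
  by apply: bsf_cont (test_bsf (t2 q)); exact: contM.
have bQ q : bsf (Q q) by rewrite QE; exact: bsfZ.
have IQ q : Int (Q q) = s ^+ 2 * Jint s phi V q by rewrite QE IntZ.
have main L : \int[lebesgue_rV R m]_(x in D) (16^-1 * comb L (fun q => Q q x)) =
    16^-1 * (s ^+ 2 * comb L (Jint s phi V)).
  have [b1 b2] := Int_comb L bQ.
  rewrite Int_supp; first by rewrite IntZ// b2 -[X in _ = _ * X]combZ; congr (16^-1 * _); congr (comb L _); apply/funext.
  move=> x Dx; rewrite /comb big1 ?mulr0// => i _; rewrite big1// => j _; rewrite big1// => t _.
  by rewrite /Q (test_out (t2 _) Dx) !mulr0.
rewrite /cintegral; congr (_ +i* _)%C.
  by rewrite -main; congr Rintegral; apply/funext => x; rewrite hessian_comb.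
by rewrite -main; congr Rintegral; apply/funext => x; rewrite hessian_comb.
Qed.

End complex_hessian.

(** * Preparation of the data *)

Section lebesgue_data.
Variables (R : realType) (m : nat).
Local Notation E := 'rV[R]_m.
Local Notation lam := (lebesgue_rV R m).

Lemma box_le (L L' : R) (x : E) : L <= L' -> box m L x -> box m L' x.
Proof.
move=> LL h a; have := h a; rewrite /= !in_itv /= => /andP[h1 h2].
by rewrite (le_trans _ h1) ?lerN2// (le_trans h2).
Qed.

Lemma ing_ae (G g : E -> R) : measurable_fun setT G -> ing g -> (forall x, 0 <= g x) ->
  (\forall x \ae lam, `|G x| <= g x) -> ing G.
Proof.
move=> mG ig g0 h; apply/integrableP; split; first exact/measurable_EFinP.
have mg := ing_measurable ig.
apply: (@le_lt_trans _ _ (\int[lam]_x (g x)%:E)%E).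
  apply: ae_ge0_le_integral => //.
  - by apply/measurable_EFinP; exact: measurableT_comp.
  - by move=> x _; rewrite lee_fin.
  - exact/measurable_EFinP.
  - by apply: filterS h => x h _; rewrite /= lee_fin.
move/integrableP: ig => [_]; apply: le_lt_trans; rewrite le_eqVlt; apply/orP; left; apply/eqP.
by apply: eq_integral => x _ /=; rewrite ger0_norm.
Qed.

(** A finite exponent above the threshold replaces p: p itself when it is finite, q + 1 when F is
    essentially bounded. For finite p, integrability of F follows from |F| <= 1 + |F|^r on the
    box. *)
Lemma Lfun_data (F : E -> R) (p : \bar R) (q L : R) : 1 <= q -> (q%:E < p)%E -> F \in Lfun lam p ->
  (forall x, ~ box m L x -> F x = 0) -> exists r, [/\ q < r, ing F & ing (fun x => `|F x| `^ r)].
Proof.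
move=> q1; rewrite inE => qp /andP[+ +] FL; rewrite !inE /= => mF.
have mFr r : measurable_fun setT (fun x => `|F x| `^ r).
  by apply: (@measurableT_comp _ _ _ _ _ _ (fun x : R => x `^ r)%R) => //; exact: measurableT_comp.
have i1 (c : R) : ing (fun x => c * \1_(box m L) x) by apply: ingZ; apply: bsf_ing; exact: bsf_box.
have g1 (c : R) (x : E) : 0 <= c -> 0 <= c * \1_(box m L) x.
  by move=> c0; rewrite mulr_ge0// indicE; case: (_ \in _).
have out (x : E) : box m L x \/ F x = 0 by have [|/FL] := pselect (box m L x); [left|right].
rewrite /finite_norm unlock; case: p qp => [r| |] //= qr hN.
  rewrite lte_fin in qr; have r0 : 0 < r by apply: lt_trans qr; exact: lt_le_trans q1.
  have ir : ing (fun x => `|F x| `^ r).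
    apply/integrableP; split; first exact/measurable_EFinP.
    have := hN => /lty_poweRy; rewrite invr_eq0 gt_eqF// => /(_ isT); apply: le_lt_trans.
    rewrite le_eqVlt; apply/orP; left; apply/eqP; apply: eq_integral => x _ /=.
    by rewrite ger0_norm// powR_ge0.
  exists r; split=> //; apply: (@ing_ae F (fun x => 1 * \1_(box m L) x + `|F x| `^ r)) => //; first exact: ingD.
  apply: nearW => x; have [hx|->] := out x; last first.
    by rewrite normr0 addr_ge0 ?powR_ge0// g1.
  rewrite indicE mem_set//= mul1r; have [h|h] := leP `|F x| 1.
    by rewrite (le_trans h)// lerDl powR_ge0.
  apply: (@le_trans _ _ (`|F x| `^ r)); last by rewrite lerDr.
  rewrite -[X in X <= _]powRr1//; apply: ler_powR; first exact: ltW.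
  by apply: ltW; exact: le_lt_trans qr.
have mu0 : (0 < lam [set: E])%E.
  apply: (@lt_le_trans _ _ (lam (box m 1))); first by rewrite lebesgue_box// lte_fin exprn_gt0// mulr_gt0.
  by apply: le_measure; rewrite ?inE//; exact: measurable_box.
have hs : (ess_sup_inf.ess_sup lam (abse \o (EFin \o F)) < +oo)%E by move: hN; rewrite mu0.
have [M M0 hM] : exists2 M : R, 0 <= M & \forall x \ae lam, `|F x| <= M.
  case: (ess_sup_inf.ess_sup _ _) hs (ess_sup_inf.ess_sup_ge lam (abse \o (EFin \o F))) => [M| |] // _ h.
    exists `|M| => //; apply: filterS h => x /=; rewrite lee_fin => /le_trans; apply.
    exact: ler_norm.
  by exists 0 => //; apply: filterS h => x /=.
exists (q + 1); split; first by rewrite ltrDl.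
  apply: (@ing_ae F (fun x => M * \1_(box m L) x)) => // [x|]; first exact: g1.
  apply: filterS hM => x hx; have [bx|->] := out x; last by rewrite normr0 g1.
  by rewrite indicE mem_set//= mulr1.
apply: (@ing_ae _ (fun x => M `^ (q + 1) * \1_(box m L) x)) => // [x|]; first by rewrite g1// powR_ge0.
apply: filterS hM => x hx; rewrite ger0_norm ?powR_ge0//.
have q0 : 0 < q + 1 by rewrite addr_gt0//; exact: lt_le_trans q1.
have [bx|->] := out x; last by rewrite normr0 powR0 ?gt_eqF// g1// powR_ge0.
rewrite indicE mem_set//= mulr1; apply: ge0_ler_powR; rewrite ?nnegrE//; exact: ltW.
Qed.

(** A multiple of the indicator of the shell between two boxes brings the mean to zero. The shell
    lies outside the smaller box, so functions supported in that box do not feel it. *)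
Lemma compensate (F : E -> R) (L r K : R) : (0 < m)%N -> 0 < L -> 1 <= r -> ing F ->
  ing (fun x => `|F x| `^ r) -> (forall x, ~ box m L x -> F x = 0) ->
  exists ft : E -> R, [/\ ing ft, forall x, ~ box m (2 * L) x -> ft x = 0, Int ft = 0,
    ing (fun x => `|ft x| `^ r) &
    forall phi : E -> R, (forall x, ~ box m L x -> phi x = 0) -> forall x, ft x * phi x = K * (F x * phi x)].
Proof.
move=> m0 L0 r1 iF iFr FL.
have L2 : L <= 2 * L by rewrite ler_peMl ?ler1n// ltW.
pose V : R := (2 * (2 * L)) ^+ m - (2 * L) ^+ m.
have V0 : 0 < V.
  by rewrite subr_gt0 ltrXn2r -?lt0n// ?mulr_ge0 ?(ltW L0)// ltr_pMl ?mulr_gt0// ltr1n.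
pose c := K * Int F / V.
pose h (x : E) : R := \1_(box m (2 * L)) x - \1_(box m L) x.
have bh : bsf h by apply: bsfB; exact: bsf_box.
have ih : Int h = V.
  rewrite /h IntB; [|exact: bsf_box|exact: bsf_box].
  have IB (l : R) : 0 <= l -> Int (\1_(box m l) : E -> R) = (2 * l) ^+ m.
    move=> l0; rewrite /Int /Rintegral integral_indic//; last exact: measurable_box.
    have hl : lam (box m l) = ((2 * l) ^+ m)%:E by exact: lebesgue_box.
    by rewrite setIT; exact: (congr1 fine hl).
  by rewrite !IB// ?mulr_ge0// ltW.
have h1 x : `|h x| <= \1_(box m (2 * L)) x.
  rewrite /h !indicE; have [hx|hx] := pselect (box m L x).
    by rewrite !mem_set ?subrr ?normr0//; exact: box_le hx.
  by rewrite (memNset hx) subr0 ger0_norm.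
have ift : ing (fun x => K * F x + - c * h x) by apply: ingD; apply: ingZ => //; exact: bsf_ing.
exists (fun x => K * F x + - c * h x); split => //.
- move=> x hx; rewrite FL ?mulr0 ?add0r; last by move=> h'; apply: hx; exact: box_le h'.
  have : `|h x| <= 0 by rewrite (le_trans (h1 x))// indicE memNset.
  by rewrite normr_le0 => /eqP ->; rewrite mulr0.
- rewrite iIntD; [|exact: ingZ|by apply: ingZ; exact: bsf_ing].
  rewrite iIntZ// iIntZ; last exact: bsf_ing.
  by rewrite ih /c mulNr divfK ?subrr// gt_eqF.
- have r0 : 0 <= r by exact: le_trans r1.
  apply: (@ing_ae _ (fun x => 2 `^ r * (`|K| `^ r * `|F x| `^ r + `|c| `^ r * \1_(box m (2 * L)) x))).
  + apply: (@measurableT_comp _ _ _ _ _ _ (fun x : R => x `^ r)%R) => //.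
    by apply: measurableT_comp => //; exact: ing_measurable ift.
  + by apply: ingZ; apply: ingD; apply: ingZ => //; apply: bsf_ing; exact: bsf_box.
  + move=> x; rewrite mulr_ge0 ?powR_ge0// addr_ge0// mulr_ge0 ?powR_ge0// indicE.
  apply: nearW => x; rewrite ger0_norm ?powR_ge0//.
  set a := K * F x; set b := - c * h x.
  have ha : `|K| `^ r * `|F x| `^ r = `|a| `^ r by rewrite /a normrM powRM.
  have hb : `|b| `^ r <= `|c| `^ r * \1_(box m (2 * L)) x.
    have := h1 x; rewrite /b normrM normrN powRM// indicE; case: (_ \in _) => /= hx.
      rewrite mulr1 ler_piMr ?powR_ge0//.
      apply: (@le_trans _ _ (1 `^ r)); last by rewrite powR1.
      by apply: ge0_ler_powR; rewrite ?nnegrE.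
    have /eqP -> : `|h x| == 0 by rewrite eq_le hx normr_ge0.
    by rewrite powR0 ?mulr0// gt_eqF// (lt_le_trans _ r1).
  rewrite ha; apply: (@le_trans _ _ (2 `^ r * (`|a| `^ r + `|b| `^ r))); last first.
    by rewrite ler_wpM2l ?powR_ge0// lerD2l.
  (* The modulus of a + b is at most twice the larger of the two moduli, here z. *)
  have key (y z : R) : 0 <= y -> y <= z -> `|a + b| <= y + z -> `|a + b| `^ r <= 2 `^ r * z `^ r.
    move=> y0 yz hab; have z0 := le_trans y0 yz.
    rewrite -powRM//; apply: ge0_ler_powR; rewrite ?nnegrE ?mulr_ge0//.
    by apply: le_trans hab _; rewrite mulr_natl mulr2n lerD2r.
  have [ab|/ltW ba] := leP `|a| `|b|.
    apply: (le_trans (key _ _ (normr_ge0 a) ab (ler_normD _ _))).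
    by rewrite ler_wpM2l ?powR_ge0// lerDr powR_ge0.
  apply: (le_trans (key _ _ (normr_ge0 b) ba _)); first by rewrite addrC ler_normD.
  by rewrite ler_wpM2l ?powR_ge0// lerDl powR_ge0.
move=> phi hphi x; have [hx|/hphi ->] := pselect (box m L x); last by rewrite !mulr0.
rewrite /h !indicE !mem_set//; last exact: box_le hx.
by rewrite subrr mulr0 addr0 mulrA.
Qed.

Lemma unif_cont (psi : E -> R) (L e : R) : continuous psi -> 0 < e -> exists2 d, 0 < d &
  forall x y : E, box m L x -> (forall a, `|x 0 a - y 0 a| <= d) -> `|psi x - psi y| <= e.
Proof.
move=> cpsi e0; have e2 : 0 < e / 2 by rewrite divr_gt0.
pose P (d : R) (x : E) := forall y : E, (forall a, `|x 0 a - y 0 a| <= d) -> `|psi x - psi y| <= e.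
have [+ _] := compact_near_coveringP (box m L).
move=> /(_ (@compact_box R m L) R (0:R)^'+ P _) H.
have {}H : \forall d \near (0:R)^'+, box m L `<=` P d.
  apply: H => x _; have /nbhs_ballP[r /= r0 hr] := eps_cont x cpsi e2.
  have r2 : 0 < r / 2 by rewrite divr_gt0.
  exists (ball x (r / 2), [set d | d < r / 2]) => /=.
    by split; [exact: nbhsx_ballx | exact: nbhs_right_lt].
  move=> [x' d] [/= hx' hd] y hy.
  have hc c : `|x 0 c - x' 0 c| < r / 2 by exact: (hx'.2 0 c).
  have b1 : ball x r x'.
    split=> // i c; rewrite (ord1 i); have h : `|x 0 c - x' 0 c| < r; last exact: h.
    by apply: lt_trans (hc c) _; rewrite ltr_pdivrMr// ltr_pMr// ltr1n.
  have b2 : ball x r y.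
    split=> // i c; rewrite (ord1 i); have h : `|x 0 c - y 0 c| < r; last exact: h.
    rewrite -(subrKA (x' 0 c)) (le_lt_trans (ler_normD _ _))// [r]splitr ltr_leD//.
    by apply: le_trans (hy c) _; exact: ltW.
  rewrite -(subrKA (psi x)) (le_trans (ler_normD _ _))// [e]splitr lerD//; last exact: (hr _ b2).
  by rewrite distrC; exact: (hr _ b1).
near (0:R)^'+ => d; exists d; first by near: d; exact: nbhs_right_gt.
have hd : box m L `<=` P d by near: d.
by move=> x y bx; exact: hd.
Unshelve. all: by end_near. Qed.

Variable s : R.
Hypothesis s0 : 0 < s.
Local Notation cube := (box m (pi / s)).
Local Notation c0 := (2 * pi / s).

Let c00 : 0 < c0. Proof. by rewrite divr_gt0// mulr_gt0// pi_gt0. Qed.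

Lemma VP_unif (psi : E -> R) (B e : R) : continuous psi -> (forall x, `|psi x| <= B) -> 0 < e ->
  exists N0, forall N y, (N0 < N)%N -> box m (2 * s)^-1 y ->
    `|Int (fun x => (\1_cube x * psi x) * VP N (s *: x - s *: y)) - c0 ^+ m * psi y| <= e.
Proof.
move=> cpsi hB e0; pose A := (3 * c0) ^+ m.
have A0 : 0 < A by rewrite exprn_gt0// mulr_gt0.
pose eta := e / (2 * A).
have eta0 : 0 < eta by rewrite divr_gt0// mulr_gt0.
have [d1 d10 hd1] := unif_cont (pi / s) cpsi eta0.
pose d := Num.min d1 (2 * s)^-1.
have d0 : 0 < d by rewrite lt_min d10 invr_gt0 mulr_gt0.
have sd : s * d <= 2^-1.
  apply: (@le_trans _ _ (s * (2 * s)^-1)); first by rewrite ler_pM2l// ge_min lexx orbT.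
  by rewrite le_eqVlt; apply/orP; left; apply/eqP; field; rewrite gt_eqF.
have B0 : 0 <= B by exact: le_trans (hB 0).
have ch0 : 0 < chord (s * d).
  apply: chord_gt0; first exact: mulr_gt0.
  by apply: (le_trans sd); have := @pi_ge2 R; lra.
pose K := 2 * B / chord (s * d) * m%:R * 8 / eta.
have K0 : 0 <= K.
  apply: divr_ge0; last exact: ltW.
  by apply: mulr_ge0 => //; apply: mulr_ge0 => //; apply: divr_ge0; [exact: mulr_ge0 | exact: ltW].
exists (Num.truncn K).+1 => N y hN hy.
have N0 : (0 < N)%N by exact: leq_ltn_trans hN.
have KN : K <= N%:R.
  by apply: ltW; apply: (lt_le_trans (truncnS_gt K)); rewrite ler_nat ltnW.
have sy a : `|s * y 0 a| <= 2^-1.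
  have := hy a; rewrite /= in_itv /= -ler_norml => h.
  rewrite normrM gtr0_norm//; apply: (@le_trans _ _ (s * (2 * s)^-1)); first by rewrite ler_pM2l.
  by rewrite le_eqVlt; apply/orP; left; apply/eqP; field; rewrite gt_eqF.
apply: le_trans (VP_approx s0 N0 (continuous_measurable_rV cpsi) hB d0 sd (ltW eta0) sy _) _.
  move=> x cx hx; apply: hd1 => // a; apply: le_trans (hx a) _.
  by rewrite ge_min lexx.
rewrite -/A; apply: (@le_trans _ _ ((eta + eta) * A)).
  apply: ler_wpM2r; first exact: ltW.
  apply: lerD => //; have Np : 0 < N%:R :> R by rewrite ltr0n.
  have -> : 2 * B / chord (s * d) * m%:R * (8 / N%:R) = K * eta / N%:R.
    by rewrite /K divfK ?gt_eqF// !mulrA.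
  by rewrite ler_pdivrMr// mulrC ler_pM2l.
by rewrite le_eqVlt; apply/orP; left; apply/eqP; rewrite /eta; field; rewrite gt_eqF.
Qed.

Lemma cube_half (x : E) : box m (2 * s)^-1 x -> cube x.
Proof.
apply: box_le; rewrite invfM ler_pM2r ?invr_gt0//.
by have := @pi_ge2 R; lra.
Qed.

(** The convolution of psi with the kernel, divided by the mass c0^m of the kernel on the cube. *)
Lemma trig_dense (psi : E -> R) (B e : R) : continuous psi -> (forall x, `|psi x| <= B) -> 0 < e ->
  exists v : TP R m, forall y, box m (2 * s)^-1 y -> `|v (s *: y) - psi y| <= e.
Proof.
move=> cpsi hB e0; have cm : 0 < c0 ^+ m by rewrite exprn_gt0.
have [N0 hN] := VP_unif cpsi hB (mulr_gt0 cm e0).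
pose N := N0.+1; pose q := symb (fun k => (vhat R N k)%:C%C) (dirichlet R m (2 * N)).
pose f (x : E) := \1_cube x * psi x.
have bf : bsf f.
  rewrite (_ : f = fun x => psi x * \1_cube x); last by apply/funext => x; rewrite mulrC.
  by apply: bsf_cont => //; exact: bsf_box.
have tq : exists K, tp K (ev (symb (fhat s f) q)).
  by exists (2 * N)%N; apply: tp_symb; rewrite dle_symb; exact: dle_dirichlet.
exists (TPcst _ ((c0 ^+ m)^-1) * MkTP tq) => y hy; rewrite TPE /=.
rewrite ev_fhat; last exact: bsf_ing.
have -> : Int (fun x => f x * ev q (s *: y - s *: x)) =
    Int (fun x => (\1_cube x * psi x) * VP N (s *: x - s *: y)).
  congr Int; apply/funext => x; rewrite -(@VP_ev R m N (2 * N) _ (leqnn _)).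
  by rewrite -opprB VP_opp.
have := hN N y (ltnSn _) hy; move: (Int _) => I hI.
have -> : (c0 ^+ m)^-1 * I - psi y = (c0 ^+ m)^-1 * (I - c0 ^+ m * psi y).
  by rewrite mulrBr mulKf// gt_eqF.
by rewrite normrM gtr0_norm ?invr_gt0// ler_pdivrMl.
Qed.

End lebesgue_data.

(** * The limit potential and its Laplacian in the weak sense *)

Section potential_weak.
Variables (R : realType) (n : nat) (i0 i1 : 'I_n.+2).
Hypothesis i01 : i0 != i1.
Local Notation m := (n.+2 + n.+2)%N.
Local Notation E := 'rV[R]_m.
Variables (s : R) (f : E -> R) (p kap : R).
Hypotheses (s0 : 0 < s) (fing : ing f) (fbox : forall x, ~ box m (2 * s)^-1 x -> f x = 0).
Hypotheses (p1 : 1 <= p) (fp : ing (fun x => `|f x| `^ p)) (fint : Int f = 0).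
Hypotheses (kap0 : 0 < kap) (kap2 : kap + m%:R / p < 2).
Local Notation w := (hweight R i0 i1).
Local Notation G := (gpot s f w).
Local Notation c0 := (2 * pi / s).

Let f0 x : ~ box m (pi / s) x -> f x = 0.
Proof. by move=> h; apply: fbox => h'; apply: h; exact: cube_half. Qed.

Lemma gpot_limit : exists2 C, 0 <= C & exists H : E -> R, forall J x,
  `|G J x - H x| <= C * p2 (- (kap * J%:R)).
Proof.
have w1 := hweight_ge1 R i01.
have [C C0 hC] : exists2 C, 0 <= C & forall J x, `|ev (hpot s f w J) x| <= C * p2 (- (kap * J%:R)).
  by eapply hpot_bound; eassumption.
have r1 := p2_lt1 kap0.
have pE k : p2 (- kap) ^+ k = p2 (- (kap * k%:R)) by rewrite p2X mulNr.
exists (C / (1 - p2 (- kap))); first by rewrite divr_ge0// subr_ge0 ltW.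
have [H hH] : exists H : E -> R, forall k x, `|G k x - H x| <= C / (1 - p2 (- kap)) * p2 (- kap) ^+ k.
  apply: geom_limit => //; first exact: p2_ge0.
  by move=> k x; rewrite gpotS normrN pE.
by exists H => J x; rewrite -pE.
Qed.

(** The kernel is moved from f to phi: f is only integrable, whereas the convolutions of the
    continuous phi converge uniformly. *)
Lemma gpot_weak (D : set E) (phi : E -> R) (e : R) : test_function D phi -> D `<=` box m (2 * s)^-1 ->
  0 < e -> exists J0, forall J, (J0 <= J)%N ->
    `|Lam s phi (wlap i0 i1 (G J)) - c0 ^+ m * Int (fun x => f x * phi x)| <= e.
Proof.
move=> tphi DL e0; have w1 := hweight_ge1 R i01.
have [mphi [B [L [B0 hB _]]]] := test_bsf tphi.
have F0 : 0 <= Int (fun x => `|f x|) by exact: Int_ge0.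
have eF : 0 < e / (Int (fun x => `|f x|) + 1) by rewrite divr_gt0// ltr_wpDl.
have [N0 hN] := VP_unif s0 (test_cont tphi) hB eF.
exists N0 => J hJ; pose N := (2 ^ J)%N.
have NN : (N0 < N)%N by apply: leq_ltn_trans hJ _; exact: ltn_expl.
pose q := symb (fun k => (vhat R N k)%:C%C) (dirichlet R m (2 * N)).
have iphi : ing phi by apply: bsf_ing; exact: test_bsf tphi.
have [i2 e2] := Int_ev_swap s q fing iphi.
have LE : Lam s phi (wlap i0 i1 (G J)) = Int (fun y => f y * Int (fun x => phi x * ev q (s *: x - s *: y))).
  rewrite -e2 (Lam_wlap _ _ _ tphi).
  transitivity (Int (fun x => \sum_a w a * (td a (td a (G J)) (s *: x) * phi x))).
    rewrite Int_sum; first by apply: eq_bigr => a _; rewrite IntZ//; exact: bsf_TPs tphi.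
    by move=> a; apply: bsfZ; exact: bsf_TPs tphi.
  congr Int; apply/funext => x; under eq_bigr => a _ do rewrite mulrA.
  rewrite -mulr_suml mulrC; congr (_ * _); rewrite ev_fhat//.
  have -> : \sum_a w a * td a (td a (G J)) (s *: x) = Int (fun y => f y * VP N (s *: x - s *: y)).
    by eapply lap_gpot; eassumption.
  by congr Int; apply/funext => y; rewrite (@VP_ev R m N (2 * N) _ (leqnn _)).
have ifp : ing (fun y => f y * phi y) by apply: ingM => //; exists B.
rewrite LE -iIntZ// -iIntB//; last exact: ingZ.
have ifn : ing (fun y => `|f y| * (e / (Int (fun x => `|f x|) + 1))).
  by apply: ingM; [exact: ing_norm | exact: measurable_cst | exists `|e / (Int (fun x => `|f x|) + 1)|].
have idf : ing (fun y => f y * Int (fun x => phi x * ev q (s *: x - s *: y)) - c0 ^+ m * (f y * phi y)).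
  rewrite (_ : (fun y => _) = fun y => f y * Int (fun x => phi x * ev q (s *: x - s *: y)) +
    -1 * (c0 ^+ m * (f y * phi y))); first by apply: ingD => //; apply: ingZ; exact: ingZ.
  by apply/funext => y; rewrite mulN1r.
apply: le_trans (iInt_norm idf) _.
apply: (@le_trans _ _ (Int (fun y => `|f y| * (e / (Int (fun x => `|f x|) + 1))))).
  apply: iInt_le => //.
    exact: ing_norm.
  move=> y; rewrite mulrCA -mulrBr normrM.
  have [by_|/fbox ->] := pselect (box m (2 * s)^-1 y); last by rewrite normr0 !mul0r.
  apply: ler_wpM2l => //; have := hN N y NN by_.
  rewrite (_ : (fun x => \1_(box m (pi / s)) x * phi x * VP N (s *: x - s *: y)) =
    (fun x => phi x * ev q (s *: x - s *: y)))//.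
  apply/funext => x; rewrite (@VP_ev R m N (2 * N) _ (leqnn _)); congr (_ * _).
  rewrite indicE; have [cx|cx] := pselect (box m (pi / s) x); first by rewrite mem_set// mul1r.
  rewrite (test_out tphi) ?mulr0// => /DL h; apply: cx; exact: cube_half.
rewrite iIntZr; last exact: ing_norm.
rewrite mulrA ler_pdivrMr ?ltr_wpDl// mulrC ler_pM2l// lerDl ler01.
by [].
Qed.

End potential_weak.

(** * Assembly *)

Section main.
Variables (R : realType) (n : nat).
Local Notation m := (n.+2 + n.+2)%N.
Local Notation E := 'rV[R]_m.

(** Origin of the constant -32 / (s^4 c): -1/2 from the definition of a very weak solution, 1/16
    from the Wirtinger derivatives, one s^2 from the gradients of the dilated function, another from
    the derivatives moved off phi, and c from the mass of the kernel. *)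
Lemma normalization (s c X : R) : s != 0 -> c != 0 ->
  - 2^-1 * (16^-1 * (s ^+ 2 * (s ^+ 2 * (c * (- 32 / (s ^+ 4 * c) * X))))) = X.
Proof. by move=> s0 c0; field; rewrite s0 c0. Qed.

(** Tietze's theorem from the compact closure: convolution needs a bounded continuous function on
    the whole space. *)
Lemma bounded_extension (Omega : set E) (L : R) (g : E -> R) : Omega `<=` box m L ->
  {within closure Omega, continuous g} ->
  exists (h : E -> R) (B : R), [/\ continuous h, forall x, `|h x| <= B & forall x, Omega x -> g x = h x].
Proof.
move=> OL cg.
have cb : closed (box m L) by apply: compact_closed; [exact: norm_hausdorff | exact: compact_box].
have cK : compact (closure Omega).
  apply: subclosed_compact; [exact: closed_closure | exact: compact_box |].
  by move=> x hx; apply: cb => B nB; have [y [Oy By]] := hx B nB; exists y; split=> //; exact: OL.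
have [M [_ hM]] := compact_bounded (continuous_compact cg cK).
pose B : R := `|M| + 1.
have B0 : 0 < B by rewrite ltr_wpDl.
have hB x : closure Omega x -> `|g x| <= B.
  by move=> hx; apply: (hM B); [rewrite /B (le_lt_trans (ler_norm M)) ?ltrDl | exists x].
have [h [h1 h2 h3]] := @continuous_bounded_extension E R (@pseudometric_normal R E) (closure Omega)
  (@closed_closure _ _) g B B0 cg hB.
exists h, B; split=> // x Ox; apply: h1; rewrite inE; exact: subset_closure.
Qed.

Lemma dense_solutions (Omega : set E) (f : E -> R) (p : \bar R) (beta : R) : bounded_set Omega ->
  ((n.+2%:R + 2^-1)%:E < p)%E -> f \_ Omega \in Lfun (lebesgue_rV R m) p ->
  0 < beta -> beta < (1 + 2 * n.+2%:R)^-1 ->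
  forall (g : E -> R) (eps : R), {within closure Omega, continuous g} -> 0 < eps ->
  exists u : E -> R, [/\ C1beta Omega beta u, very_weak_solution Omega f u &
    forall x, Omega x -> `|u x - g x| <= eps].
Proof.
move=> bO hp fp beta0 betaN g eps cg eps0.
have [L L0 OL] := box_bounded bO.
have L2 : L <= 2 * L by rewrite ler_peMl ?ler1n// ltW.
pose N : R := n.+2%:R.
have N2 : 2 <= N by rewrite /N ler_nat.
(* The box of half-side (2 s)^-1 = 2 L, on which the kernel acts as an approximate identity, then
   contains both Omega and the shell that compensates the mean. *)
pose s : R := (4 * L)^-1.
have s0 : 0 < s by rewrite invr_gt0 mulr_gt0.
have sN0 : s != 0 by rewrite gt_eqF.
have s2 : (2 * s)^-1 = 2 * L by rewrite /s; field; rewrite gt_eqF.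
pose c0 : R := 2 * pi / s.
have cm0 : c0 ^+ m != 0 by rewrite expf_neq0// gt_eqF// divr_gt0// mulr_gt0// pi_gt0.
have FL x : ~ box m L x -> (f \_ Omega) x = 0.
  by move=> hx; rewrite patchE memNset// => /OL.
have q1 : 1 <= n.+2%:R + 2^-1 :> R by move: N2; rewrite /N => h; lra.
have [r [qr iF iFr]] := Lfun_data q1 hp fp FL.
have r1 : 1 <= r by apply: (le_trans q1); exact: ltW.
have [ft [i1 i2 i3 i4 i5]] := compensate (- 32 / (s ^+ 4 * c0 ^+ m)) (isT : (0 < m)%N) L0 r1 iF iFr FL.
rewrite -s2 in i2.
pose i0 : 'I_n.+2 := ord0; pose i1' : 'I_n.+2 := ord_max.
have i01 : i0 != i1' by [].
(* The limiting Hoelder exponent. As r > N + 1/2, one has 2 N / r < 4 N del, and 2 del + 4 N del =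
   2; this gives kap + m / r < 2. *)
pose del : R := (1 + 2 * N)^-1.
have N1 : 0 < 1 + 2 * N by lra.
have del0 : 0 < del by rewrite invr_gt0.
have delE : del * (1 + 2 * N) = 1 by rewrite /del mulVf// gt_eqF.
pose kap := 2 * del.
have kap0 : 0 < kap by rewrite mulr_gt0.
have kap2 : kap + m%:R / r < 2.
  have r0 : 0 < r by exact: lt_le_trans r1.
  have -> : m%:R = 2 * N :> R by rewrite natrD /N; ring.
  have h : 2 * N / r < 4 * N * del.
    rewrite ltr_pdivrMr//; have -> : 2 * N = 4 * N * del * (N + 2^-1).
      transitivity (2 * N * (del * (1 + 2 * N))); first by rewrite delE mulr1.
      by field.
    by rewrite ltr_pM2l// mulr_gt0// mulr_gt0//; lra.
  have e2 : kap + 4 * N * del = 2 by rewrite /kap -[RHS]mulr1 -[X in _ = _ * X]delE; ring.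
  by apply: (@lt_le_trans _ _ (kap + 4 * N * del)); [rewrite ltrD2l | rewrite e2].
have betad : beta < del by [].
(* Room on both sides: beta < b for convergence in the Hoelder norm, 2 b < kap for the approximation
   of H. Moreover 5 b < 1, since 1 + 2 N >= 5. *)
pose b := (beta + del) / 2.
have bb : beta < b by rewrite /b; move: betad => h; lra.
have bd : b < del by rewrite /b; move: betad => h; lra.
have bk : 2 * b < kap by rewrite /kap ltr_pM2l.
have b5 : 5 * b < 1.
  apply: (@lt_le_trans _ _ (5 * del)); first by rewrite ltr_pM2l.
  by rewrite -delE mulrC ler_pM2l//; lra.
have w1 := hweight_ge1 R i01.
have [CJ CJ0 [H hH]] : exists2 C, 0 <= C & exists H : E -> R, forall J x,
    `|gpot s ft (hweight R i0 i1') J x - H x| <= C * p2 (- (kap * J%:R)).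
  by eapply gpot_limit; eassumption.
(* The index 5 q^2 makes the degree comparable to [par_lam q], which is 2^(5 q^2). *)
pose jt q := gpot s ft (hweight R i0 i1') (5 * q ^ 2).
have tpjt q : tp (par_nu n q) (jt q).
  apply: tp_leq (tp_gpot s0 i1 r1 i4 (hweight R i0 i1') kap2 (5 * q ^ 2)).
  by rewrite /par_nu /par_lam leq_mul2r; apply/orP; right; apply: (@leq_trans (12 * 1)) => //; rewrite leq_mul2l.
have jte q x : `|jt q x - H x| <= CJ * p2 (- (5 * kap * q%:R ^+ 2)).
  have -> : 5 * kap * q%:R ^+ 2 = kap * (5 * q ^ 2)%:R :> R by rewrite natrM natrX; ring.
  exact: hH.
have [BH hBH] : exists BH, forall x, `|H x| <= BH.
  have [B B0 hB] := TP_bnd (jt 0%N).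
  exists (CJ * p2 (- (5 * kap * 0%:R ^+ 2)) + B) => x.
  have -> : H x = - (jt 0%N x - H x) + jt 0%N x by rewrite opprB subrK.
  by rewrite (le_trans (ler_normD _ _))// normrN lerD.
have [h [B [ch hB gh]]] := bounded_extension OL cg.
have e2 : 0 < eps / 2 by rewrite divr_gt0.
have [v hv] := trig_dense s0 ch hB e2.
have [uk [gk [U [V [C [hop_k happ hUv hV bV]]]]]] := torus_solution i01 beta0 bb b5 bk CJ0 tpjt jte hBH v e2.
have happ' e : 0 < e -> exists t : TP R m, (forall x, `|t x - U x| <= e) /\
    forall a x, `|td a t x - V a x| <= e.
  by move=> /happ[k [h1 h2 _]]; exists (uk k).
have happrox e : 0 < e -> exists u g : TP R m, [/\ hop (fun a b : 'I_m => td a u * td b u) = wlap i0 i1' g,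
    forall a x, `|td a u x - V a x| <= e & forall x, `|g x - H x| <= e].
  by move=> /happ[k [_ h2 h3]]; exists (uk k), (gk k).
have cV a : continuous (V a) by move=> x; exact: (cont_limit_grad beta0 hV bV).
exists (fun x => U (s *: x)); split.
- exact: (scaled_C1beta Omega s0 beta0 happ' hV bV).
- exists (fun a x => s * V a (s *: x)); first exact: (scaled_W12 Omega s0 beta0 happ' hV bV).
  move=> phi tphi phiC; rewrite /phiC (cintegral_hessian tphi cV erefl).
  have im0 : comb (@imL R n) (Jint s phi V) = 0 by eapply comb_Jint_im; eassumption.
  have [mphi [Bp [_ [_ hBp _]]]] := test_bsf tphi.
  have OL2 : Omega `<=` box m (2 * s)^-1 by rewrite s2 => x /OL; exact: box_le.
  pose Lval := c0 ^+ m * Int (fun x => ft x * phi x).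
  have hpot e : 0 < e -> exists t : TP R m, (forall x, `|t x - H x| <= e) /\
      `|Lam s phi (wlap i0 i1' t) - Lval| <= e.
    move=> e0; have [Q hQ] := p2_small CJ kap0 e0.
    have [J0 hJ0] : exists J0, forall J, (J0 <= J)%N ->
        `|Lam s phi (wlap i0 i1' (gpot s ft (hweight R i0 i1') J)) - Lval| <= e.
      by eapply gpot_weak; eassumption.
    exists (gpot s ft (hweight R i0 i1') (maxn Q J0)); split; last by apply: hJ0; exact: leq_maxr.
    by move=> x; apply: le_trans (hH _ x) _; apply: hQ; exact: leq_maxl.
  have re0 : comb (@reL R n) (Jint s phi V) = s ^+ 2 * Lval by eapply comb_Jint_re; eassumption.
  have FI : \int[lebesgue_rV R m]_(x in Omega) (f x * phi x) = Int (fun x => (f \_ Omega) x * phi x).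
    rewrite Rintegral_mkcond; congr Rintegral; apply/funext => x; rewrite !patchE.
    by case: ifP => //; rewrite mul0r.
  have LE : Lval = c0 ^+ m * (- 32 / (s ^+ 4 * c0 ^+ m) * Int (fun x => (f \_ Omega) x * phi x)).
    rewrite /Lval; congr (_ * _); rewrite -iIntZ; last by apply: ingM => //; exists Bp.
    congr Int; apply/funext => x; apply: i5 => y hy.
    by apply: (test_out tphi) => /OL.
  rewrite im0 re0 LE FI !mulr0 half_complex.
  rewrite -[(_ +i* 0)%C]/(_%:C%C) -rmorphN -rmorphM; congr (_%:C)%C.
  exact: normalization.
- move=> x Ox; rewrite (gh x Ox) -(subrKA (v (s *: x))) (le_trans (ler_normD _ _))//.
  rewrite [leRHS]splitr; apply: lerD; first exact: hUv.
  by apply: hv; rewrite s2; apply: box_le L2 _; exact: OL.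
Qed.

End main.

Theorem theorem1p1 (R : realType) (n : nat) (Omega : set 'rV[R]_(n + n))
    (f : 'rV[R]_(n + n) -> R) (p : \bar R) (beta : R) :
  (2 <= n)%N ->
  open Omega -> Omega !=set0 -> connected Omega ->
  simply_connected R Omega -> bounded_set Omega ->
  ((n%:R + 2^-1)%:E < p)%E ->
  f \_ Omega \in Lfun (lebesgue_rV R (n + n)) p ->
  0 < beta -> beta < (1 + 2 * n%:R)^-1 ->
  (exists u : 'rV[R]_(n + n) -> R,
     C1beta Omega beta u /\ very_weak_solution Omega f u) /\
  (forall (g : 'rV[R]_(n + n) -> R) (eps : R),
     {within closure Omega, continuous g} -> 0 < eps ->
     exists u : 'rV[R]_(n + n) -> R,
       [/\ C1beta Omega beta u, very_weak_solution Omega f u &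
           (ereal_sup [set `|u x - g x|%:E | x in Omega] < eps%:E)%E]).
Proof.
case: n Omega f => [|[|n]]// Omega f _ _ _ _ _ bO hp fp beta0 betaN.
have main := dense_solutions bO hp fp beta0 betaN; split.
  have c0 : {within closure Omega, continuous (fun=> 0 : R)}.
    by apply: continuous_subspaceT => x; exact: cst_continuous.
  by have [u [h1 h2 _]] := main (fun=> 0) 1 c0 ltr01; exists u.
(* Half of eps, as the supremum has to be strictly smaller than eps. *)
move=> g eps cg eps0; have e2 : 0 < eps / 2 by rewrite divr_gt0.
have [u [h1 h2 h3]] := main g (eps / 2) cg e2; exists u; split=> //.
apply: (@le_lt_trans _ _ (eps / 2)%:E).
  by apply: ge_ereal_sup => _ [x Ox <-]; rewrite lee_fin; exact: h3.
by rewrite lte_fin ltr_pdivrMr// ltr_pMr// ltr1n.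
Qed.
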